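(* Let $0<p,\theta\le\infty$, $L\in\mathbb N$ with $L>1/p$ (where $L=1$ additionally requires $p<\infty$), and $\mathbf r\in\mathbb R^d$ with $\mathbf r>1/p$ componentwise. Then for all $f\in S^{\mathbf r}_{p,\theta}B(\mathbb T^d)$ $$\|f|S^{\mathbf r}_{p,\theta}B(\mathbb T^d)\|\asymp\Big(\sum_{\mathbf j\in\mathbb N_0^d}2^{\theta\,\mathbf r\cdot\mathbf j}\|q^L_{\mathbf j}[f]\|_{L_p(\mathbb T^d)}^\theta\Big)^{1/\theta}$$ (supremum if $\theta=\infty$), with constants independent of $f$.
   Context: $\mathbb T^d$ is $[-\pi,\pi]^d$ with opposite points identified. Function spaces: an admissible system $(\varphi_j)_{j\ge0}\subset C_0^\infty(\mathbb R)$ satisfies $\mathrm{supp}\,\varphi_0\subset[-A,A]$, $\mathrm{supp}\,\varphi_j\subset\{B2^j\le|\xi|\le C2^j\}$ ($j\ge1$), $\sup_{\xi,j}2^{jr}|D^r\varphi_j(\xi)|<\infty$ for all $r$, $\sum_j\varphi_j\equiv1$; $\delta_{\mathbf j}[f]=\sum_{\mathbf k}\varphi_{j_1}(k_1)\cdots\varphi_{j_d}(k_d)\hat f(\mathbf k)e^{i\mathbf k\cdot\mathbf x}$; $\|f|S^{\mathbf r}_{p,\theta}B\|=(\sum_{\mathbf j}2^{\theta\mathbf r\cdot\mathbf j}\|\delta_{\mathbf j}[f]\|_{L_p}^\theta)^{1/\theta}$ (sup if $\theta=\infty$). For $\mathbf r>1/p$ elements are continuous functions, to which $q^L_{\mathbf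 j}$ is applied. Kernels: $\mathrm{sinc}(x)=\sin x/x$, $\mathrm{sinc}(0)=1$; for $L\ge2$, $K^L(x)=\prod_{\ell=1}^L\mathrm{sinc}(2^{-\ell}x)$ and $K^L_{\pi,j}(x)=\sum_{k\in\mathbb Z}K^L(2^j(x+2\pi k))$; for $L=1$, $K^1_{\pi,0}\equiv1$, $K^1_{\pi,j}(x)=2^{-j}\sum_{k=-2^{j-1}}^{2^{j-1}-1}e^{ikx}$. With $U_0=\{0\}$, $U_j=\{-2^{j-1},\dots,2^{j-1}-1\}$, $I^L_j[f](x)=\sum_{u\in U_j}f(2\pi u/2^j)K^L_{\pi,j}(x-2\pi u/2^j)$; $\eta^L_0=I^L_0$, $\eta^L_j=I^L_j-I^L_{j-1}$ ($j\ge1$); $q^L_{\mathbf j}[f]=(\eta^L_{j_1}\otimes\cdots\otimes\eta^L_{j_d})f$, the $i$-th factor acting in the $i$-th variable. *)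

(* Defs.v *)
From Stdlib Require Import Reals Lra ZArith ClassicalEpsilon.
Open Scope R_scope.

Inductive ext := Fin (r : R) | Inf.

(** x^y for x >= 0, y > 0, with 0^y = 0 (Stdlib's Rpower 0 y = 1). *)
Definition rpow (x y : R) : R := if Rlt_dec 0 x then Rpower x y else 0.

Definition Cx := (R * R)%type.
Definition C0 : Cx := (0, 0).
Definition Cadd (z w : Cx) : Cx := (fst z + fst w, snd z + snd w).
Definition Copp (z : Cx) : Cx := (- fst z, - snd z).
Definition Cmul (z w : Cx) : Cx :=
  (fst z * fst w - snd z * snd w, fst z * snd w + snd z * fst w).
Definition Cscal (a : R) (z : Cx) : Cx := (a * fst z, a * snd z).
Definition Cabs (z : Cx) : R := sqrt (fst z * fst z + snd z * snd z).
Definition Cei (t : R) : Cx := (cos t, sin t).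

Fixpoint Csum (n : nat) (F : nat -> Cx) : Cx :=
  match n with O => C0 | S m => Cadd (Csum m F) (F m) end.
Fixpoint Rsum (n : nat) (F : nat -> R) : R :=
  match n with O => 0 | S m => Rsum m F + F m end.
Fixpoint Rprod (n : nat) (F : nat -> R) : R :=
  match n with O => 1 | S m => Rprod m F * F m end.

(** Points of R^d are functions nat -> R (only coordinates < d matter). *)
Definition upd (x : nat -> R) (i : nat) (t : R) : nat -> R :=
  fun k => if Nat.eqb k i then t else x k.
Definition updZ (x : nat -> Z) (i : nat) (t : Z) : nat -> Z :=
  fun k => if Nat.eqb k i then t else x k.
Definition updN (x : nat -> nat) (i : nat) (t : nat) : nat -> nat :=
  fun k => if Nat.eqb k i then t else x k.

(** Riemann integral (value 0 if not Riemann integrable; all integrands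
    used below are continuous). *)
Definition RInt (g : R -> R) (a b : R) : R :=
  match excluded_middle_informative (inhabited (Riemann_integrable g a b)) with
  | left H => RiemannInt (epsilon H (fun _ => True))
  | right _ => 0
  end.

Fixpoint intbox (d : nat) (g : (nat -> R) -> R) (x : nat -> R) : R :=
  match d with
  | O => g x
  | S n => RInt (fun t => intbox n g (upd x n t)) (- PI) PI
  end.
Definition integral (d : nat) (g : (nat -> R) -> R) : R :=
  intbox d g (fun _ => 0).

Definition inbox (d : nat) (x : nat -> R) : Prop :=
  forall i, (i < d)%nat -> - PI <= x i <= PI.

Definition supbox (d : nat) (g : (nat -> R) -> Cx) : R :=
  epsilon (inhabits 0)
    (fun s => is_lub (fun y => exists x, inbox d x /\ y = Cabs (g x)) s).

Definition Lpnorm (d : nat) (p : ext) (g : (nat -> R) -> Cx) : R :=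
  match p with
  | Fin q => rpow (integral d (fun x => rpow (Cabs (g x)) q)) (1 / q)
  | Inf => supbox d g
  end.

Fixpoint Zbox (d : nat) (T : nat -> nat) (F : (nat -> Z) -> Cx) (k : nat -> Z) : Cx :=
  match d with
  | O => F k
  | S n => Csum (2 * T n + 1)
             (fun i => Zbox n T F (updZ k n (Z.of_nat i - Z.of_nat (T n))%Z))
  end.
Fixpoint Nbox (d : nat) (N : nat) (F : (nat -> nat) -> R) (j : nat -> nat) : R :=
  match d with
  | O => F j
  | S n => Rsum (S N) (fun i => Nbox n N F (updN j n i))
  end.

Definition dotZ (d : nat) (k : nat -> Z) (x : nat -> R) : R :=
  Rsum d (fun i => IZR (k i) * x i).
Definition dotr (d : nat) (r : nat -> R) (j : nat -> nat) : R :=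
  Rsum d (fun i => r i * INR (j i)).

Definition fcoef (d : nat) (f : (nat -> R) -> Cx) (k : nat -> Z) : Cx :=
  Cscal (/ (2 * PI) ^ d)
    (integral d (fun x => fst (Cmul (f x) (Cei (- dotZ d k x)))),
     integral d (fun x => snd (Cmul (f x) (Cei (- dotZ d k x))))).

Definition admissible (phi : nat -> R -> R) (A B C : R) : Prop :=
  0 < A /\ 0 < B /\ 0 < C /\
  (forall xi, phi O xi <> 0 -> Rabs xi <= A) /\
  (forall j xi, (1 <= j)%nat -> phi j xi <> 0 ->
      B * 2 ^ j <= Rabs xi <= C * 2 ^ j) /\
  (exists D : nat -> nat -> R -> R,
      (forall j, D j O = phi j) /\
      (forall j n xi, derivable_pt_lim (D j n) xi (D j (S n) xi)) /\
      (forall n, exists M, forall j xi, 2 ^ (j * n) * Rabs (D j n xi) <= M)) /\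
  (forall xi, infinite_sum (fun j => phi j xi) 1).

(** Frequency cut-off: phi_j vanishes outside [-Tb j, Tb j]. *)
Definition Tb (A C : R) (j : nat) : nat := (Z.to_nat (up (Rmax A C)) * 2 ^ j)%nat.

Definition delta (d : nat) (phi : nat -> R -> R) (A C : R)
    (f : (nat -> R) -> Cx) (j : nat -> nat) (x : nat -> R) : Cx :=
  Zbox d (fun i => Tb A C (j i))
    (fun k => Cscal (Rprod d (fun i => phi (j i) (IZR (k i))))
                (Cmul (fcoef d f k) (Cei (dotZ d k x))))
    (fun _ => 0%Z).

Definition sinc (x : R) : R := if Req_EM_T x 0 then 1 else sin x / x.
Definition KL (L : nat) (x : R) : R := Rprod L (fun l => sinc (x / 2 ^ (S l))).
Definition Rlim (u : nat -> R) : R := epsilon (inhabits 0) (fun l => Un_cv u l).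

(** K^L_{pi,m}; for L >= 2 the series over k in Z (absolutely convergent)
    is taken as the limit of symmetric partial sums. *)
Definition Kper (L m : nat) (x : R) : Cx :=
  match L with
  | 1%nat =>
      match m with
      | O => (1, 0)
      | S m' => Cscal (/ 2 ^ m)
                  (Csum (2 ^ m) (fun t => Cei (IZR (Z.of_nat t - Z.of_nat (2 ^ m'))%Z * x)))
      end
  | _ => (Rlim (fun N => Rsum (2 * N + 1)
             (fun t => KL L (2 ^ m * (x + 2 * PI * IZR (Z.of_nat t - Z.of_nat N)%Z)))), 0)
  end.

Definition Ivar (L m i : nat) (g : (nat -> R) -> Cx) (x : nat -> R) : Cx :=
  match m with
  | O => Cmul (g (upd x i 0)) (Kper L O (x i - 0))
  | S m' => Csum (2 ^ m) (fun t =>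
      let pt := 2 * PI * IZR (Z.of_nat t - Z.of_nat (2 ^ m'))%Z / 2 ^ m in
      Cmul (g (upd x i pt)) (Kper L m (x i - pt)))
  end.

Definition etavar (L j i : nat) (g : (nat -> R) -> Cx) : (nat -> R) -> Cx :=
  match j with
  | O => Ivar L O i g
  | S j' => fun x => Cadd (Ivar L j i g x) (Copp (Ivar L j' i g x))
  end.

(** q^L_j[f] = (eta_{j1} (x) ... (x) eta_{jd}) f. *)
Fixpoint qop (d L : nat) (j : nat -> nat) (f : (nat -> R) -> Cx) : (nat -> R) -> Cx :=
  match d with
  | O => f
  | S n => etavar L (j n) n (qop n L j f)
  end.

(** (sum_j a_j^theta)^{1/theta} <= M  (sup_j a_j <= M if theta = infinity),
    for a nonnegative family a indexed by N_0^d. *)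
Definition seqnorm_le (d : nat) (theta : ext) (a : (nat -> nat) -> R) (M : R) : Prop :=
  match theta with
  | Fin t => forall N, rpow (Nbox d N (fun j => rpow (a j) t) (fun _ => O)) (1 / t) <= M
  | Inf => forall j, a j <= M
  end.

Definition besov_terms d phi A C (p : ext) (r : nat -> R) f : (nat -> nat) -> R :=
  fun j => Rpower 2 (dotr d r j) * Lpnorm d p (delta d phi A C f j).
Definition q_terms d (L : nat) (p : ext) (r : nat -> R) f : (nat -> nat) -> R :=
  fun j => Rpower 2 (dotr d r j) * Lpnorm d p (qop d L j f).

Definition cont_periodic (d : nat) (f : (nat -> R) -> Cx) : Prop :=
  (forall x y, (forall i, (i < d)%nat -> x i = y i) -> f x = f y) /\
  (forall x i, (i < d)%nat -> f (upd x i (x i + 2 * PI)) = f x) /\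
  (forall x eps, 0 < eps -> exists del, 0 < del /\
     forall y, (forall i, (i < d)%nat -> Rabs (y i - x i) < del) ->
       Cabs (Cadd (f y) (Copp (f x))) < eps).

Definition ext_pos (e : ext) : Prop := match e with Fin r => 0 < r | Inf => True end.
Definition gt_invp (y : R) (p : ext) : Prop :=
  match p with Fin q => / q < y | Inf => 0 < y end.

(* Main.v *)
(** On trigonometric polynomials of degree about [2^l] in one variable, [eta_j] is bounded on [L_p]
    with norm at most a constant times [(1 + 2^(l-j))^(1/p)]: for [L >= 2] this follows from the decay
    of the kernel and the Plancherel-Polya sampling inequality, for [L = 1] from the M. Riesz projection
    theorem. It vanishes there when [j >= l + const], because the interpolation reproduces low
    frequencies. Dually, discretised convolution with the kernel of [phi_l] is bounded with the roles of
    [j] and [l] exchanged, and annihilates degree [2^j] when [l >= j + const]. Since [f] is the uniform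
    limit of the partial sums of its [delta_l f], and [delta_l f] is the uniform limit of discretised
    convolutions, which see only the values of [f] on a dyadic grid and hence only finitely many [q_j f],
    the weighted norms of [q_j f] and of [delta_l f] control each other through tensor products of
    kernels decaying like [2^(-tau |j - l|)] as soon as [r_i > 1/p], and such kernels are bounded on
    sequence spaces. Iterating over the variables needs only Fubini's theorem for continuous functions,
    which is obtained from Riemann sums on dyadic grids. *)

Require Import Defs.
From Stdlib Require Import Reals Lra Lia ZArith Psatz ClassicalEpsilon FunctionalExtensionality.
From Coquelicot Require Import Coquelicot.
Open Scope R_scope.
Notation RInt := Coquelicot.RInt.RInt.

(* For $p<1$ there is neither duality nor Minkowski's inequality, so norm bounds come from pointwise
   bounds on powers of finite sums, where the decay of a kernel pays for the summation. The sums are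
   finite because quadrature of a trigonometric polynomial on a fine enough grid is exact. This also
   replaces Poisson summation: each sinc is a limit of rescaled Dirichlet kernels, and the finite
   periodisation of their product is already a polynomial of the degree of $K^L_{\pi,m}$ that
   reproduces low frequencies exactly. Norms are carried as $p$-th powers (first powers for
   $p=\infty$). On that scale discretisation costs a factor growing like $2^{l-j}$, against a gain
   $2^{pr(l-j)}$ from the smoothness weights; this is the only use of $r>1/p$. Both inequalities
   lead to the same one-sided kernel in $(j,l)$, so one transfer argument serves both. The finite
   expansions approximate $f$ at no rate uniform in $f$; every domination is therefore stated up to
   an arbitrary error on finite boxes, and the error is removed only inside the sequence norms. *)
Add Field Cx_field :
  (C_field_theory : @field_theory Cx (RtoC 0) (RtoC 1) Cplus Cmult Cminus Complex.Copp Cdiv Cinv eq).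

(** The definitions carry their own pair arithmetic on [Cx], convertible with that of the field [C];
    folding one into the other lets [ring] work on either spelling. *)
Ltac cring :=
  change Cadd with Cplus; change Cmul with Cmult; change Defs.Copp with Complex.Copp;
  change C0 with (RtoC 0);
  match goal with |- @eq _ ?a ?b => first [change (@eq C a b); ring | change (@eq Cx a b); ring] end.

Lemma Cmult_integral (a b : C) : (a * b = 0)%C -> a = 0 \/ b = 0.
Proof.
  intros H. assert (E : Cmod a * Cmod b = 0) by (rewrite <- Cmod_mult, H; apply Cmod_0).
  apply Rmult_integral in E. destruct E as [E|E]; [left|right]; apply Cmod_eq_0, E.
Qed.

Lemma Cscal_mult (a : R) (z : C) : Cscal a z = (RtoC a * z)%C.
Proof. unfold Cscal, Cmult, RtoC; simpl; f_equal; ring. Qed.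

Lemma Cabs_Cmod (z : C) : Cabs z = Cmod z.
Proof. unfold Cabs, Cmod; f_equal; ring. Qed.

Lemma Cabs_sub (z w : C) : Cabs (Cadd z (Defs.Copp w)) = Cmod (z - w).
Proof. rewrite Cabs_Cmod; reflexivity. Qed.

(** * Finite sums *)

Lemma Rsum_ext n F G : (forall v, (v < n)%nat -> F v = G v) -> Rsum n F = Rsum n G.
Proof.
  induction n; simpl; intros H; [reflexivity|].
  rewrite IHn by (intros; apply H; lia). rewrite H by lia. reflexivity.
Qed.

Lemma Rsum_le n F G : (forall v, (v < n)%nat -> F v <= G v) -> Rsum n F <= Rsum n G.
Proof.
  induction n; simpl; intros H; [lra|].
  apply Rplus_le_compat; [apply IHn; intros|]; apply H; lia.
Qed.

Lemma Rsum_plus n F G : Rsum n (fun v => F v + G v) = Rsum n F + Rsum n G.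
Proof. induction n; simpl; [|rewrite IHn]; ring. Qed.

Lemma Rsum_scal n a F : Rsum n (fun v => a * F v) = a * Rsum n F.
Proof. induction n; simpl; [|rewrite IHn]; ring. Qed.

Lemma Rsum_scal_r n a F : Rsum n (fun v => F v * a) = Rsum n F * a.
Proof. induction n; simpl; [|rewrite IHn]; ring. Qed.

Lemma Rsum_const n a : Rsum n (fun _ => a) = INR n * a.
Proof. induction n; [simpl; ring|]. rewrite S_INR; simpl; rewrite IHn; ring. Qed.

Lemma Rsum_nonneg n F : (forall v, (v < n)%nat -> 0 <= F v) -> 0 <= Rsum n F.
Proof.
  intros H. replace 0 with (Rsum n (fun _ => 0)) by (rewrite Rsum_const; ring).
  apply Rsum_le, H.
Qed.

Lemma Rsum_le_const n F M : (forall v, (v < n)%nat -> F v <= M) -> Rsum n F <= INR n * M.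
Proof. intros H. rewrite <- Rsum_const. apply Rsum_le, H. Qed.

Lemma Rsum_ge_term n F v :
  (forall v, (v < n)%nat -> 0 <= F v) -> (v < n)%nat -> F v <= Rsum n F.
Proof.
  induction n; intros H Hv; [lia|]. simpl.
  destruct (Nat.eq_dec v n) as [->|Hne].
  - pose proof (Rsum_nonneg n F (fun v Hv => H v (Nat.lt_lt_succ_r _ _ Hv))). lra.
  - pose proof (H n (Nat.lt_succ_diag_r n)).
    pose proof (IHn (fun v Hv => H v (Nat.lt_lt_succ_r _ _ Hv)) ltac:(lia)). lra.
Qed.

Lemma Rsum_swap n m F :
  Rsum n (fun i => Rsum m (fun j => F i j)) = Rsum m (fun j => Rsum n (fun i => F i j)).
Proof.
  induction n; simpl; [rewrite Rsum_const; ring|]. rewrite IHn, Rsum_plus. reflexivity.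
Qed.

Lemma Rsum_shift n F : Rsum (S n) F = F O + Rsum n (fun v => F (S v)).
Proof. induction n; simpl; [ring|]. simpl in IHn. rewrite IHn. ring. Qed.

Lemma Rsum_split n m F : Rsum (n + m) F = Rsum n F + Rsum m (fun v => F (n + v)%nat).
Proof.
  induction m; simpl; [rewrite Nat.add_0_r; ring|].
  rewrite Nat.add_succ_r; simpl. rewrite IHm; ring.
Qed.

Lemma Rsum_rev n F : Rsum n F = Rsum n (fun v => F (n - 1 - v)%nat).
Proof.
  induction n; [reflexivity|]. rewrite (Rsum_shift n (fun v => F (S n - 1 - v)%nat)).
  simpl (Rsum (S n) F). rewrite IHn.
  replace (S n - 1 - 0)%nat with n by lia. rewrite Rplus_comm. f_equal.
  apply Rsum_ext; intros v Hv. f_equal. lia.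
Qed.

Lemma Rsum_Rabs n F : Rabs (Rsum n F) <= Rsum n (fun v => Rabs (F v)).
Proof.
  induction n; simpl; [rewrite Rabs_R0; lra|].
  eapply Rle_trans; [apply Rabs_triang|]. lra.
Qed.

Lemma Rsum_telescope n F : Rsum n (fun v => F v - F (S v)) = F O - F n.
Proof. induction n; simpl; [|rewrite IHn]; ring. Qed.

Lemma Csum_ext n (F G : nat -> C) :
  (forall v, (v < n)%nat -> F v = G v) -> Csum n F = Csum n G.
Proof.
  induction n; simpl; intros H; [reflexivity|].
  rewrite IHn by (intros; apply H; lia). rewrite H by lia. reflexivity.
Qed.

Lemma Csum_S n (F : nat -> C) : Csum (S n) F = (Csum n F + F n)%C.
Proof. reflexivity. Qed.

Lemma Csum_plus n (F G : nat -> C) :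
  Csum n (fun v => (F v + G v)%C) = (Csum n F + Csum n G)%C.
Proof. induction n; simpl; [|rewrite IHn]; cring. Qed.

Lemma Csum_scal n a (F : nat -> C) : Csum n (fun v => (a * F v)%C) = (a * Csum n F)%C.
Proof. induction n; simpl; [|rewrite IHn]; cring. Qed.

Lemma Csum_scal_r n a (F : nat -> C) : Csum n (fun v => (F v * a)%C) = (Csum n F * a)%C.
Proof. induction n; simpl; [|rewrite IHn]; cring. Qed.

Lemma Csum_minus n (F G : nat -> C) :
  Csum n (fun v => (F v - G v)%C) = (Csum n F - Csum n G)%C.
Proof. induction n; simpl; [|rewrite IHn]; cring. Qed.

Lemma Csum_zero n (F : nat -> C) : (forall v, (v < n)%nat -> F v = 0) -> Csum n F = RtoC 0.
Proof.
  induction n; simpl; intros H; [reflexivity|].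
  rewrite IHn by (intros; apply H; lia). rewrite H by lia. cring.
Qed.

Lemma Csum_const n (a : C) : Csum n (fun _ => a) = (RtoC (INR n) * a)%C.
Proof.
  induction n; [simpl; cring|]. rewrite S_INR, RtoC_plus; simpl. rewrite IHn; cring.
Qed.

Lemma Csum_swap n m (F : nat -> nat -> C) :
  Csum n (fun i => Csum m (fun j => F i j)) = Csum m (fun j => Csum n (fun i => F i j)).
Proof.
  induction n; simpl; [symmetry; apply Csum_zero; reflexivity|].
  rewrite IHn. symmetry; apply Csum_plus.
Qed.

Lemma Csum_shift n (F : nat -> C) : Csum (S n) F = (F O + Csum n (fun v => F (S v)))%C.
Proof. induction n; simpl; [cring|]. simpl in IHn. rewrite IHn. cring. Qed.

Lemma Csum_split n m (F : nat -> C) :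
  Csum (n + m) F = (Csum n F + Csum m (fun v => F (n + v)%nat))%C.
Proof.
  induction m; simpl; [rewrite Nat.add_0_r; cring|].
  rewrite Nat.add_succ_r; simpl. rewrite IHm; cring.
Qed.

Lemma Csum_mul n m (F : nat -> C) :
  Csum (n * m) F = Csum n (fun i => Csum m (fun j => F (i * m + j)%nat)).
Proof.
  induction n; simpl; [reflexivity|].
  rewrite Nat.add_comm, Csum_split, IHn. reflexivity.
Qed.

Lemma Csum_telescope n (F : nat -> C) : Csum n (fun v => (F (S v) - F v)%C) = (F n - F O)%C.
Proof. induction n; simpl; [|rewrite IHn]; cring. Qed.

Lemma Cmod_Csum n (F : nat -> C) : Cmod (Csum n F) <= Rsum n (fun v => Cmod (F v)).
Proof.
  induction n; simpl.
  - change C0 with (RtoC 0). rewrite Cmod_0; lra.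
  - change (Cmod (Csum n F + F n)%C <= Rsum n (fun v => Cmod (F v)) + Cmod (F n)).
    eapply Rle_trans; [apply Cmod_triangle|]. lra.
Qed.

Lemma Cmod_minus_le (z w : C) : Cmod (z - w) <= Cmod z + Cmod w.
Proof. unfold Cminus. eapply Rle_trans; [apply Cmod_triangle|]. rewrite Cmod_opp; lra. Qed.

Lemma Cmod_minus_sym (z w : C) : Cmod (z - w) = Cmod (w - z).
Proof. rewrite <- Cmod_opp. f_equal. cring. Qed.

Lemma Cmod_triangle_sub (z w : C) : Cmod z <= Cmod w + Cmod (z - w).
Proof. replace z with (w + (z - w))%C at 1 by cring. apply Cmod_triangle. Qed.

Lemma Cmod_sub3 (x y z : C) : Cmod (x - z) <= Cmod (x - y) + Cmod (y - z).
Proof. replace (x - z)%C with ((x - y) + (y - z))%C by cring. apply Cmod_triangle. Qed.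

(** * Exponentials *)

Definition ek (k : Z) (t : R) : C := Cei (IZR k * t).

Lemma Cei_plus a b : Cei (a + b) = (Cei a * Cei b)%C.
Proof. unfold Cei, Cmult; simpl. rewrite cos_plus, sin_plus. f_equal; ring. Qed.

Lemma Cei_0 : Cei 0 = RtoC 1.
Proof. unfold Cei, RtoC. rewrite cos_0, sin_0; reflexivity. Qed.

Lemma Cmod_Cei a : Cmod (Cei a) = 1.
Proof.
  unfold Cei, Cmod; simpl. rewrite !Rmult_1_r.
  replace (cos a * cos a + sin a * sin a) with 1; [apply sqrt_1|].
  pose proof (sin2_cos2 a) as H; unfold Rsqr in H; lra.
Qed.

Lemma Cei_conj a : Cconj (Cei a) = Cei (- a).
Proof. unfold Cei, Cconj; simpl. rewrite cos_neg, sin_neg; reflexivity. Qed.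

Lemma Cei_2PI_nat n : Cei (2 * PI * INR n) = RtoC 1.
Proof.
  induction n; [simpl; rewrite Rmult_0_r; apply Cei_0|].
  rewrite S_INR, Rmult_plus_distr_l, Cei_plus, IHn, Rmult_1_r.
  unfold Cei. rewrite cos_2PI, sin_2PI. change (1, 0) with (RtoC 1). cring.
Qed.

Lemma Cei_2PI k : Cei (2 * PI * IZR k) = RtoC 1.
Proof.
  destruct (Z_le_gt_dec 0 k) as [H|H].
  - rewrite <- (Z2Nat.id k H), <- INR_IZR_INZ. apply Cei_2PI_nat.
  - assert (E : (Cei (2 * PI * IZR k) * Cei (2 * PI * IZR (- k)) = 1)%C).
    { rewrite <- Cei_plus. rewrite opp_IZR.
      replace (2 * PI * IZR k + 2 * PI * - IZR k) with 0 by ring. apply Cei_0. }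
    assert (E2 : Cei (2 * PI * IZR (- k)) = RtoC 1).
    { rewrite <- (Z2Nat.id (- k)) by lia. rewrite <- INR_IZR_INZ. apply Cei_2PI_nat. }
    rewrite E2 in E. rewrite <- E. cring.
Qed.

Lemma ek_plus k s t : ek k (s + t) = (ek k s * ek k t)%C.
Proof. unfold ek. rewrite Rmult_plus_distr_l. apply Cei_plus. Qed.

Lemma ek_add k l t : ek (k + l) t = (ek k t * ek l t)%C.
Proof. unfold ek. rewrite plus_IZR, Rmult_plus_distr_r. apply Cei_plus. Qed.

Lemma ek_0 t : ek 0 t = RtoC 1.
Proof. unfold ek. rewrite Rmult_0_l. apply Cei_0. Qed.

Lemma ek_at0 k : ek k 0 = RtoC 1.
Proof. unfold ek. rewrite Rmult_0_r. apply Cei_0. Qed.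

Lemma Cmod_ek k t : Cmod (ek k t) = 1.
Proof. apply Cmod_Cei. Qed.

Lemma ek_opp k t : ek (- k) t = ek k (- t).
Proof. unfold ek. rewrite opp_IZR. f_equal; ring. Qed.

Lemma ek_conj k t : Cconj (ek k t) = ek (- k) t.
Proof. unfold ek. rewrite Cei_conj, opp_IZR. f_equal; ring. Qed.

Lemma ek_2PI k m : ek k (2 * PI * IZR m) = RtoC 1.
Proof.
  unfold ek. replace (IZR k * (2 * PI * IZR m)) with (2 * PI * IZR (k * m))
    by (rewrite mult_IZR; ring). apply Cei_2PI.
Qed.

Lemma Cmod_Cei_sub1 a : Cmod (Cei a - 1) = 2 * Rabs (sin (a / 2)).
Proof.
  assert (E : (Cei a - 1 = Cei (a / 2) * (RtoC (2 * sin (a / 2)) * Ci))%C).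
  { replace (Cei a) with (Cei (a / 2 + a / 2)) by (f_equal; field).
    rewrite Cei_plus.
    pose proof (sin2_cos2 (a / 2)) as H; unfold Rsqr in H.
    unfold Cei, Cminus, Cplus, Complex.Copp, Cmult, RtoC, Ci; simpl; f_equal; nra. }
  rewrite E, !Cmod_mult, Cmod_Cei, Cmod_Ci, Cmod_R, Rabs_mult, (Rabs_pos_eq 2) by lra. ring.
Qed.

Lemma IZR_ge1 k : k <> 0%Z -> 1 <= Rabs (IZR k).
Proof.
  intros H. rewrite <- abs_IZR. apply IZR_le. lia.
Qed.

Lemma Zdiv_cases (N k : Z) :
  (0 < N)%Z -> (exists q, k = N * q)%Z \/ (exists q r, k = N * q + r /\ 0 < r < N)%Z.
Proof.
  intros HN. pose proof (Z.div_mod k N ltac:(lia)) as E.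
  pose proof (Z.mod_pos_bound k N HN) as B.
  destruct (Z.eq_dec (k mod N) 0) as [H0|H0].
  - left; exists (k / N)%Z; lia.
  - right; exists (k / N)%Z, (k mod N)%Z; lia.
Qed.

(** The offset [s] stays free: the sampling inequality averages over all translates of the grid, and
    the nodes of $I_m$ start at [0] or at [- PI] according to [m]. *)
Definition gpt (N : nat) (s : R) (v : nat) : R := s + 2 * PI * INR v / INR N.

Lemma grid_arg (N : nat) q : (1 <= N)%nat ->
  forall v, ek (Z.of_nat N * q) (2 * PI * INR v / INR N) = RtoC 1.
Proof.
  intros HN v. assert (INR N <> 0) by (apply not_0_INR; lia).
  unfold ek. rewrite mult_IZR, <- INR_IZR_INZ.
  replace (INR N * IZR q * (2 * PI * INR v / INR N)) with (2 * PI * IZR (q * Z.of_nat v)).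
  - apply Cei_2PI.
  - rewrite !mult_IZR, <- INR_IZR_INZ. field. assumption.
Qed.

Lemma gridsum_ek_div (N : nat) q x : (1 <= N)%nat ->
  Csum N (fun v => ek (Z.of_nat N * q) (gpt N x v))
  = (RtoC (INR N) * ek (Z.of_nat N * q) x)%C.
Proof.
  intros HN. rewrite <- Csum_const. apply Csum_ext. intros v _.
  unfold gpt. rewrite ek_plus, grid_arg by assumption. cring.
Qed.

Lemma ek_step_neq1 (N : nat) q r : (0 < r < Z.of_nat N)%Z ->
  ek (Z.of_nat N * q + r) (2 * PI / INR N) <> RtoC 1.
Proof.
  intros Hr E.
  assert (HN : 0 < INR N) by (apply lt_0_INR; lia).
  assert (F : Cmod (ek (Z.of_nat N * q + r) (2 * PI / INR N) - 1) = 0).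
  { rewrite E. replace (RtoC 1 - RtoC 1)%C with (RtoC 0) by cring. apply Cmod_0. }
  rewrite ek_add in F.
  replace (2 * PI / INR N) with (2 * PI * INR 1 / INR N) in F at 1 by (simpl; field; lra).
  rewrite grid_arg in F by lia.
  replace (1 * ek r (2 * PI / INR N))%C with (ek r (2 * PI / INR N)) in F by cring.
  unfold ek in F. rewrite Cmod_Cei_sub1 in F.
  assert (0 < sin (IZR r * (2 * PI / INR N) / 2)).
  { assert (0 < IZR r < INR N)
      by (rewrite INR_IZR_INZ; split; apply IZR_lt; lia).
    replace (IZR r * (2 * PI / INR N) / 2) with (PI * (IZR r / INR N)) by (field; lra).
    pose proof PI_RGT_0.
    assert (0 < IZR r / INR N < 1).
    { split; [apply Rdiv_lt_0_compat; lra|]. apply -> Rdiv_lt_1; lra. }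
    apply sin_gt_0; nra. }
  rewrite Rabs_pos_eq in F by lra. lra.
Qed.

(** Multiplication by the step ratio minus 1 telescopes the sum, and its two ends agree because the
    grid closes up after a full turn; the ratio is not 1 since [N] does not divide the frequency. *)
Lemma gridsum_ek_ndiv (N : nat) q r x : (0 < r < Z.of_nat N)%Z ->
  Csum N (fun v => ek (Z.of_nat N * q + r) (gpt N x v)) = RtoC 0.
Proof.
  intros Hr. set (k := (Z.of_nat N * q + r)%Z).
  assert (HN : 0 < INR N) by (apply lt_0_INR; lia).
  set (z := ek k (2 * PI / INR N)).
  assert (Hz : (z - 1 <> 0)%C).
  { intros E. apply (ek_step_neq1 N q r Hr). fold k; fold z.
    replace z with ((z - 1) + 1)%C by cring. rewrite E. cring. }
  set (F := fun v : nat => ek k (gpt N x v)).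
  change (Csum N F = RtoC 0).
  assert (E : ((z - 1) * Csum N F = 0)%C).
  { rewrite <- Csum_scal.
    transitivity (Csum N (fun v => (F (S v) - F v)%C)).
    - apply Csum_ext; intros v _. unfold F, z, gpt.
      replace (x + 2 * PI * INR (S v) / INR N) with
        ((x + 2 * PI * INR v / INR N) + 2 * PI / INR N) by (rewrite S_INR; field; lra).
      rewrite (ek_plus k (x + _)). cring.
    - rewrite Csum_telescope. unfold F, gpt.
      replace (x + 2 * PI * INR N / INR N) with (x + 2 * PI * IZR 1) by (field; lra).
      rewrite ek_plus, ek_2PI. simpl. unfold Rdiv. rewrite Rmult_0_r, Rmult_0_l, Rplus_0_r.
      cring. }
  destruct (Cmult_integral _ _ E) as [E0|E0]; [contradiction|exact E0].
Qed.

(** * Trigonometric polynomials *)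

(** Trigonometric polynomials with spectrum in [S], as a predicate on functions: linear facts become
    an induction over characters, and frequencies may repeat. [S] is an arbitrary set because
    half-lines, gaps and half-open blocks occur as spectra later on. *)
Inductive TS (S : Z -> Prop) : (R -> C) -> Prop :=
| TS_nil : TS S (fun _ => RtoC 0)
| TS_cons k a h : S k -> TS S h -> TS S (fun t => (a * ek k t + h t)%C).

Definition TP (D : R) : (R -> C) -> Prop := TS (fun k => Rabs (IZR k) <= D).

Lemma TS_mono (S S' : Z -> Prop) h : (forall k, S k -> S' k) -> TS S h -> TS S' h.
Proof. intros HS; induction 1; constructor; auto. Qed.

Lemma TS_eq S h h' : TS S h -> (forall t, h t = h' t) -> TS S h'.
Proof.
  intros H E. replace h' with h; [exact H|]. apply functional_extensionality, E.
Qed.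

Lemma TS_ek S k : S k -> TS S (ek k).
Proof.
  intros Hk. apply (TS_eq S (fun t => (RtoC 1 * ek k t + 0)%C)).
  - apply (TS_cons S k (RtoC 1) (fun _ => RtoC 0)); [exact Hk|constructor].
  - intros t; cring.
Qed.

Lemma TS_plus S h g : TS S h -> TS S g -> TS S (fun t => (h t + g t)%C).
Proof.
  intros Hh Hg. induction Hh.
  - apply (TS_eq S g); [exact Hg|intros; cring].
  - eapply TS_eq; [apply (TS_cons S k a _ H IHHh)|]. intros; simpl; cring.
Qed.

Lemma TS_scal S c h : TS S h -> TS S (fun t => (c * h t)%C).
Proof.
  induction 1.
  - eapply TS_eq; [constructor|]. intros; simpl; cring.
  - eapply TS_eq; [apply (TS_cons S k (c * a)%C _ H IHTS)|]. intros; simpl; cring.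
Qed.

Lemma TS_scal_r S c h : TS S h -> TS S (fun t => (h t * c)%C).
Proof. intros H. eapply TS_eq; [apply (TS_scal S c h H)|]. intros; simpl; cring. Qed.

Lemma TS_minus S h g : TS S h -> TS S g -> TS S (fun t => (h t - g t)%C).
Proof.
  intros Hh Hg. eapply TS_eq; [apply (TS_plus S h _ Hh (TS_scal S (-(1))%C g Hg))|].
  intros; simpl; cring.
Qed.

Lemma TS_csum S n (F : nat -> R -> C) :
  (forall v, (v < n)%nat -> TS S (F v)) -> TS S (fun t => Csum n (fun v => F v t)).
Proof.
  induction n; intros H; simpl; [constructor|].
  apply (TS_plus S (fun t => Csum n (fun v => F v t)) (F n)); [apply IHn; intros; apply H; lia|].
  apply H; lia.
Qed.

Lemma TS_mul S1 S2 S h g : (forall k l, S1 k -> S2 l -> S (k + l)%Z) ->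
  TS S1 h -> TS S2 g -> TS S (fun t => (h t * g t)%C).
Proof.
  intros HS Hh Hg. induction Hh.
  - eapply TS_eq; [constructor|]. intros; simpl; cring.
  - assert (H1 : TS S (fun t => (a * (ek k t * g t))%C)).
    { apply TS_scal. clear -HS H Hg. induction Hg.
      - eapply TS_eq; [constructor|]. intros; simpl; cring.
      - eapply TS_eq; [apply (TS_cons S (k + k0) a _ (HS _ _ H H0) IHHg)|].
        intros; simpl. rewrite ek_add. cring. }
    eapply TS_eq; [apply (TS_plus S _ _ H1 IHHh)|]. intros; simpl; cring.
Qed.

Lemma TS_shift S h s : TS S h -> TS S (fun t => h (t + s)).
Proof.
  induction 1; [constructor|].
  eapply TS_eq; [apply (TS_cons S k (a * ek k s)%C _ H IHTS)|].
  intros; simpl. rewrite ek_plus. cring.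
Qed.

Lemma TS_reflect (S S' : Z -> Prop) h s :
  (forall k, S k -> S' (- k)%Z) -> TS S h -> TS S' (fun t => h (s - t)).
Proof.
  intros HS; induction 1; [constructor|].
  eapply TS_eq; [apply (TS_cons S' (- k) (a * ek k s)%C _ (HS _ H) IHTS)|].
  intros; simpl. unfold Rminus. rewrite ek_plus, ek_opp. cring.
Qed.

Lemma TS_period S h t m : TS S h -> h (t + 2 * PI * IZR m) = h t.
Proof. induction 1; [reflexivity|]. rewrite IHTS, ek_plus, ek_2PI. cring. Qed.

Lemma TP_mono D D' h : D <= D' -> TP D h -> TP D' h.
Proof. intros HD; apply TS_mono; intros; lra. Qed.

Lemma TP_mul D D' h g : TP D h -> TP D' g -> TP (D + D') (fun t => (h t * g t)%C).
Proof.
  apply TS_mul. intros k l Hk Hl. rewrite plus_IZR.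
  eapply Rle_trans; [apply Rabs_triang|]. lra.
Qed.

Lemma TP_reflect D h s : TP D h -> TP D (fun t => h (s - t)).
Proof. apply TS_reflect; intros; rewrite opp_IZR, Rabs_Ropp; assumption. Qed.

Lemma TP_const D c : 0 <= D -> TP D (fun _ => c).
Proof.
  intros HD. eapply TS_eq; [apply (TS_scal _ c (ek 0)), TS_ek|].
  - simpl; rewrite Rabs_R0; lra.
  - intros; simpl; rewrite ek_0; cring.
Qed.

(** * The interpolation kernel on an even grid *)

(** The Dirichlet kernel with the asymmetric spectrum $-M,\dots,M-1$, equal to $K^1_{\pi,m+1}$ for
    $M=2^m$. Products of such kernels approximate $K^L$, and powers of one of them serve as
    localising factors. *)
Definition dk (M : nat) (t : R) : C :=
  (RtoC (/ INR (2 * M)) * Csum (2 * M) (fun v => ek (Z.of_nat v - Z.of_nat M) t))%C.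

Lemma INR2M_pos M : (1 <= M)%nat -> 0 < INR (2 * M).
Proof. intros; apply lt_0_INR; lia. Qed.

Lemma dk_TP M : TP (INR M) (dk M).
Proof.
  apply TS_scal, (TS_csum _ _ (fun v => ek (Z.of_nat v - Z.of_nat M))).
  intros v Hv. apply TS_ek. rewrite minus_IZR, <- !INR_IZR_INZ.
  apply Rabs_le. pose proof (pos_INR v). apply lt_INR in Hv.
  rewrite mult_INR in Hv. simpl in Hv. lra.
Qed.

Lemma dk_0 M : (1 <= M)%nat -> dk M 0 = RtoC 1.
Proof.
  intros HM. unfold dk. erewrite Csum_ext; [|intros v _; rewrite ek_at0; reflexivity].
  rewrite Csum_const. pose proof (INR2M_pos M HM).
  transitivity (RtoC (/ INR (2 * M) * INR (2 * M))).
  - rewrite RtoC_mult; cring.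
  - f_equal; field; lra.
Qed.

Lemma dk_le1 M t : (1 <= M)%nat -> Cmod (dk M t) <= 1.
Proof.
  intros HM. pose proof (INR2M_pos M HM). unfold dk. rewrite Cmod_mult, Cmod_R.
  assert (0 < / INR (2 * M)) by (apply Rinv_0_lt_compat; lra).
  rewrite Rabs_pos_eq by lra.
  assert (Cmod (Csum (2 * M) (fun v => ek (Z.of_nat v - Z.of_nat M) t)) <= INR (2 * M) * 1).
  { eapply Rle_trans; [apply Cmod_Csum|]. apply Rsum_le_const; intros; rewrite Cmod_ek; lra. }
  replace 1 with (/ INR (2 * M) * INR (2 * M)) by (field; lra).
  apply Rmult_le_compat_l; lra.
Qed.

(** Multiplying by [Cei t - 1] telescopes the asymmetric sum into a symmetric difference of
    exponentials. The cross-multiplied form avoids a case distinction at zeros of [Cei t - 1]. *)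
Lemma dk_geom M t : (1 <= M)%nat ->
  (dk M t * (Cei t - 1) = RtoC (2 * sin (INR M * t) / INR (2 * M)) * Ci)%C.
Proof.
  intros HM. pose proof (INR2M_pos M HM). unfold dk.
  assert (E : (Csum (2 * M) (fun v => ek (Z.of_nat v - Z.of_nat M) t) * (Cei t - 1)
    = Cei (INR M * t) - Cei (- (INR M * t)))%C).
  { rewrite <- Csum_scal_r.
    set (F := fun v : nat => ek (Z.of_nat v - Z.of_nat M) t).
    transitivity (Csum (2 * M) (fun v => (F (S v) - F v)%C)).
    - apply Csum_ext; intros v _. unfold F.
      replace (Z.of_nat (S v) - Z.of_nat M)%Z with ((Z.of_nat v - Z.of_nat M) + 1)%Z by lia.
      rewrite ek_add. replace (ek 1 t) with (Cei t) by (unfold ek; f_equal; ring). cring.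
    - rewrite Csum_telescope. unfold F, ek. rewrite !minus_IZR, <- !INR_IZR_INZ, mult_INR.
      replace ((INR 2 * INR M - INR M) * t) with (INR M * t) by (simpl; ring).
      replace ((INR 0 - INR M) * t) with (- (INR M * t)) by (simpl; ring). reflexivity. }
  rewrite <- Cmult_assoc, E. clear E. revert H. generalize (INR (2 * M)). intros N HN.
  unfold Cei, RtoC, Cmult, Cminus, Cplus, Complex.Copp, Ci; simpl.
  rewrite cos_neg, sin_neg. f_equal; field; lra.
Qed.

Lemma dk_decay M t : (1 <= M)%nat -> Cmod (dk M t) * (INR (2 * M) * Rabs (sin (t / 2))) <= 1.
Proof.
  intros HM. pose proof (INR2M_pos M HM).
  pose proof (f_equal Cmod (dk_geom M t HM)) as E.
  rewrite !Cmod_mult, Cmod_Ci, Cmod_Cei_sub1, Cmod_R, Rmult_1_r in E.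
  assert (B : Rabs (2 * sin (INR M * t) / INR (2 * M)) <= 2 / INR (2 * M)).
  { unfold Rdiv. rewrite !Rabs_mult, (Rabs_pos_eq 2), (Rabs_pos_eq (/ _)) by
      (try apply Rlt_le, Rinv_0_lt_compat; lra).
    apply Rmult_le_compat_r; [apply Rlt_le, Rinv_0_lt_compat; lra|].
    assert (Rabs (sin (INR M * t)) <= 1) by (apply Rabs_le, SIN_bound). lra. }
  rewrite <- E in B.
  apply Rmult_le_reg_r with (2 / INR (2 * M)); [apply Rdiv_lt_0_compat; lra|].
  replace (Cmod (dk M t) * (INR (2 * M) * Rabs (sin (t / 2))) * (2 / INR (2 * M)))
    with (Cmod (dk M t) * (2 * Rabs (sin (t / 2)))) by (field; lra). lra.
Qed.

(** Unlike in [dk], the block of [n] frequencies may start anywhere and may have odd length, as the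
    spectrum $-f,\dots,f$ of a polynomial of degree $f$ does. *)
Definition dkg (N : nat) (z : Z) (n : nat) (t : R) : C :=
  (RtoC (/ INR N) * Csum n (fun v => ek (z + Z.of_nat v) t))%C.

(** Discrete orthogonality: two frequencies of a block of length at most [N] differ by less than
    [N], so summation over the grid keeps only the matching one. *)
Lemma dkg_interp N z n h s x : (1 <= n <= N)%nat ->
  TS (fun k => (z <= k < z + Z.of_nat n)%Z) h ->
  Csum N (fun v => (h (gpt N s v) * dkg N z n (x - gpt N s v))%C) = h x.
Proof.
  intros Hn Hh. assert (HNp : 0 < INR N) by (apply lt_0_INR; lia). induction Hh.
  - apply Csum_zero; intros; cring.
  - set (y := gpt N s) in *.
    transitivity ((a * Csum N (fun v => ek k (y v) * dkg N z n (x - y v)) +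
      Csum N (fun v => h (y v) * dkg N z n (x - y v)))%C).
    { rewrite <- Csum_scal, <- Csum_plus. apply Csum_ext; intros; cring. }
    rewrite IHHh. f_equal. f_equal.
    transitivity (RtoC (/ INR N) * Csum n (fun u =>
      (ek (z + Z.of_nat u) x * Csum N (fun v => ek (k - (z + Z.of_nat u)) (y v)))))%C.
    { transitivity (RtoC (/ INR N) * Csum N (fun v => Csum n (fun u =>
       ek (z + Z.of_nat u) x * ek (k - (z + Z.of_nat u)) (y v))))%C.
      - rewrite <- Csum_scal. apply Csum_ext; intros v _. unfold dkg.
        rewrite (Cmult_comm (RtoC _)), Cmult_assoc, Cmult_comm. f_equal.
        rewrite <- Csum_scal. apply Csum_ext; intros u _.
        unfold Zminus, Rminus. rewrite ek_plus, (ek_add k), !(ek_opp _ (y v)). cring.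
      - f_equal. rewrite Csum_swap. apply Csum_ext; intros u _. rewrite Csum_scal. reflexivity. }
    set (u0 := Z.to_nat (k - z)).
    assert (Hu0 : (u0 < n)%nat) by (unfold u0; lia).
    replace n with (u0 + (1 + (n - 1 - u0)))%nat at 1 by lia.
    assert (Z1 : forall u : nat, (u < n)%nat -> u <> u0 ->
      (ek (z + Z.of_nat u) x *
        Csum N (fun v => ek (k - (z + Z.of_nat u)) (y v)))%C = RtoC 0).
    { intros u Hu Hne.
      destruct (Z_lt_le_dec 0 (k - (z + Z.of_nat u))) as [Hp|Hp].
      - replace (k - (z + Z.of_nat u))%Z with
          (Z.of_nat N * 0 + (k - (z + Z.of_nat u)))%Z by lia.
        unfold y. rewrite gridsum_ek_ndiv by lia. cring.
      - replace (k - (z + Z.of_nat u))%Z with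
          (Z.of_nat N * (-1) + (k - (z + Z.of_nat u) + Z.of_nat N))%Z by lia.
        unfold y. rewrite gridsum_ek_ndiv by (unfold u0 in *; lia). cring. }
    rewrite Csum_split.
    rewrite (Csum_zero u0) by (intros; apply Z1; lia).
    rewrite Csum_split. rewrite (Csum_zero (n - 1 - u0)) by (intros; apply Z1; lia).
    simpl (Csum 1 _). rewrite Nat.add_0_r.
    replace (z + Z.of_nat u0)%Z with k by (unfold u0; lia).
    replace (k - k)%Z with (Z.of_nat N * 0)%Z by lia. unfold y. rewrite gridsum_ek_div by lia.
    rewrite Z.mul_0_r, ek_0.
    transitivity (RtoC (/ INR N * INR N) * ek k x)%C.
    + rewrite RtoC_mult. cring.
    + rewrite Rinv_l by lra. cring.
Qed.

Lemma dk_interp M h s x : (1 <= M)%nat -> TS (fun k => Rabs (IZR k) < INR M) h ->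
  Csum (2 * M) (fun v => (h (gpt (2 * M) s v) * dk M (x - gpt (2 * M) s v))%C) = h x.
Proof.
  intros HM Hh. rewrite <- (dkg_interp (2 * M) (- Z.of_nat M) (2 * M) h s x).
  - apply Csum_ext; intros v _. unfold dk, dkg. do 2 f_equal.
    apply Csum_ext; intros; f_equal; lia.
  - lia.
  - revert Hh; apply TS_mono. intros k Hk.
    assert (Z.abs k < Z.of_nat M)%Z by (apply lt_IZR; rewrite abs_IZR, <- INR_IZR_INZ; exact Hk).
    lia.
Qed.

(** * Real powers *)

Lemma exp_le x y : x <= y -> exp x <= exp y.
Proof. intros [H| ->]; [left; apply exp_increasing, H|lra]. Qed.

Lemma rpow_ge0 x y : 0 <= rpow x y.
Proof. unfold rpow; destruct (Rlt_dec 0 x); [apply Rlt_le, exp_pos|lra]. Qed.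

Lemma rpow_pos x y : 0 < x -> rpow x y = Rpower x y.
Proof. intros; unfold rpow; destruct (Rlt_dec 0 x); [reflexivity|contradiction]. Qed.

Lemma rpow_0 y : rpow 0 y = 0.
Proof. unfold rpow; destruct (Rlt_dec 0 0); [lra|reflexivity]. Qed.

Lemma rpow_gt0 x y : 0 < x -> 0 < rpow x y.
Proof. intros; rewrite rpow_pos by assumption; apply exp_pos. Qed.

Lemma rpow_1r x : 0 <= x -> rpow x 1 = x.
Proof.
  intros [H|<-]; [rewrite rpow_pos, Rpower_1 by assumption; reflexivity|apply rpow_0].
Qed.

Lemma rpow_le x x' y : 0 <= y -> 0 <= x <= x' -> rpow x y <= rpow x' y.
Proof.
  intros Hy [[H|<-] H']; [|rewrite rpow_0; apply rpow_ge0].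
  rewrite !rpow_pos by lra. apply Rle_Rpower_l; lra.
Qed.

Lemma rpow_mult x x' y : 0 <= x -> 0 <= x' -> rpow (x * x') y = rpow x y * rpow x' y.
Proof.
  intros [H|<-] [H'|<-]; rewrite ?Rmult_0_l, ?Rmult_0_r, ?rpow_0, ?Rmult_0_r, ?Rmult_0_l;
    try reflexivity.
  rewrite !rpow_pos by nra. symmetry; apply Rpower_mult_distr; assumption.
Qed.

Lemma rpow_rpow x y z : rpow (rpow x y) z = rpow x (y * z).
Proof.
  destruct (Rlt_dec 0 x) as [H|H].
  - rewrite (rpow_pos x y), (rpow_pos x (y * z)), rpow_pos by (try apply exp_pos; assumption).
    apply Rpower_mult.
  - unfold rpow. destruct (Rlt_dec 0 x); [contradiction|].
    destruct (Rlt_dec 0 0); [lra|reflexivity].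
Qed.

Lemma rpow_inv_r x y : 0 < y -> 0 <= x -> rpow (rpow x y) (1 / y) = x.
Proof.
  intros Hy Hx. rewrite rpow_rpow. replace (y * (1 / y)) with 1 by (field; lra).
  apply rpow_1r, Hx.
Qed.

Lemma rpow_inv_l x y : 0 < y -> 0 <= x -> rpow (rpow x (1 / y)) y = x.
Proof.
  intros Hy Hx. rewrite rpow_rpow. replace (1 / y * y) with 1 by (field; lra).
  apply rpow_1r, Hx.
Qed.

Lemma rpow_le_inv x y s : 0 < s -> 0 <= x -> 0 <= y -> rpow x s <= rpow y s -> x <= y.
Proof.
  intros Hs Hx Hy H. rewrite <- (rpow_inv_r x s), <- (rpow_inv_r y s) by assumption.
  apply rpow_le; [apply Rlt_le, Rdiv_lt_0_compat; lra|].
  split; [apply rpow_ge0|assumption].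
Qed.

Lemma rpow_plus_le x y s : 0 < s -> 0 <= x -> 0 <= y ->
  rpow (x + y) s <= rpow 2 s * (rpow x s + rpow y s).
Proof.
  intros Hs Hx Hy.
  assert (H : rpow (x + y) s <= rpow (2 * Rmax x y) s).
  { apply rpow_le; [lra|]. pose proof (Rmax_l x y); pose proof (Rmax_r x y). lra. }
  rewrite rpow_mult in H by first [lra | eapply Rle_trans; [exact Hx|apply Rmax_l]].
  eapply Rle_trans; [exact H|]. apply Rmult_le_compat_l; [apply rpow_ge0|].
  pose proof (rpow_ge0 x s); pose proof (rpow_ge0 y s).
  unfold Rmax; destruct (Rle_dec x y); lra.
Qed.

(** After division by [x + y] both terms lie in $[0,1]$, where a power at most 1 does not decrease
    them, and they add up to 1. *)
Lemma rpow_subadd x y s : 0 < s <= 1 -> 0 <= x -> 0 <= y ->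
  rpow (x + y) s <= rpow x s + rpow y s.
Proof.
  intros Hs [Hx|<-] [Hy|<-]; rewrite ?Rplus_0_l, ?Rplus_0_r, ?rpow_0; try lra.
  assert (P : forall u v, 0 < u -> 0 < v -> u / (u + v) <= Rpower (u / (u + v)) s).
  { intros u v Hu Hv. assert (0 < u / (u + v)) by (apply Rdiv_lt_0_compat; lra).
    assert (u / (u + v) <= 1) by (apply Rle_div_l; lra).
    rewrite <- (Rpower_1 (u / (u + v))) at 1 by assumption.
    unfold Rpower. apply exp_le.
    assert (ln (u / (u + v)) <= 0) by (rewrite <- ln_1; apply ln_le; assumption). nra. }
  pose proof (P x y Hx Hy) as P1. pose proof (P y x Hy Hx) as P2.
  rewrite (Rplus_comm y x) in P2.
  rewrite !rpow_pos by lra.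
  replace (Rpower x s) with (Rpower (x / (x + y)) s * Rpower (x + y) s)
    by (rewrite Rpower_mult_distr by (try apply Rdiv_lt_0_compat; lra); f_equal; field; lra).
  replace (Rpower y s) with (Rpower (y / (x + y)) s * Rpower (x + y) s)
    by (rewrite Rpower_mult_distr by (try apply Rdiv_lt_0_compat; lra); f_equal; field; lra).
  assert (E : x / (x + y) + y / (x + y) = 1) by (field; lra).
  assert (0 < Rpower (x + y) s) by apply exp_pos. nra.
Qed.

Lemma rpow_Rsum_subadd n F s : 0 < s <= 1 -> (forall v, (v < n)%nat -> 0 <= F v) ->
  rpow (Rsum n F) s <= Rsum n (fun v => rpow (F v) s).
Proof.
  intros Hs. induction n; intros H; simpl; [rewrite rpow_0; lra|].
  eapply Rle_trans; [apply rpow_subadd; [exact Hs|apply Rsum_nonneg; intros|]; apply H; lia|].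
  apply Rplus_le_compat_r, IHn; intros; apply H; lia.
Qed.

(* Replaces convexity: [b v <= S^(1/q) / w v] for each v, where S is the sum on the right. *)
Lemma rpow_Rsum_weight n F w W q : 0 < q ->
  (forall v, (v < n)%nat -> 0 <= F v) -> (forall v, (v < n)%nat -> 0 < w v) ->
  Rsum n (fun v => / w v) <= W ->
  rpow (Rsum n F) q <= rpow W q * Rsum n (fun v => rpow (w v * F v) q).
Proof.
  intros Hq HF Hw HW.
  set (S := Rsum n (fun v => rpow (w v * F v) q)).
  assert (HS : 0 <= S) by (apply Rsum_nonneg; intros; apply rpow_ge0).
  assert (HWp : 0 <= W).
  { eapply Rle_trans; [|exact HW]. apply Rsum_nonneg; intros.
    apply Rlt_le, Rinv_0_lt_compat, Hw; assumption. }
  rewrite <- (rpow_inv_l S q) by assumption.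
  rewrite <- rpow_mult by (try apply rpow_ge0; assumption).
  apply rpow_le; [lra|]. split; [apply Rsum_nonneg, HF|].
  apply Rle_trans with (Rsum n (fun v => / w v) * rpow S (1 / q));
    [|apply Rmult_le_compat_r; [apply rpow_ge0|exact HW]].
  rewrite <- Rsum_scal_r. apply Rsum_le. intros v Hv. specialize (Hw v Hv). specialize (HF v Hv).
  apply (Rmult_le_reg_l (w v)); [exact Hw|].
  rewrite <- Rmult_assoc, Rinv_r, Rmult_1_l by lra.
  rewrite <- (rpow_inv_r (w v * F v) q) by nra.
  apply rpow_le; [apply Rlt_le, Rdiv_lt_0_compat; lra|]. split; [apply rpow_ge0|].
  unfold S. apply (Rsum_ge_term n (fun v => rpow (w v * F v) q));
    [intros; apply rpow_ge0|exact Hv].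
Qed.

Lemma rpow_continuous q x : 0 < q -> continuous (fun x => rpow x q) x.
Proof.
  intros Hq. destruct (Rtotal_order x 0) as [H|[->|H]].
  - apply (continuous_ext_loc _ (fun _ => 0)); [|apply continuous_const].
    assert (He : 0 < - x) by lra. exists (mkposreal _ He). intros y Hy.
    unfold ball in Hy; simpl in Hy; unfold AbsRing_ball, abs, minus, plus, opp in Hy; simpl in Hy.
    apply Rabs_def2 in Hy. unfold rpow; destruct (Rlt_dec 0 y); [lra|reflexivity].
  - apply continuity_pt_filterlim. intros eps Heps.
    exists (Rpower eps (/ q)). split; [apply exp_pos|].
    intros y [_ Hy]. simpl in *. unfold R_dist in *. rewrite rpow_0, Rminus_0_r in *.
    rewrite Rabs_pos_eq by apply rpow_ge0.
    destruct (Rlt_dec 0 y) as [Hy0|Hy0].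
    + rewrite rpow_pos by assumption. rewrite Rabs_pos_eq in Hy by lra.
      replace eps with (Rpower (Rpower eps (/ q)) q)
        by (rewrite Rpower_mult, Rinv_l, Rpower_1 by lra; reflexivity).
      apply Rlt_Rpower_l; [exact Hq|lra].
    + unfold rpow; destruct (Rlt_dec 0 y); [contradiction|exact Heps].
  - apply (continuous_ext_loc _ (fun y => exp (q * ln y))).
    + exists (mkposreal _ H). intros y Hy.
      unfold ball in Hy; simpl in Hy; unfold AbsRing_ball, abs, minus, plus, opp in Hy; simpl in Hy.
      apply Rabs_def2 in Hy. rewrite rpow_pos by lra. reflexivity.
    + apply (ex_derive_continuous (fun y => exp (q * ln y))). auto_derive. exact H.
Qed.

Lemma Rpower_neg_le1 x s : 1 <= x -> 0 <= s -> Rpower x (- s) <= 1.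
Proof. intros. rewrite <- (Rpower_O x) by lra. apply Rle_Rpower; lra. Qed.

Lemma Rpower_neg_anti x y s : 0 < x <= y -> 0 <= s -> Rpower y (- s) <= Rpower x (- s).
Proof.
  intros H Hs. unfold Rpower. apply exp_le.
  assert (ln x <= ln y) by (apply ln_le; lra). nra.
Qed.

Lemma ln_le_sub1 x : 0 < x -> ln x <= x - 1.
Proof. intros H. pose proof (exp_ineq1_le (ln x)) as E. rewrite exp_ln in E by assumption. lra. Qed.

(** This is $\int_a^b x^{-s}\,dx\ge (b-a)b^{-s}$ in integrated form, obtained from $e^u\ge 1+u$ and
    $\ln x\le x-1$. *)
Lemma Rpower_telescope a b s : 0 < a -> a <= b -> 1 < s ->
  (s - 1) * (b - a) * Rpower b (- s) <= Rpower a (1 - s) - Rpower b (1 - s).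
Proof.
  intros Ha Hab Hs.
  assert (E1 : Rpower a (1 - s) = Rpower b (1 - s) * exp ((s - 1) * ln (b / a))).
  { unfold Rpower. rewrite <- exp_plus. f_equal. rewrite ln_div by lra. ring. }
  assert (E2 : Rpower b (- s) * b = Rpower b (1 - s)).
  { rewrite <- (Rpower_1 b) at 2 by lra. rewrite <- Rpower_plus. f_equal; ring. }
  rewrite E1.
  assert (L : 1 - a / b <= ln (b / a)).
  { pose proof (ln_le_sub1 (a / b) ltac:(apply Rdiv_lt_0_compat; lra)) as H.
    rewrite ln_div in * by lra. lra. }
  pose proof (exp_ineq1_le ((s - 1) * ln (b / a))) as H.
  assert (0 < Rpower b (1 - s)) by apply exp_pos.
  assert (H2 : (s - 1) * (1 - a / b) <= exp ((s - 1) * ln (b / a)) - 1) by nra.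
  apply Rle_trans with (Rpower b (1 - s) * ((s - 1) * (1 - a / b))); [|nra].
  rewrite <- E2. right. field. lra.
Qed.

(** Integral test in the variable [1 + mu * w]; the factor [/ mu] is what later turns into the
    number of nodes per unit of decay. *)
Lemma Rsum_decay n mu s : 0 < mu -> 1 < s ->
  Rsum n (fun w => Rpower (1 + mu * INR w) (- s)) <= 1 + / (mu * (s - 1)).
Proof.
  intros Hmu Hs.
  assert (Hp : 0 < / (mu * (s - 1))) by (apply Rinv_0_lt_compat; nra).
  destruct n; [simpl; lra|]. rewrite Rsum_shift. simpl (INR 0). rewrite Rmult_0_r, Rplus_0_r.
  apply Rplus_le_compat; [apply Rpower_neg_le1; lra|].
  set (F := fun v : nat => / (mu * (s - 1)) * Rpower (1 + mu * INR v) (1 - s)).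
  apply Rle_trans with (Rsum n (fun v => F v - F (S v))).
  - apply Rsum_le. intros v _. unfold F.
    pose proof (pos_INR v).
    pose proof (Rpower_telescope (1 + mu * INR v) (1 + mu * INR (S v)) s ltac:(nra)
      ltac:(rewrite S_INR; nra) Hs) as T.
    replace (1 + mu * INR (S v) - (1 + mu * INR v)) with mu in T by (rewrite S_INR; ring).
    apply (Rmult_le_reg_l (mu * (s - 1))); [nra|].
    replace (mu * (s - 1) * (/ (mu * (s - 1)) * Rpower (1 + mu * INR v) (1 - s) -
      / (mu * (s - 1)) * Rpower (1 + mu * INR (S v)) (1 - s)))
      with (Rpower (1 + mu * INR v) (1 - s) - Rpower (1 + mu * INR (S v)) (1 - s))
      by (field; split; lra). lra.
  - rewrite Rsum_telescope. unfold F. simpl (INR 0). rewrite Rmult_0_r, Rplus_0_r.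
    assert (0 < Rpower (1 + mu * INR n) (1 - s)) by apply exp_pos.
    replace (Rpower 1 (1 - s)) with 1
      by (unfold Rpower; rewrite ln_1, Rmult_0_r, exp_0; reflexivity). nra.
Qed.

(** * Weights on the circle *)

Lemma Rsum_period (P : Z -> R) (N : nat) k : (1 <= N)%nat ->
  (forall z, P (z + Z.of_nat N)%Z = P z) ->
  Rsum N (fun v => P (Z.of_nat v + k)%Z) = Rsum N (fun v => P (Z.of_nat v)).
Proof.
  intros HN HP.
  assert (Hn : forall n : nat, Rsum N (fun v => P (Z.of_nat v + Z.of_nat n)%Z)
    = Rsum N (fun v => P (Z.of_nat v))).
  { induction n.
    - apply Rsum_ext; intros; f_equal; lia.
    - rewrite <- IHn. set (G := fun v : nat => P (Z.of_nat v + Z.of_nat n)%Z).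
      pose proof (Rsum_shift N G) as E. simpl (Rsum (S N) G) in E.
      assert (E2 : G N = G O) by
        (unfold G; replace (Z.of_nat N + Z.of_nat n)%Z with ((Z.of_nat 0 + Z.of_nat n) + Z.of_nat N)%Z by lia; apply HP).
      transitivity (Rsum N (fun v => G (S v))).
      + apply Rsum_ext; intros; unfold G; f_equal; lia.
      + fold G. lra. }
  assert (HPm : forall (m : nat) z, P (z + Z.of_nat (m * N))%Z = P z).
  { induction m; intros z; [f_equal; lia|].
    replace (z + Z.of_nat (S m * N))%Z with ((z + Z.of_nat (m * N)) + Z.of_nat N)%Z by lia.
    rewrite HP. apply IHm. }
  (* A possibly negative shift is made nonnegative by adding [N] times its absolute value, a
     multiple of the period. *)
  transitivity (Rsum N (fun v => P (Z.of_nat v + Z.of_nat (Z.to_nat (k + Z.of_nat (Z.to_nat (Z.abs k) * N))))%Z)).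
  - apply Rsum_ext; intros v _. rewrite <- (HPm (Z.to_nat (Z.abs k)) (Z.of_nat v + k)%Z).
    f_equal. rewrite Z2Nat.id by nia. lia.
  - apply Hn.
Qed.

(** Half the chord $|e^{iy}-1|$: a periodic substitute for the distance from $y$ to $2\pi\mathbb Z$,
    Lipschitz and stable under translation by periods. *)
Definition asin2 (y : R) : R := Rabs (sin (y / 2)).

Lemma asin2_Cei y : asin2 y = Cmod (Cei y - 1) / 2.
Proof. rewrite Cmod_Cei_sub1. unfold asin2. field. Qed.

Lemma asin2_ge0 y : 0 <= asin2 y.
Proof. apply Rabs_pos. Qed.

Lemma asin2_le1 y : asin2 y <= 1.
Proof. apply Rabs_le, SIN_bound. Qed.

Lemma asin2_period y k : asin2 (y + 2 * PI * IZR k) = asin2 y.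
Proof. rewrite !asin2_Cei, Cei_plus, Cei_2PI. do 3 f_equal. cring. Qed.

Lemma asin2_opp y : asin2 (- y) = asin2 y.
Proof.
  unfold asin2. replace (- y / 2) with (- (y / 2)) by field. rewrite sin_neg. apply Rabs_Ropp.
Qed.

Lemma asin2_sym x y : asin2 (x - y) = asin2 (y - x).
Proof. rewrite <- asin2_opp. f_equal; ring. Qed.

(** Periodic counterpart of $(1+\lambda|y|)^{-s}$. Orders of decay add under multiplication and
    scale under powers, so decay can be split and spent piecewise. *)
Definition wt (lam s y : R) : R := Rpower (1 + lam * asin2 y) (- s).

Lemma wt_pos lam s y : 0 < wt lam s y.
Proof. apply exp_pos. Qed.

Lemma wt_base lam y : 0 <= lam -> 1 <= 1 + lam * asin2 y.
Proof. intros. pose proof (asin2_ge0 y). nra. Qed.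

Lemma wt_le1 lam s y : 0 <= lam -> 0 <= s -> wt lam s y <= 1.
Proof. intros. apply Rpower_neg_le1; [apply wt_base|]; assumption. Qed.

Lemma wt_mult lam s s' y : wt lam s y * wt lam s' y = wt lam (s + s') y.
Proof. unfold wt. rewrite <- Rpower_plus. f_equal; ring. Qed.

Lemma wt_inv lam s y : / wt lam s y = wt lam (- s) y.
Proof. unfold wt. rewrite <- Rpower_Ropp. f_equal; ring. Qed.

Lemma wt_rpow lam s q y : rpow (wt lam s y) q = wt lam (s * q) y.
Proof. rewrite rpow_pos by apply wt_pos. unfold wt. rewrite Rpower_mult. f_equal; ring. Qed.

Lemma wt_sym lam s x y : wt lam s (x - y) = wt lam s (y - x).
Proof. unfold wt; rewrite asin2_sym; reflexivity. Qed.

Lemma wt_anti lam s s' y : 0 <= lam -> s <= s' -> wt lam s' y <= wt lam s y.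
Proof. intros. apply Rle_Rpower; [apply wt_base; assumption|lra]. Qed.

Lemma wt_pow lam M y : 0 <= lam -> wt lam (INR M) y * (1 + lam * asin2 y) ^ M = 1.
Proof.
  intros H. unfold wt. rewrite <- Rpower_pow by (pose proof (wt_base lam y H); lra).
  rewrite <- Rpower_plus, Rplus_opp_l. apply Rpower_O. pose proof (wt_base lam y H); lra.
Qed.

(** Two Taylor terms suffice: $x-x^3/6\ge x/3$ for $x\le 2$, and $\pi/2\le 2$. *)
Lemma sin_ge_third x : 0 <= x <= PI / 2 -> x / 3 <= sin x.
Proof.
  intros [H0 H1]. pose proof PI_4.
  destruct (pre_sin_bound x 0 H0 ltac:(lra)) as [HS _].
  unfold sin_approx, sin_term in HS. simpl in HS.
  eapply Rle_trans; [|exact HS]. nra.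
Qed.

Lemma sin_ge_min a : 0 <= a <= PI -> Rmin a (PI - a) / 3 <= sin a.
Proof.
  intros H. unfold Rmin. destruct (Rle_dec a (PI - a)) as [L|L].
  - apply sin_ge_third; lra.
  - rewrite <- sin_PI_x. apply sin_ge_third; lra.
Qed.

Lemma wt_grid_sum s : 1 < s -> exists C, 0 < C /\ forall (N : nat) lam y t, (1 <= N)%nat ->
  0 < lam -> Rsum N (fun v => wt lam s (y - gpt N t v)) <= C * (1 + INR N / lam).
Proof.
  (* One node is bounded by 1; the others fall into two decaying sums, each at most
     [1 + N / (lam * (s - 1))]. *)
  intros Hs. exists (3 + 2 / (s - 1)).
  assert (Hs1 : 0 < / (s - 1)) by (apply Rinv_0_lt_compat; lra).
  split; [unfold Rdiv; lra|]. intros N lam y t HN Hlam.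
  assert (HNp : 0 < INR N) by (apply lt_0_INR; lia). pose proof PI_RGT_0 as HPI.
  pose proof (archimed ((y - t) * INR N / (2 * PI))) as [A1 A2].
  (* Index of the last node not beyond [y]; after rotating the grid by it the offset [y0] lies
     within one mesh width. *)
  set (k := (up ((y - t) * INR N / (2 * PI)) - 1)%Z).
  set (y0 := y - t - 2 * PI * IZR k / INR N).
  assert (Hy0 : 0 <= y0 <= 2 * PI / INR N).
  { assert (E : y0 = ((y - t) * INR N / (2 * PI) - IZR k) * (2 * PI / INR N))
      by (unfold y0; field; lra).
    assert (0 < 2 * PI / INR N) by (apply Rdiv_lt_0_compat; lra).
    unfold k in E. rewrite minus_IZR in E. simpl in E. rewrite E. split; nra. }
  set (P := fun z : Z => wt lam s (y0 - 2 * PI * IZR z / INR N)).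
  assert (HP : forall z, P (z + Z.of_nat N)%Z = P z).
  { intros z. unfold P, wt. f_equal. f_equal. f_equal.
    rewrite <- (asin2_period (y0 - 2 * PI * IZR z / INR N) (-1)). f_equal.
    rewrite plus_IZR, <- INR_IZR_INZ. field. lra. }
  assert (E : Rsum N (fun v => wt lam s (y - gpt N t v)) = Rsum N (fun v => P (Z.of_nat v))).
  { rewrite <- (Rsum_period P N (- k) HN HP). apply Rsum_ext; intros v _. unfold P, gpt, y0.
    f_equal. rewrite plus_IZR, opp_IZR, <- INR_IZR_INZ. field. lra. }
  rewrite E.
  set (mu := lam / INR N). assert (Hmu : 0 < mu) by (apply Rdiv_lt_0_compat; lra).
  assert (B : Rsum N (fun v => P (Z.of_nat v)) <=
    1 + (Rsum (N - 1) (fun w => Rpower (1 + mu * INR w) (- s)) +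
         Rsum (N - 1) (fun w => Rpower (1 + mu * INR w) (- s)))).
  { replace N with (S (N - 1)) at 1 by lia. rewrite Rsum_shift.
    apply Rplus_le_compat; [unfold P; apply wt_le1; lra|].
    (* Nodes on the near half of the circle are counted from one end of the grid and the remaining
       ones from the other end, hence the reversal of one copy. *)
    rewrite (Rsum_rev (N - 1) (fun w => Rpower (1 + mu * INR w) (- s))) at 2.
    rewrite <- Rsum_plus. apply Rsum_le. intros v Hv.
    assert (Hv1 : INR v + 2 <= INR N + 0 \/ INR v + 1 = INR N - 0).
    { destruct (Nat.eq_dec (v + 1) N) as [Ev|Ev].
      - right. rewrite <- Ev, plus_INR; simpl; lra.
      - left. replace 2 with (INR 2) by reflexivity. rewrite <- plus_INR, Rplus_0_r. apply le_INR; lia. }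
    assert (Hv2 : INR v + 1 <= INR N) by lra. clear Hv1. pose proof (pos_INR v) as Hv0.
    set (al := PI * (INR v + 1) / INR N - y0 / 2).
    assert (Hal : PI * INR v / INR N <= al <= PI * (INR v + 1) / INR N).
    { unfold al. split; [|lra].
      assert (y0 / 2 <= PI / INR N) by (replace (PI / INR N) with (2 * PI / INR N / 2) by (field; lra); lra).
      replace (PI * (INR v + 1) / INR N) with (PI * INR v / INR N + PI / INR N) by (field; lra). lra. }
    assert (Hal0 : 0 <= PI * INR v / INR N) by (apply Rmult_le_pos; [apply Rmult_le_pos; lra|apply Rlt_le, Rinv_0_lt_compat; lra]).
    assert (Hal1 : PI * (INR v + 1) / INR N <= PI) by (apply Rle_div_l; [lra|nra]).
    assert (EP : P (Z.of_nat (S v)) = Rpower (1 + lam * sin al) (- s)).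
    { unfold P, wt, asin2. f_equal. f_equal. f_equal.
      rewrite <- INR_IZR_INZ, S_INR.
      replace ((y0 - 2 * PI * (INR v + 1) / INR N) / 2) with (- al) by (unfold al; field; lra).
      rewrite sin_neg, Rabs_Ropp. apply Rabs_pos_eq. apply sin_ge_0; lra. }
    rewrite EP. pose proof (sin_ge_min al ltac:(lra)) as HS.
    (* The estimate [PI > 3] cancels the factor 1/3 lost in [sin_ge_min]. *)
    pose proof PI2_3_2. unfold PI2 in *.
    assert (G : forall w, 0 <= w -> w / INR N <= sin al ->
      Rpower (1 + lam * sin al) (- s) <= Rpower (1 + mu * w) (- s)).
    { intros w Hw Hle. apply Rpower_neg_anti; [|lra]. unfold mu.
      replace (lam / INR N * w) with (lam * (w / INR N)) by (field; lra).
      assert (0 <= w / INR N) by (apply Rmult_le_pos; [lra|apply Rlt_le, Rinv_0_lt_compat; lra]).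
      split; nra. }
    unfold Rmin in HS. destruct (Rle_dec al (PI - al)) as [L|L].
    - apply Rle_trans with (Rpower (1 + mu * INR v) (- s) + 0);
        [rewrite Rplus_0_r|apply Rplus_le_compat_l, Rlt_le, exp_pos].
      apply G; [lra|]. apply Rle_trans with (al / 3); [|exact HS].
      apply Rle_trans with (PI * INR v / INR N / 3); [|lra].
      unfold Rdiv. rewrite Rmult_assoc, (Rmult_comm (/ INR N)), <- Rmult_assoc.
      apply Rmult_le_compat_r; [apply Rlt_le, Rinv_0_lt_compat; lra|]. nra.
    - apply Rle_trans with (0 + Rpower (1 + mu * INR (N - 1 - 1 - v)) (- s));
        [rewrite Rplus_0_l|apply Rplus_le_compat_r, Rlt_le, exp_pos].
      assert (Hw : INR (N - 1 - 1 - v) <= INR N - (INR v + 1)).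
      { rewrite !minus_INR by lia. simpl. lra. }
      apply G; [apply pos_INR|]. apply Rle_trans with ((PI - al) / 3); [|exact HS].
      apply Rle_trans with ((PI - PI * (INR v + 1) / INR N) / 3); [|lra].
      replace ((PI - PI * (INR v + 1) / INR N) / 3) with ((PI / 3 * (INR N - (INR v + 1))) / INR N)
        by (field; lra).
      unfold Rdiv. apply Rmult_le_compat_r; [apply Rlt_le, Rinv_0_lt_compat; lra|]. nra. }
  pose proof (Rsum_decay (N - 1) mu s Hmu Hs) as D.
  eapply Rle_trans; [exact B|].
  assert (Emu : / (mu * (s - 1)) = INR N / lam * / (s - 1)) by (unfold mu; field; lra).
  rewrite Emu in D.
  assert (0 < INR N / lam) by (apply Rdiv_lt_0_compat; lra).
  unfold Rdiv at 1. nra.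
Qed.

(** * Complex limits *)

Definition ccv (u : nat -> C) (l : C) : Prop :=
  forall eps, 0 < eps -> exists N, forall n, (N <= n)%nat -> Cmod (u n - l) < eps.

Lemma ccv_eventually u v l : (exists N, forall n, (N <= n)%nat -> u n = v n) -> ccv u l -> ccv v l.
Proof.
  intros [N HN] H eps He. destruct (H eps He) as [N' H']. exists (N + N')%nat. intros n Hn.
  rewrite <- HN by lia. apply H'; lia.
Qed.

Lemma ccv_const c : ccv (fun _ => c) c.
Proof.
  intros eps He. exists O. intros. replace (c - c)%C with (RtoC 0) by cring.
  rewrite Cmod_0; exact He.
Qed.

Lemma ccv_unique u l l' : ccv u l -> ccv u l' -> l = l'.
Proof.
  intros H H'. destruct (Req_dec (Cmod (l - l')) 0) as [E|E].
  - apply Cmod_eq_0 in E. replace l with ((l - l') + l')%C by cring. rewrite E. cring.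
  - pose proof (Cmod_ge_0 (l - l')). assert (He : 0 < Cmod (l - l') / 2) by lra.
    destruct (H _ He) as [N HN], (H' _ He) as [N' HN'].
    specialize (HN (N + N')%nat ltac:(lia)). specialize (HN' (N + N')%nat ltac:(lia)).
    pose proof (Cmod_sub3 l (u (N + N')%nat) l') as T.
    rewrite (Cmod_minus_sym l (u (N + N')%nat)) in T. lra.
Qed.

Lemma ccv_plus u v l m : ccv u l -> ccv v m -> ccv (fun n => (u n + v n)%C) (l + m)%C.
Proof.
  intros Hu Hv eps He. destruct (Hu (eps / 2)) as [N HN]; [lra|].
  destruct (Hv (eps / 2)) as [N' HN']; [lra|]. exists (N + N')%nat. intros n Hn.
  replace (u n + v n - (l + m))%C with ((u n - l) + (v n - m))%C by cring.
  eapply Rle_lt_trans; [apply Cmod_triangle|].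
  specialize (HN n ltac:(lia)); specialize (HN' n ltac:(lia)). lra.
Qed.

Lemma ccv_scal c u l : ccv u l -> ccv (fun n => (c * u n)%C) (c * l)%C.
Proof.
  intros Hu eps He. pose proof (Cmod_ge_0 c).
  destruct (Hu (eps / (Cmod c + 1))) as [N HN]; [apply Rdiv_lt_0_compat; lra|].
  exists N. intros n Hn. replace (c * u n - c * l)%C with (c * (u n - l))%C by cring.
  rewrite Cmod_mult. specialize (HN n Hn). pose proof (Cmod_ge_0 (u n - l)).
  apply Rle_lt_trans with ((Cmod c + 1) * Cmod (u n - l)); [nra|].
  replace eps with ((Cmod c + 1) * (eps / (Cmod c + 1))) by (field; lra).
  apply Rmult_lt_compat_l; lra.
Qed.

Lemma ccv_mult u v l m : (forall n, Cmod (u n) <= 1) -> ccv u l -> ccv v m ->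
  ccv (fun n => (u n * v n)%C) (l * m)%C.
Proof.
  intros Hb Hu Hv eps He. pose proof (Cmod_ge_0 m).
  destruct (Hu (eps / 2 / (Cmod m + 1))) as [N HN]; [repeat apply Rdiv_lt_0_compat; lra|].
  destruct (Hv (eps / 2)) as [N' HN']; [lra|]. exists (N + N')%nat. intros n Hn.
  replace (u n * v n - l * m)%C with (u n * (v n - m) + (u n - l) * m)%C by cring.
  eapply Rle_lt_trans; [apply Cmod_triangle|]. rewrite !Cmod_mult.
  specialize (HN n ltac:(lia)); specialize (HN' n ltac:(lia)). specialize (Hb n).
  pose proof (Cmod_ge_0 (u n)). pose proof (Cmod_ge_0 (v n - m)). pose proof (Cmod_ge_0 (u n - l)).
  assert (Cmod (u n - l) * Cmod m <= eps / 2).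
  { apply Rle_trans with (Cmod (u n - l) * (Cmod m + 1)); [nra|].
    apply Rlt_le. apply Rlt_div_r; lra. }
  nra.
Qed.

Lemma ccv_Csum n (u : nat -> nat -> C) l :
  (forall v, (v < n)%nat -> ccv (fun k => u k v) (l v)) ->
  ccv (fun k => Csum n (u k)) (Csum n l).
Proof.
  induction n; intros H; simpl; [apply ccv_const|].
  apply (ccv_plus (fun k => Csum n (u k)) (fun k => u k n)); [apply IHn; intros|]; apply H; lia.
Qed.

(** Polynomials of degree at most [D] are recovered from their values at [2 f + 1] nodes, with [f]
    the integer part of [D]. The interpolation formula passes to the pointwise limit and exhibits it
    as a combination of translated kernels. *)
Lemma TP_limit D u h : 0 <= D -> (forall n, TP D (u n)) -> (forall x, ccv (fun n => u n x) (h x)) ->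
  TP D h.
Proof.
  intros HD Hu Hl. pose proof (archimed D) as [A1 A2].
  set (f := (up D - 1)%Z).
  assert (Hf0 : (0 <= f)%Z).
  { unfold f. assert (0 < up D)%Z by (apply lt_IZR; lra). lia. }
  assert (HfD : IZR f <= D) by (unfold f; rewrite minus_IZR; lra).
  assert (HDf : D < IZR f + 1) by (unfold f; rewrite minus_IZR; lra).
  set (N := Z.to_nat (2 * f + 1)).
  assert (HT : forall n, TS (fun k => (- f <= k < - f + Z.of_nat N)%Z) (u n)).
  { intros n. generalize (Hu n). apply TS_mono. intros k Hk.
    assert (Z.abs k < f + 1)%Z by (apply lt_IZR; rewrite abs_IZR, plus_IZR; lra).
    unfold N; lia. }
  assert (E : forall x, h x =
    Csum N (fun v => (dkg N (- f) N (x - gpt N 0 v) * h (gpt N 0 v))%C)).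
  { intros x. apply (ccv_unique (fun n => u n x)); [apply Hl|].
    apply (ccv_eventually (fun n =>
      Csum N (fun v => (dkg N (- f) N (x - gpt N 0 v) * u n (gpt N 0 v))%C))).
    - exists O. intros n _. rewrite <- (dkg_interp N (- f) N (u n) 0 x); [|unfold N; lia|apply HT].
      apply Csum_ext; intros; cring.
    - apply ccv_Csum. intros v _. apply ccv_scal, Hl. }
  eapply TS_eq; [|intros x; symmetry; apply E].
  apply (TS_csum _ N (fun v x => (dkg N (- f) N (x - gpt N 0 v) * h (gpt N 0 v))%C)).
  intros v _. apply (TS_scal_r _ _ (fun x => dkg N (- f) N (x - gpt N 0 v))).
  apply (TS_shift _ (dkg N (- f) N) (- gpt N 0 v)).
  apply TS_scal, (TS_csum _ N (fun v => ek (- f + Z.of_nat v))).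
  intros w Hw. apply TS_ek. rewrite <- abs_IZR.
  apply Rle_trans with (IZR f); [apply IZR_le; unfold N in Hw; lia|exact HfD].
Qed.

(** * Periodisation of the kernels [K^L] *)

Fixpoint Cprod (n : nat) (F : nat -> C) : C :=
  match n with O => RtoC 1 | S m => (Cprod m F * F m)%C end.

Lemma Cprod_le1 n F : (forall l, (l < n)%nat -> Cmod (F l) <= 1) -> Cmod (Cprod n F) <= 1.
Proof.
  induction n; intros H; simpl; [rewrite Cmod_1; lra|]. rewrite Cmod_mult.
  specialize (IHn (fun l Hl => H l (Nat.lt_lt_succ_r _ _ Hl))).
  specialize (H n (Nat.lt_succ_diag_r n)).
  pose proof (Cmod_ge_0 (F n)). pose proof (Cmod_ge_0 (Cprod n F)). nra.
Qed.

Lemma Cprod_le2 n F : (2 <= n)%nat -> (forall l, (l < n)%nat -> Cmod (F l) <= 1) ->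
  Cmod (Cprod n F) <= Cmod (F O) * Cmod (F 1%nat).
Proof.
  intros Hn. induction Hn as [|n Hn IH]; intros H.
  - simpl. rewrite !Cmod_mult, Cmod_1. lra.
  - simpl. rewrite Cmod_mult. specialize (IH (fun l Hl => H l (Nat.lt_lt_succ_r _ _ Hl))).
    specialize (H n (Nat.lt_succ_diag_r n)).
    pose proof (Cmod_ge_0 (F n)). pose proof (Cmod_ge_0 (Cprod n F)). nra.
Qed.

Lemma Cprod_shift n F : Cprod (S n) F = (F O * Cprod n (fun l => F (S l)))%C.
Proof. induction n; simpl; [cring|]. simpl in IHn. rewrite IHn. cring. Qed.

Lemma RtoC_Rprod n F : RtoC (Rprod n F) = Cprod n (fun l => RtoC (F l)).
Proof. induction n; simpl; [reflexivity|]. rewrite RtoC_mult, IHn; reflexivity. Qed.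

Lemma RtoC_Rsum n F : RtoC (Rsum n F) = Csum n (fun l => RtoC (F l)).
Proof. induction n; simpl; [reflexivity|]. rewrite RtoC_plus, IHn; reflexivity. Qed.

Lemma ccv_Cprod n (u : nat -> nat -> C) l :
  (forall k v, Cmod (u k v) <= 1) ->
  (forall v, (v < n)%nat -> ccv (fun k => u k v) (l v)) ->
  ccv (fun k => Cprod n (u k)) (Cprod n l).
Proof.
  intros Hb. induction n; intros H; simpl; [apply ccv_const|].
  apply (ccv_mult (fun k => Cprod n (u k)) (fun k => u k n)).
  - intros k. apply Cprod_le1; intros; apply Hb.
  - apply IHn; intros; apply H; lia.
  - apply H; lia.
Qed.

Definition symsum (F : Z -> C) (N : nat) : C :=
  Csum (2 * N + 1) (fun t => F (Z.of_nat t - Z.of_nat N)%Z).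

Lemma symsum_S F N :
  symsum F (S N) = (symsum F N + (F (- Z.of_nat (S N))%Z + F (Z.of_nat (S N))))%C.
Proof.
  unfold symsum. replace (2 * S N + 1)%nat with (S (S (2 * N + 1))) by lia.
  rewrite Csum_shift, Csum_S.
  replace (Csum (2 * N + 1) (fun v => F (Z.of_nat (S v) - Z.of_nat (S N))%Z))
    with (Csum (2 * N + 1) (fun t => F (Z.of_nat t - Z.of_nat N)%Z))
    by (apply Csum_ext; intros; f_equal; lia).
  replace (Z.of_nat 0 - Z.of_nat (S N))%Z with (- Z.of_nat (S N))%Z by lia.
  replace (Z.of_nat (S (2 * N + 1)) - Z.of_nat (S N))%Z with (Z.of_nat (S N)) by lia. cring.
Qed.

(** Telescoping from $1/n^2\le 1/(n-1)-1/n$; the factor 2 counts the two signs of $n$. *)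
Lemma symsum_tail F B N0 N : (1 <= N0 <= N)%nat -> 0 <= B ->
  (forall n, (Z.of_nat N0 < Z.abs n <= Z.of_nat N)%Z -> Cmod (F n) <= B / (IZR n * IZR n)) ->
  Cmod (symsum F N - symsum F N0) <= 2 * B * (/ INR N0 - / INR N).
Proof.
  intros [H0 H1] HB. induction H1 as [|N H1 IH]; intros H.
  - replace (symsum F N0 - symsum F N0)%C with (RtoC 0) by cring. rewrite Cmod_0; lra.
  - specialize (IH ltac:(intros; apply H; lia)). rewrite symsum_S.
    pose proof (H (- Z.of_nat (S N))%Z ltac:(lia)) as B1.
    pose proof (H (Z.of_nat (S N)) ltac:(lia)) as B2.
    rewrite opp_IZR in B1. rewrite <- !INR_IZR_INZ in *.
    assert (HN : 1 <= INR N) by (apply (le_INR 1); lia).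
    assert (B3 : B / (INR (S N) * INR (S N)) <= B * (/ INR N - / INR (S N))).
    { unfold Rdiv. apply Rmult_le_compat_l; [exact HB|]. rewrite S_INR.
      replace (/ INR N - / (INR N + 1)) with (/ (INR N * (INR N + 1))) by (field; lra).
      apply Rinv_le_contravar; nra. }
    replace (- INR (S N) * - INR (S N)) with (INR (S N) * INR (S N)) in B1 by ring.
    match goal with |- Cmod (?s + (?a + ?b) - ?s0) <= _ =>
      replace (s + (a + b) - s0)%C with ((s - s0) + (a + b))%C by cring;
      pose proof (Cmod_triangle (s - s0) (a + b)); pose proof (Cmod_triangle a b) end.
    lra.
Qed.

(* Tannery's theorem for symmetric partial sums. *)
Lemma tannery (u : Z -> R) (v : nat -> Z -> C) B n0 R0 : 0 <= B ->
  (forall n, (Z.of_nat n0 < Z.abs n)%Z -> Rabs (u n) <= B / (IZR n * IZR n)) ->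
  (forall r n, (R0 <= r)%nat -> (Z.of_nat n0 < Z.abs n)%Z -> (Z.abs n <= Z.of_nat (2 ^ r))%Z ->
     Cmod (v (S r) n) <= B / (IZR n * IZR n)) ->
  (forall n, ccv (fun r => v r n) (RtoC (u n))) ->
  exists l, Un_cv (fun N => Rsum (2 * N + 1) (fun t => u (Z.of_nat t - Z.of_nat N)%Z)) l /\
    ccv (fun r => Csum (2 ^ S r) (fun t => v (S r) (Z.of_nat t - Z.of_nat (2 ^ r))%Z)) (RtoC l).
Proof.
  intros HB Hu Hv Hl.
  set (w := fun n => RtoC (u n)).
  assert (Ew : forall N, symsum w N = RtoC (Rsum (2 * N + 1) (fun t => u (Z.of_nat t - Z.of_nat N)%Z)))
    by (intros; symmetry; apply RtoC_Rsum).
  set (W := fun N => Rsum (2 * N + 1) (fun t => u (Z.of_nat t - Z.of_nat N)%Z)) in *.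
  assert (T : forall N0 N, (1 <= N0)%nat -> (n0 <= N0)%nat -> (N0 <= N)%nat ->
    Rabs (W N - W N0) <= 2 * B / INR N0).
  { intros N0 N H1 H2 H3.
    pose proof (symsum_tail w B N0 N ltac:(lia) HB) as H.
    rewrite !Ew, <- RtoC_minus, Cmod_R in H. eapply Rle_trans; [apply H|].
    - intros n Hn. unfold w. rewrite Cmod_R. apply Hu; lia.
    - assert (0 < / INR N) by (apply Rinv_0_lt_compat, lt_0_INR; lia). unfold Rdiv. nra. }
  assert (Small : forall eps, 0 < eps -> exists N0, (1 <= N0)%nat /\ (n0 <= N0)%nat /\ 2 * B / INR N0 < eps).
  { intros eps He. destruct (INR_unbounded (2 * B / eps)) as [k Hk].
    exists (S (k + n0)). split; [lia|]. split; [lia|].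
    assert (INR k <= INR (S (k + n0))) by (apply le_INR; lia).
    assert (0 <= 2 * B / eps) by (apply Rmult_le_pos; [lra|apply Rlt_le, Rinv_0_lt_compat; lra]).
    apply Rlt_div_l; [lra|]. apply Rlt_div_l in Hk; [|lra]. nra. }
  assert (Cau : Cauchy_crit W).
  { intros eps He. destruct (Small (eps / 2) ltac:(lra)) as [N0 [H1 [H2 H3]]].
    exists N0. intros n m Hn Hm. unfold R_dist.
    pose proof (T N0 n H1 H2 Hn). pose proof (T N0 m H1 H2 Hm).
    replace (W n - W m) with ((W n - W N0) - (W m - W N0)) by ring.
    unfold Rminus at 1. eapply Rle_lt_trans; [apply Rabs_triang|]. rewrite Rabs_Ropp. lra. }
  destruct (Rcomplete.R_complete W Cau) as [l Hlim]. exists l. split; [exact Hlim|].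
  (* Five parts: one for the unpaired term, one for the tail of [v], one for convergence on the
     fixed window, and two for the distance of [W N0] from the limit. *)
  intros eps He. destruct (Small (eps / 5) ltac:(lra)) as [N0 [H1 [H2 H3]]].
  assert (D0 : Rabs (l - W N0) <= 2 * eps / 5).
  { destruct (Hlim (eps / 5) ltac:(lra)) as [N1 HN1].
    specialize (HN1 (N0 + N1)%nat ltac:(lia)). unfold R_dist in HN1.
    pose proof (T N0 (N0 + N1)%nat H1 H2 ltac:(lia)) as TT.
    replace (l - W N0) with (- (W (N0 + N1)%nat - l) + (W (N0 + N1)%nat - W N0)) by ring.
    eapply Rle_trans; [apply Rabs_triang|]. rewrite Rabs_Ropp. lra. }
  assert (CV : ccv (fun r => symsum (v r) N0) (symsum w N0))
    by (apply ccv_Csum; intros; apply Hl).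
  destruct (CV (eps / 5) ltac:(lra)) as [R1 HR1].
  exists (R0 + R1 + S N0)%nat. intros r Hr.
  assert (Hr2 : (r < 2 ^ r)%nat) by (apply Nat.pow_gt_lin_r; lia).
  set (H := (2 ^ r)%nat) in *.
  (* The range $-H,\dots,H-1$ is the symmetric window of radius $H-1$ together with the unpaired
     index $-H$. *)
  assert (Es : Csum (2 ^ S r) (fun t => v (S r) (Z.of_nat t - Z.of_nat H)%Z) =
    (v (S r) (- Z.of_nat H)%Z + symsum (v (S r)) (H - 1))%C).
  { simpl (2 ^ S r)%nat. fold H. replace (H + (H + 0))%nat with (S (2 * (H - 1) + 1)) by lia.
    rewrite Csum_shift. unfold symsum. f_equal. apply Csum_ext; intros; f_equal; lia. }
  rewrite Es.
  pose proof (Hv r (- Z.of_nat H)%Z ltac:(lia) ltac:(lia) ltac:(unfold H; lia)) as B1.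
  pose proof (symsum_tail (v (S r)) B N0 (H - 1) ltac:(lia) HB
    ltac:(intros; apply Hv; unfold H in *; lia)) as B2.
  specialize (HR1 (S r) ltac:(lia)). rewrite Ew in HR1. fold (W N0) in HR1.
  assert (HH : 1 <= INR N0 <= INR H) by (split; [apply (le_INR 1)|apply le_INR]; lia).
  assert (B3 : B / (IZR (- Z.of_nat H) * IZR (- Z.of_nat H)) <= 2 * B / INR N0).
  { rewrite opp_IZR, <- INR_IZR_INZ.
    apply Rle_trans with (B / INR N0).
    - unfold Rdiv. apply Rmult_le_compat_l; [exact HB|]. apply Rinv_le_contravar; nra.
    - unfold Rdiv. assert (0 < / INR N0) by (apply Rinv_0_lt_compat; lra). nra. }
  assert (B4 : 2 * B * (/ INR N0 - / INR (H - 1)) <= 2 * B / INR N0).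
  { assert (0 < / INR (H - 1)) by (apply Rinv_0_lt_compat, lt_0_INR; lia). unfold Rdiv. nra. }
  set (a := v (S r) (- Z.of_nat H)%Z) in *. set (b := symsum (v (S r)) (H - 1)) in *.
  set (c := symsum (v (S r)) N0) in *.
  replace (a + b - RtoC l)%C with (a + ((b - c) + ((c - RtoC (W N0)) + (RtoC (W N0) - RtoC l))))%C by cring.
  rewrite <- RtoC_minus.
  eapply Rle_lt_trans; [apply Cmod_triangle|].
  pose proof (Cmod_triangle (b - c) ((c - RtoC (W N0)) + RtoC (W N0 - l))).
  pose proof (Cmod_triangle (c - RtoC (W N0)) (RtoC (W N0 - l))) as X. rewrite Cmod_R in X.
  rewrite Rabs_minus_sym in X. lra.
Qed.

Lemma INR_pow2 n : INR (2 ^ n) = 2 ^ n.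
Proof. rewrite pow_INR. reflexivity. Qed.

Lemma pow2_gt0 n : 0 < 2 ^ n.
Proof. apply pow_lt; lra. Qed.

Lemma pow2_ge1 n : 1 <= 2 ^ n.
Proof. apply pow_R1_Rle; lra. Qed.

Lemma pow2_nat_pos n : (1 <= 2 ^ n)%nat.
Proof. pose proof (Nat.pow_gt_lin_r 2 n ltac:(lia)). lia. Qed.

Lemma IZR_pow2_nat n : IZR (Z.of_nat (2 ^ n)) = 2 ^ n.
Proof. rewrite <- INR_IZR_INZ. apply INR_pow2. Qed.

(* [Ek L m r z] tends to [KL L (2^m z)] as [r] grows. *)
Definition Ek (L m r : nat) (z : R) : C :=
  Cprod L (fun l => dk (2 ^ (m + r - S l)) (z / 2 ^ r)).

(** Each factor of [Ek L m (S r)] has period $2\pi 2^{r+1}$, so these $2^{r+1}$ translates run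
    through one full period of shifts: the finite sum is the periodisation of the approximating
    product. *)
Definition kq (L m r : nat) (x : R) : C :=
  Csum (2 ^ S r) (fun n => Ek L m (S r) (x - 2 * PI * IZR (Z.of_nat n - Z.of_nat (2 ^ r)))).

(** Summation over the translates annihilates the frequencies not divisible by $2^{r+1}$ and, after
    rescaling, divides the others by it. *)
Lemma kq_point_TP W h r : TP W h ->
  TP (W / 2 ^ S r) (fun x =>
    Csum (2 ^ S r) (fun n => h ((x - 2 * PI * IZR (Z.of_nat n - Z.of_nat (2 ^ r))) / 2 ^ S r))).
Proof.
  intros H. set (Q := (2 ^ S r)%nat).
  assert (HQ : 0 < 2 ^ S r) by apply pow2_gt0.
  assert (HQ1 : (1 <= Q)%nat) by apply pow2_nat_pos.
  induction H.
  - eapply TS_eq; [constructor|]. intros t; simpl. symmetry; apply Csum_zero; reflexivity.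
  - eapply TS_eq; [eapply (TS_plus _ (fun x => a * Csum Q (fun n =>
      ek k ((x - 2 * PI * IZR (Z.of_nat n - Z.of_nat (2 ^ r))) / 2 ^ S r)))%C); [|exact IHTS]|].
    2:{ intros t. simpl. rewrite <- Csum_scal, <- Csum_plus. reflexivity. }
    apply TS_scal.
    assert (E : forall x, Csum Q (fun n => ek k ((x - 2 * PI * IZR (Z.of_nat n - Z.of_nat (2 ^ r))) / 2 ^ S r))
      = (ek k (x / 2 ^ S r) * Csum Q (fun n => ek (- k) (gpt Q (- PI) n)))%C).
    { intros x. rewrite <- Csum_scal. apply Csum_ext. intros n _.
      rewrite ek_opp, <- ek_plus. f_equal. unfold gpt, Q.
      rewrite minus_IZR, IZR_pow2_nat, <- INR_IZR_INZ, INR_pow2. simpl (2 ^ S r). field.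
      pose proof (pow2_gt0 r); lra. }
    destruct (Zdiv_cases (Z.of_nat Q) (- k) ltac:(lia)) as [[q Hq]|[q [t [Hq Ht]]]].
    + apply (TS_eq _ (fun x => (ek k (x / 2 ^ S r) *
        (RtoC (INR Q) * ek (Z.of_nat Q * q) (- PI)))%C));
        [|intros x; rewrite E, Hq, gridsum_ek_div by exact HQ1; reflexivity].
      apply (TS_scal_r _ _ (fun x => ek k (x / 2 ^ S r))). assert (k = Z.of_nat Q * (- q))%Z as Ek by lia.
      eapply TS_eq; [apply (TS_ek _ (- q)%Z)|].
      * apply (Rmult_le_reg_l (2 ^ S r)); [exact HQ|].
        replace (2 ^ S r * (W / 2 ^ S r)) with W by (field; lra).
        eapply Rle_trans; [|exact H]. rewrite Ek, mult_IZR, Rabs_mult.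
        unfold Q. rewrite IZR_pow2_nat, (Rabs_pos_eq (2 ^ S r)) by lra. lra.
      * intros x. unfold ek. rewrite Ek, mult_IZR. unfold Q. rewrite IZR_pow2_nat.
        f_equal. field. lra.
    + eapply TS_eq; [constructor|]. intros x; cbv beta. fold Q.
      rewrite E, Hq, gridsum_ek_ndiv by exact Ht. cring.
Qed.

(** The degrees form a geometric sum, $2^{m-1}+\dots+2^{m-n}=2^m(1-2^{-n})$. *)
Lemma Cprod_dk_TP n m : (n <= m)%nat ->
  TP (2 ^ m * (1 - / 2 ^ n)) (fun t => Cprod n (fun l => dk (2 ^ (m - S l)) t)).
Proof.
  induction n; intros Hn; simpl Cprod.
  - apply (TP_const _ (RtoC 1)). simpl. pose proof (pow2_gt0 m). lra.
  - replace (2 ^ m * (1 - / 2 ^ S n)) with (2 ^ m * (1 - / 2 ^ n) + 2 ^ (m - S n)).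
    + apply (TP_mul _ _ (fun t => Cprod n (fun l => dk (2 ^ (m - S l)) t)) (dk (2 ^ (m - S n))));
        [apply IHn; lia|].
      rewrite <- INR_pow2. apply dk_TP.
    + assert (E : 2 ^ m = 2 ^ (m - S n) * 2 ^ S n) by (rewrite <- pow_add; f_equal; lia).
      rewrite E. simpl (2 ^ S n). pose proof (pow2_gt0 n). field. lra.
Qed.

Lemma kq_TP L m r : (L <= m + S r)%nat -> TP (2 ^ m * (1 - / 2 ^ L)) (kq L m r).
Proof.
  intros HL. pose proof (pow2_gt0 (S r)).
  replace (2 ^ m * (1 - / 2 ^ L)) with (2 ^ (m + S r) * (1 - / 2 ^ L) / 2 ^ S r).
  - apply (kq_point_TP _ (fun t => Cprod L (fun l => dk (2 ^ (m + S r - S l)) t))).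
    apply Cprod_dk_TP, HL.
  - rewrite pow_add. field. pose proof (pow2_gt0 L). split; lra.
Qed.

Lemma Cprod_dk_tail_TP n m : (S n <= m)%nat ->
  TP (2 ^ m * (/ 2 - / 2 ^ S n)) (fun t => Cprod n (fun l => dk (2 ^ (m - S (S l))) t)).
Proof.
  intros Hn. replace (2 ^ m * (/ 2 - / 2 ^ S n)) with (2 ^ (m - 1) * (1 - / 2 ^ n)).
  - eapply TS_eq; [apply (Cprod_dk_TP n (m - 1)); lia|]. intros t; simpl.
    replace (fun l : nat => dk (2 ^ (m - 1 - S l)) t) with (fun l : nat => dk (2 ^ (m - S (S l))) t);
      [reflexivity|].
    apply functional_extensionality; intros l. do 2 f_equal. lia.
  - replace m with (S (m - 1)) at 2 by lia. simpl. pose proof (pow2_gt0 n). field. lra.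
Qed.

Lemma Cprod_dk_at0 n (M : nat -> nat) : (forall l, (1 <= M l)%nat) ->
  Cprod n (fun l => dk (M l) 0) = RtoC 1.
Proof.
  intros HM. induction n; simpl; [reflexivity|]. rewrite IHn, dk_0 by apply HM. cring.
Qed.

(** The nodes and the translates together form one grid with [2 * M] points, where [M = 2^(m+r)]. On
    it the first factor [dk M] of the product is the interpolation kernel, while the other factors
    can be treated as part of the interpolated polynomial. *)
Lemma kq_rep L m r k s x : (1 <= L)%nat -> (L <= m + S r)%nat -> Rabs (IZR k) < 2 ^ m / 2 ^ L ->
  Csum (2 ^ m) (fun u => (ek k (gpt (2 ^ m) s u) * kq L m r (x - gpt (2 ^ m) s u))%C) = ek k x.
Proof.
  intros HL1 HL Hk. destruct L as [|L]; [lia|].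
  set (a := (2 ^ m)%nat). set (Q := (2 ^ S r)%nat). set (M := (2 ^ (m + r))%nat).
  assert (HM : (2 * M = Q * a)%nat).
  { unfold M, Q, a. rewrite <- Nat.pow_add_r. replace (S r + m)%nat with (S (m + r)) by lia.
    reflexivity. }
  pose proof (pow2_gt0 m) as Hm. pose proof (pow2_gt0 r) as Hr. pose proof (pow2_gt0 L) as HLp.
  set (E' := fun t => Cprod L (fun l => dk (2 ^ (m + S r - S (S l))) t)).
  (* The character times all kernel factors but the first; these factors all equal 1 at
     [y = x / 2 ^ S r], where the interpolation formula is evaluated. *)
  set (h := fun y => (ek (k * Z.of_nat Q) y * E' (x / 2 ^ S r - y)%R)%C).
  assert (Hh : TS (fun j => Rabs (IZR j) < INR M) h).
  { apply (TS_mono (fun j => Rabs (IZR j) <= Rabs (IZR k) * 2 ^ S r + 2 ^ (m + S r) * (/ 2 - / 2 ^ S L))).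
    - intros j Hj. eapply Rle_lt_trans; [exact Hj|]. unfold M. rewrite INR_pow2.
      rewrite (pow_add 2 m (S r)), (pow_add 2 m r). simpl (2 ^ S _) in *.
      apply Rlt_div_r in Hk; [|lra].
      (* Degree budget: the remaining factors use up all of [2 ^ (m + r)] except [2 ^ S r] times the
         bound assumed for the frequency [k]. *)
      assert (E : 2 ^ m * 2 ^ r = (2 ^ m * (2 * 2 ^ r)) * / (2 * 2 ^ L) + 2 ^ m * (2 * 2 ^ r) * (/ 2 - / (2 * 2 ^ L)))
        by (field; lra).
      rewrite E. apply Rplus_lt_compat_r.
      apply (Rmult_lt_reg_r (2 * 2 ^ L)); [lra|].
      replace (2 ^ m * (2 * 2 ^ r) * / (2 * 2 ^ L) * (2 * 2 ^ L)) with (2 ^ m * (2 * 2 ^ r)) by (field; lra).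
      nra.
    - apply (TP_mul _ _ (ek (k * Z.of_nat Q)) (fun y => E' (x / 2 ^ S r - y))).
      + apply TS_ek. unfold Q. rewrite mult_IZR, IZR_pow2_nat, Rabs_mult, (Rabs_pos_eq (2 ^ S r));
          [lra|apply Rlt_le, pow2_gt0].
      + apply TP_reflect. apply Cprod_dk_tail_TP. lia. }
  (* The translates are numbered from [- 2 ^ r], which after rescaling moves the first node back by
     [PI]. *)
  pose proof (dk_interp M h ((s - PI * 2 ^ S r) / 2 ^ S r) (x / 2 ^ S r) ltac:(apply pow2_nat_pos) Hh) as I.
  assert (Hres : h (x / 2 ^ S r) = ek k x).
  { unfold h, E'. rewrite Rminus_diag. rewrite Cprod_dk_at0 by (intros; apply pow2_nat_pos).
    unfold ek, Q. rewrite mult_IZR, IZR_pow2_nat.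
    replace (IZR k * 2 ^ S r * (x / 2 ^ S r)) with (IZR k * x)
      by (field; pose proof (pow2_gt0 (S r)); lra). cring. }
  rewrite Hres in I. rewrite <- I. rewrite HM, Csum_mul, Csum_swap.
  apply Csum_ext. intros u _. unfold kq. fold Q. rewrite <- Csum_scal.
  apply Csum_ext. intros n _.
  set (y := gpt (Q * a) ((s - PI * 2 ^ S r) / 2 ^ S r) (n * a + u)).
  assert (Ea : INR (Q * a) = 2 ^ S r * 2 ^ m) by (unfold Q, a; rewrite mult_INR, !INR_pow2; reflexivity).
  assert (Ey : (x - gpt a s u - 2 * PI * IZR (Z.of_nat n - Z.of_nat (2 ^ r))) / 2 ^ S r = x / 2 ^ S r - y).
  { unfold y, gpt. rewrite Ea, plus_INR, mult_INR. unfold a. rewrite INR_pow2.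
    rewrite minus_IZR, IZR_pow2_nat, <- INR_IZR_INZ. simpl (2 ^ S r). field. lra. }
  unfold Ek. rewrite Ey, Cprod_shift. unfold h.
  replace (dk (2 ^ (m + S r - 1)) (x / 2 ^ S r - y)) with (dk M (x / 2 ^ S r - y))
    by (unfold M; do 2 f_equal; lia).
  replace (ek (k * Z.of_nat Q) y) with (ek k (gpt a s u)); [unfold E'; cring|].
  transitivity (ek k (gpt a s u + 2 * PI * IZR (Z.of_nat n - Z.of_nat (2 ^ r)))).
  - rewrite ek_plus, ek_2PI. cring.
  - unfold ek. f_equal. rewrite mult_IZR. unfold Q. rewrite IZR_pow2_nat. unfold y, gpt.
    rewrite Ea, plus_INR, mult_INR. unfold a. rewrite INR_pow2.
    rewrite minus_IZR, IZR_pow2_nat, <- INR_IZR_INZ. simpl (2 ^ S r). field. lra.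
Qed.

(** * The sinc function as a limit of rescaled Dirichlet kernels *)

Lemma sinc_0 : sinc 0 = 1.
Proof. unfold sinc; destruct (Req_EM_T 0 0); [reflexivity|contradiction]. Qed.

Lemma sinc_neq0 x : x <> 0 -> sinc x = sin x / x.
Proof. intros; unfold sinc; destruct (Req_EM_T x 0); [contradiction|reflexivity]. Qed.

Lemma abs_sin_le x : Rabs (sin x) <= Rabs x.
Proof.
  assert (P : forall y, 0 <= y -> Rabs (sin y) <= y).
  { intros y [Hy|<-]; [|rewrite sin_0, Rabs_R0; lra].
    destruct (Rle_dec y 1) as [H1|H1].
    - pose proof (sin_lt_x y Hy). pose proof PI2_3_2. unfold PI2 in *.
      rewrite Rabs_pos_eq; [lra|]. apply sin_ge_0; lra.
    - pose proof (SIN_bound y). assert (Rabs (sin y) <= 1) by (apply Rabs_le; lra). lra. }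
  destruct (Rle_dec 0 x) as [H|H].
  - rewrite (Rabs_pos_eq x) by exact H. apply P, H.
  - rewrite <- Rabs_Ropp, <- sin_neg, <- (Rabs_Ropp x), (Rabs_pos_eq (- x)) by lra. apply P; lra.
Qed.

Lemma sinc_le1 x : Rabs (sinc x) <= 1.
Proof.
  destruct (Req_dec x 0) as [->|H]; [rewrite sinc_0, Rabs_R1; lra|].
  rewrite sinc_neq0 by exact H. unfold Rdiv. rewrite Rabs_mult, Rabs_inv.
  apply Rle_div_l; [apply Rabs_pos_lt, H|]. rewrite Rmult_1_l. apply abs_sin_le.
Qed.

Lemma sinc_decay x : Rabs x * Rabs (sinc x) <= 1.
Proof.
  destruct (Req_dec x 0) as [->|H]; [rewrite Rabs_R0; lra|].
  rewrite sinc_neq0 by exact H. unfold Rdiv. rewrite Rabs_mult, Rabs_inv.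
  replace (Rabs x * (Rabs (sin x) * / Rabs x)) with (Rabs (sin x)) by (field; apply Rabs_no_R0, H).
  apply Rabs_le, SIN_bound.
Qed.

Lemma Cei_second_order t : Rabs t <= 1 -> Cmod (Cei t - 1 - RtoC t * Ci) <= Rabs t * Rabs t.
Proof.
  intros Ht.
  assert (P : forall y, 0 <= y <= 1 -> Rabs (sin y - y) <= y * y / 2).
  { intros y [[Hy|<-] H1]; [|rewrite sin_0, Rminus_0_r, Rabs_R0; lra].
    destruct (pre_sin_bound y 0 ltac:(lra) ltac:(lra)) as [HS _].
    unfold sin_approx, sin_term in HS. simpl in HS. pose proof (sin_lt_x y Hy).
    rewrite Rabs_minus_sym, Rabs_pos_eq by lra. nra. }
  assert (S : Rabs (sin t - t) <= Rabs t * Rabs t / 2).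
  { destruct (Rle_dec 0 t) as [H|H].
    - rewrite (Rabs_pos_eq t) in * by exact H. apply P; lra.
    - rewrite (Rabs_left t) in * by lra. rewrite <- Rabs_Ropp.
      replace (- (sin t - t)) with (sin (- t) - - t) by (rewrite sin_neg; ring). apply P; lra. }
  assert (Co : Rabs (cos t - 1) <= Rabs t * Rabs t / 2).
  { replace (cos t) with (1 - 2 * sin (t / 2) * sin (t / 2))
      by (rewrite <- cos_2a_sin; f_equal; field).
    replace (1 - 2 * sin (t / 2) * sin (t / 2) - 1) with (- (2 * (sin (t / 2) * sin (t / 2)))) by ring.
    rewrite Rabs_Ropp, !Rabs_mult, (Rabs_pos_eq 2) by lra.
    pose proof (abs_sin_le (t / 2)) as B. unfold Rdiv in B at 2. rewrite Rabs_mult, (Rabs_pos_eq (/ 2)) in B by lra.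
    pose proof (Rabs_pos (sin (t / 2))). nra. }
  replace (Cei t - 1 - RtoC t * Ci)%C with (RtoC (cos t - 1) + RtoC (sin t - t) * Ci)%C
    by (unfold Cei, RtoC, Ci, Cminus, Cplus, Cmult, Complex.Copp; simpl; f_equal; ring).
  eapply Rle_trans; [apply Cmod_triangle|]. rewrite Cmod_mult, Cmod_Ci, !Cmod_R. lra.
Qed.

(** By [dk_geom], $d_M(t)(e^{it}-1)=\mathrm{sinc}(Mt)\,it$; replacing $e^{it}-1$ by $it$ costs $t^2$
    with a factor at most 1, and division by $|t|$ leaves $|t|$, uniformly in $M$. *)
Lemma dk_sinc M t : (1 <= M)%nat -> Rabs t <= 1 ->
  Cmod (dk M t - RtoC (sinc (INR M * t))) <= Rabs t.
Proof.
  intros HM Ht. destruct (Req_dec t 0) as [->|H0].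
  { rewrite Rmult_0_r, sinc_0, dk_0 by exact HM.
    replace (RtoC 1 - RtoC 1)%C with (RtoC 0) by cring. rewrite Cmod_0, Rabs_R0. lra. }
  assert (HMp : 0 < INR M) by (apply lt_0_INR; lia).
  pose proof (Rabs_pos_lt t H0) as Hp.
  apply (Rmult_le_reg_r (Rabs t)); [exact Hp|].
  assert (E : ((dk M t - RtoC (sinc (INR M * t))) * (RtoC t * Ci) =
    - (dk M t * (Cei t - 1 - RtoC t * Ci)))%C).
  { assert (E1 : (RtoC (sinc (INR M * t)) * (RtoC t * Ci) = dk M t * (Cei t - 1))%C).
    { rewrite dk_geom by exact HM. rewrite sinc_neq0 by nra.
      rewrite Cmult_assoc, <- RtoC_mult. do 2 f_equal. rewrite mult_INR. simpl (INR 2). field. lra. }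
    transitivity (dk M t * (RtoC t * Ci) - RtoC (sinc (INR M * t)) * (RtoC t * Ci))%C; [cring|].
    rewrite E1. cring. }
  apply (f_equal Cmod) in E. rewrite Cmod_opp, !Cmod_mult, Cmod_Ci, Cmod_R in E.
  replace (Cmod (dk M t - RtoC (sinc (INR M * t))) * Rabs t) with
    (Cmod (dk M t - RtoC (sinc (INR M * t))) * (Rabs t * 1)) by ring.
  rewrite E. pose proof (Cei_second_order t Ht). pose proof (dk_le1 M t HM).
  pose proof (Cmod_ge_0 (dk M t)). pose proof (Cmod_ge_0 (Cei t - 1 - RtoC t * Ci)). nra.
Qed.

Lemma pow2_unbounded b : exists R0, forall r, (R0 <= r)%nat -> b < 2 ^ r.
Proof.
  destruct (INR_unbounded b) as [n Hn]. exists n. intros r Hr.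
  eapply Rlt_trans; [exact Hn|]. rewrite <- INR_pow2. apply lt_INR.
  pose proof (Nat.pow_gt_lin_r 2 r ltac:(lia)). lia.
Qed.

Lemma Ek_lim L m z : ccv (fun r => Ek L m r z) (RtoC (KL L (2 ^ m * z))).
Proof.
  unfold KL. rewrite RtoC_Rprod. apply (ccv_Cprod L (fun r l => dk (2 ^ (m + r - S l)) (z / 2 ^ r))).
  - intros; apply dk_le1, pow2_nat_pos.
  - intros l _ eps He.
    destruct (pow2_unbounded (Rabs z / eps)) as [R1 H1].
    destruct (pow2_unbounded (Rabs z)) as [R2 H2].
    exists (R1 + R2 + S l)%nat. intros r Hr.
    specialize (H1 r ltac:(lia)); specialize (H2 r ltac:(lia)). pose proof (pow2_gt0 r) as Hp.
    assert (Ez : Rabs (z / 2 ^ r) = Rabs z / 2 ^ r)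
      by (unfold Rdiv; rewrite Rabs_mult, (Rabs_pos_eq (/ _)); [reflexivity|apply Rlt_le, Rinv_0_lt_compat, Hp]).
    replace (2 ^ m * z / 2 ^ S l) with (INR (2 ^ (m + r - S l)) * (z / 2 ^ r)).
    + eapply Rle_lt_trans; [apply dk_sinc; [apply pow2_nat_pos|]|]; rewrite Ez.
      * apply Rle_div_l; lra.
      * apply Rlt_div_l; [exact Hp|]. apply Rlt_div_l in H1; [lra|exact He].
    + rewrite INR_pow2. assert (E : 2 ^ m * 2 ^ r = 2 ^ (m + r - S l) * 2 ^ S l)
        by (rewrite <- !pow_add; f_equal; lia).
      apply (Rmult_eq_reg_r (2 ^ r * 2 ^ S l)); [|pose proof (pow2_gt0 (S l)); nra].
      replace (2 ^ m * z / 2 ^ S l * (2 ^ r * 2 ^ S l)) with (z * (2 ^ m * 2 ^ r))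
        by (field; pose proof (pow2_gt0 (S l)); lra).
      rewrite E. field. lra.
Qed.

Lemma sinc_scaled_decay m l z : Rabs z * Rabs (sinc (2 ^ m * z / 2 ^ S l)) <= 2 ^ S l.
Proof.
  pose proof (sinc_decay (2 ^ m * z / 2 ^ S l)) as H. pose proof (pow2_gt0 (S l)) as Hl.
  pose proof (pow2_ge1 m) as Hm. unfold Rdiv in H at 1.
  rewrite !Rabs_mult, (Rabs_pos_eq (2 ^ m)), (Rabs_pos_eq (/ _)) in H
    by (try apply Rlt_le, Rinv_0_lt_compat; lra).
  set (y := Rabs (sinc _)) in *. assert (0 <= y) by apply Rabs_pos. pose proof (Rabs_pos z).
  apply Rmult_le_compat_l with (r := 2 ^ S l) in H; [|lra].
  replace (2 ^ S l * (2 ^ m * Rabs z * / 2 ^ S l * y)) with (2 ^ m * (Rabs z * y)) in H by (field; lra).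
  assert (0 <= Rabs z * y) by nra. nra.
Qed.

(** Two factors already give a summable bound, the others being at most 1. The constant is the
    product of the scales 2 and 4, and the bound is uniform in [m] because $2^m\ge1$. *)
Lemma KL_decay2 L m z : (2 <= L)%nat -> z <> 0 -> Rabs (KL L (2 ^ m * z)) <= 8 / (z * z).
Proof.
  intros HL Hz. rewrite <- Cmod_R. unfold KL. rewrite RtoC_Rprod.
  eapply Rle_trans; [apply Cprod_le2; [exact HL|]|].
  - intros; rewrite Cmod_R; apply sinc_le1.
  - cbv beta. rewrite !Cmod_R. pose proof (sinc_scaled_decay m 0 z) as H0.
    pose proof (sinc_scaled_decay m 1 z) as H1. simpl (2 ^ 1) in *. simpl (2 ^ 2) in *.
    pose proof (Rabs_pos_lt z Hz) as Hp.
    replace (z * z) with (Rabs z * Rabs z) by (rewrite <- Rabs_mult; apply Rabs_pos_eq, Rle_0_sqr).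
    apply (Rle_div_r _ _ (Rabs z * Rabs z)); [apply Rmult_lt_0_compat; lra|].
    set (a := Rabs (sinc (2 ^ m * z / (2 * 1)))) in *. set (b := Rabs (sinc (2 ^ m * z / (2 * (2 * 1))))) in *.
    assert (0 <= a) by apply Rabs_pos. assert (0 <= b) by apply Rabs_pos.
    replace (a * b * (Rabs z * Rabs z)) with ((Rabs z * a) * (Rabs z * b)) by ring.
    replace 8 with (2 * 4) by ring. apply Rmult_le_compat; try nra; lra.
Qed.

(** The range exceeds half a period because the rescaled translates [x - 2 PI n] overshoot [PI] by a
    multiple of [x]. On it $\pi-|y|/2\ge|y|/6$, and [sin_ge_min] contributes another third. *)
Lemma asin2_ge y : Rabs y <= 3 * PI / 2 -> Rabs y / 18 <= asin2 y.
Proof.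
  intros H. pose proof PI_RGT_0.
  replace (asin2 y) with (asin2 (Rabs y))
    by (unfold Rabs at 1; destruct (Rcase_abs y); [apply asin2_opp|reflexivity]).
  pose proof (Rabs_pos y). unfold asin2.
  pose proof (sin_ge_min (Rabs y / 2) ltac:(lra)) as S.
  eapply Rle_trans; [|apply Rle_abs]. eapply Rle_trans; [|exact S].
  unfold Rmin; destruct (Rle_dec _ _); lra.
Qed.

Lemma dk_decay_lin m r l y : (l <= 1)%nat -> (1 <= r)%nat -> Rabs (y / 2 ^ r) <= 3 * PI / 2 ->
  Cmod (dk (2 ^ (m + r - S l)) (y / 2 ^ r)) * Rabs y <= 36.
Proof.
  intros Hl Hr Hy. pose proof (asin2_ge _ Hy) as A.
  pose proof (dk_decay (2 ^ (m + r - S l)) (y / 2 ^ r) (pow2_nat_pos _)) as D.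
  fold (asin2 (y / 2 ^ r)) in D. pose proof (pow2_gt0 r) as Hp.
  assert (Ea : Rabs (y / 2 ^ r) = Rabs y / 2 ^ r)
    by (unfold Rdiv; rewrite Rabs_mult, (Rabs_pos_eq (/ _)); [reflexivity|apply Rlt_le, Rinv_0_lt_compat, Hp]).
  rewrite Ea in A.
  assert (N1 : 2 ^ r <= 2 * INR (2 * 2 ^ (m + r - S l))).
  { rewrite mult_INR, INR_pow2. simpl (INR 2).
    replace (2 * ((1 + 1) * 2 ^ (m + r - S l))) with (2 ^ (2 + (m + r - S l))) by (simpl; ring).
    apply Rle_pow; [lra|lia]. }
  set (N := INR _) in *. set (c := Cmod (dk (2 ^ (m + r - S l)) (y / 2 ^ r))) in *.
  assert (0 <= c) by apply Cmod_ge_0.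
  assert (B : Rabs y / 36 <= N * asin2 (y / 2 ^ r)).
  { apply Rle_trans with (2 ^ r / 2 * (Rabs y / 2 ^ r / 18)).
    - right; field; lra.
    - apply Rmult_le_compat; try lra. pose proof (Rabs_pos y).
      assert (0 < / 2 ^ r) by (apply Rinv_0_lt_compat, Hp). unfold Rdiv; nra. }
  apply Rmult_le_compat_l with (r := c) in B; [|assumption]. lra.
Qed.

Lemma kq_lim L m x : (2 <= L)%nat ->
  exists l, Un_cv (fun N => Rsum (2 * N + 1)
      (fun t => KL L (2 ^ m * (x + 2 * PI * IZR (Z.of_nat t - Z.of_nat N))))) l /\
    ccv (fun r => kq L m r x) (RtoC l).
Proof.
  intros HL. set (u := fun n : Z => KL L (2 ^ m * (x - 2 * PI * IZR n))).
  set (v := fun (r : nat) (n : Z) => Ek L m r (x - 2 * PI * IZR n)).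
  destruct (INR_unbounded (Rabs x)) as [n0 Hn0].
  destruct (pow2_unbounded (Rabs x)) as [R0 HR0].
  pose proof PI2_3_2 as HPI. unfold PI2 in HPI.
  (* Beyond [n0 > |x|] the translate by [2 PI n] stays at distance at least [|n|] from the origin,
     which gives a common majorant of order $1/n^2$. *)
  assert (Far : forall n, (Z.of_nat n0 < Z.abs n)%Z -> Rabs (IZR n) <= Rabs (x - 2 * PI * IZR n)
    /\ 0 < Rabs (IZR n)).
  { intros n Hn. assert (INR n0 < Rabs (IZR n)) by (rewrite <- abs_IZR, INR_IZR_INZ; apply IZR_lt, Hn).
    pose proof (pos_INR n0). split; [|lra].
    pose proof (Rabs_triang_inv (2 * PI * IZR n) x) as T. rewrite Rabs_minus_sym in T.
    rewrite !Rabs_mult, (Rabs_pos_eq 2), (Rabs_pos_eq PI) in T by lra. nra. }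
  assert (Sq : forall z n c, 0 <= c -> 0 < Rabs (IZR n) <= Rabs z -> c / (z * z) <= c / (IZR n * IZR n)).
  { intros z n c Hc Hz. unfold Rdiv. apply Rmult_le_compat_l; [exact Hc|].
    replace (z * z) with (Rabs z * Rabs z) by (rewrite <- Rabs_mult; apply Rabs_pos_eq, Rle_0_sqr).
    replace (IZR n * IZR n) with (Rabs (IZR n) * Rabs (IZR n)) by (rewrite <- Rabs_mult; apply Rabs_pos_eq, Rle_0_sqr).
    apply Rinv_le_contravar; nra. }
  (* Two Dirichlet factors contribute 36 each by [dk_decay_lin]; the product also exceeds the 8 of
     [KL_decay2]. *)
  destruct (tannery u v (36 * 36) n0 R0) as [l [H1 H2]]; [lra| | | |].
  - intros n Hn. destruct (Far n Hn) as [F1 F2].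
    eapply Rle_trans; [apply KL_decay2; [exact HL|]|].
    + intros E. rewrite E, Rabs_R0 in F1. lra.
    + eapply Rle_trans; [apply (Sq _ n 8); [lra|split; assumption]|].
      unfold Rdiv. apply Rmult_le_compat_r; [|lra]. apply Rlt_le, Rinv_0_lt_compat.
      unfold Rabs in F2; destruct (Rcase_abs (IZR n)); nra.
  - intros r n Hr Hn Hnr. destruct (Far n Hn) as [F1 F2]. unfold v, Ek.
    set (z := x - 2 * PI * IZR n) in *.
    eapply Rle_trans; [apply Cprod_le2; [exact HL|intros; apply dk_le1, pow2_nat_pos]|].
    assert (Hz : Rabs (z / 2 ^ S r) <= 3 * PI / 2).
    { pose proof (pow2_gt0 (S r)) as Hp.
      unfold Rdiv at 1. rewrite Rabs_mult, (Rabs_pos_eq (/ _)) by (apply Rlt_le, Rinv_0_lt_compat, Hp).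
      apply Rle_div_l; [exact Hp|]. specialize (HR0 r Hr).
      assert (Rabs (IZR n) <= 2 ^ r) by (rewrite <- abs_IZR, <- IZR_pow2_nat; apply IZR_le, Hnr).
      assert (Rabs z <= Rabs x + 2 * PI * Rabs (IZR n)).
      { unfold z, Rminus. eapply Rle_trans; [apply Rabs_triang|].
        rewrite Rabs_Ropp, !Rabs_mult, (Rabs_pos_eq 2), (Rabs_pos_eq PI) by lra. lra. }
      simpl. nra. }
    pose proof (dk_decay_lin m (S r) 0 z ltac:(lia) ltac:(lia) Hz) as D0.
    pose proof (dk_decay_lin m (S r) 1 z ltac:(lia) ltac:(lia) Hz) as D1.
    eapply Rle_trans; [|apply (Sq z n); [lra|split; assumption]].
    replace (z * z) with (Rabs z * Rabs z) by (rewrite <- Rabs_mult; apply Rabs_pos_eq, Rle_0_sqr).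
    apply (Rle_div_r _ _ (Rabs z * Rabs z)); [apply Rmult_lt_0_compat; lra|].
    match goal with |- ?a * ?b * _ <= _ =>
      replace (a * b * (Rabs z * Rabs z)) with ((a * Rabs z) * (b * Rabs z)) by ring;
      assert (0 <= a) by apply Cmod_ge_0; assert (0 <= b) by apply Cmod_ge_0 end.
    apply Rmult_le_compat; try nra; assumption.
  - intros n. apply Ek_lim.
  - exists l. split.
    + intros eps He. destruct (H1 eps He) as [N HN]. exists N. intros n Hn.
      (* [Kper] translates by [+ 2 PI k] and [kq] by [- 2 PI k]; on a symmetric window the order of
         summation reverses one into the other. *)
      rewrite Rsum_rev. specialize (HN n Hn).
      replace (Rsum (2 * n + 1) (fun v0 => KL L (2 ^ m * (x + 2 * PI * IZR (Z.of_nat (2 * n + 1 - 1 - v0) - Z.of_nat n)))))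
        with (Rsum (2 * n + 1) (fun t => u (Z.of_nat t - Z.of_nat n)%Z)); [exact HN|].
      apply Rsum_ext. intros t Ht. unfold u. do 2 f_equal.
      replace (Z.of_nat (2 * n + 1 - 1 - t) - Z.of_nat n)%Z with (- (Z.of_nat t - Z.of_nat n))%Z by lia.
      rewrite opp_IZR. ring.
    + intros eps He. destruct (H2 eps He) as [N HN]. exists N. intros n Hn. apply HN, Hn.
Qed.

Lemma Rlim_eq u l : Un_cv u l -> Rlim u = l.
Proof.
  intros H. unfold Rlim. apply (UL_sequence u); [|exact H].
  apply epsilon_spec. exists l; exact H.
Qed.

Lemma Kper_Rlim L m x : (2 <= L)%nat -> Kper L m x = RtoC (Rlim (fun N => Rsum (2 * N + 1)
  (fun t => KL L (2 ^ m * (x + 2 * PI * IZR (Z.of_nat t - Z.of_nat N)))))).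
Proof. intros HL. destruct L as [|[|L]]; [lia|lia|reflexivity]. Qed.

Lemma Kper_lim L m x : (2 <= L)%nat -> ccv (fun r => kq L m r x) (Kper L m x).
Proof.
  intros HL. destruct (kq_lim L m x HL) as [l [H1 H2]].
  rewrite Kper_Rlim, (Rlim_eq _ l) by assumption. exact H2.
Qed.

Lemma Kper_1_0 x : Kper 1 0 x = RtoC 1.
Proof. reflexivity. Qed.

Lemma Kper_1_S m x : Kper 1 (S m) x = dk (2 ^ m) x.
Proof.
  unfold Kper. rewrite Cscal_mult. unfold dk.
  change (2 * 2 ^ m)%nat with (2 ^ S m)%nat. rewrite INR_pow2. reflexivity.
Qed.

(** The degree bound holds for all the approximants [kq] and passes to the limit; shifting the index
    by [L] keeps all exponents [m + S r - S l] free of truncation. *)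
Lemma Kper_TP L m : (1 <= L)%nat -> TP (2 ^ m * (1 - / 2 ^ L)) (Kper L m).
Proof.
  intros HL. assert (Hb : 0 <= 1 - / 2 ^ L).
  { pose proof (pow2_ge1 L). assert (/ 2 ^ L <= / 1) by (apply Rinv_le_contravar; lra).
    rewrite Rinv_1 in *. lra. }
  pose proof (pow2_gt0 m) as Hm.
  destruct (Nat.eq_dec L 1) as [->|HL2].
  - destruct m as [|m].
    + eapply TS_eq; [apply (TP_const (2 ^ 0 * (1 - / 2 ^ 1)) (RtoC 1)); apply Rmult_le_pos; [apply Rlt_le, Hm|exact Hb]|]. intros; symmetry; apply Kper_1_0.
    + replace (2 ^ S m * (1 - / 2 ^ 1)) with (INR (2 ^ m)) by (rewrite INR_pow2; simpl; field).
      eapply TS_eq; [apply dk_TP|]. intros; symmetry; apply Kper_1_S.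
  - apply (TP_limit _ (fun r => kq L m (r + L))); [apply Rmult_le_pos; lra| |].
    + intros n. apply kq_TP. lia.
    + intros x eps He. destruct (Kper_lim L m x ltac:(lia) eps He) as [N HN].
      exists N. intros n Hn. apply HN. lia.
Qed.

(** The reproduction identity is exact for every [kq] with large index, so it survives the limit
    without any estimate. *)
Lemma Kper_rep L m k s x : (1 <= L)%nat -> Rabs (IZR k) < 2 ^ m / 2 ^ L ->
  Csum (2 ^ m) (fun u => (ek k (gpt (2 ^ m) s u) * Kper L m (x - gpt (2 ^ m) s u))%C) = ek k x.
Proof.
  intros HL Hk. destruct (Nat.eq_dec L 1) as [->|HL2].
  - destruct m as [|m].
    + assert (k = 0%Z).
      { destruct (Z.eq_dec k 0) as [E|E]; [exact E|]. pose proof (IZR_ge1 k E). simpl in Hk. lra. }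
      subst. change (2 ^ 0)%nat with 1%nat. rewrite Csum_S, !ek_0, Kper_1_0. simpl (Csum 0 _). cring.
    + rewrite <- (dk_interp (2 ^ m) (ek k) s x).
      * apply Csum_ext; intros; rewrite Kper_1_S; reflexivity.
      * apply pow2_nat_pos.
      * apply TS_ek. rewrite INR_pow2. simpl in Hk. lra.
  - apply (ccv_unique (fun r => Csum (2 ^ m)
      (fun u => (ek k (gpt (2 ^ m) s u) * kq L m r (x - gpt (2 ^ m) s u))%C))).
    + apply ccv_Csum. intros; apply ccv_scal, Kper_lim. lia.
    + apply (ccv_eventually (fun _ => ek k x)); [|apply ccv_const].
      exists L. intros r Hr. symmetry. apply kq_rep; [assumption|lia|assumption].
Qed.

(** * Cardinal property and decay of the periodised kernels *)

Lemma Rprod_S n F : Rprod (S n) F = Rprod n F * F n.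
Proof. reflexivity. Qed.

Lemma sin_IZR_PI n : sin (IZR n * PI) = 0.
Proof. apply sin_eq_0_1. exists n; reflexivity. Qed.

Lemma KL_int L n : (1 <= L)%nat -> n <> 0%Z -> KL L (2 * PI * IZR n) = 0.
Proof.
  intros HL Hn. unfold KL. induction HL as [|L HL IH]; rewrite Rprod_S; [simpl|].
  - rewrite sinc_neq0.
    + replace (2 * PI * IZR n / (2 * 1)) with (IZR n * PI) by field.
      rewrite sin_IZR_PI. unfold Rdiv. ring.
    + pose proof PI_RGT_0. assert (IZR n <> 0) by (apply not_0_IZR, Hn).
      replace (2 * PI * IZR n / (2 * 1)) with (IZR n * PI) by field. nra.
  - rewrite IH. ring.
Qed.

Lemma KL_0 L : KL L 0 = 1.
Proof.
  unfold KL. induction L; [reflexivity|]. rewrite Rprod_S, IHL.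
  replace (0 / 2 ^ S L) with 0 by (unfold Rdiv; ring). rewrite sinc_0. ring.
Qed.

Lemma Z_small_mult w P z : w <> 0%Z -> (Z.abs w < P)%Z -> (w + P * z <> 0)%Z.
Proof.
  intros Hw HP E. destruct (Z.eq_dec z 0) as [->|Hz]; [lia|].
  assert (1 <= z \/ z <= -1)%Z as [H|H] by lia; nia.
Qed.

(** At a difference of two nodes every term of the series is $K^L$ at a multiple of $2\pi$, where
    the first sinc factor vanishes unless the multiple is 0. The partial sums are therefore
    constant. *)
Lemma Kper_int L m w : (1 <= L)%nat -> (Z.abs w < Z.of_nat (2 ^ m))%Z ->
  Kper L m (2 * PI * IZR w / 2 ^ m) = if Z.eq_dec w 0 then RtoC 1 else RtoC 0.
Proof.
  intros HL Hw. destruct (Nat.eq_dec L 1) as [->|HL2].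
  - destruct m as [|m].
    + destruct (Z.eq_dec w 0); [apply Kper_1_0|simpl in Hw; lia].
    + rewrite Kper_1_S. destruct (Z.eq_dec w 0) as [->|Hne].
      * unfold Rdiv. rewrite Rmult_0_r, Rmult_0_l. apply dk_0, pow2_nat_pos.
      * unfold dk. set (N := (2 * 2 ^ m)%nat).
        assert (HN : INR N = 2 ^ S m) by (unfold N; rewrite mult_INR, INR_pow2; reflexivity).
        pose proof (pow2_gt0 m).
        assert (E : Csum N (fun v => ek (Z.of_nat v - Z.of_nat (2 ^ m)) (2 * PI * IZR w / 2 ^ S m)) =
          Csum N (fun v => ek w (gpt N (- PI) v))).
        { apply Csum_ext; intros v _. unfold ek, gpt. f_equal.
          rewrite minus_IZR, IZR_pow2_nat, <- INR_IZR_INZ, HN. simpl. field. lra. }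
        rewrite E. destruct (Z_lt_le_dec 0 w) as [Hp|Hp].
        -- replace w with (Z.of_nat N * 0 + w)%Z by lia.
           rewrite gridsum_ek_ndiv; [cring|]. unfold N. simpl (2 ^ S m)%nat in Hw. lia.
        -- replace w with (Z.of_nat N * (-1) + (w + Z.of_nat N))%Z by lia.
           rewrite gridsum_ek_ndiv; [cring|]. unfold N. simpl (2 ^ S m)%nat in Hw. lia.
  - rewrite Kper_Rlim by lia. pose proof (pow2_gt0 m).
    assert (Ez : forall z, 2 ^ m * (2 * PI * IZR w / 2 ^ m + 2 * PI * IZR z) =
      2 * PI * IZR (w + Z.of_nat (2 ^ m) * z)).
    { intros z. rewrite plus_IZR, mult_IZR, IZR_pow2_nat. field. lra. }
    destruct (Z.eq_dec w 0) as [->|Hne].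
    + f_equal. apply Rlim_eq. intros eps He. exists O. intros n _.
      replace (Rsum _ _) with 1; [rewrite R_dist_eq; exact He|]. symmetry.
      replace (2 * n + 1)%nat with (n + (1 + n))%nat by lia. rewrite !Rsum_split. simpl (Rsum 1 _).
      assert (Z0 : forall t : nat, (Z.of_nat t <> Z.of_nat n)%Z ->
        KL L (2 ^ m * (2 * PI * 0 / 2 ^ m + 2 * PI * IZR (Z.of_nat t - Z.of_nat n))) = 0).
      { intros t Ht. rewrite Ez. apply KL_int; [exact HL|]. nia. }
      rewrite (Rsum_ext n _ (fun _ => 0)) by (intros; apply Z0; lia).
      rewrite (Rsum_ext n (fun v => KL L _) (fun _ => 0)) by (intros; apply Z0; lia).
      rewrite !Rsum_const, Ez.
      replace (0 + Z.of_nat (2 ^ m) * (Z.of_nat (n + 0) - Z.of_nat n))%Z with 0%Z by nia.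
      rewrite !Rmult_0_r, KL_0. ring.
    + f_equal. apply Rlim_eq. intros eps He. exists O. intros n _.
      rewrite (Rsum_ext _ _ (fun _ => 0)).
      * rewrite Rsum_const, Rmult_0_r, R_dist_eq. exact He.
      * intros t _. rewrite Ez. apply KL_int; [exact HL|]. apply Z_small_mult; assumption.
Qed.

Lemma mod2PI x : exists k, - PI <= x + 2 * PI * IZR k <= PI.
Proof.
  pose proof PI_RGT_0. pose proof (archimed ((- x - PI) / (2 * PI))) as [A1 A2].
  exists (up ((- x - PI) / (2 * PI))).
  assert (E : (- x - PI) / (2 * PI) * (2 * PI) = - x - PI) by (field; lra).
  revert A1 A2 E. generalize (IZR (up ((- x - PI) / (2 * PI)))) ((- x - PI) / (2 * PI)).
  intros k t A1 A2 E. nra.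
Qed.

Lemma asin2_le y : asin2 y <= Rabs y / 2.
Proof.
  unfold asin2. eapply Rle_trans; [apply abs_sin_le|]. unfold Rdiv.
  rewrite Rabs_mult, (Rabs_pos_eq (/ 2)) by lra. lra.
Qed.

Lemma KL_decay L y : Rabs (KL L y) * (1 + Rabs y) ^ L <= (2 * 2 ^ L) ^ L.
Proof.
  unfold KL. assert (H : forall n, (n <= L)%nat ->
    Rabs (Rprod n (fun l => sinc (y / 2 ^ S l))) * (1 + Rabs y) ^ n <= (2 * 2 ^ L) ^ n).
  { induction n; intros Hn; [simpl; rewrite Rabs_R1; lra|]. rewrite Rprod_S. change ((1 + Rabs y) ^ S n) with ((1 + Rabs y) * (1 + Rabs y) ^ n).
    change ((2 * 2 ^ L) ^ S n) with ((2 * 2 ^ L) * (2 * 2 ^ L) ^ n).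
    rewrite Rabs_mult. specialize (IHn ltac:(lia)).
    set (p := Rabs (Rprod n _)) in *. set (s := Rabs (sinc _)).
    assert (B : s * (1 + Rabs y) <= 2 * 2 ^ L).
    { pose proof (sinc_scaled_decay 0 n y) as D. rewrite pow_O, Rmult_1_l in D. fold s in D.
      assert (s <= 1) by apply sinc_le1.
      assert (2 ^ S n <= 2 ^ L) by (apply Rle_pow; [lra|lia]).
      pose proof (pow2_ge1 L). lra. }
    replace (p * s * ((1 + Rabs y) * (1 + Rabs y) ^ n)) with
      ((s * (1 + Rabs y)) * (p * (1 + Rabs y) ^ n)) by ring.
    pose proof (Rabs_pos y).
    apply Rmult_le_compat; try assumption.
    - apply Rmult_le_pos; [apply Rabs_pos|lra].
    - apply Rmult_le_pos; [apply Rabs_pos|apply pow_le; lra]. }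
  apply H; lia.
Qed.

(** On one period the central term carries the decay; every other term, with argument of size at
    least $2^m|n|$, is below the weight, and $L\ge2$ makes these summable in $n$. The inverse weight
    is multiplied in before summing, which keeps the bounds uniform in [m]. *)
Lemma Kper_decay L : (2 <= L)%nat ->
  exists C, 0 < C /\ forall m x, Cmod (Kper L m x) <= C * wt (2 ^ m) (INR L) x.
Proof.
  intros HL. set (c := (2 * 2 ^ L) ^ L).
  assert (Hc : 0 < c) by (apply pow_lt; pose proof (pow2_gt0 L); lra).
  pose proof (pow2_gt0 L) as HLp.
  (* The term $n=0$ gives [c]; the terms $n=\pm1$ and the tail from 1 on give [2 * (c * 2 ^ L)]
     each. *)
  exists (c + 4 * (c * 2 ^ L)). split; [nra|]. intros m x.
  pose proof (pow2_ge1 m) as Ha. set (a := 2 ^ m) in *.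
  assert (Red : forall y, - PI <= y <= PI ->
    Cmod (Kper L m y) * (1 + a * asin2 y) ^ L <= c + 4 * (c * 2 ^ L)).
  { intros y Hy. set (s := 1 + a * asin2 y).
    assert (Hs : 1 <= s) by (apply wt_base; lra).
    assert (HsL : 1 <= s ^ L) by (apply pow_R1_Rle, Hs).
    set (F := fun n : Z => (RtoC (KL L (a * (y + 2 * PI * IZR n))) * RtoC (s ^ L))%C).
    assert (F0 : Cmod (F 0%Z) <= c).
    { unfold F. rewrite <- RtoC_mult, Cmod_R, Rabs_mult, (Rabs_pos_eq (s ^ L)) by lra.
      eapply Rle_trans; [|apply (KL_decay L (a * (y + 2 * PI * 0)))].
      apply Rmult_le_compat_l; [apply Rabs_pos|]. apply pow_incr. split; [lra|].
      unfold s. rewrite Rabs_mult, (Rabs_pos_eq a) by lra.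
      replace (y + 2 * PI * 0) with y by ring. pose proof (asin2_le y). pose proof (Rabs_pos y). nra. }
    assert (Fn : forall n, n <> 0%Z -> Cmod (F n) <= c * 2 ^ L / (IZR n * IZR n)).
    { intros n Hn. unfold F. rewrite <- RtoC_mult, Cmod_R, Rabs_mult, (Rabs_pos_eq (s ^ L)) by lra.
      pose proof (IZR_ge1 n Hn) as H1. pose proof PI2_3_2 as HPI. unfold PI2 in HPI.
      set (t := a * (y + 2 * PI * IZR n)).
      assert (Ht : a * Rabs (IZR n) <= Rabs t).
      { unfold t. rewrite Rabs_mult, (Rabs_pos_eq a) by lra. apply Rmult_le_compat_l; [lra|].
        pose proof (Rabs_triang_inv (2 * PI * IZR n) (- y)) as T.
        replace (2 * PI * IZR n - - y) with (y + 2 * PI * IZR n) in T by ring.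
        rewrite Rabs_Ropp, !Rabs_mult, (Rabs_pos_eq 2), (Rabs_pos_eq PI) in T by lra.
        assert (Rabs y <= PI) by (apply Rabs_le; lra). nra. }
      pose proof (KL_decay L t) as K. fold c in K.
      assert (Hsq : 0 < IZR n * IZR n) by (unfold Rabs in H1; destruct (Rcase_abs (IZR n)); nra).
      apply (Rle_div_r _ _ (IZR n * IZR n)); [exact Hsq|].
      (* Since [asin2] is at most 1 and [a] at least 1, the base of the weight never exceeds
         [2 * a]. *)
      assert (S1 : s ^ L <= 2 ^ L * a ^ L).
      { rewrite <- Rpow_mult_distr. apply pow_incr. split; [lra|]. unfold s.
        pose proof (asin2_le1 y). nra. }
      assert (S2 : a ^ L * (IZR n * IZR n) <= (1 + Rabs t) ^ L).
      { apply Rle_trans with ((a * Rabs (IZR n)) ^ L).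
        - rewrite Rpow_mult_distr. apply Rmult_le_compat_l; [apply pow_le; lra|].
          apply Rle_trans with (Rabs (IZR n) ^ 2); [|apply Rle_pow; [exact H1|exact HL]].
          right. rewrite pow2_abs. ring.
        - apply pow_incr. split; [apply Rmult_le_pos; lra|lra]. }
      set (k := Rabs (KL L t)) in *. assert (0 <= k) by apply Rabs_pos.
      apply Rle_trans with (k * (2 ^ L * a ^ L) * (IZR n * IZR n)).
      - apply Rmult_le_compat_r; [lra|]. apply Rmult_le_compat_l; assumption.
      - replace (k * (2 ^ L * a ^ L) * (IZR n * IZR n)) with (k * (a ^ L * (IZR n * IZR n)) * 2 ^ L) by ring.
        apply Rmult_le_compat_r; [lra|].
        eapply Rle_trans; [apply Rmult_le_compat_l; [assumption|exact S2]|]. exact K. }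
    assert (Bn : forall N, (1 <= N)%nat -> Cmod (symsum F N) <= c + 4 * (c * 2 ^ L)).
    { intros N HN.
      pose proof (symsum_tail F (c * 2 ^ L) 1 N ltac:(lia) ltac:(nra) ltac:(intros; apply Fn; lia)) as T.
      assert (0 < / INR N) by (apply Rinv_0_lt_compat, lt_0_INR; lia).
      simpl (INR 1) in T. rewrite Rinv_1 in T.
      pose proof (symsum_S F 0) as E.
      assert (E0 : symsum F 0 = F 0%Z) by (unfold symsum; simpl; cring).
      rewrite E0 in E.
      pose proof (Fn (- Z.of_nat 1)%Z ltac:(lia)) as G1. pose proof (Fn (Z.of_nat 1) ltac:(lia)) as G2.
      simpl (- Z.of_nat 1)%Z in *. simpl (Z.of_nat 1) in *.
      assert (G3 : Cmod (symsum F 1) <= c + 2 * (c * 2 ^ L)).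
      { rewrite E. eapply Rle_trans; [apply Cmod_triangle|].
        pose proof (Cmod_triangle (F (-1)%Z) (F 1%Z)).
        replace (c * 2 ^ L / (-1 * -1)) with (c * 2 ^ L) in G1 by field.
        replace (c * 2 ^ L / (1 * 1)) with (c * 2 ^ L) in G2 by field. simpl in *. lra. }
      pose proof (Cmod_triangle_sub (symsum F N) (symsum F 1)) as G4.
      assert (0 <= c * 2 ^ L * / INR N) by (apply Rmult_le_pos; nra).
      revert T G3 G4. generalize (Cmod (symsum F N)) (Cmod (symsum F 1)) (Cmod (symsum F N - symsum F 1)).
      intros u v w T G3 G4. lra. }
    destruct (kq_lim L m y HL) as [l [Hl _]].
    rewrite Kper_Rlim, (Rlim_eq _ l Hl), Cmod_R by exact HL. fold a in Hl.
    destruct (Rle_dec (Rabs l * s ^ L) (c + 4 * (c * 2 ^ L))) as [Hle|Hgt]; [exact Hle|exfalso].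
    set (d := Rabs l * s ^ L - (c + 4 * (c * 2 ^ L))). assert (Hd : 0 < d) by (unfold d; lra).
    destruct (Hl (d / s ^ L)) as [N HN]; [apply Rdiv_lt_0_compat; lra|].
    specialize (HN (S N) ltac:(lia)). specialize (Bn (S N) ltac:(lia)).
    unfold R_dist in HN. set (SN := Rsum _ _) in HN.
    assert (ES : symsum F (S N) = RtoC (SN * s ^ L)).
    { unfold symsum, F, SN. rewrite Csum_scal_r, RtoC_mult, RtoC_Rsum. reflexivity. }
    rewrite ES, Cmod_R, Rabs_mult, (Rabs_pos_eq (s ^ L)) in Bn by lra.
    pose proof (Rabs_triang_inv l SN) as T. rewrite Rabs_minus_sym in T.
    apply Rlt_div_r in HN; [|lra]. unfold d in HN. nra. }
  destruct (mod2PI x) as [k Hk]. specialize (Red _ Hk).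
  rewrite (TS_period _ _ x k (Kper_TP L m ltac:(lia))), asin2_period in Red.
  pose proof (wt_pow a L x ltac:(lra)) as W. pose proof (wt_pos a (INR L) x) as Wp.
  apply Rmult_le_compat_r with (r := wt a (INR L) x) in Red; [|lra].
  replace (Cmod (Kper L m x) * (1 + a * asin2 x) ^ L * wt a (INR L) x)
    with (Cmod (Kper L m x) * (wt a (INR L) x * (1 + a * asin2 x) ^ L)) in Red by ring.
  rewrite W, Rmult_1_r in Red. exact Red.
Qed.

(** * Interpolation operators in one variable *)

(** First node of $I_m$: $U_0=\{0\}$, whereas $U_m$ for $m\ge1$ starts at $-2^{m-1}$, that is at the
    point $-\pi$. *)
Definition gs (m : nat) : R := match m with O => 0 | _ => - PI end.

Definition Iop (L m : nat) (h : R -> C) (x : R) : C :=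
  Csum (2 ^ m) (fun u => (h (gpt (2 ^ m) (gs m) u) * Kper L m (x - gpt (2 ^ m) (gs m) u))%C).

Definition etaop (L j : nat) (h : R -> C) : R -> C :=
  match j with O => Iop L O h | S j' => fun x => (Iop L j h x - Iop L j' h x)%C end.

Lemma gpt_sub N s u v : (1 <= N)%nat ->
  gpt N s u - gpt N s v = 2 * PI * IZR (Z.of_nat u - Z.of_nat v) / INR N.
Proof.
  intros HN. unfold gpt. rewrite minus_IZR, <- !INR_IZR_INZ. field. apply not_0_INR; lia.
Qed.

Lemma Iop_interp L m h v : (1 <= L)%nat -> (v < 2 ^ m)%nat ->
  Iop L m h (gpt (2 ^ m) (gs m) v) = h (gpt (2 ^ m) (gs m) v).
Proof.
  intros HL Hv. unfold Iop.
  assert (E : forall u, (u < 2 ^ m)%nat -> Kper L m (gpt (2 ^ m) (gs m) v - gpt (2 ^ m) (gs m) u) =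
    if Nat.eq_dec u v then RtoC 1 else RtoC 0).
  { intros u Hu. rewrite gpt_sub, INR_pow2, Kper_int by (try apply pow2_nat_pos; try assumption; lia).
    destruct (Z.eq_dec _ 0), (Nat.eq_dec u v); try reflexivity; lia. }
  replace (2 ^ m)%nat with (v + (1 + (2 ^ m - 1 - v)))%nat at 1 by lia.
  rewrite Csum_split, Csum_split. simpl (Csum 1 _). rewrite Nat.add_0_r.
  rewrite Csum_zero, (Csum_zero (2 ^ m - 1 - v)); rewrite ?E by lia.
  - destruct (Nat.eq_dec v v); [cring|contradiction].
  - intros u Hu. rewrite E by lia. destruct (Nat.eq_dec _ _); [lia|cring].
  - intros u Hu. rewrite E by lia. destruct (Nat.eq_dec _ _); [lia|cring].
Qed.

Lemma Iop_TP L m h : (1 <= L)%nat -> TP (2 ^ m * (1 - / 2 ^ L)) (Iop L m h).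
Proof.
  intros HL. unfold Iop.
  apply (TS_csum _ _ (fun u x => (h (gpt (2 ^ m) (gs m) u) * Kper L m (x - gpt (2 ^ m) (gs m) u))%C)).
  intros u _. apply (TS_scal _ _ (fun x => Kper L m (x - gpt (2 ^ m) (gs m) u))).
  apply (TS_shift _ (Kper L m)), Kper_TP, HL.
Qed.

Lemma Iop_rep L m h x : (1 <= L)%nat -> TS (fun k => Rabs (IZR k) < 2 ^ m / 2 ^ L) h ->
  Iop L m h x = h x.
Proof.
  intros HL Hh. induction Hh; unfold Iop in *.
  - apply Csum_zero; intros; cring.
  - rewrite <- IHHh, <- (Kper_rep L m k (gs m) x HL H), <- Csum_scal, <- Csum_plus.
    apply Csum_ext; intros; cring.
Qed.

Lemma Iop_telescope L N h x : Csum (S N) (fun j => etaop L j h x) = Iop L N h x.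
Proof.
  induction N; [simpl; cring|]. rewrite Csum_S, IHN. simpl etaop. cring.
Qed.

(** * Integral inequalities in one variable *)

Lemma continuous_lip (g : R -> R) K :
  (forall x y, Rabs (g x - g y) <= K * Rabs (x - y)) -> forall x, continuous g x.
Proof.
  intros H x. apply continuity_pt_filterlim. intros eps He.
  assert (HK : 0 < Rabs K + 1) by (pose proof (Rabs_pos K); lra).
  exists (eps / (Rabs K + 1)). split; [apply Rdiv_lt_0_compat; assumption|].
  intros y [_ Hy]. simpl in *. unfold R_dist in *.
  eapply Rle_lt_trans; [apply H|]. apply Rlt_div_r in Hy; [|exact HK].
  pose proof (Rle_abs K). pose proof (Rabs_pos (y - x)). nra.
Qed.

Lemma Cei_lip a b : Cmod (Cei a - Cei b) <= Rabs (a - b).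
Proof.
  replace (Cei a - Cei b)%C with (Cei b * (Cei (a - b) - 1))%C.
  - rewrite Cmod_mult, Cmod_Cei, Cmod_Cei_sub1, Rmult_1_l.
    pose proof (abs_sin_le ((a - b) / 2)) as H. unfold Rdiv in H at 2.
    rewrite Rabs_mult, (Rabs_pos_eq (/ 2)) in H by lra. lra.
  - replace a with (b + (a - b)) at 2 by ring. rewrite Cei_plus. cring.
Qed.

Lemma TS_lip S0 h : TS S0 h -> exists K, 0 <= K /\ forall x y, Cmod (h x - h y) <= K * Rabs (x - y).
Proof.
  induction 1 as [|k a h Hk Hh [K [HK IH]]].
  - exists 0. split; [lra|]. intros. replace (0 - 0)%C with (RtoC 0) by cring. rewrite Cmod_0. lra.
  - exists (Cmod a * Rabs (IZR k) + K). pose proof (Cmod_ge_0 a). pose proof (Rabs_pos (IZR k)).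
    split; [nra|]. intros x y.
    replace (a * ek k x + h x - (a * ek k y + h y))%C with
      (a * (ek k x - ek k y) + (h x - h y))%C by cring.
    eapply Rle_trans; [apply Cmod_triangle|]. rewrite Cmod_mult.
    pose proof (IH x y). pose proof (Cei_lip (IZR k * x) (IZR k * y)) as E.
    fold (ek k x) (ek k y) in E.
    replace (IZR k * x - IZR k * y) with (IZR k * (x - y)) in E by ring. rewrite Rabs_mult in E.
    assert (Cmod a * Cmod (ek k x - ek k y) <= Cmod a * (Rabs (IZR k) * Rabs (x - y)))
      by (apply Rmult_le_compat_l; assumption). lra.
Qed.

Lemma Cmod_rev_triangle (z w : C) : Rabs (Cmod z - Cmod w) <= Cmod (z - w).
Proof.
  apply Rabs_le. pose proof (Cmod_triangle_sub z w). pose proof (Cmod_triangle_sub w z) as T.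
  rewrite (Cmod_minus_sym w z) in T. lra.
Qed.

(** Only moduli are integrated in one variable, so continuity of the modulus is all that has to be
    recorded. *)
Definition cont_norm (h : R -> C) : Prop := forall x, continuous (fun t => Cmod (h t)) x.

Lemma TS_cont S h : TS S h -> cont_norm h.
Proof.
  intros H. destruct (TS_lip S h H) as [K [_ HK]]. intros x. apply (continuous_lip _ K).
  intros y z. eapply Rle_trans; [apply Cmod_rev_triangle|apply HK].
Qed.

Lemma rpow_cont q (g : R -> R) : 0 < q -> (forall x, continuous g x) ->
  forall x, continuous (fun t => rpow (g t) q) x.
Proof. intros Hq Hg x. apply (continuous_comp g (fun y => rpow y q)); [apply Hg|apply rpow_continuous, Hq]. Qed.

Lemma ex_RInt_cont (f : R -> R) a b : (forall x, continuous f x) -> ex_RInt f a b.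
Proof. intros H. apply (ex_RInt_continuous (V := R_CompleteNormedModule)). intros; apply H. Qed.

Lemma Rsum_continuous n (F : nat -> R -> R) x :
  (forall v, continuous (F v) x) -> continuous (fun t => Rsum n (fun v => F v t)) x.
Proof.
  intros H. induction n; simpl; [apply continuous_const|].
  apply (continuous_plus (fun t => Rsum n (fun v => F v t)) (F n)); [exact IHn|apply H].
Qed.

Lemma cont_scal c (f : R -> R) x : continuous f x -> continuous (fun t => c * f t) x.
Proof. exact (continuous_scal_r (K := R_AbsRing) (V := R_NormedModule) c f x). Qed.

Lemma RInt_Rsum n (F : nat -> R -> R) a b : (forall v x, continuous (F v) x) ->
  RInt (fun t => Rsum n (fun v => F v t)) a b = Rsum n (fun v => RInt (F v) a b).
Proof.
  intros H. induction n; simpl.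
  - rewrite RInt_const. unfold scal; simpl; unfold mult; simpl. ring.
  - rewrite <- IHn. apply (RInt_plus (V := R_CompleteNormedModule)).
    + apply ex_RInt_cont. intros; apply Rsum_continuous; intros; apply H.
    + apply ex_RInt_cont, H.
Qed.

Lemma RInt_scal_R (f : R -> R) c a b : (forall x, continuous f x) ->
  RInt (fun t => c * f t) a b = c * RInt f a b.
Proof. intros H. apply (RInt_scal (V := R_CompleteNormedModule)), ex_RInt_cont, H. Qed.

Lemma RInt_mono (f g : R -> R) a b : a <= b -> (forall x, continuous f x) ->
  (forall x, continuous g x) -> (forall x, f x <= g x) -> RInt f a b <= RInt g a b.
Proof. intros; apply RInt_le; try apply ex_RInt_cont; auto. Qed.

Lemma RInt_nonneg (f : R -> R) a b : a <= b -> (forall x, continuous f x) ->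
  (forall x, 0 <= f x) -> 0 <= RInt f a b.
Proof. intros. apply RInt_ge_0; try apply ex_RInt_cont; auto. Qed.

Lemma RInt_const_R c a b : RInt (fun _ : R => c) a b = (b - a) * c.
Proof. rewrite RInt_const. reflexivity. Qed.

Lemma RInt_translate (P : R -> R) s : (forall x, continuous P x) ->
  (forall x, P (x + 2 * PI) = P x) ->
  RInt (fun x => P (x + s)) (- PI) PI = RInt P (- PI) PI.
Proof.
  intros HP Hper.
  assert (E : forall v a b, RInt (fun y => P (y + v)) a b = RInt P (a + v) (b + v)).
  { intros v a b. pose proof (RInt_comp_lin P 1 v a b) as H.
    rewrite !Rmult_1_l in H. rewrite <- H by (apply ex_RInt_cont, HP).
    apply RInt_ext. intros x _. unfold scal; simpl; unfold mult; simpl. rewrite !Rmult_1_l. reflexivity. }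
  rewrite E.
  assert (E2 : RInt P (- PI) (- PI + s) = RInt P PI (PI + s)).
  { replace PI with (- PI + 2 * PI) at 3 by ring. replace (PI + s) with (- PI + s + 2 * PI) by ring.
    rewrite <- E. apply RInt_ext. intros; symmetry; apply Hper. }
  pose proof (RInt_Chasles P (- PI) (- PI + s) (PI + s)
    (ex_RInt_cont _ _ _ HP) (ex_RInt_cont _ _ _ HP)) as C1.
  pose proof (RInt_Chasles P (- PI) PI (PI + s)
    (ex_RInt_cont _ _ _ HP) (ex_RInt_cont _ _ _ HP)) as C2.
  unfold plus in C1, C2; simpl in C1, C2. lra.
Qed.

Definition I1 (q : R) (h : R -> C) : R := RInt (fun t => rpow (Cmod (h t)) q) (- PI) PI.

Lemma I1_nonneg q h : 0 < q -> cont_norm h -> 0 <= I1 q h.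
Proof.
  intros Hq Hh. pose proof PI_RGT_0. apply RInt_nonneg; [lra|apply rpow_cont; assumption|].
  intros; apply rpow_ge0.
Qed.

Lemma I1_mono q h g : 0 < q -> cont_norm h -> cont_norm g ->
  (forall x, Cmod (h x) <= Cmod (g x)) -> I1 q h <= I1 q g.
Proof.
  intros Hq Hh Hg H. pose proof PI_RGT_0.
  apply RInt_mono; [lra| | |]; try (apply rpow_cont; assumption).
  intros x. apply rpow_le; [lra|]. split; [apply Cmod_ge_0|apply H].
Qed.

Lemma I1_translate q S h s : 0 < q -> TS S h -> I1 q (fun x => h (x + s)) = I1 q h.
Proof.
  intros Hq Hh. apply (RInt_translate (fun t => rpow (Cmod (h t)) q)).
  - apply rpow_cont; [exact Hq|]. apply (TS_cont S), Hh.
  - intros x. rewrite <- (TS_period S h x 1 Hh). do 3 f_equal. ring.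
Qed.

Lemma wt_continuous lam s y x : 0 <= lam -> continuous (fun t => wt lam s (t - y)) x.
Proof.
  intros Hl. unfold wt, Rpower.
  apply (continuous_comp (fun t => 1 + lam * asin2 (t - y)) (fun z => exp (- s * ln z))).
  - apply (continuous_lip _ (lam / 2)). intros u v. unfold asin2.
    replace (1 + lam * Rabs (sin ((u - y) / 2)) - (1 + lam * Rabs (sin ((v - y) / 2)))) with
      (lam * (Rabs (sin ((u - y) / 2)) - Rabs (sin ((v - y) / 2)))) by ring.
    rewrite Rabs_mult, (Rabs_pos_eq lam) by exact Hl. unfold Rdiv at 3.
    rewrite Rmult_assoc. apply Rmult_le_compat_l; [exact Hl|].
    replace (Rabs (sin ((u - y) / 2))) with (asin2 (u - y)) by reflexivity.
    replace (Rabs (sin ((v - y) / 2))) with (asin2 (v - y)) by reflexivity.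
    rewrite !asin2_Cei.
    pose proof (Cmod_rev_triangle (Cei (u - y) - 1) (Cei (v - y) - 1)) as H.
    replace (Cei (u - y) - 1 - (Cei (v - y) - 1))%C with (Cei (u - y) - Cei (v - y))%C in H by cring.
    pose proof (Cei_lip (u - y) (v - y)) as H2. replace (u - y - (v - y)) with (u - v) in H2 by ring.
    replace (Cmod (Cei (u - y) - 1) / 2 - Cmod (Cei (v - y) - 1) / 2) with
      ((Cmod (Cei (u - y) - 1) - Cmod (Cei (v - y) - 1)) * / 2) by field.
    rewrite Rabs_mult, (Rabs_pos_eq (/ 2)) by lra. lra.
  - apply (ex_derive_continuous (fun z => exp (- s * ln z))). auto_derive.
    pose proof (wt_base lam (x - y) Hl). lra.
Qed.

Lemma wt_period lam s x k : wt lam s (x + 2 * PI * IZR k) = wt lam s x.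
Proof. unfold wt. rewrite asin2_period. reflexivity. Qed.

(** By translation invariance $2^m$ copies of the integral form the integral of a grid sum, which
    [wt_grid_sum] bounds pointwise by [C * 2]. *)
Lemma RInt_wt s : 1 < s -> exists C, 0 < C /\
  forall m y, RInt (fun x => wt (2 ^ m) s (x - y)) (- PI) PI <= C / 2 ^ m.
Proof.
  intros Hs. destruct (wt_grid_sum s Hs) as [C [HC H]].
  pose proof PI_RGT_0 as HPI. exists (4 * PI * C). split; [nra|].
  intros m y. pose proof (pow2_gt0 m) as Hm.
  set (J := RInt (fun x => wt (2 ^ m) s (x - y)) (- PI) PI).
  assert (E : 2 ^ m * J = RInt (fun x => Rsum (2 ^ m) (fun v => wt (2 ^ m) s (x - gpt (2 ^ m) y v))) (- PI) PI).
  { rewrite (RInt_Rsum (2 ^ m) (fun v x => wt (2 ^ m) s (x - gpt (2 ^ m) y v)))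
      by (intros; apply wt_continuous; lra).
    rewrite (Rsum_ext _ _ (fun _ => J)); [rewrite Rsum_const, INR_pow2; reflexivity|].
    intros v _. unfold J.
    rewrite <- (RInt_translate (fun x => wt (2 ^ m) s (x - y)) (y - gpt (2 ^ m) y v)).
    - apply RInt_ext. intros; f_equal; ring.
    - intros; apply wt_continuous; lra.
    - intros x. rewrite <- (wt_period _ _ (x - y) 1). f_equal. ring. }
  apply (Rle_div_r _ _ (2 ^ m)); [exact Hm|]. rewrite Rmult_comm, E.
  apply Rle_trans with (RInt (fun _ => C * 2) (- PI) PI).
  - apply RInt_mono; [lra| |intros; apply continuous_const|].
    + intros x. apply (Rsum_continuous _ (fun v x => wt (2 ^ m) s (x - gpt (2 ^ m) y v))).
      intros; apply wt_continuous; lra.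
    + intros x. eapply Rle_trans; [apply H; [apply pow2_nat_pos|exact Hm]|].
      rewrite INR_pow2. replace (2 ^ m / 2 ^ m) with 1 by (field; lra). lra.
  - rewrite RInt_const_R. lra.
Qed.

(** * Sampling and reconstruction inequalities in one variable *)

Lemma dk_wt l y : Cmod (dk (2 ^ l) y) <= 2 * wt (2 ^ l) 1 y.
Proof.
  pose proof (dk_le1 (2 ^ l) y (pow2_nat_pos l)) as H1.
  pose proof (dk_decay (2 ^ l) y (pow2_nat_pos l)) as H2. fold (asin2 y) in H2.
  rewrite mult_INR, INR_pow2 in H2. simpl (INR 2) in H2.
  pose proof (pow2_gt0 l). pose proof (wt_pow (2 ^ l) 1 y ltac:(lra)) as W. rewrite pow_1 in W.
  pose proof (wt_base (2 ^ l) y ltac:(lra)) as Hb. change (INR 1) with 1 in W.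
  apply (Rmult_le_reg_r (1 + 2 ^ l * asin2 y)); [lra|].
  rewrite Rmult_assoc, W. pose proof (Cmod_ge_0 (dk (2 ^ l) y)). nra.
Qed.

Lemma Cprod_dk_pow l P y :
  Cmod (Cprod P (fun _ => dk (2 ^ l) y)) <= 2 ^ P * wt (2 ^ l) (INR P) y.
Proof.
  induction P.
  - simpl Cprod. rewrite Cmod_1. simpl. unfold wt. rewrite Ropp_0, Rpower_O; [lra|].
    pose proof (wt_base (2 ^ l) y ltac:(apply Rlt_le, pow2_gt0)). lra.
  - simpl Cprod. rewrite Cmod_mult. rewrite S_INR, <- wt_mult.
    pose proof (dk_wt l y). pose proof (Cmod_ge_0 (dk (2 ^ l) y)).
    pose proof (Cmod_ge_0 (Cprod P (fun _ => dk (2 ^ l) y))).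
    pose proof (pow2_gt0 P). pose proof (wt_pos (2 ^ l) (INR P) y).
    replace (2 ^ S P * (wt (2 ^ l) (INR P) y * wt (2 ^ l) 1 y)) with
      ((2 ^ P * wt (2 ^ l) (INR P) y) * (2 * wt (2 ^ l) 1 y)) by (simpl; ring).
    apply Rmult_le_compat; assumption.
Qed.

Lemma Cprod_dk_pow_TP l P : TP (INR P * 2 ^ l) (fun y => Cprod P (fun _ => dk (2 ^ l) y)).
Proof.
  induction P.
  - apply (TP_const _ (RtoC 1)). simpl. lra.
  - rewrite S_INR, Rmult_plus_distr_r, Rmult_1_l. simpl.
    apply (TP_mul _ _ (fun y => Cprod P (fun _ => dk (2 ^ l) y)) (dk (2 ^ l))); [exact IHP|].
    rewrite <- INR_pow2. apply dk_TP.
Qed.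

(** Of [P] orders of decay, two pay for a weighted summation; the [q]-th power of the rest must
    still have order 2. *)
Lemma exists_power q : 0 < q -> exists P : nat, 2 <= (INR P - 2) * q /\ (2 <= P)%nat.
Proof.
  intros Hq. destruct (INR_unbounded (2 / q)) as [n Hn]. exists (n + 2)%nat.
  split; [|lia]. rewrite plus_INR. simpl (INR 2). apply Rlt_div_l in Hn; lra.
Qed.

(* Plancherel-Polya: interpolate [y |-> h y * dk(x-y)^P] on a slightly finer grid. *)
Lemma plancherel_polya q : 0 < q -> exists (c : nat) C, 0 < C /\ forall l h s x, TP (2 ^ l) h ->
  rpow (Cmod (h x)) q <= C * Rsum (2 ^ (l + c)) (fun v =>
    wt (2 ^ l) 2 (x - gpt (2 ^ (l + c)) s v) * rpow (Cmod (h (gpt (2 ^ (l + c)) s v))) q).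
Proof.
  intros Hq. destruct (exists_power q Hq) as [P [HP HP2]].
  destruct (wt_grid_sum 2 ltac:(lra)) as [C0 [HC0 Hgrid]].
  (* The polynomial times [P] localising factors has degree at most [(1 + P) * 2 ^ l], below half
     the number [2 ^ (l + P + 2)] of nodes because [P < 2 ^ P]. [W] bounds the sum of the order-2
     weights over this grid. *)
  set (c := (P + 2)%nat). set (W := C0 * (1 + 2 ^ c)).
  assert (HW : 0 < W) by (pose proof (pow2_gt0 c); unfold W; nra).
  exists c, (rpow W q * rpow (2 ^ P) q).
  split; [apply Rmult_lt_0_compat; apply rpow_gt0; [exact HW|apply pow2_gt0]|].
  intros l h s x Hh. set (N := (2 ^ (l + c))%nat). set (y := gpt N s).
  pose proof (pow2_gt0 l) as Hl. pose proof (pow2_gt0 P) as HPp.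
  assert (Hb : Cmod (h x) <= Rsum N (fun v => Cmod (h (y v)) * (2 ^ P * wt (2 ^ l) (INR P) (x - y v)))).
  { set (M := (2 ^ (l + c - 1))%nat).
    assert (HN : N = (2 * M)%nat).
    { unfold N, M. replace (l + c)%nat with (S (l + c - 1)) at 1 by (unfold c; lia). reflexivity. }
    set (g := fun z => (h z * Cprod P (fun _ => dk (2 ^ l) (x - z)))%C).
    assert (Hg : TS (fun k => Rabs (IZR k) < INR M) g).
    { apply (TS_mono (fun k => Rabs (IZR k) <= 2 ^ l + INR P * 2 ^ l)).
      - intros k Hk. eapply Rle_lt_trans; [exact Hk|]. unfold M. rewrite INR_pow2.
        replace (l + c - 1)%nat with (l + S P)%nat by (unfold c; lia). rewrite pow_add.
        assert (INR P < 2 ^ P).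
        { rewrite <- INR_pow2. apply lt_INR. apply Nat.pow_gt_lin_r. lia. }
        pose proof (pow2_ge1 P). change (2 ^ S P) with (2 * 2 ^ P).
        replace (2 ^ l + INR P * 2 ^ l) with (2 ^ l * (1 + INR P)) by ring.
        apply Rmult_lt_compat_l; lra.
      - apply (TP_mul _ _ h (fun z => Cprod P (fun _ => dk (2 ^ l) (x - z)))); [exact Hh|].
        apply (TP_reflect _ (fun z => Cprod P (fun _ => dk (2 ^ l) z))), Cprod_dk_pow_TP. }
    pose proof (dk_interp M g s x (pow2_nat_pos _) Hg) as E.
    unfold g in E at 2. rewrite Rminus_diag, (Cprod_dk_at0 P (fun _ => (2 ^ l)%nat)), Cmult_1_r in E
      by (intros; apply pow2_nat_pos).
    rewrite <- E, <- HN. eapply Rle_trans; [apply Cmod_Csum|]. apply Rsum_le. intros v _.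
    fold y. unfold g. rewrite !Cmod_mult.
    pose proof (dk_le1 M (x - y v) (pow2_nat_pos _)).
    pose proof (Cprod_dk_pow l P (x - y v)).
    set (A := Cmod (h (y v))). set (B := Cmod (Cprod P _)) in *. set (D := Cmod (dk M _)) in *.
    assert (0 <= A) by apply Cmod_ge_0. assert (0 <= B) by apply Cmod_ge_0.
    assert (0 <= D) by apply Cmod_ge_0.
    apply Rle_trans with (A * B * 1); [apply Rmult_le_compat_l; [nra|assumption]|]. nra. }
  eapply Rle_trans; [apply rpow_le; [lra|split; [apply Cmod_ge_0|exact Hb]]|].
  eapply Rle_trans; [apply (rpow_Rsum_weight N _ (fun v => / wt (2 ^ l) 2 (x - y v)) W q Hq)|].
  - intros v _. pose proof (Cmod_ge_0 (h (y v))). pose proof (wt_pos (2 ^ l) (INR P) (x - y v)). 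
    apply Rmult_le_pos; nra.
  - intros v _. apply Rinv_0_lt_compat, wt_pos.
  - eapply Rle_trans; [right; apply Rsum_ext; intros v _; apply Rinv_inv|].
    eapply Rle_trans; [apply Hgrid; [apply pow2_nat_pos|exact Hl]|]. unfold W, N.
    rewrite INR_pow2, pow_add. right. field. lra.
  - rewrite Rmult_assoc. apply Rmult_le_compat_l; [apply rpow_ge0|].
    rewrite <- Rsum_scal. apply Rsum_le. intros v _. fold (y v).
    pose proof (Cmod_ge_0 (h (y v))).
    rewrite wt_inv.
    replace (wt (2 ^ l) (- (2)) (x - y v) * (Cmod (h (y v)) * (2 ^ P * wt (2 ^ l) (INR P) (x - y v)))) with
      (2 ^ P * (wt (2 ^ l) (- (2)) (x - y v) * wt (2 ^ l) (INR P) (x - y v)) * Cmod (h (y v))) by ring.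
    rewrite wt_mult. pose proof (wt_pos (2 ^ l) (- (2) + INR P) (x - y v)).
    rewrite rpow_mult, rpow_mult, wt_rpow by nra.
    rewrite Rmult_assoc. apply Rmult_le_compat_l; [apply rpow_ge0|].
    apply Rmult_le_compat_r; [apply rpow_ge0|]. apply wt_anti; [lra|]. lra.
Qed.

(** The fine grid in [plancherel_polya] may be translated at will; integrating over the translation
    turns its values into copies of the integral, while the coarse nodes enter only through a grid
    sum of weights. *)
Lemma sampling q : 0 < q -> exists C, 0 < C /\ forall l j s h, TP (2 ^ l) h ->
  Rsum (2 ^ j) (fun u => rpow (Cmod (h (gpt (2 ^ j) s u))) q) <= C * (2 ^ j + 2 ^ l) * I1 q h.
Proof.
  intros Hq. destruct (plancherel_polya q Hq) as [c [C [HC HPP]]].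
  destruct (wt_grid_sum 2 ltac:(lra)) as [C0 [HC0 Hgrid]].
  pose proof PI_RGT_0 as HPI. pose proof (pow2_gt0 c) as Hc.
  exists (C * C0 * 2 ^ c / (2 * PI)). split; [apply Rdiv_lt_0_compat; [|lra]; apply Rmult_lt_0_compat; nra|].
  intros l j s h Hh. pose proof (pow2_gt0 l) as Hl. pose proof (pow2_gt0 j) as Hj.
  set (S := Rsum (2 ^ j) _).
  set (F := fun v t => rpow (Cmod (h (gpt (2 ^ (l + c)) t v))) q).
  assert (FE : forall v t, F v t = (fun z => rpow (Cmod (h z)) q) (t + gpt (2 ^ (l + c)) 0 v)).
  { intros v t. unfold F. replace (t + gpt (2 ^ (l + c)) 0 v) with (gpt (2 ^ (l + c)) t v)
      by (unfold gpt; ring). reflexivity. }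
  assert (Fc : forall v t, continuous (F v) t).
  { intros v t. apply (continuous_ext (fun t => (fun z => rpow (Cmod (h z)) q) (t + gpt (2 ^ (l + c)) 0 v)));
      [intros; symmetry; apply FE|].
    apply (rpow_cont q (fun t => Cmod (h (t + gpt (2 ^ (l + c)) 0 v))) Hq).
    apply (TS_cont (fun k => Rabs (IZR k) <= 2 ^ l) (fun t => h (t + gpt (2 ^ (l + c)) 0 v))).
    apply TS_shift, Hh. }
  set (K := C * C0 * (1 + 2 ^ j / 2 ^ l)).
  assert (HK : 0 < K) by (assert (0 < 2 ^ j / 2 ^ l) by (apply Rdiv_lt_0_compat; lra);
      unfold K; repeat apply Rmult_lt_0_compat; lra).
  assert (B : forall t, S <= K * Rsum (2 ^ (l + c)) (fun v => F v t)).
  { intros t. apply Rle_trans with (Rsum (2 ^ j) (fun u => C * Rsum (2 ^ (l + c)) (fun v =>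
      wt (2 ^ l) 2 (gpt (2 ^ j) s u - gpt (2 ^ (l + c)) t v) * F v t))).
    - apply Rsum_le. intros u _. apply HPP, Hh.
    - rewrite Rsum_scal, Rsum_swap. unfold K. rewrite (Rmult_assoc C C0), Rmult_assoc.
      apply Rmult_le_compat_l; [lra|]. rewrite <- Rsum_scal. apply Rsum_le. intros v _.
      rewrite Rsum_scal_r. apply Rmult_le_compat_r; [apply rpow_ge0|].
      rewrite (Rsum_ext _ _ (fun u => wt (2 ^ l) 2 (gpt (2 ^ (l + c)) t v - gpt (2 ^ j) s u)))
        by (intros; apply wt_sym).
      eapply Rle_trans; [apply Hgrid; [apply pow2_nat_pos|exact Hl]|]. rewrite INR_pow2. lra. }
  assert (I : RInt (fun _ => S) (- PI) PI <= RInt (fun t => K * Rsum (2 ^ (l + c)) (fun v => F v t)) (- PI) PI).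
  { apply RInt_mono; [lra|intros; apply continuous_const| |exact B].
    intros t. apply (cont_scal K). apply (Rsum_continuous _ F). intros; apply Fc. }
  rewrite RInt_const_R, RInt_scal_R in I by (intros; apply (Rsum_continuous _ F); intros; apply Fc).
  rewrite (RInt_Rsum _ F) in I by exact Fc.
  rewrite (Rsum_ext _ _ (fun _ => I1 q h)) in I.
  - rewrite Rsum_const, INR_pow2, pow_add in I.
    assert (E : K * (2 ^ l * 2 ^ c * I1 q h) = 2 * PI * (C * C0 * 2 ^ c / (2 * PI) * (2 ^ j + 2 ^ l) * I1 q h))
      by (unfold K; field; lra).
    rewrite E in I. apply (Rmult_le_reg_l (2 * PI)); [lra|]. lra.
  - intros v _. rewrite <- (I1_translate q _ h (gpt (2 ^ (l + c)) 0 v) Hq Hh).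
    apply RInt_ext. intros t _. apply FE.
Qed.

(** For [q <= 1] subadditivity keeps decay of order [L q], above 1 by hypothesis. For [q > 1] an
    order slightly above 1 is spent on the weighted sum, and [L >= 2] leaves enough. *)
Lemma recon_pointwise q L : 0 < q -> (2 <= L)%nat -> / q < INR L ->
  exists s C, 1 < s /\ 0 < C /\ forall m (a : nat -> Complex.C) t x,
    rpow (Cmod (Csum (2 ^ m) (fun u => (a u * Kper L m (x - gpt (2 ^ m) t u))%C))) q
    <= C * Rsum (2 ^ m) (fun u => rpow (Cmod (a u)) q * wt (2 ^ m) s (x - gpt (2 ^ m) t u)).
Proof.
  intros Hq HL HqL. destruct (Kper_decay L HL) as [C1 [HC1 HK]].
  assert (HLq : 1 < INR L * q).
  { apply (Rmult_lt_compat_r q) in HqL; [|exact Hq]. rewrite Rinv_l in HqL; lra. }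
  assert (HL2 : 2 <= INR L) by (apply (le_INR 2), HL).
  assert (B : forall m (a : nat -> Complex.C) t x,
    Cmod (Csum (2 ^ m) (fun u => (a u * Kper L m (x - gpt (2 ^ m) t u))%C)) <=
    Rsum (2 ^ m) (fun u => C1 * wt (2 ^ m) (INR L) (x - gpt (2 ^ m) t u) * Cmod (a u))).
  { intros m a t x. eapply Rle_trans; [apply Cmod_Csum|]. apply Rsum_le. intros u _.
    rewrite Cmod_mult, Rmult_comm. apply Rmult_le_compat_r; [apply Cmod_ge_0|apply HK]. }
  assert (Pos : forall m (a : nat -> Complex.C) t x (u : nat),
    0 <= C1 * wt (2 ^ m) (INR L) (x - gpt (2 ^ m) t u) * Cmod (a u)).
  { intros. pose proof (wt_pos (2 ^ m) (INR L) (x - gpt (2 ^ m) t u)).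
    apply Rmult_le_pos; [nra|apply Cmod_ge_0]. }
  destruct (Rle_dec q 1) as [Hq1|Hq1].
  - exists (INR L * q), (rpow C1 q). split; [exact HLq|]. split; [apply rpow_gt0, HC1|].
    intros m a t x. eapply Rle_trans; [apply rpow_le; [lra|split; [apply Cmod_ge_0|apply B]]|].
    eapply Rle_trans; [apply rpow_Rsum_subadd; [lra|intros; apply Pos]|].
    rewrite <- Rsum_scal. apply Rsum_le. intros u _.
    pose proof (wt_pos (2 ^ m) (INR L) (x - gpt (2 ^ m) t u)).
    rewrite !rpow_mult, wt_rpow by (try apply Cmod_ge_0; nra). lra.
  (* Half of the room between [1 / q] and 1, so that $(1-e)q=(q+1)/2>1$. *)
  - set (e := (1 - / q) / 2). assert (Hqi : 0 < / q < 1).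
    { split; [apply Rinv_0_lt_compat, Hq|]. rewrite <- Rinv_1. apply Rinv_lt_contravar; lra. }
    destruct (wt_grid_sum (1 + e) ltac:(unfold e; lra)) as [C0 [HC0 Hgrid]].
    exists ((INR L - (1 + e)) * q), (rpow (C0 * 2) q * rpow C1 q).
    split; [|split; [apply Rmult_lt_0_compat; apply rpow_gt0; lra|]].
    { apply Rlt_le_trans with ((1 - e) * q); [|nra]. unfold e.
      replace ((1 - (1 - / q) / 2) * q) with ((q + 1) / 2) by (field; lra). lra. }
    intros m a t x. pose proof (pow2_gt0 m) as Hm.
    eapply Rle_trans; [apply rpow_le; [lra|split; [apply Cmod_ge_0|apply B]]|].
    eapply Rle_trans; [apply (rpow_Rsum_weight _ _
      (fun u => / wt (2 ^ m) (1 + e) (x - gpt (2 ^ m) t u)) (C0 * 2) q Hq)|].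
    + intros; apply Pos.
    + intros; apply Rinv_0_lt_compat, wt_pos.
    + eapply Rle_trans; [right; apply Rsum_ext; intros v _; apply Rinv_inv|].
      eapply Rle_trans; [apply Hgrid; [apply pow2_nat_pos|exact Hm]|].
      rewrite INR_pow2. right. field. lra.
    + rewrite Rmult_assoc. apply Rmult_le_compat_l; [apply rpow_ge0|].
      rewrite <- Rsum_scal. apply Rsum_le. intros u _. rewrite wt_inv.
      set (z := x - gpt (2 ^ m) t u).
      replace (wt (2 ^ m) (- (1 + e)) z * (C1 * wt (2 ^ m) (INR L) z * Cmod (a u))) with
        (C1 * (wt (2 ^ m) (- (1 + e)) z * wt (2 ^ m) (INR L) z) * Cmod (a u)) by ring.
      rewrite wt_mult. pose proof (wt_pos (2 ^ m) (- (1 + e) + INR L) z).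
      rewrite !rpow_mult, wt_rpow by (try apply Cmod_ge_0; nra).
      replace (- (1 + e) + INR L) with (INR L - (1 + e)) by ring. lra.
Qed.

Lemma recon q L : 0 < q -> (2 <= L)%nat -> / q < INR L ->
  exists C, 0 < C /\ forall m (a : nat -> Complex.C) t,
    I1 q (fun x => Csum (2 ^ m) (fun u => (a u * Kper L m (x - gpt (2 ^ m) t u))%C))
    <= C / 2 ^ m * Rsum (2 ^ m) (fun u => rpow (Cmod (a u)) q).
Proof.
  intros Hq HL HqL. destruct (recon_pointwise q L Hq HL HqL) as [s [C [Hs [HC HP]]]].
  destruct (RInt_wt s Hs) as [C0 [HC0 HI]]. pose proof PI_RGT_0.
  exists (C * C0). split; [nra|]. intros m a t. pose proof (pow2_gt0 m) as Hm.
  assert (Hc : forall v x, continuous (fun x => rpow (Cmod (a v)) q * wt (2 ^ m) s (x - gpt (2 ^ m) t v)) x)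
    by (intros; apply cont_scal, wt_continuous; lra).
  apply Rle_trans with (RInt (fun x => C * Rsum (2 ^ m) (fun u =>
    rpow (Cmod (a u)) q * wt (2 ^ m) s (x - gpt (2 ^ m) t u))) (- PI) PI).
  - apply RInt_mono; [lra| | |intros; apply HP].
    + apply rpow_cont; [exact Hq|]. apply (TS_cont (fun k => Rabs (IZR k) <= 2 ^ m * (1 - / 2 ^ L))).
      apply (TS_csum _ _ (fun u x => (a u * Kper L m (x - gpt (2 ^ m) t u))%C)).
      intros u _. apply (TS_scal _ _ (fun x => Kper L m (x - gpt (2 ^ m) t u))).
      apply (TS_shift _ (Kper L m)), Kper_TP. lia.
    + intros x. apply cont_scal.
      apply (Rsum_continuous _ (fun u x => rpow (Cmod (a u)) q * wt (2 ^ m) s (x - gpt (2 ^ m) t u))).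
      intros; apply Hc.
  - rewrite RInt_scal_R by (intros; apply (Rsum_continuous _
      (fun u x => rpow (Cmod (a u)) q * wt (2 ^ m) s (x - gpt (2 ^ m) t u))); intros; apply Hc).
    rewrite (RInt_Rsum _ (fun u x => rpow (Cmod (a u)) q * wt (2 ^ m) s (x - gpt (2 ^ m) t u))) by exact Hc.
    unfold Rdiv. rewrite !Rmult_assoc. apply Rmult_le_compat_l; [lra|].
    rewrite <- Rmult_assoc, <- Rsum_scal. apply Rsum_le. intros u _.
    rewrite (RInt_scal_R (fun x => wt (2 ^ m) s (x - gpt (2 ^ m) t u)))
      by (intros; apply wt_continuous; lra).
    rewrite Rmult_comm. apply Rmult_le_compat_r; [apply rpow_ge0|apply HI].
Qed.

Lemma recon_sup L : (2 <= L)%nat -> exists C, 0 < C /\ forall m (a : nat -> Complex.C) t x M,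
  (forall u, (u < 2 ^ m)%nat -> Cmod (a u) <= M) ->
  Cmod (Csum (2 ^ m) (fun u => (a u * Kper L m (x - gpt (2 ^ m) t u))%C)) <= C * M.
Proof.
  intros HL. destruct (Kper_decay L HL) as [C1 [HC1 HK]].
  assert (HL2 : 2 <= INR L) by (apply (le_INR 2), HL).
  destruct (wt_grid_sum (INR L) ltac:(lra)) as [C0 [HC0 Hgrid]].
  exists (C1 * (C0 * 2)). split; [nra|]. intros m a t x M HM. pose proof (pow2_gt0 m) as Hm.
  assert (H0 : 0 <= M) by (eapply Rle_trans; [apply Cmod_ge_0|apply (HM O), pow2_nat_pos]).
  eapply Rle_trans; [apply Cmod_Csum|].
  apply Rle_trans with (Rsum (2 ^ m) (fun u => M * C1 * wt (2 ^ m) (INR L) (x - gpt (2 ^ m) t u))).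
  - apply Rsum_le. intros u Hu. rewrite Cmod_mult, Rmult_assoc.
    apply Rmult_le_compat; try apply Cmod_ge_0; [apply HM, Hu|apply HK].
  - rewrite Rsum_scal.
    pose proof (Hgrid (2 ^ m)%nat (2 ^ m) x t (pow2_nat_pos m) Hm) as G. rewrite INR_pow2 in G.
    replace (1 + 2 ^ m / 2 ^ m) with 2 in G by (field; lra).
    apply Rle_trans with (M * C1 * (C0 * 2)); [apply Rmult_le_compat_l; [nra|exact G]|].
    right; ring.
Qed.

(** * The M. Riesz projection theorem for trigonometric polynomials *)

Definition cont2 (f : R -> R -> R) : Prop := forall s t, continuity_2d_pt f s t.

Lemma cont2_const c : cont2 (fun _ _ => c).
Proof. intros s t. apply continuity_2d_pt_const. Qed.

Lemma cont2_plus f g : cont2 f -> cont2 g -> cont2 (fun s t => f s t + g s t).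
Proof. intros Hf Hg s t. apply continuity_2d_pt_plus; auto. Qed.

Lemma cont2_mult f g : cont2 f -> cont2 g -> cont2 (fun s t => f s t * g s t).
Proof. intros Hf Hg s t. apply continuity_2d_pt_mult; auto. Qed.

Lemma cont2_comp (h : R -> R) f : (forall s t, continuous h (f s t)) -> cont2 f ->
  cont2 (fun s t => h (f s t)).
Proof.
  intros Hh Hf s t. apply continuity_1d_2d_pt_comp; [|apply Hf].
  apply continuity_pt_filterlim, Hh.
Qed.

Lemma cont2_Rsum n (F : nat -> R -> R -> R) : (forall k, cont2 (F k)) ->
  cont2 (fun s t => Rsum n (fun k => F k s t)).
Proof.
  intros H. induction n; simpl; [apply cont2_const|].
  apply (cont2_plus (fun s t => Rsum n (fun k => F k s t)) (F n)); auto.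
Qed.

Lemma cont2_continuous_t f s : cont2 f -> forall t, continuous (f s) t.
Proof.
  intros H t. apply continuity_pt_filterlim. intros eps He.
  destruct (H s t (mkposreal eps He)) as [d Hd]. exists d. split; [apply cond_pos|].
  intros y [_ Hy]. simpl in *. unfold R_dist in *. apply Hd; [|exact Hy].
  rewrite Rminus_diag, Rabs_R0. apply cond_pos.
Qed.

Lemma mean_diff (f fs : R -> R -> R) : (forall s t, is_derive (fun s => f s t) s (fs s t)) ->
  cont2 f -> cont2 fs -> forall s,
  is_derive (fun s => RInt (f s) (- PI) PI) s (RInt (fs s) (- PI) PI).
Proof.
  intros Hd Hc Hcs s.
  assert (E : forall s t, Derive (fun z => f z t) s = fs s t) by (intros; apply is_derive_unique, Hd).
  replace (RInt (fs s) (- PI) PI) with (RInt (fun t => Derive (fun u => f u t) s) (- PI) PI)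
    by (apply RInt_ext; intros; apply E).
  apply (is_derive_RInt_param f (- PI) PI s).
  - exists (mkposreal 1 Rlt_0_1). intros y _ t _. exists (fs y t). apply Hd.
  - intros t _. apply (continuity_2d_pt_ext fs); [intros; symmetry; apply E|apply Hcs].
  - exists (mkposreal 1 Rlt_0_1). intros y _. apply ex_RInt_cont. apply cont2_continuous_t, Hc.
Qed.

(* The circular means are convex in [s] and bounded as [s] tends to minus infinity. *)
Lemma subharmonic_mean (f fs fss ft ftt : R -> R -> R) B :
  (forall s t, is_derive (fun s => f s t) s (fs s t)) ->
  (forall s t, is_derive (fun s => fs s t) s (fss s t)) ->
  (forall s t, is_derive (fun t => f s t) t (ft s t)) ->
  (forall s t, is_derive (fun t => ft s t) t (ftt s t)) ->
  cont2 f -> cont2 fs -> cont2 fss -> cont2 ftt ->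
  (forall s, ft s PI = ft s (- PI)) ->
  (forall s t, 0 <= fss s t + ftt s t) ->
  (forall s t, s <= 0 -> Rabs (f s t) <= B) ->
  forall s, s <= 0 -> RInt (f s) (- PI) PI <= RInt (f 0) (- PI) PI.
Proof.
  intros H1 H2 H3 H4 C0 C1 C2 C4 Hper Hlap HB.
  pose proof PI_RGT_0 as HPI.
  set (M := fun s => RInt (f s) (- PI) PI). set (M1 := fun s => RInt (fs s) (- PI) PI).
  set (M2 := fun s => RInt (fss s) (- PI) PI).
  assert (D1 : forall s, is_derive M s (M1 s)) by (apply mean_diff; assumption).
  assert (D2 : forall s, is_derive M1 s (M2 s)) by (apply mean_diff; assumption).
  (* The second [t]-derivative integrates to 0 over a period, so the second derivative of the mean
     is the mean of the Laplacian. *)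
  assert (P2 : forall s, 0 <= M2 s).
  { intros s. assert (E : RInt (ftt s) (- PI) PI = 0).
    { assert (I : is_RInt (ftt s) (- PI) PI (minus (ft s PI) (ft s (- PI)))).
      { apply (is_RInt_derive (ft s) (ftt s)); [intros; apply H4|].
        intros; apply cont2_continuous_t, C4. }
      rewrite (is_RInt_unique _ _ _ _ I), Hper. apply Rminus_diag. }
    assert (E2 : M2 s + RInt (ftt s) (- PI) PI = RInt (fun t => fss s t + ftt s t) (- PI) PI).
    { symmetry. apply (RInt_plus (V := R_CompleteNormedModule));
        apply ex_RInt_cont, cont2_continuous_t; assumption. }
    assert (0 <= RInt (fun t => fss s t + ftt s t) (- PI) PI).
    { apply RInt_nonneg; [lra| |apply Hlap].
      apply (cont2_continuous_t (fun s t => fss s t + ftt s t)), cont2_plus; assumption. }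
    lra. }
  assert (Mv : forall a b, a < b -> exists c, a <= c <= b /\ M b - M a = M1 c * (b - a)).
  { intros a b Hab. destruct (MVT_gen M a b M1) as [c [Hc E]].
    - intros; apply D1.
    - intros x _. apply continuity_pt_filterlim. apply (ex_derive_continuous M). exists (M1 x); apply D1.
    - rewrite Rmin_left, Rmax_right in Hc by lra. exists c. split; assumption. }
  assert (Mono : forall a b, a <= b -> M1 a <= M1 b).
  { intros a b [Hab| ->]; [|lra]. destruct (MVT_gen M1 a b M2) as [c [Hc E]].
    - intros; apply D2.
    - intros x _. apply continuity_pt_filterlim. apply (ex_derive_continuous M1). exists (M2 x); apply D2.
    - pose proof (P2 c). nra. }
  assert (Bd : forall s, s <= 0 -> Rabs (M s) <= 2 * PI * B).
  { intros s Hs. unfold M. replace (2 * PI) with (PI - - PI) by ring.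
    apply abs_RInt_le_const; [lra|apply ex_RInt_cont, cont2_continuous_t, C0|].
    intros; apply HB, Hs. }
  assert (Pos : forall s, s <= 0 -> 0 <= M1 s).
  { intros s Hs. destruct (Rle_dec 0 (M1 s)) as [H|H]; [exact H|exfalso].
    (* By convexity a negative slope at [s] persists to the left; over the length [d] the mean would
       change by more than the [4 * PI * B] that its bound allows. *)
    set (d := (4 * PI * B + 1) / - M1 s).
    assert (B0 : 0 <= B) by (eapply Rle_trans; [apply Rabs_pos|apply (HB s 0 Hs)]).
    assert (Hd : 0 < d) by (apply Rdiv_lt_0_compat; nra).
    destruct (Mv (s - d) s ltac:(lra)) as [c [Hc E]].
    pose proof (Mono c s ltac:(lra)) as Hm.
    pose proof (Bd s Hs) as B1. pose proof (Bd (s - d) ltac:(lra)) as B2.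
    apply Rabs_le_between in B1. apply Rabs_le_between in B2.
    replace (s - (s - d)) with d in E by ring.
    assert (Ed : - M1 s * d = 4 * PI * B + 1) by (unfold d; field; lra). nra. }
  intros s [Hs| ->]; [|lra]. destruct (Mv s 0 Hs) as [c [Hc E]].
  pose proof (Pos c ltac:(lra)). change (M s <= M 0). nra.
Qed.

(** * Derivatives of the analytic extension of a trigonometric polynomial *)

Lemma is_derive_Rsum n (F : nat -> R -> R) (F' : nat -> R) x :
  (forall k, is_derive (F k) x (F' k)) ->
  is_derive (fun y => Rsum n (fun k => F k y)) x (Rsum n F').
Proof.
  intros H. induction n; simpl; [auto_derive; auto|].
  apply (is_derive_plus (fun y => Rsum n (fun k => F k y)) (F n)); [exact IHn|apply H].
Qed.

Lemma is_derive_ext_val (f : R -> R) (x l l' : R) : is_derive f x l -> l = l' -> is_derive f x l'.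
Proof. intros H <-; exact H. Qed.

Lemma der_plus (f g : R -> R) (x a b : R) : is_derive f x a -> is_derive g x b ->
  is_derive (fun y => f y + g y) x (a + b).
Proof. exact (is_derive_plus f g x a b). Qed.

Lemma der_minus (f g : R -> R) (x a b : R) : is_derive f x a -> is_derive g x b ->
  is_derive (fun y => f y - g y) x (a - b).
Proof. exact (is_derive_minus f g x a b). Qed.

Lemma der_mult (f g : R -> R) (x a b : R) : is_derive f x a -> is_derive g x b ->
  is_derive (fun y => f y * g y) x (a * g x + f x * b).
Proof. intros Hf Hg. apply (is_derive_mult f g x a b Hf Hg). intros; apply Rmult_comm. Qed.

Lemma der_scal c (f : R -> R) (x a : R) : is_derive f x a -> is_derive (fun y => c * f y) x (c * a).
Proof. exact (is_derive_scal f x c a). Qed.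

Lemma der_pow al (f : R -> R) (x a : R) : 0 < f x -> is_derive f x a ->
  is_derive (fun y => Rpower (f y) al) x (al * Rpower (f x) (al - 1) * a).
Proof.
  intros Hp Hf. eapply is_derive_ext_val.
  - apply (is_derive_comp (fun z => Rpower z al) f); [|exact Hf]. unfold Rpower. auto_derive; [exact Hp|reflexivity].
  - unfold scal; simpl; unfold mult; simpl. unfold Rminus. rewrite Rpower_plus, Rpower_Ropp, Rpower_1 by exact Hp.
    unfold Rpower. field. lra.
Qed.

Lemma Rpower_continuous al x : 0 < x -> continuous (fun z => Rpower z al) x.
Proof.
  intros H. apply (ex_derive_continuous (fun z => Rpower z al)). unfold Rpower. auto_derive. exact H.
Qed.

(** Real part of $\sum_k k^n c_k e^{k(s+it)}$, and [hV] is the imaginary part: the $n$-th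
    [s]-derivative of $w(z)=\sum_k c_kz^k$ at $z=e^{s+it}$. In these coordinates the disc is
    $s\le0$, its centre is $s=-\infty$, and circular means are integrals over [t]. *)
Definition hU (K : nat) (c : nat -> C) (n : nat) (s t : R) : R := Rsum K (fun k =>
  INR k ^ n * (exp (INR k * s) * (fst (c k) * cos (INR k * t) - snd (c k) * sin (INR k * t)))).
Definition hV (K : nat) (c : nat -> C) (n : nat) (s t : R) : R := Rsum K (fun k =>
  INR k ^ n * (exp (INR k * s) * (fst (c k) * sin (INR k * t) + snd (c k) * cos (INR k * t)))).

Lemma hU_s (K : nat) (c : nat -> C) n s t : is_derive (fun s => hU K c n s t) s (hU K c (S n) s t).
Proof.
  apply (is_derive_Rsum K (fun k s => INR k ^ n * (exp (INR k * s) * (fst (c k) * cos (INR k * t) - snd (c k) * sin (INR k * t))))).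
  intros k. auto_derive; [exact I|]. simpl. ring.
Qed.

Lemma hV_s (K : nat) (c : nat -> C) n s t : is_derive (fun s => hV K c n s t) s (hV K c (S n) s t).
Proof.
  apply (is_derive_Rsum K (fun k s => INR k ^ n * (exp (INR k * s) * (fst (c k) * sin (INR k * t) + snd (c k) * cos (INR k * t))))).
  intros k. auto_derive; [exact I|]. simpl. ring.
Qed.

Lemma hU_t (K : nat) (c : nat -> C) n s t : is_derive (fun t => hU K c n s t) t (- hV K c (S n) s t).
Proof.
  unfold hV. replace (- _) with (-1 * Rsum K (fun k =>
    INR k ^ S n * (exp (INR k * s) * (fst (c k) * sin (INR k * t) + snd (c k) * cos (INR k * t))))) by ring.
  rewrite <- Rsum_scal.
  apply (is_derive_Rsum K (fun k t => INR k ^ n * (exp (INR k * s) * (fst (c k) * cos (INR k * t) - snd (c k) * sin (INR k * t))))).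
  intros k. auto_derive; [exact I|]. simpl. ring.
Qed.

Lemma hV_t (K : nat) (c : nat -> C) n s t : is_derive (fun t => hV K c n s t) t (hU K c (S n) s t).
Proof.
  apply (is_derive_Rsum K (fun k t => INR k ^ n * (exp (INR k * s) * (fst (c k) * sin (INR k * t) + snd (c k) * cos (INR k * t))))).
  intros k. auto_derive; [exact I|]. simpl. ring.
Qed.

Lemma cont2_exp a : cont2 (fun s _ => exp (a * s)).
Proof.
  intros s t. apply continuity_1d_2d_pt_comp.
  - apply derivable_continuous_pt, derivable_pt_exp.
  - apply (cont2_mult (fun _ _ => a) (fun s _ => s)); [apply cont2_const|].
    intros ? ?; apply continuity_2d_pt_id1.
Qed.

Lemma cont2_cos a : cont2 (fun _ t => cos (a * t)).
Proof.
  intros s t. apply continuity_1d_2d_pt_comp; [apply continuity_cos|].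
  apply (cont2_mult (fun _ _ => a) (fun _ t => t)); [apply cont2_const|].
  intros ? ?; apply continuity_2d_pt_id2.
Qed.

Lemma cont2_sin a : cont2 (fun _ t => sin (a * t)).
Proof.
  intros s t. apply continuity_1d_2d_pt_comp; [apply continuity_sin|].
  apply (cont2_mult (fun _ _ => a) (fun _ t => t)); [apply cont2_const|].
  intros ? ?; apply continuity_2d_pt_id2.
Qed.

Lemma hU_cont (K : nat) (c : nat -> C) n : cont2 (hU K c n).
Proof.
  apply (cont2_Rsum K (fun k s t => INR k ^ n * (exp (INR k * s) * (fst (c k) * cos (INR k * t) - snd (c k) * sin (INR k * t))))).
  intros k. apply (cont2_mult (fun _ _ => INR k ^ n)); [apply cont2_const|].
  apply (cont2_mult (fun s _ => exp (INR k * s))); [apply cont2_exp|].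
  intros s t.
  apply (continuity_2d_pt_minus (fun _ t => fst (c k) * cos (INR k * t)) (fun _ t => snd (c k) * sin (INR k * t))).
  - apply (cont2_mult (fun _ _ => fst (c k)) (fun _ t => cos (INR k * t))); [apply cont2_const|apply cont2_cos].
  - apply (cont2_mult (fun _ _ => snd (c k)) (fun _ t => sin (INR k * t))); [apply cont2_const|apply cont2_sin].
Qed.

Lemma hV_cont (K : nat) (c : nat -> C) n : cont2 (hV K c n).
Proof.
  apply (cont2_Rsum K (fun k s t => INR k ^ n * (exp (INR k * s) * (fst (c k) * sin (INR k * t) + snd (c k) * cos (INR k * t))))).
  intros k. apply (cont2_mult (fun _ _ => INR k ^ n)); [apply cont2_const|].
  apply (cont2_mult (fun s _ => exp (INR k * s))); [apply cont2_exp|].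
  apply (cont2_plus (fun _ t => fst (c k) * sin (INR k * t)) (fun _ t => snd (c k) * cos (INR k * t))).
  - apply (cont2_mult (fun _ _ => fst (c k)) (fun _ t => sin (INR k * t))); [apply cont2_const|apply cont2_sin].
  - apply (cont2_mult (fun _ _ => snd (c k)) (fun _ t => cos (INR k * t))); [apply cont2_const|apply cont2_cos].
Qed.

Lemma cos_nPI k : cos (INR k * PI) = cos (INR k * - PI).
Proof. replace (INR k * - PI) with (- (INR k * PI)) by ring. rewrite cos_neg. reflexivity. Qed.

Lemma sin_nPI k : sin (INR k * PI) = 0.
Proof. rewrite INR_IZR_INZ. apply sin_IZR_PI. Qed.

Lemma sin_nPI' k : sin (INR k * - PI) = 0.
Proof. replace (INR k * - PI) with (- (INR k * PI)) by ring. rewrite sin_neg, sin_nPI. ring. Qed.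

Lemma hU_per (K : nat) (c : nat -> C) n s : hU K c n s PI = hU K c n s (- PI).
Proof. apply Rsum_ext; intros. rewrite sin_nPI, sin_nPI', cos_nPI. reflexivity. Qed.

Lemma hV_per (K : nat) (c : nat -> C) n s : hV K c n s PI = hV K c n s (- PI).
Proof. apply Rsum_ext; intros. rewrite sin_nPI, sin_nPI', cos_nPI. reflexivity. Qed.

Definition hB (K : nat) (c : nat -> C) : R := Rsum K (fun k => Rabs (fst (c k)) + Rabs (snd (c k))).

Lemma trig_comb_le x y al be : Rabs al <= 1 -> Rabs be <= 1 ->
  Rabs (x * al + y * be) <= Rabs x + Rabs y.
Proof.
  intros H1 H2. eapply Rle_trans; [apply Rabs_triang|]. rewrite !Rabs_mult.
  pose proof (Rabs_pos x); pose proof (Rabs_pos y). nra.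
Qed.

Lemma cos_abs1 x : Rabs (cos x) <= 1.
Proof. apply Rabs_le, COS_bound. Qed.

Lemma sin_abs1 x : Rabs (sin x) <= 1.
Proof. apply Rabs_le, SIN_bound. Qed.

Lemma hU_bound (K : nat) (c : nat -> C) s t : s <= 0 -> Rabs (hU K c 0 s t) <= hB K c.
Proof.
  intros Hs. eapply Rle_trans; [apply Rsum_Rabs|]. apply Rsum_le. intros k _.
  simpl (_ ^ 0). rewrite Rmult_1_l, Rabs_mult, (Rabs_pos_eq (exp _)) by apply Rlt_le, exp_pos.
  assert (exp (INR k * s) <= 1).
  { rewrite <- exp_0. apply exp_le. pose proof (pos_INR k). nra. }
  pose proof (exp_pos (INR k * s)).
  pose proof (trig_comb_le (fst (c k)) (snd (c k)) (cos (INR k * t)) (- sin (INR k * t))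
    (cos_abs1 _) ltac:(rewrite Rabs_Ropp; apply sin_abs1)) as H1.
  replace (fst (c k) * cos (INR k * t) + snd (c k) * - sin (INR k * t)) with
    (fst (c k) * cos (INR k * t) - snd (c k) * sin (INR k * t)) in H1 by ring.
  match goal with |- _ * ?u <= _ => assert (0 <= u) by apply Rabs_pos end. nra.
Qed.

(** The constant term has no imaginary part, and every other summand carries at least one factor
    [exp s]: the conjugate function vanishes at the centre of the disc. *)
Lemma hV_small (K : nat) (c : nat -> C) s t : snd (c 0%nat) = 0 -> s <= 0 -> Rabs (hV K c 0 s t) <= hB K c * exp s.
Proof.
  intros H0 Hs. unfold hB. rewrite <- Rsum_scal_r.
  eapply Rle_trans; [apply Rsum_Rabs|]. apply Rsum_le. intros k _.
  simpl (_ ^ 0). rewrite Rmult_1_l, Rabs_mult, (Rabs_pos_eq (exp _)) by apply Rlt_le, exp_pos.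
  pose proof (Rabs_pos (fst (c k))). pose proof (Rabs_pos (snd (c k))). pose proof (exp_pos s).
  destruct k as [|k].
  - rewrite H0. simpl (INR 0). rewrite !Rmult_0_l, sin_0, Rmult_0_r, Rplus_0_l, Rabs_R0, Rmult_0_r.
    nra.
  - assert (exp (INR (S k) * s) <= exp s).
    { apply exp_le. rewrite S_INR. pose proof (pos_INR k). nra. }
    pose proof (trig_comb_le (fst (c (S k))) (snd (c (S k))) _ _
      (sin_abs1 (INR (S k) * t)) (cos_abs1 (INR (S k) * t))) as HT.
    pose proof (exp_pos (INR (S k) * s)).
    match goal with |- _ * ?u <= _ => assert (0 <= u) by apply Rabs_pos end. nra.
Qed.

(** Chain-rule values of the first derivative of [P^al], and in [dpow2] of the second. As functions
    of the derivatives of [P] they serve both variables. *)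
Definition dpow1 (al P P1 : R) : R := al * Rpower P (al - 1) * P1.
Definition dpow2 (al P P1 P2 : R) : R :=
  al * ((al - 1) * Rpower P (al - 1 - 1) * P1 * P1 + Rpower P (al - 1) * P2).

Lemma der_dpow1 al (P P1 : R -> R) (x p2 : R) : 0 < P x -> is_derive P x (P1 x) -> is_derive P1 x p2 ->
  is_derive (fun y => dpow1 al (P y) (P1 y)) x (dpow2 al (P x) (P1 x) p2).
Proof.
  intros Hp H1 H2. unfold dpow1, dpow2.
  eapply is_derive_ext_val.
  - apply (der_mult (fun y => al * Rpower (P y) (al - 1)) P1); [|exact H2].
    apply der_scal, der_pow; [exact Hp|exact H1].
  - ring.
Qed.

Lemma cont2_pow al P : (forall s t, 0 < P s t) -> cont2 P -> cont2 (fun s t => Rpower (P s t) al).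
Proof. intros Hp HP. apply (cont2_comp (fun z => Rpower z al)); [|exact HP]. intros; apply Rpower_continuous, Hp. Qed.

Lemma cont2_dpow1 al P P1 : (forall s t, 0 < P s t) -> cont2 P -> cont2 P1 ->
  cont2 (fun s t => dpow1 al (P s t) (P1 s t)).
Proof.
  intros Hp HP H1. unfold dpow1. apply (cont2_mult (fun s t => al * Rpower (P s t) (al - 1)) P1); [|exact H1].
  apply (cont2_mult (fun _ _ => al)); [apply cont2_const|apply cont2_pow; assumption].
Qed.

Lemma cont2_dpow2 al P P1 P2 : (forall s t, 0 < P s t) -> cont2 P -> cont2 P1 -> cont2 P2 ->
  cont2 (fun s t => dpow2 al (P s t) (P1 s t) (P2 s t)).
Proof.
  intros Hp HP H1 H2. unfold dpow2. apply (cont2_mult (fun _ _ => al)); [apply cont2_const|].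
  apply (cont2_plus (fun s t => (al - 1) * Rpower (P s t) (al - 1 - 1) * P1 s t * P1 s t)).
  - repeat apply cont2_mult; try assumption; [apply cont2_const|apply cont2_pow; assumption].
  - apply cont2_mult; [apply cont2_pow; assumption|exact H2].
Qed.

Lemma cont2_minus f g : cont2 f -> cont2 g -> cont2 (fun s t => f s t - g s t).
Proof. intros Hf Hg s t. apply continuity_2d_pt_minus; auto. Qed.

Lemma cont2_opp f : cont2 f -> cont2 (fun s t => - f s t).
Proof. intros Hf s t. apply continuity_2d_pt_opp; auto. Qed.

Lemma Rpower_sub1 x a : 0 < x -> Rpower x a = Rpower x (a - 1) * x.
Proof.
  intros H. rewrite <- (Rpower_1 x) at 3 by exact H. rewrite <- Rpower_plus. f_equal; ring.
Qed.

Lemma hB_nonneg K c : 0 <= hB K c.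
Proof. apply Rsum_nonneg; intros. pose proof (Rabs_pos (fst (c v))). pose proof (Rabs_pos (snd (c v))). lra. Qed.

Lemma hV_bound K c s t : snd (c 0%nat) = 0 -> s <= 0 -> Rabs (hV K c 0 s t) <= hB K c.
Proof.
  intros H0 Hs. pose proof (hV_small K c s t H0 Hs). pose proof (hB_nonneg K c).
  assert (exp s <= 1) by (rewrite <- exp_0; apply exp_le; lra). nra.
Qed.

Lemma hV_tiny K c eps : snd (c 0%nat) = 0 -> 0 < eps ->
  exists s, s <= 0 /\ forall t, hV K c 0 s t * hV K c 0 s t <= eps.
Proof.
  intros H0 He. pose proof (hB_nonneg K c) as HB.
  (* Capping at 1 gives [d * d <= d <= eps] and keeps the chosen [s] nonpositive. *)
  set (d := Rmin eps 1). assert (Hd : 0 < d <= 1 /\ d <= eps).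
  { unfold d, Rmin; destruct (Rle_dec eps 1); lra. }
  exists (ln (d / (hB K c + 1))).
  assert (Hq : 0 < d / (hB K c + 1) <= 1).
  { split; [apply Rdiv_lt_0_compat; lra|apply Rle_div_l; lra]. }
  assert (Hs : ln (d / (hB K c + 1)) <= 0) by (rewrite <- ln_1; apply ln_le; lra).
  split; [exact Hs|]. intros t. pose proof (hV_small K c _ t H0 Hs) as V.
  rewrite exp_ln in V by lra.
  assert (hB K c * (d / (hB K c + 1)) <= d).
  { replace d with ((hB K c + 1) * (d / (hB K c + 1))) at 2 by (field; lra). nra. }
  set (v := hV K c 0 _ t) in *.
  replace (v * v) with (Rabs v * Rabs v) by (rewrite <- Rabs_mult; apply Rabs_pos_eq, Rle_0_sqr).
  pose proof (Rabs_pos v). nra.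
Qed.

(** The functions $u^2$ and, as [qV], $v^2$ for $w=u+iv$. The suffixes [1] and [2] mark
    [s]-derivatives, [t] and [tt] mark [t]-derivatives rewritten by the Cauchy-Riemann equations. *)
Definition qX K c (s t : R) : R := hU K c 0 s t * hU K c 0 s t.
Definition qX1 K c s t : R := 2 * (hU K c 0 s t * hU K c 1 s t).
Definition qX2 K c s t : R := 2 * (hU K c 1 s t * hU K c 1 s t + hU K c 0 s t * hU K c 2 s t).
Definition qXt K c s t : R := 2 * (- (hU K c 0 s t * hV K c 1 s t)).
Definition qXtt K c s t : R := 2 * (hV K c 1 s t * hV K c 1 s t - hU K c 0 s t * hU K c 2 s t).
Definition qV K c (s t : R) : R := hV K c 0 s t * hV K c 0 s t.
Definition qV1 K c s t : R := 2 * (hV K c 0 s t * hV K c 1 s t).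
Definition qV2 K c s t : R := 2 * (hV K c 1 s t * hV K c 1 s t + hV K c 0 s t * hV K c 2 s t).
Definition qVt K c s t : R := 2 * (hV K c 0 s t * hU K c 1 s t).
Definition qVtt K c s t : R := 2 * (hU K c 1 s t * hU K c 1 s t - hV K c 0 s t * hV K c 2 s t).

Lemma qX_s K c s t : is_derive (fun s => qX K c s t) s (qX1 K c s t).
Proof.
  unfold qX, qX1. eapply is_derive_ext_val; [apply der_mult; apply hU_s|]. cbv beta; ring.
Qed.
Lemma qX1_s K c s t : is_derive (fun s => qX1 K c s t) s (qX2 K c s t).
Proof.
  unfold qX1, qX2. apply der_scal. eapply is_derive_ext_val; [apply der_mult; apply hU_s|]. cbv beta; ring.
Qed.
Lemma qX_t K c s t : is_derive (fun t => qX K c s t) t (qXt K c s t).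
Proof.
  unfold qX, qXt. eapply is_derive_ext_val; [apply der_mult; apply hU_t|]. cbv beta; ring.
Qed.
Lemma qXt_t K c s t : is_derive (fun t => qXt K c s t) t (qXtt K c s t).
Proof.
  unfold qXt, qXtt. apply der_scal. eapply is_derive_ext_val.
  - apply (is_derive_opp (fun t => hU K c 0 s t * hV K c 1 s t)).
    apply der_mult; [apply hU_t|apply hV_t].
  - unfold opp; simpl. ring.
Qed.
Lemma qV_s K c s t : is_derive (fun s => qV K c s t) s (qV1 K c s t).
Proof.
  unfold qV, qV1. eapply is_derive_ext_val; [apply der_mult; apply hV_s|]. cbv beta; ring.
Qed.
Lemma qV1_s K c s t : is_derive (fun s => qV1 K c s t) s (qV2 K c s t).
Proof.
  unfold qV1, qV2. apply der_scal. eapply is_derive_ext_val; [apply der_mult; apply hV_s|]. cbv beta; ring.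
Qed.
Lemma qV_t K c s t : is_derive (fun t => qV K c s t) t (qVt K c s t).
Proof.
  unfold qV, qVt. eapply is_derive_ext_val; [apply der_mult; apply hV_t|]. cbv beta; ring.
Qed.
Lemma qVt_t K c s t : is_derive (fun t => qVt K c s t) t (qVtt K c s t).
Proof.
  unfold qVt, qVtt. apply der_scal. eapply is_derive_ext_val.
  - apply der_mult; [apply hV_t|apply hU_t].
  - cbv beta; ring.
Qed.

Ltac cont2_tac := repeat first
  [ apply cont2_const | apply hU_cont | apply hV_cont
  | apply cont2_plus | apply cont2_minus | apply cont2_mult | apply cont2_opp ].

Lemma qX_c K c : cont2 (qX K c). Proof. unfold qX; cont2_tac. Qed.
Lemma qX1_c K c : cont2 (qX1 K c). Proof. unfold qX1; cont2_tac. Qed.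
Lemma qX2_c K c : cont2 (qX2 K c). Proof. unfold qX2; cont2_tac. Qed.
Lemma qXt_c K c : cont2 (qXt K c). Proof. unfold qXt; cont2_tac. Qed.
Lemma qXtt_c K c : cont2 (qXtt K c). Proof. unfold qXtt; cont2_tac. Qed.
Lemma qV_c K c : cont2 (qV K c). Proof. unfold qV; cont2_tac. Qed.
Lemma qV1_c K c : cont2 (qV1 K c). Proof. unfold qV1; cont2_tac. Qed.
Lemma qV2_c K c : cont2 (qV2 K c). Proof. unfold qV2; cont2_tac. Qed.
Lemma qVt_c K c : cont2 (qVt K c). Proof. unfold qVt; cont2_tac. Qed.
Lemma qVtt_c K c : cont2 (qVtt K c). Proof. unfold qVtt; cont2_tac. Qed.

Lemma qX_bound K c s t : s <= 0 -> 0 <= qX K c s t <= hB K c * hB K c.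
Proof.
  intros Hs. unfold qX. pose proof (hU_bound K c s t Hs) as H. split; [apply Rle_0_sqr|].
  replace (hU K c 0 s t * hU K c 0 s t) with (Rabs (hU K c 0 s t) * Rabs (hU K c 0 s t))
    by (rewrite <- Rabs_mult; apply Rabs_pos_eq, Rle_0_sqr).
  apply Rmult_le_compat; try assumption; apply Rabs_pos.
Qed.

Lemma qV_bound K c s t : snd (c 0%nat) = 0 -> s <= 0 -> 0 <= qV K c s t <= hB K c * hB K c.
Proof.
  intros H0 Hs. unfold qV. pose proof (hV_bound K c s t H0 Hs) as H. split; [apply Rle_0_sqr|].
  replace (hV K c 0 s t * hV K c 0 s t) with (Rabs (hV K c 0 s t) * Rabs (hV K c 0 s t))
    by (rewrite <- Rabs_mult; apply Rabs_pos_eq, Rle_0_sqr).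
  apply Rmult_le_compat; try assumption; apply Rabs_pos.
Qed.

(* P. Stein's function: [A (u^2+eps)^al - (|w|^2+eps)^al] is subharmonic when [1/2 < al <= 1]. *)
Lemma riesz_eps_le2 al K c eps : 1 / 2 < al <= 1 -> snd (c 0%nat) = 0 -> 0 < eps ->
  RInt (fun t => Rpower (qX K c 0 t + qV K c 0 t + eps) al) (- PI) PI <=
  2 / (2 * al - 1) * RInt (fun t => Rpower (qX K c 0 t + eps) al) (- PI) PI.
Proof.
  (* Chosen so that [A * (2 * al - 1) = 2] closes the Laplacian estimate; it blows up as [al] tends
     to 1/2, that is as [p] tends to 1. *)
  intros Hal H0 He. set (A := 2 / (2 * al - 1)).
  assert (HA : A * (2 * al - 1) = 2) by (unfold A; field; lra).
  assert (HA1 : 2 <= A) by nra.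
  set (X := fun s t => qX K c s t + eps). set (Y := fun s t => qX K c s t + qV K c s t + eps).
  assert (HX : forall s t, 0 < X s t) by (intros; unfold X, qX; nra).
  assert (HY : forall s t, 0 < Y s t) by (intros; unfold Y, qX, qV; nra).
  assert (HXc : cont2 X) by (apply cont2_plus; [apply qX_c|apply cont2_const]).
  assert (HYc : cont2 Y) by (apply cont2_plus; [apply cont2_plus; [apply qX_c|apply qV_c]|apply cont2_const]).
  set (Y1 := fun s t => qX1 K c s t + qV1 K c s t). set (Y2 := fun s t => qX2 K c s t + qV2 K c s t).
  set (Yt := fun s t => qXt K c s t + qVt K c s t). set (Ytt := fun s t => qXtt K c s t + qVtt K c s t).
  assert (HX1 : forall s t, is_derive (fun s => X s t) s (qX1 K c s t)).
  { intros. unfold X. eapply is_derive_ext_val; [apply der_plus; [apply qX_s|apply is_derive_const]|].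
    unfold zero; simpl; ring. }
  assert (HXt : forall s t, is_derive (fun t => X s t) t (qXt K c s t)).
  { intros. unfold X. eapply is_derive_ext_val; [apply der_plus; [apply qX_t|apply is_derive_const]|].
    unfold zero; simpl; ring. }
  assert (HY1 : forall s t, is_derive (fun s => Y s t) s (Y1 s t)).
  { intros. unfold Y. eapply is_derive_ext_val;
      [apply der_plus; [apply der_plus; [apply qX_s|apply qV_s]|apply is_derive_const]|].
    unfold zero; simpl; unfold Y1; ring. }
  assert (HYt : forall s t, is_derive (fun t => Y s t) t (Yt s t)).
  { intros. unfold Y. eapply is_derive_ext_val;
      [apply der_plus; [apply der_plus; [apply qX_t|apply qV_t]|apply is_derive_const]|].
    unfold zero; simpl; unfold Yt; ring. }
  assert (HY2 : forall s t, is_derive (fun s => Y1 s t) s (Y2 s t))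
    by (intros; apply der_plus; [apply qX1_s|apply qV1_s]).
  assert (HYtt : forall s t, is_derive (fun t => Yt s t) t (Ytt s t))
    by (intros; apply der_plus; [apply qXt_t|apply qVt_t]).
  assert (Y1c : cont2 Y1) by (apply cont2_plus; [apply qX1_c|apply qV1_c]).
  assert (Y2c : cont2 Y2) by (apply cont2_plus; [apply qX2_c|apply qV2_c]).
  assert (Ytc : cont2 Yt) by (apply cont2_plus; [apply qXt_c|apply qVt_c]).
  assert (Yttc : cont2 Ytt) by (apply cont2_plus; [apply qXtt_c|apply qVtt_c]).
  set (H := hB K c * hB K c).
  set (psi := fun s t => A * Rpower (X s t) al - Rpower (Y s t) al).
  assert (psic : cont2 psi).
  { apply cont2_minus; [apply cont2_mult; [apply cont2_const|]|]; apply cont2_pow; assumption. }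
  assert (M : forall s, s <= 0 -> RInt (psi s) (- PI) PI <= RInt (psi 0) (- PI) PI).
  { apply (subharmonic_mean psi
      (fun s t => A * dpow1 al (X s t) (qX1 K c s t) - dpow1 al (Y s t) (Y1 s t))
      (fun s t => A * dpow2 al (X s t) (qX1 K c s t) (qX2 K c s t) - dpow2 al (Y s t) (Y1 s t) (Y2 s t))
      (fun s t => A * dpow1 al (X s t) (qXt K c s t) - dpow1 al (Y s t) (Yt s t))
      (fun s t => A * dpow2 al (X s t) (qXt K c s t) (qXtt K c s t) - dpow2 al (Y s t) (Yt s t) (Ytt s t))
      (A * Rpower (H + eps) al + Rpower (H + H + eps) al)).
    - intros s t. apply der_minus; [apply der_scal|]; unfold dpow1;
        [apply (der_pow al (fun s => X s t))|apply (der_pow al (fun s => Y s t))]; auto.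
    - intros s t. apply der_minus; [apply der_scal|].
      + apply (der_dpow1 al (fun s => X s t) (fun s => qX1 K c s t)); auto. apply qX1_s.
      + apply (der_dpow1 al (fun s => Y s t) (fun s => Y1 s t)); auto.
    - intros s t. apply der_minus; [apply der_scal|]; unfold dpow1;
        [apply (der_pow al (fun t => X s t))|apply (der_pow al (fun t => Y s t))]; auto.
    - intros s t. apply der_minus; [apply der_scal|].
      + apply (der_dpow1 al (fun t => X s t) (fun t => qXt K c s t)); auto. apply qXt_t.
      + apply (der_dpow1 al (fun t => Y s t) (fun t => Yt s t)); auto.
    - exact psic.
    - apply cont2_minus; [apply cont2_mult; [apply cont2_const|]|]; apply cont2_dpow1; auto; apply qX1_c.
    - apply cont2_minus; [apply cont2_mult; [apply cont2_const|]|]; apply cont2_dpow2; auto;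
        [apply qX1_c|apply qX2_c].
    - apply cont2_minus; [apply cont2_mult; [apply cont2_const|]|]; apply cont2_dpow2; auto;
        [apply qXt_c|apply qXtt_c].
    - intros s. unfold X, Y, Yt, qX, qXt, qV, qVt. rewrite !hU_per, !hV_per. reflexivity.
    - intros s t. unfold dpow2. rewrite (Rpower_sub1 (X s t) (al - 1)), (Rpower_sub1 (Y s t) (al - 1)) by auto.
      (* Here [al <= 1] enters: the power [al - 1] is nonincreasing and [Y >= X]. *)
      assert (Hxy : Rpower (Y s t) (al - 1 - 1) * Y s t <= Rpower (X s t) (al - 1 - 1) * X s t).
      { rewrite <- !Rpower_sub1 by auto. replace (al - 1) with (- (1 - al)) by ring.
        apply Rpower_neg_anti; [|lra]. split; [auto|]. unfold X, Y, qV. nra. }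
      assert (Px : 0 < Rpower (X s t) (al - 1 - 1)) by apply exp_pos.
      assert (Py : 0 < Rpower (Y s t) (al - 1 - 1)) by apply exp_pos.
      set (x := Rpower (X s t) (al - 1 - 1)) in *. set (y := Rpower (Y s t) (al - 1 - 1)) in *.
      pose proof (HX s t) as PX. pose proof (HY s t) as PY.
      (* [G] is $|w'|^2$. By the Cauchy-Riemann equations all squared gradients and Laplacians
         involved are multiples of it, and subharmonicity becomes an inequality between
         coefficients. *)
      set (G := hU K c 1 s t * hU K c 1 s t + hV K c 1 s t * hV K c 1 s t).
      assert (HG : 0 <= G) by (unfold G; nra).
      set (u := qX K c s t). set (w := qX K c s t + qV K c s t).
      assert (E1 : qX1 K c s t * qX1 K c s t + qXt K c s t * qXt K c s t = 4 * u * G)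
        by (unfold u, qX1, qXt, qX, G; ring).
      assert (E2 : qX2 K c s t + qXtt K c s t = 2 * G) by (unfold qX2, qXtt, G; ring).
      assert (E3 : Y1 s t * Y1 s t + Yt s t * Yt s t = 4 * w * G)
        by (unfold w, Y1, Yt, qX1, qXt, qX, qV, qV1, qVt, G; ring).
      assert (E4 : Y2 s t + Ytt s t = 4 * G) by (unfold Y2, Ytt, qX2, qXtt, qV2, qVtt, G; ring).
      assert (Hu : 0 <= u <= X s t) by (unfold u, X, qX; split; [apply Rle_0_sqr|lra]).
      assert (Hw : 0 <= w <= Y s t) by (unfold w, Y, qX, qV; split; nra).
      match goal with |- 0 <= ?e => replace e with
        (al * (A * (x * ((al - 1) * (qX1 K c s t * qX1 K c s t + qXt K c s t * qXt K c s t) + X s t * (qX2 K c s t + qXtt K c s t)))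
          - y * ((al - 1) * (Y1 s t * Y1 s t + Yt s t * Yt s t) + Y s t * (Y2 s t + Ytt s t)))) by ring end.
      rewrite E1, E2, E3, E4.
      replace (A * (x * ((al - 1) * (4 * u * G) + X s t * (2 * G))) - y * ((al - 1) * (4 * w * G) + Y s t * (4 * G)))
        with (G * (A * (x * (4 * (al - 1) * u + 2 * X s t)) - y * (4 * (al - 1) * w + 4 * Y s t))) by ring.
      apply Rmult_le_pos; [lra|]. apply Rmult_le_pos; [exact HG|].
      assert (B1 : x * ((2 * al - 1) * (2 * X s t)) <= x * (4 * (al - 1) * u + 2 * X s t))
        by (apply Rmult_le_compat_l; nra).
      assert (B2 : y * (4 * (al - 1) * w + 4 * Y s t) <= y * (4 * Y s t))
        by (apply Rmult_le_compat_l; nra).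
      assert (B3 : A * (x * ((2 * al - 1) * (2 * X s t))) <= A * (x * (4 * (al - 1) * u + 2 * X s t)))
        by (apply Rmult_le_compat_l; lra).
      replace (A * (x * ((2 * al - 1) * (2 * X s t)))) with ((A * (2 * al - 1)) * (2 * (x * X s t))) in B3 by ring.
      rewrite HA in B3. lra.
    - intros s t Hs. pose proof (qX_bound K c s t Hs) as BX. pose proof (qV_bound K c s t H0 Hs) as BV.
      fold H in BX, BV. pose proof (HX s t) as PX. pose proof (HY s t) as PY.
      assert (T1 : Rpower (X s t) al <= Rpower (H + eps) al) by (apply Rle_Rpower_l; unfold X in *; lra).
      assert (T2 : Rpower (Y s t) al <= Rpower (H + H + eps) al) by (apply Rle_Rpower_l; unfold Y in *; lra).
      assert (0 < Rpower (X s t) al) by apply exp_pos. assert (0 < Rpower (Y s t) al) by apply exp_pos.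
      unfold psi. apply Rabs_le. split; nra. }
  (* Far to the left $v^2\le\varepsilon\le X$, so $Y^\alpha\le2X^\alpha\le AX^\alpha$: the mean of
     [psi] is nonnegative there and hence at [s = 0], which is the claim. *)
  destruct (hV_tiny K c eps H0 He) as [s [Hs Hv]].
  specialize (M s Hs). pose proof PI_RGT_0 as HPI.
  assert (P0 : 0 <= RInt (psi s) (- PI) PI).
  { apply RInt_nonneg; [lra|apply cont2_continuous_t, psic|]. intros t. unfold psi.
    assert (PX := HX s t). assert (PY := HY s t).
    assert (T : Rpower (Y s t) al <= Rpower (X s t) al + Rpower eps al).
    { rewrite <- !rpow_pos by assumption.
      assert (EY : Y s t = X s t + qV K c s t) by (unfold X, Y; ring). rewrite EY.
      assert (0 <= qV K c s t) by (unfold qV; apply Rle_0_sqr).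
      eapply Rle_trans; [apply rpow_subadd; [lra|lra|assumption]|].
      apply Rplus_le_compat_l. apply rpow_le; [lra|]. split; [assumption|apply Hv]. }
    assert (T2 : Rpower eps al <= Rpower (X s t) al).
    { apply Rle_Rpower_l; [lra|]. unfold X, qX. nra. }
    assert (0 < Rpower eps al) by apply exp_pos. nra. }
  assert (E : RInt (psi 0) (- PI) PI = A * RInt (fun t => Rpower (X 0 t) al) (- PI) PI -
    RInt (fun t => Rpower (Y 0 t) al) (- PI) PI).
  { unfold psi. rewrite <- RInt_scal_R.
    - apply (RInt_minus (V := R_CompleteNormedModule)); apply ex_RInt_cont; intros x.
      + apply cont_scal. apply (cont2_continuous_t (fun s t => Rpower (X s t) al)), cont2_pow; assumption.
      + apply (cont2_continuous_t (fun s t => Rpower (Y s t) al)), cont2_pow; assumption.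
    - intros x. apply (cont2_continuous_t (fun s t => Rpower (X s t) al)), cont2_pow; assumption. }
  unfold X, Y in E. lra.
Qed.

(* For exponents [2 (m+1) >= 2] the subharmonic function is [A u^2 (|w|^2+eps)^m - (|w|^2+eps)^(m+1)]. *)
Lemma riesz_eps_ge2 m K c eps : 0 <= m -> snd (c 0%nat) = 0 -> 0 < eps <= 1 ->
  RInt (fun t => Rpower (qX K c 0 t + qV K c 0 t + eps) (m + 1)) (- PI) PI <=
  2 * (m + 1) * (m + 1) * RInt (fun t => qX K c 0 t * Rpower (qX K c 0 t + qV K c 0 t + eps) m) (- PI) PI
  + 4 * PI * eps * Rpower (hB K c * hB K c + hB K c * hB K c + 1) m.
Proof.
  (* Up to a common positive factor, the term [2 * A * z^2] in the Laplacian of $Au^2Y^m$, with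
     [z = Y], has to absorb the bound [4 * (m+1)^2 * z^2] for that of $Y^{m+1}$. *)
  intros Hm H0 He. set (A := 2 * (m + 1) * (m + 1)).
  assert (HA1 : 2 <= A) by (unfold A; nra).
  set (X := fun s t => qX K c s t). set (Y := fun s t => qX K c s t + qV K c s t + eps).
  assert (HX : forall s t, 0 <= X s t) by (intros; unfold X, qX; nra).
  assert (HY : forall s t, 0 < Y s t) by (intros; unfold Y, qX, qV; nra).
  assert (HXc : cont2 X) by apply qX_c.
  assert (HYc : cont2 Y) by (apply cont2_plus; [apply cont2_plus; [apply qX_c|apply qV_c]|apply cont2_const]).
  set (Y1 := fun s t => qX1 K c s t + qV1 K c s t). set (Y2 := fun s t => qX2 K c s t + qV2 K c s t).
  set (Yt := fun s t => qXt K c s t + qVt K c s t). set (Ytt := fun s t => qXtt K c s t + qVtt K c s t).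
  assert (HY1 : forall s t, is_derive (fun s => Y s t) s (Y1 s t)).
  { intros. unfold Y. eapply is_derive_ext_val;
      [apply der_plus; [apply der_plus; [apply qX_s|apply qV_s]|apply is_derive_const]|].
    unfold zero; simpl; unfold Y1; ring. }
  assert (HYt : forall s t, is_derive (fun t => Y s t) t (Yt s t)).
  { intros. unfold Y. eapply is_derive_ext_val;
      [apply der_plus; [apply der_plus; [apply qX_t|apply qV_t]|apply is_derive_const]|].
    unfold zero; simpl; unfold Yt; ring. }
  assert (HY2 : forall s t, is_derive (fun s => Y1 s t) s (Y2 s t))
    by (intros; apply der_plus; [apply qX1_s|apply qV1_s]).
  assert (HYtt : forall s t, is_derive (fun t => Yt s t) t (Ytt s t))
    by (intros; apply der_plus; [apply qXt_t|apply qVt_t]).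
  assert (Y1c : cont2 Y1) by (apply cont2_plus; [apply qX1_c|apply qV1_c]).
  assert (Y2c : cont2 Y2) by (apply cont2_plus; [apply qX2_c|apply qV2_c]).
  assert (Ytc : cont2 Yt) by (apply cont2_plus; [apply qXt_c|apply qVt_c]).
  assert (Yttc : cont2 Ytt) by (apply cont2_plus; [apply qXtt_c|apply qVtt_c]).
  set (Q := fun s t => Rpower (Y s t) m).
  set (Q1 := fun s t => dpow1 m (Y s t) (Y1 s t)). set (Q2 := fun s t => dpow2 m (Y s t) (Y1 s t) (Y2 s t)).
  set (Qt := fun s t => dpow1 m (Y s t) (Yt s t)). set (Qtt := fun s t => dpow2 m (Y s t) (Yt s t) (Ytt s t)).
  assert (HQ1 : forall s t, is_derive (fun s => Q s t) s (Q1 s t))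
    by (intros; apply (der_pow m (fun s => Y s t)); auto).
  assert (HQt : forall s t, is_derive (fun t => Q s t) t (Qt s t))
    by (intros; apply (der_pow m (fun t => Y s t)); auto).
  assert (HQ2 : forall s t, is_derive (fun s => Q1 s t) s (Q2 s t))
    by (intros; apply (der_dpow1 m (fun s => Y s t) (fun s => Y1 s t)); auto).
  assert (HQtt : forall s t, is_derive (fun t => Qt s t) t (Qtt s t))
    by (intros; apply (der_dpow1 m (fun t => Y s t) (fun t => Yt s t)); auto).
  assert (Qc : cont2 Q) by (apply cont2_pow; assumption).
  assert (Q1c : cont2 Q1) by (apply cont2_dpow1; assumption).
  assert (Q2c : cont2 Q2) by (apply cont2_dpow2; assumption).
  assert (Qtc : cont2 Qt) by (apply cont2_dpow1; assumption).
  assert (Qttc : cont2 Qtt) by (apply cont2_dpow2; assumption).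
  set (H := hB K c * hB K c). assert (HH : 0 <= H) by (unfold H; nra).
  set (psi := fun s t => A * (X s t * Q s t) - Rpower (Y s t) (m + 1)).
  assert (psic : cont2 psi).
  { apply cont2_minus; [|apply cont2_pow; assumption].
    apply (cont2_mult (fun _ _ => A)); [apply cont2_const|apply cont2_mult; assumption]. }
  assert (M : forall s, s <= 0 -> RInt (psi s) (- PI) PI <= RInt (psi 0) (- PI) PI).
  { apply (subharmonic_mean psi
      (fun s t => A * (qX1 K c s t * Q s t + X s t * Q1 s t) - dpow1 (m + 1) (Y s t) (Y1 s t))
      (fun s t => A * ((qX2 K c s t * Q s t + qX1 K c s t * Q1 s t) + (qX1 K c s t * Q1 s t + X s t * Q2 s t))
         - dpow2 (m + 1) (Y s t) (Y1 s t) (Y2 s t))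
      (fun s t => A * (qXt K c s t * Q s t + X s t * Qt s t) - dpow1 (m + 1) (Y s t) (Yt s t))
      (fun s t => A * ((qXtt K c s t * Q s t + qXt K c s t * Qt s t) + (qXt K c s t * Qt s t + X s t * Qtt s t))
         - dpow2 (m + 1) (Y s t) (Yt s t) (Ytt s t))
      (A * (H * Rpower (H + H + eps) m) + Rpower (H + H + eps) (m + 1))).
    - intros s t. apply der_minus; [apply der_scal|].
      + apply (der_mult (fun s => X s t) (fun s => Q s t)); [apply qX_s|apply HQ1].
      + apply (der_pow (m + 1) (fun s => Y s t)); auto.
    - intros s t. apply der_minus; [apply der_scal, der_plus|].
      + apply (der_mult (fun s => qX1 K c s t) (fun s => Q s t)); [apply qX1_s|apply HQ1].
      + apply (der_mult (fun s => X s t) (fun s => Q1 s t)); [apply qX_s|apply HQ2].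
      + apply (der_dpow1 (m + 1) (fun s => Y s t) (fun s => Y1 s t)); auto.
    - intros s t. apply der_minus; [apply der_scal|].
      + apply (der_mult (fun t => X s t) (fun t => Q s t)); [apply qX_t|apply HQt].
      + apply (der_pow (m + 1) (fun t => Y s t)); auto.
    - intros s t. apply der_minus; [apply der_scal, der_plus|].
      + apply (der_mult (fun t => qXt K c s t) (fun t => Q s t)); [apply qXt_t|apply HQt].
      + apply (der_mult (fun t => X s t) (fun t => Qt s t)); [apply qX_t|apply HQtt].
      + apply (der_dpow1 (m + 1) (fun t => Y s t) (fun t => Yt s t)); auto.
    - exact psic.
    - apply cont2_minus; [|apply cont2_dpow1; assumption]. apply cont2_mult; [apply cont2_const|].
      apply cont2_plus; apply cont2_mult; try assumption. apply qX1_c.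
    - apply cont2_minus; [|apply cont2_dpow2; assumption]. apply cont2_mult; [apply cont2_const|].
      repeat apply cont2_plus; apply cont2_mult; try assumption; first [apply qX1_c|apply qX2_c].
    - apply cont2_minus; [|apply cont2_dpow2; assumption]. apply cont2_mult; [apply cont2_const|].
      repeat apply cont2_plus; apply cont2_mult; try assumption; first [apply qXt_c|apply qXtt_c].
    - intros s. unfold Q, Qt, X, Y, Yt, qX, qXt, qV, qVt. rewrite !hU_per, !hV_per. reflexivity.
    - intros s t. unfold Q, Q1, Q2, Qt, Qtt, dpow1, dpow2.
      replace (m + 1 - 1) with m by ring.
      rewrite (Rpower_sub1 (Y s t) m), (Rpower_sub1 (Y s t) (m - 1)) by auto.
      assert (Py : 0 < Rpower (Y s t) (m - 1 - 1)) by apply exp_pos.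
      set (y := Rpower (Y s t) (m - 1 - 1)) in *.
      pose proof (HX s t) as PX. pose proof (HY s t) as PY.
      set (G := hU K c 1 s t * hU K c 1 s t + hV K c 1 s t * hV K c 1 s t).
      assert (HG : 0 <= G) by (unfold G; nra).
      set (w := qX K c s t + qV K c s t).
      assert (E2 : qX2 K c s t + qXtt K c s t = 2 * G) by (unfold qX2, qXtt, G; ring).
      assert (E3 : Y1 s t * Y1 s t + Yt s t * Yt s t = 4 * w * G)
        by (unfold w, Y1, Yt, qX1, qXt, qX, qV, qV1, qVt, G; ring).
      assert (E4 : Y2 s t + Ytt s t = 4 * G) by (unfold Y2, Ytt, qX2, qXtt, qV2, qVtt, G; ring).
      assert (E5 : qX1 K c s t * Y1 s t + qXt K c s t * Yt s t = 4 * X s t * G)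
        by (unfold X, Y1, Yt, qX1, qXt, qX, qV, qV1, qVt, G; ring).
      assert (Hw : 0 <= w <= Y s t) by (unfold w, Y, qX, qV; split; nra).
      set (x := X s t) in *. set (z := Y s t) in *.
      match goal with |- 0 <= ?e => replace e with
        (y * (A * ((qX2 K c s t + qXtt K c s t) * (z * z)
            + 2 * m * z * (qX1 K c s t * Y1 s t + qXt K c s t * Yt s t)
            + x * (m * ((m - 1) * (Y1 s t * Y1 s t + Yt s t * Yt s t) + z * (Y2 s t + Ytt s t))))
          - (m + 1) * (m * z * (Y1 s t * Y1 s t + Yt s t * Yt s t) + z * z * (Y2 s t + Ytt s t)))) by ring end.
      rewrite E2, E3, E4, E5. apply Rmult_le_pos; [lra|].
      replace (A * (2 * G * (z * z) + 2 * m * z * (4 * x * G) + x * (m * ((m - 1) * (4 * w * G) + z * (4 * G))))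
        - (m + 1) * (m * z * (4 * w * G) + z * z * (4 * G))) with
        (G * (A * (2 * (z * z)) + A * (8 * (m * (x * z)) + 4 * (x * (m * ((m - 1) * w + z))))
          - 4 * (m + 1) * (z * (m * w + z)))) by ring.
      apply Rmult_le_pos; [exact HG|].
      assert (B1 : 0 <= m * (x * z)) by (apply Rmult_le_pos; [lra|apply Rmult_le_pos; lra]).
      (* Nonnegative also for [m < 1], since [w <= z]. *)
      assert (B2 : 0 <= x * (m * ((m - 1) * w + z))).
      { apply Rmult_le_pos; [exact PX|]. apply Rmult_le_pos; [exact Hm|]. nra. }
      assert (B3 : 0 <= A * (8 * (m * (x * z)) + 4 * (x * (m * ((m - 1) * w + z)))))
        by (apply Rmult_le_pos; lra).
      assert (B4 : z * (m * w + z) <= (m + 1) * (z * z)).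
      { assert (0 <= m * (z * (z - w))) by (apply Rmult_le_pos; [lra|apply Rmult_le_pos; lra]). lra. }
      assert (B5 : 4 * (m + 1) * (z * (m * w + z)) <= 4 * (m + 1) * ((m + 1) * (z * z)))
        by (apply Rmult_le_compat_l; lra).
      unfold A in *. lra.
    - intros s t Hs. pose proof (qX_bound K c s t Hs) as BX. pose proof (qV_bound K c s t H0 Hs) as BV.
      fold H in BX, BV. pose proof (HY s t) as PY. fold (X s t) in BX.
      assert (T1 : Q s t <= Rpower (H + H + eps) m) by (apply Rle_Rpower_l; unfold Y, X in *; lra).
      assert (T2 : Rpower (Y s t) (m + 1) <= Rpower (H + H + eps) (m + 1))
        by (apply Rle_Rpower_l; unfold Y, X in *; lra).
      assert (0 < Q s t) by apply exp_pos. assert (0 < Rpower (Y s t) (m + 1)) by apply exp_pos.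
      assert (T3 : 0 <= X s t * Q s t <= H * Rpower (H + H + eps) m)
        by (split; [apply Rmult_le_pos; lra|apply Rmult_le_compat; lra]).
      unfold psi. apply Rabs_le. split; nra. }
  destruct (hV_tiny K c eps H0 ltac:(lra)) as [s [Hs Hv]].
  specialize (M s Hs). pose proof PI_RGT_0 as HPI.
  (* Far to the left [psi] is bounded below only by [- D]: there
     $Y-u^2=v^2+\varepsilon\le2\varepsilon$, and $Y^m$ is bounded in terms of the coefficients. *)
  set (D := 2 * eps * Rpower (H + H + 1) m).
  assert (P0 : 2 * PI * - D <= RInt (psi s) (- PI) PI).
  { replace (2 * PI * - D) with ((PI - - PI) * - D) by ring. rewrite <- RInt_const_R.
    apply RInt_mono; [lra|intros; apply continuous_const|apply cont2_continuous_t, psic|].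
    intros t. unfold psi. rewrite (Rpower_sub1 (Y s t) (m + 1)) by auto.
    replace (m + 1 - 1) with m by ring. fold (Q s t).
    pose proof (qX_bound K c s t Hs) as BX. pose proof (qV_bound K c s t H0 Hs) as BV.
    specialize (Hv t). fold (qV K c s t) in Hv. fold H in BX, BV.
    assert (T1 : Q s t <= Rpower (H + H + 1) m).
    { pose proof (HY s t). apply Rle_Rpower_l; unfold Y in *; lra. }
    assert (0 < Q s t) by apply exp_pos.
    replace (A * (X s t * Q s t) - Q s t * Y s t) with
      (Q s t * ((A - 1) * X s t) - Q s t * (qV K c s t + eps)) by (unfold X, Y; ring).
    assert (0 <= Q s t * ((A - 1) * X s t))
      by (apply Rmult_le_pos; [lra|apply Rmult_le_pos; [lra|apply HX]]).
    assert (Q s t * (qV K c s t + eps) <= Rpower (H + H + 1) m * (2 * eps))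
      by (apply Rmult_le_compat; lra).
    unfold D. lra. }
  assert (E : RInt (psi 0) (- PI) PI = A * RInt (fun t => X 0 t * Q 0 t) (- PI) PI -
    RInt (fun t => Rpower (Y 0 t) (m + 1)) (- PI) PI).
  { unfold psi. rewrite <- RInt_scal_R.
    - apply (RInt_minus (V := R_CompleteNormedModule)); apply ex_RInt_cont; intros x.
      + apply cont_scal. apply (cont2_continuous_t (fun s t => X s t * Q s t)), cont2_mult; assumption.
      + apply (cont2_continuous_t (fun s t => Rpower (Y s t) (m + 1))), cont2_pow; assumption.
    - intros x. apply (cont2_continuous_t (fun s t => X s t * Q s t)), cont2_mult; assumption. }
  change (RInt (fun t => Rpower (Y 0 t) (m + 1)) (- PI) PI <=
    A * RInt (fun t => X 0 t * Q 0 t) (- PI) PI + 4 * PI * eps * Rpower (H + H + 1) m).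
  unfold D in P0. lra.
Qed.

(** * Removal of the regularisation, and the projections onto half-lines of frequencies *)

Lemma le_eps_mult a b k : 0 <= k -> (forall e, 0 < e <= 1 -> a <= b + k * e) -> a <= b.
Proof.
  intros Hk H. destruct (Rle_dec a b) as [Hle|Hgt]; [exact Hle|exfalso].
  set (e := Rmin 1 ((a - b) / (2 * (k + 1)))).
  assert (He : 0 < e <= 1 /\ e <= (a - b) / (2 * (k + 1))).
  { assert (0 < (a - b) / (2 * (k + 1))) by (apply Rdiv_lt_0_compat; lra).
    unfold e. destruct (Rmin_case_strong 1 ((a - b) / (2 * (k + 1))) (fun x => 0 < x <= 1 /\ x <= (a - b) / (2 * (k + 1)))); intros; lra. }
  specialize (H e (proj1 He)).
  assert (k * e <= (a - b) / 2).
  { apply Rle_trans with ((k + 1) * e); [nra|].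
    replace ((a - b) / 2) with ((k + 1) * ((a - b) / (2 * (k + 1)))) by (field; lra).
    apply Rmult_le_compat_l; lra. }
  lra.
Qed.

Lemma rpow_le_Rpower x eps al : 0 <= al -> 0 < eps -> 0 <= x -> rpow x al <= Rpower (x + eps) al.
Proof. intros Ha He Hx. rewrite <- rpow_pos by lra. apply rpow_le; lra. Qed.

Lemma qX_rpow_cont K c al : 0 < al -> forall t, continuous (fun t => rpow (qX K c 0 t) al) t.
Proof. intros Ha. apply rpow_cont; [exact Ha|]. apply (cont2_continuous_t (qX K c)), qX_c. Qed.

(** For [p <= 2] the regularisation is sent to 0 directly. For [p > 2] the mixed integral of
    $u^2Y^m$ is split by Young's inequality, and half of the left side is absorbed. *)
Lemma riesz_conjugate p : 1 < p -> exists C, 0 < C /\ forall K c, snd (c 0%nat) = 0 ->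
  RInt (fun t => rpow (qX K c 0 t + qV K c 0 t) (p / 2)) (- PI) PI <=
  C * RInt (fun t => rpow (qX K c 0 t) (p / 2)) (- PI) PI.
Proof.
  intros Hp. set (al := p / 2). assert (Hal : 1 / 2 < al) by (unfold al; lra).
  pose proof PI_RGT_0 as HPI.
  assert (Yc : forall K c e t, continuous (fun t => qX K c 0 t + qV K c 0 t + e) t).
  { intros. apply (cont2_continuous_t (fun s t => qX K c s t + qV K c s t + e)).
    apply cont2_plus; [apply cont2_plus; [apply qX_c|apply qV_c]|apply cont2_const]. }
  assert (Wc : forall K c t, continuous (fun t => rpow (qX K c 0 t + qV K c 0 t) al) t).
  { intros K c. apply rpow_cont; [lra|]. intros t.
    apply (cont2_continuous_t (fun s t => qX K c s t + qV K c s t)).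
    apply cont2_plus; [apply qX_c|apply qV_c]. }
  assert (YP : forall K c e b t, 0 < e -> continuous (fun t => Rpower (qX K c 0 t + qV K c 0 t + e) b) t).
  { intros K c e b t He. apply (cont2_continuous_t (fun s t => Rpower (qX K c s t + qV K c s t + e) b)).
    apply cont2_pow; [intros; unfold qX, qV; nra|].
    apply cont2_plus; [apply cont2_plus; [apply qX_c|apply qV_c]|apply cont2_const]. }
  assert (Nn : forall K c t, 0 <= qX K c 0 t /\ 0 <= qV K c 0 t)
    by (intros; split; [unfold qX|unfold qV]; apply Rle_0_sqr).
  assert (Low : forall K c e, 0 < e -> RInt (fun t => rpow (qX K c 0 t + qV K c 0 t) al) (- PI) PI <=
    RInt (fun t => Rpower (qX K c 0 t + qV K c 0 t + e) al) (- PI) PI).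
  { intros K c e He. apply RInt_mono; [lra|apply Wc|intros; apply YP, He|].
    intros t. destruct (Nn K c t). apply rpow_le_Rpower; lra. }
  destruct (Rle_dec al 1) as [H1|H1].
  - set (A := 2 / (2 * al - 1)). assert (HA : 0 < A) by (apply Rdiv_lt_0_compat; lra).
    exists (A * rpow 2 al). split; [apply Rmult_lt_0_compat; [lra|apply rpow_gt0; lra]|].
    intros K c H0.
    apply (le_eps_mult _ _ (A * rpow 2 al * (2 * PI))).
    { pose proof (rpow_ge0 2 al). apply Rmult_le_pos; [apply Rmult_le_pos; lra|lra]. }
    (* Regularising by [e0 ^ (1 / al)] makes the resulting error linear in [e0]. *)
    intros e0 He0. set (e := Rpower e0 (/ al)). assert (He : 0 < e) by apply exp_pos.
    assert (Ee : rpow e al = e0).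
    { rewrite rpow_pos by exact He. unfold e. rewrite Rpower_mult, Rinv_l, Rpower_1; lra. }
    eapply Rle_trans; [apply (Low K c e He)|].
    eapply Rle_trans; [apply riesz_eps_le2; [lra|exact H0|exact He]|]. fold A.
    rewrite !Rmult_assoc, <- Rmult_plus_distr_l. apply Rmult_le_compat_l; [lra|].
    apply Rle_trans with (RInt (fun t => rpow 2 al * (rpow (qX K c 0 t) al + e0)) (- PI) PI).
    + apply RInt_mono; [lra| | |].
      * intros t. apply (cont2_continuous_t (fun s t => Rpower (qX K c s t + e) al)), cont2_pow;
          [intros; unfold qX; nra|apply cont2_plus; [apply qX_c|apply cont2_const]].
      * intros t. apply cont_scal. apply (continuous_plus (fun t => rpow (qX K c 0 t) al));
          [apply qX_rpow_cont; lra|apply continuous_const].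
      * intros t. destruct (Nn K c t). rewrite <- rpow_pos by lra. rewrite <- Ee.
        apply rpow_plus_le; lra.
    + rewrite RInt_scal_R.
      * rewrite <- Rmult_plus_distr_l. apply Rmult_le_compat_l; [apply rpow_ge0|]. right.
        rewrite (RInt_plus (V := R_CompleteNormedModule) (fun t => rpow (qX K c 0 t) al) (fun _ => e0)).
        -- rewrite RInt_const_R. unfold plus; simpl. ring.
        -- apply ex_RInt_cont, qX_rpow_cont; lra.
        -- apply ex_RInt_cont; intros; apply continuous_const.
      * intros t. apply (continuous_plus (fun t => rpow (qX K c 0 t) al));
          [apply qX_rpow_cont; lra|apply continuous_const].
  - set (m := al - 1). assert (Hm : 0 < m) by (unfold m; lra).
    set (A := 2 * (m + 1) * (m + 1)). assert (HA : 2 <= A) by (unfold A; nra).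
    (* Young's inequality by cases: if [A * x <= y / 2] the half of [y^al] suffices; otherwise
       [y < 2 * A * x], so [y^m] is at most [(2 * A)^m * x^m]. *)
    set (k := A * Rpower (2 * A) m). assert (Hk : 0 < k) by (apply Rmult_lt_0_compat; [lra|apply exp_pos]).
    exists (2 * k). split; [lra|]. intros K c H0.
    set (D := Rpower (hB K c * hB K c + hB K c * hB K c + 1) m).
    assert (HD : 0 < D) by apply exp_pos.
    apply (le_eps_mult _ _ (8 * PI * D)); [nra|]. intros e He.
    pose proof (riesz_eps_ge2 m K c e ltac:(lra) H0 He) as R1. fold A D in R1.
    replace (m + 1) with al in R1 by (unfold m; ring).
    pose proof (Low K c e ltac:(lra)) as L.
    set (J := RInt (fun t => Rpower (qX K c 0 t + qV K c 0 t + e) al) (- PI) PI) in *.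
    assert (Yng : A * RInt (fun t => qX K c 0 t * Rpower (qX K c 0 t + qV K c 0 t + e) m) (- PI) PI <=
      / 2 * J + k * RInt (fun t => rpow (qX K c 0 t) al) (- PI) PI).
    { unfold J. rewrite <- !RInt_scal_R.
      2: apply qX_rpow_cont; lra. 2: intros; apply YP; lra.
      2: intros t; apply (continuous_mult (fun t => qX K c 0 t)); [apply (cont2_continuous_t (qX K c)), qX_c|apply YP; lra].
      assert (C1 : forall t, continuous (fun t => / 2 * Rpower (qX K c 0 t + qV K c 0 t + e) al) t)
        by (intros; apply cont_scal, YP; lra).
      assert (C2 : forall t, continuous (fun t => k * rpow (qX K c 0 t) al) t)
        by (intros; apply cont_scal, qX_rpow_cont; lra).
      rewrite <- (RInt_plus (V := R_CompleteNormedModule)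
        (fun t => / 2 * Rpower (qX K c 0 t + qV K c 0 t + e) al) (fun t => k * rpow (qX K c 0 t) al))
        by (apply ex_RInt_cont; assumption).
      apply RInt_mono; [lra| | |].
      - intros t. apply cont_scal, (continuous_mult (fun t => qX K c 0 t));
          [apply (cont2_continuous_t (qX K c)), qX_c|apply YP; lra].
      - intros t. apply (continuous_plus (fun t => / 2 * Rpower (qX K c 0 t + qV K c 0 t + e) al)); auto.
      - intros t. unfold plus; simpl. destruct (Nn K c t) as [N1 N2].
        set (x := qX K c 0 t) in *. set (y := x + qV K c 0 t + e). assert (Hy : 0 < y) by (unfold y; lra).
        assert (Q0 : 0 < Rpower y m) by apply exp_pos.
        assert (Ey : Rpower y al = Rpower y m * y).
        { rewrite (Rpower_sub1 y al Hy). reflexivity. }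
        pose proof (rpow_ge0 x al).
        destruct (Rle_dec (A * x) (y / 2)) as [Hle|Hgt].
        + rewrite Ey. apply Rle_trans with (Rpower y m * (y / 2)); [|nra].
          replace (A * (x * Rpower y m)) with (Rpower y m * (A * x)) by ring.
          apply Rmult_le_compat_l; lra.
        + assert (Hx : 0 < x) by nra.
          assert (P : Rpower y m <= Rpower (2 * A * x) m) by (apply Rle_Rpower_l; lra).
          rewrite <- Rpower_mult_distr in P by lra.
          rewrite (rpow_pos x al Hx). rewrite (Rpower_sub1 x al Hx). fold m.
          assert (0 < Rpower y al) by apply exp_pos.
          assert (A * x * Rpower y m <= A * x * (Rpower (2 * A) m * Rpower x m))
            by (apply Rmult_le_compat_l; nra).
          unfold k. lra. }
    lra.
Qed.

Lemma Csum_extend K K' (F : nat -> C) : (K <= K')%nat -> (forall j, (K <= j)%nat -> F j = RtoC 0) ->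
  Csum K' F = Csum K F.
Proof.
  intros HK HF. replace K' with (K + (K' - K))%nat by lia. rewrite Csum_split.
  rewrite (Csum_zero (K' - K)) by (intros; apply HF; lia). cring.
Qed.

Lemma Csum_single K k (F : nat -> C) : (k < K)%nat -> (forall j, j <> k -> F j = RtoC 0) ->
  Csum K F = F k.
Proof.
  intros Hk HF. rewrite (Csum_extend (S k) K) by (try lia; intros; apply HF; lia).
  rewrite Csum_S, Csum_zero by (intros; apply HF; lia). cring.
Qed.

(** Collects the coefficients, so that a polynomial with positive spectrum becomes the boundary
    value of a power series without constant term. *)
Lemma TS_pos_repr S h : (forall k, S k -> (0 < k)%Z) -> TS S h ->
  exists K (c : nat -> C), c O = RtoC 0 /\ (forall j, (K <= j)%nat -> c j = RtoC 0) /\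
    forall t, h t = Csum K (fun k => (c k * ek (Z.of_nat k) t)%C).
Proof.
  intros HS Hh. induction Hh as [|k a h Hk Hh [K [c [H0 [Hz E]]]]].
  - exists O, (fun _ => RtoC 0). repeat split; reflexivity.
  - specialize (HS k Hk). set (n := Z.to_nat k).
    exists (Nat.max K (Datatypes.S n)), (fun j => (c j + if Nat.eq_dec j n then a else RtoC 0)%C).
    split; [|split].
    + rewrite H0. destruct (Nat.eq_dec 0 n) as [E0|_]; [unfold n in E0; lia|cring].
    + intros j Hj. rewrite Hz by lia. destruct (Nat.eq_dec j n); [lia|cring].
    + intros t. rewrite (Csum_ext _ _ (fun j => (c j * ek (Z.of_nat j) t +
        (if Nat.eq_dec j n then a else RtoC 0) * ek (Z.of_nat j) t)%C)) by (intros; cring).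
      rewrite Csum_plus, (Csum_extend K) by (try lia; intros; rewrite Hz by assumption; cring).
      rewrite <- E, (Csum_single _ n).
      * destruct (Nat.eq_dec n n); [|contradiction]. unfold n. rewrite Z2Nat.id by lia. cring.
      * lia.
      * intros j Hj. destruct (Nat.eq_dec j n); [contradiction|cring].
Qed.

Lemma hU_hV_Csum K (c : nat -> C) t :
  Csum K (fun k => (c k * ek (Z.of_nat k) t)%C) = (hU K c 0 0 t, hV K c 0 0 t).
Proof.
  unfold hU, hV. induction K; simpl; [reflexivity|]. rewrite IHK.
  unfold Cadd, Cmult, ek, Cei; simpl. rewrite Rmult_0_r, exp_0, <- INR_IZR_INZ. f_equal; ring.
Qed.

Lemma rpow_Cmod z p : 0 < p -> rpow (Cmod z) p = rpow (fst z * fst z + snd z * snd z) (p / 2).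
Proof.
  intros Hp. assert (E : fst z * fst z + snd z * snd z = Cmod z * Cmod z).
  { unfold Cmod. rewrite sqrt_sqrt; [simpl; ring|].
    apply Rplus_le_le_0_compat; apply pow2_ge_0. }
  rewrite E. pose proof (Cmod_ge_0 z) as [H|H].
  - rewrite rpow_mult by apply Cmod_ge_0. rewrite !rpow_pos by exact H.
    rewrite <- Rpower_plus. f_equal; field.
  - rewrite <- H, Rmult_0_l, !rpow_0. reflexivity.
Qed.

(** A real constant is allowed because the bound on the conjugate function asks only that the
    imaginary part vanish at the centre of the disc. Without it the zero frequency could not be
    carried along. *)
Lemma riesz_re p : 1 < p -> exists C, 0 < C /\ forall S h a,
  (forall k, S k -> (0 < k)%Z) -> TS S h ->
  I1 p (fun t => (h t + RtoC a)%C) <= C * I1 p (fun t => RtoC (fst (h t) + a)).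
Proof.
  intros Hp. destruct (riesz_conjugate p Hp) as [C [HC H]]. exists C. split; [exact HC|].
  intros S h a HS Hh. destruct (TS_pos_repr S h HS Hh) as [K [c [H0 [Hz E]]]].
  set (c' := fun j => (c j + if Nat.eq_dec j 0 then RtoC a else RtoC 0)%C).
  assert (E' : forall t, (h t + RtoC a)%C = (hU (K + 1) c' 0 0 t, hV (K + 1) c' 0 0 t)).
  { intros t. rewrite <- hU_hV_Csum. unfold c'.
    rewrite (Csum_ext _ _ (fun j => (c j * ek (Z.of_nat j) t +
      (if Nat.eq_dec j 0 then RtoC a else RtoC 0) * ek (Z.of_nat j) t)%C)) by (intros; cring).
    rewrite Csum_plus, (Csum_extend K) by (try lia; intros; rewrite Hz by assumption; cring).
    rewrite <- E, (Csum_single _ 0%nat).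
    - destruct (Nat.eq_dec 0 0); [|contradiction]. simpl. rewrite ek_0. cring.
    - lia.
    - intros j Hj. destruct (Nat.eq_dec j 0); [contradiction|cring]. }
  assert (Hc0 : snd (c' O) = 0).
  { unfold c'. rewrite H0. simpl. ring. }
  specialize (H (K + 1)%nat c' Hc0). unfold I1.
  rewrite (RInt_ext _ (fun t => rpow (qX (K + 1) c' 0 t + qV (K + 1) c' 0 t) (p / 2))).
  - rewrite (RInt_ext (fun t => rpow (Cmod (RtoC (fst (h t) + a))) p)
      (fun t => rpow (qX (K + 1) c' 0 t) (p / 2))); [exact H|].
    intros t _. rewrite rpow_Cmod by lra. simpl. f_equal.
    replace (fst (h t) + a) with (fst (h t + RtoC a)%C) by reflexivity. rewrite E'. unfold qX. simpl. ring.
  - intros t _. rewrite E', rpow_Cmod by lra. reflexivity.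
Qed.

(** Sorts the summands of a representation, so uniqueness of Fourier coefficients is not
    involved. *)
Lemma TS_split S h b : TS S h -> exists F G, TS (fun k => S k /\ (b < k)%Z) F /\
  TS (fun k => S k /\ (k <= b)%Z) G /\ forall t, h t = (F t + G t)%C.
Proof.
  induction 1 as [|k a h Hk Hh [F [G [HF [HG E]]]]].
  - exists (fun _ => RtoC 0), (fun _ => RtoC 0). repeat split; [constructor|constructor|intros; cring].
  - destruct (Z_lt_le_dec b k) as [Hb|Hb].
    + exists (fun t => (a * ek k t + F t)%C), G. repeat split; [constructor; auto|exact HG|].
      intros t. rewrite E. cring.
    + exists F, (fun t => (a * ek k t + G t)%C). repeat split; [exact HF|constructor; auto|].
      intros t. rewrite E. cring.
Qed.

Lemma TS_nonpos_conj S h : (forall k, S k -> (k <= 0)%Z) -> TS S h ->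
  exists c F, TS (fun k => (0 < k)%Z) F /\ forall t, h t = (c + Cconj (F t))%C.
Proof.
  intros HS. induction 1 as [|k a h Hk Hh [c [F [HF E]]]].
  - exists (RtoC 0), (fun _ => RtoC 0). split; [constructor|]. intros; unfold Cconj, RtoC, Cplus; simpl.
    f_equal; ring.
  - specialize (HS k Hk). destruct (Z.eq_dec k 0) as [->|Hne].
    + exists (a + c)%C, F. split; [exact HF|]. intros t. rewrite E, ek_0. cring.
    + exists c, (fun t => (Cconj a * ek (- k) t + F t)%C). split; [constructor; [lia|exact HF]|].
      intros t. rewrite E, Cplus_conj, Cmult_conj, Cconj_conj, ek_conj.
      replace (- - k)%Z with k by lia. cring.
Qed.

Lemma I1_plus q h g : 0 < q -> cont_norm h -> cont_norm g -> cont_norm (fun t => (h t + g t)%C) ->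
  I1 q (fun t => (h t + g t)%C) <= rpow 2 q * (I1 q h + I1 q g).
Proof.
  intros Hq Hh Hg Hs. pose proof PI_RGT_0. unfold I1.
  pose proof (rpow_cont q _ Hq Hh) as C1. pose proof (rpow_cont q _ Hq Hg) as C2.
  assert (C3 : forall t, continuous (fun t => rpow (Cmod (h t)) q + rpow (Cmod (g t)) q) t)
    by (intros t; apply (continuous_plus (fun t => rpow (Cmod (h t)) q)); [apply C1|apply C2]).
  assert (E : RInt (fun t => rpow (Cmod (h t)) q) (- PI) PI + RInt (fun t => rpow (Cmod (g t)) q) (- PI) PI
    = RInt (fun t => rpow (Cmod (h t)) q + rpow (Cmod (g t)) q) (- PI) PI).
  { symmetry. apply (RInt_plus (V := R_CompleteNormedModule)); apply ex_RInt_cont; assumption. }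
  rewrite E, <- RInt_scal_R by exact C3.
  apply RInt_mono; [lra|apply rpow_cont; assumption|intros; apply cont_scal, C3|].
  intros t. eapply Rle_trans; [|apply rpow_plus_le; [exact Hq|apply Cmod_ge_0|apply Cmod_ge_0]].
  apply rpow_le; [lra|]. split; [apply Cmod_ge_0|apply Cmod_triangle].
Qed.

Lemma I1_ext q h g : (forall t, Cmod (h t) = Cmod (g t)) -> I1 q h = I1 q g.
Proof. intros H. apply RInt_ext. intros t _. rewrite H. reflexivity. Qed.

Lemma TS_all S h : TS S h -> TS (fun _ => True) h.
Proof. apply TS_mono; auto. Qed.

Lemma cont_norm_re h a : TS (fun _ => True) h -> cont_norm (fun t => RtoC (fst (h t) + a)).
Proof.
  intros Hh. destruct (TS_lip _ h Hh) as [K [_ HK]]. intros x. apply (continuous_lip _ K).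
  intros y z. rewrite !Cmod_R. eapply Rle_trans; [apply Rabs_triang_inv2|].
  replace (fst (h y) + a - (fst (h z) + a)) with (Re (h y - h z)%C) by (unfold Re; simpl; ring).
  eapply Rle_trans; [apply re_le_Cmod|apply HK].
Qed.

(* With [h = F + c + conj F2], real and imaginary parts of [h] control [F + F2] and [F - F2],
   hence [2F + c]; applying this twice isolates [F]. *)
Lemma riesz_double p : 1 < p -> exists C, 0 < C /\ forall F F2 c h,
  TS (fun k => (0 < k)%Z) F -> TS (fun k => (0 < k)%Z) F2 ->
  (forall t, h t = (F t + c + Cconj (F2 t))%C) -> TS (fun _ => True) h ->
  I1 p (fun t => (RtoC 2 * F t + c)%C) <= C * I1 p h.
Proof.
  intros Hp. destruct (riesz_re p Hp) as [C [HC H]].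
  exists (rpow 2 p * (C + C)). split; [apply Rmult_lt_0_compat; [apply rpow_gt0|]; lra|].
  intros F F2 c h HF HF2 E Hh.
  set (G1 := fun t => (F t + F2 t + RtoC (fst c))%C).
  (* The factor [Ci] turns the imaginary part of [h] into the real part that [riesz_re] can use;
     [- snd c] is the real part of [Ci * c]. *)
  set (G2 := fun t => (Ci * (F t + (- (1)) * F2 t) + RtoC (- snd c))%C).
  assert (HFF : TS (fun k => (0 < k)%Z) (fun t => (F t + F2 t)%C)) by (apply TS_plus; assumption).
  assert (HFG : TS (fun k => (0 < k)%Z) (fun t => (Ci * (F t + (- (1)) * F2 t))%C))
    by (apply TS_scal, TS_plus; [assumption|apply TS_scal; assumption]).
  assert (B1 : I1 p G1 <= C * I1 p h).
  { eapply Rle_trans; [apply (H _ _ (fst c) ltac:(intros ? K; exact K) HFF)|].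
    apply Rmult_le_compat_l; [lra|]. apply I1_mono; [lra|apply cont_norm_re, (TS_all _ _ HFF)|eapply TS_cont, Hh|].
    intros t. rewrite Cmod_R. replace (fst (F t + F2 t)%C + fst c) with (Re (h t)); [apply re_le_Cmod|].
    rewrite E. unfold Re; simpl. ring. }
  assert (B2 : I1 p G2 <= C * I1 p h).
  { eapply Rle_trans; [apply (H _ _ (- snd c) ltac:(intros ? K; exact K) HFG)|].
    apply Rmult_le_compat_l; [lra|]. apply I1_mono; [lra|apply cont_norm_re, (TS_all _ _ HFG)|eapply TS_cont, Hh|].
    intros t. rewrite Cmod_R.
    replace (fst (Ci * (F t + (- (1)) * F2 t))%C + - snd c) with (Re (Ci * h t)%C).
    - eapply Rle_trans; [apply re_le_Cmod|]. rewrite Cmod_mult, Cmod_Ci. lra.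
    - rewrite E. unfold Re, Ci, Cmult, Cplus, Complex.Copp, Cconj; simpl. ring. }
  assert (TG1 : TS (fun _ => True) G1).
  { apply (TS_plus _ (fun t => (F t + F2 t)%C)); [apply (TS_all _ _ HFF)|].
    eapply TS_eq; [apply (TS_scal _ (RtoC (fst c)) (ek 0)), TS_ek; exact I|]. intros; simpl. rewrite ek_0. cring. }
  assert (TG2 : TS (fun _ => True) G2).
  { apply (TS_plus _ (fun t => (Ci * (F t + (- (1)) * F2 t))%C)); [apply (TS_all _ _ HFG)|].
    eapply TS_eq; [apply (TS_scal _ (RtoC (- snd c)) (ek 0)), TS_ek; exact I|]. intros; simpl. rewrite ek_0. cring. }
  assert (EG : forall t, (RtoC 2 * F t + c)%C = (G1 t + (- Ci) * G2 t)%C).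
  { intros t. unfold G1, G2, Cmult, Cplus, Complex.Copp, RtoC, Ci. destruct c as [c1 c2].
    destruct (F t) as [f1 f2], (F2 t) as [g1 g2]. simpl. f_equal; ring. }
  assert (TG2' : TS (fun _ => True) (fun t => (- Ci * G2 t)%C)) by (apply TS_scal, TG2).
  rewrite (I1_ext p _ (fun t => (G1 t + (- Ci) * G2 t)%C)) by (intros; rewrite EG; reflexivity).
  eapply Rle_trans; [apply I1_plus; [lra|eapply TS_cont, TG1|eapply TS_cont, TG2'|]|].
  - eapply TS_cont. apply (TS_plus _ G1); [exact TG1|exact TG2'].
  - rewrite (I1_ext p (fun t => (- Ci * G2 t)%C) G2)
      by (intros; rewrite Cmod_mult, Cmod_opp, Cmod_Ci; ring).
    rewrite Rmult_assoc. apply Rmult_le_compat_l; [apply rpow_ge0|]. lra.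
Qed.

(** Multiplication by a character moves the cut from [b] to 0 and leaves all moduli unchanged, so
    the constant does not depend on [b]. *)
Lemma riesz_split p : 1 < p -> exists C, 0 < C /\ forall S h b, TS S h -> exists F G,
  TS (fun k => S k /\ (b < k)%Z) F /\ TS (fun k => S k /\ (k <= b)%Z) G /\
  (forall t, h t = (F t + G t)%C) /\ I1 p F <= C * I1 p h /\ I1 p G <= C * I1 p h.
Proof.
  intros Hp. destruct (riesz_double p Hp) as [C [HC H]].
  set (C1 := rpow 2 p * (C * C + C)).
  assert (H2 : 0 < rpow 2 p) by (apply rpow_gt0; lra).
  assert (HC1 : 0 < C1) by (unfold C1; nra).
  exists (rpow 2 p * (1 + C1) + C1). split; [nra|].
  intros S h b Hh. destruct (TS_split S h b Hh) as [F [G [HF [HG E]]]].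
  set (sh := fun (u : R -> Complex.C) t => (u t * ek (- b) t)%C).
  assert (Hsh : forall (S1 S2 : Z -> Prop) u, (forall k, S1 k -> S2 (k - b)%Z) -> TS S1 u -> TS S2 (sh u)).
  { intros S1 S2 u HS Hu. apply (TS_mul S1 (fun k => k = (- b)%Z) S2 u (ek (- b))).
    - intros k l Hk ->. replace (k + - b)%Z with (k - b)%Z by lia. apply HS, Hk.
    - exact Hu.
    - apply TS_ek. reflexivity. }
  assert (HI : forall u, I1 p (sh u) = I1 p u)
    by (intros; apply I1_ext; intros; unfold sh; rewrite Cmod_mult, Cmod_ek; ring).
  assert (PF : TS (fun k => (0 < k)%Z) (sh F)) by (eapply Hsh; [|exact HF]; cbv beta; intros; lia).
  assert (PG : TS (fun k => (k <= 0)%Z) (sh G)) by (eapply Hsh; [|exact HG]; cbv beta; intros; lia).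
  assert (Ph : TS (fun _ => True) (sh h)) by (eapply Hsh; [|exact Hh]; cbv beta; auto).
  destruct (TS_nonpos_conj _ (sh G) ltac:(intros ? K; exact K) PG) as [c [F2 [HF2 EG]]].
  assert (B1 : I1 p (fun t => (RtoC 2 * sh F t + c)%C) <= C * I1 p h).
  { rewrite <- (HI h). apply (H (sh F) F2 c); try assumption.
    intros t. rewrite <- Cplus_assoc, <- EG. unfold sh. rewrite E. cring. }
  assert (T2F : TS (fun k => (0 < k)%Z) (fun t => (RtoC 2 * sh F t)%C)) by (apply TS_scal, PF).
  assert (Tc : TS (fun _ => True) (fun _ => c)).
  { eapply TS_eq; [apply (TS_scal _ c (ek 0)), TS_ek; exact I|]. intros; simpl. rewrite ek_0. cring. }
  assert (T2Fc : TS (fun _ => True) (fun t => (RtoC 2 * sh F t + c)%C))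
    by (apply (TS_plus _ _ _ (TS_all _ _ T2F) Tc)).
  (* The same bound applied to [2 F + c] controls [4 F + c], where [F] is the shifted upper part;
     subtraction leaves [2 F], free of the unknown constant. *)
  assert (B2 : I1 p (fun t => (RtoC 2 * (RtoC 2 * sh F t) + c)%C) <= C * I1 p (fun t => (RtoC 2 * sh F t + c)%C)).
  { apply (H (fun t => (RtoC 2 * sh F t)%C) (fun _ => RtoC 0) c); try assumption; [constructor|].
    intros t. replace (Cconj (RtoC 0)) with (RtoC 0) by (unfold Cconj, RtoC; simpl; f_equal; ring). cring. }
  assert (T4Fc : TS (fun _ => True) (fun t => (RtoC 2 * (RtoC 2 * sh F t) + c)%C))
    by (apply (TS_plus _ _ _ (TS_all _ _ (TS_scal _ (RtoC 2) _ T2F)) Tc)).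
  assert (TM : TS (fun _ => True) (fun t => ((- (1)) * (RtoC 2 * sh F t + c))%C)) by (apply TS_scal, T2Fc).
  assert (B3 : I1 p (fun t => (RtoC 2 * sh F t)%C) <= C1 * I1 p h).
  { rewrite (I1_ext p _ (fun t => (RtoC 2 * (RtoC 2 * sh F t) + c + (- (1)) * (RtoC 2 * sh F t + c))%C))
      by (intros; f_equal; cring).
    eapply Rle_trans; [apply (I1_plus p (fun t => (RtoC 2 * (RtoC 2 * sh F t) + c)%C));
      [lra|eapply TS_cont, T4Fc|eapply TS_cont, TM|]|].
    - eapply TS_cont. apply (TS_plus _ _ _ T4Fc TM).
    - rewrite (I1_ext p (fun t => ((- (1)) * (RtoC 2 * sh F t + c))%C) (fun t => (RtoC 2 * sh F t + c)%C))
        by (intros; rewrite Cmod_mult, Cmod_opp, Cmod_1; ring).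
      unfold C1. rewrite Rmult_assoc. apply Rmult_le_compat_l; [lra|]. nra. }
  assert (B4 : I1 p F <= C1 * I1 p h).
  { eapply Rle_trans; [|exact B3]. rewrite <- (HI F). apply I1_mono; [lra|eapply TS_cont, PF|eapply TS_cont, T2F|].
    intros t. rewrite Cmod_mult, Cmod_R, Rabs_pos_eq by lra. pose proof (Cmod_ge_0 (sh F t)). lra. }
  assert (Nh : 0 <= I1 p h) by (apply I1_nonneg; [lra|eapply TS_cont, Hh]).
  assert (Nh2 : 0 <= rpow 2 p * (1 + C1) * I1 p h) by (apply Rmult_le_pos; [nra|exact Nh]).
  assert (Nh3 : 0 <= C1 * I1 p h) by (apply Rmult_le_pos; lra).
  exists F, G. split; [exact HF|]. split; [exact HG|]. split; [exact E|]. split; [lra|].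
  assert (TmF : TS (fun _ => True) (fun t => ((- (1)) * F t)%C)) by (apply TS_scal, (TS_all _ _ HF)).
  rewrite (I1_ext p G (fun t => (h t + (- (1)) * F t)%C)) by (intros; rewrite E; f_equal; cring).
  eapply Rle_trans; [apply I1_plus; [lra|eapply TS_cont, Hh|eapply TS_cont, TmF|]|].
  - eapply TS_cont. apply (TS_plus _ _ _ (TS_all _ _ Hh) TmF).
  - rewrite (I1_ext p (fun t => ((- (1)) * F t)%C) F) by (intros; rewrite Cmod_mult, Cmod_opp, Cmod_1; ring).
    apply Rle_trans with (rpow 2 p * (I1 p h + C1 * I1 p h)); [apply Rmult_le_compat_l; lra|]. lra.
Qed.

(** * Boundedness of the interpolation operators *)

Lemma Iop_ext L m h g x :
  (forall u, (u < 2 ^ m)%nat -> h (gpt (2 ^ m) (gs m) u) = g (gpt (2 ^ m) (gs m) u)) ->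
  Iop L m h x = Iop L m g x.
Proof. intros H. apply Csum_ext. intros u Hu. rewrite H by exact Hu. reflexivity. Qed.

Lemma Iop_plus L m h g x : Iop L m (fun t => (h t + g t)%C) x = (Iop L m h x + Iop L m g x)%C.
Proof. unfold Iop. rewrite <- Csum_plus. apply Csum_ext; intros; cring. Qed.

(** The whole block of $2^{m+1}$ frequencies, with its asymmetric end, is reproduced, which is more
    than [Iop_rep] gives; aliased pieces may land anywhere in it. *)
Lemma Iop1_rep m h x :
  TS (fun k => (- Z.of_nat (2 ^ m) <= k < Z.of_nat (2 ^ m))%Z) h -> Iop 1 (S m) h x = h x.
Proof.
  intros Hh. rewrite <- (dkg_interp (2 ^ S m) (- Z.of_nat (2 ^ m)) (2 ^ S m) h (gs (S m)) x).
  - unfold Iop. apply Csum_ext. intros u _. rewrite Kper_1_S. unfold dk, dkg. do 2 f_equal.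
    apply Csum_ext. intros; f_equal; lia.
  - pose proof (pow2_nat_pos (S m)). lia.
  - revert Hh. apply TS_mono. intros k Hk. simpl (2 ^ S m)%nat. lia.
Qed.

Lemma ek_node m s u : (1 <= m)%nat -> ek (s * Z.of_nat (2 ^ m)) (gpt (2 ^ m) (gs m) u) = RtoC 1.
Proof.
  intros Hm. destruct m as [|m]; [lia|]. unfold gs, gpt, ek.
  rewrite mult_IZR, IZR_pow2_nat, INR_pow2.
  replace (IZR s * 2 ^ S m * (- PI + 2 * PI * INR u / 2 ^ S m)) with
    (2 * PI * IZR (s * (Z.of_nat u - Z.of_nat (2 ^ m)))); [apply Cei_2PI|].
  rewrite mult_IZR, minus_IZR, IZR_pow2_nat, <- INR_IZR_INZ. simpl. field.
  pose proof (pow2_gt0 m); lra.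
Qed.

(* For [L = 1] interpolate first with [K^2]; the Dirichlet interpolant is its aliased image. *)
Lemma iop_bound q L : 0 < q -> (1 <= L)%nat -> / q < INR L -> exists C, 0 < C /\ forall m h,
  I1 q (Iop L m h) <= C / 2 ^ m * Rsum (2 ^ m) (fun u => rpow (Cmod (h (gpt (2 ^ m) (gs m) u))) q).
Proof.
  intros Hq HL HqL. destruct (Nat.eq_dec L 1) as [->|HL2].
  2:{ destruct (recon q L Hq ltac:(lia) HqL) as [C [HC H]]. exists C. split; [exact HC|].
      intros m h. apply H. }
  simpl (INR 1) in HqL.
  assert (Hq1 : 1 < q).
  { apply (Rmult_lt_compat_r q) in HqL; [|exact Hq]. rewrite Rinv_l in HqL; lra. }
  destruct (recon q 2 Hq ltac:(lia) ltac:(simpl; lra)) as [C [HC HR]].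
  destruct (riesz_split q Hq1) as [Cr [HCr HS]].
  assert (H2q : 0 < rpow 2 q) by (apply rpow_gt0; lra). pose proof PI_RGT_0 as HPI.
  set (Q := rpow 2 q * (Cr + rpow 2 q * (Cr * Cr + Cr * Cr)) * C).
  assert (HQ : 0 < Q).
  { unfold Q. assert (0 < Cr * Cr) by nra. apply Rmult_lt_0_compat; [|exact HC].
    apply Rmult_lt_0_compat; [exact H2q|]. nra. }
  exists (Q + 2 * PI). split; [lra|].
  intros m h. set (S0 := Rsum (2 ^ m) _).
  assert (HS0 : 0 <= S0) by (apply Rsum_nonneg; intros; apply rpow_ge0).
  pose proof (pow2_gt0 m) as Hm.
  assert (HS0m : 0 <= S0 / 2 ^ m) by (apply Rmult_le_pos; [exact HS0|apply Rlt_le, Rinv_0_lt_compat, Hm]).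
  replace ((Q + 2 * PI) / 2 ^ m * S0) with ((Q + 2 * PI) * (S0 / 2 ^ m)) by (field; lra).
  destruct m as [|m].
  - unfold S0 in *. simpl (2 ^ 0)%nat in *. simpl Rsum in *. simpl (2 ^ 0) in *.
    rewrite (I1_ext q _ (fun _ => h (gpt 1 (gs 0) 0))).
    + unfold I1. rewrite RInt_const_R. pose proof (rpow_ge0 (Cmod (h (gpt 1 (gs 0) 0))) q) as Hr.
      set (r := rpow (Cmod (h (gpt 1 (gs 0) 0))) q) in *. assert (0 <= Q * r) by (apply Rmult_le_pos; lra).
      change (gpt 1 0 0) with (gpt 1 (gs 0) 0). fold r. replace ((Q + 2 * PI) * ((0 + r) / 1)) with (Q * r + 2 * PI * r) by field. lra.
    + intros t. unfold Iop. change (2 ^ 0)%nat with 1%nat. rewrite Csum_S, Kper_1_0.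
      simpl (Csum 0 _). f_equal. cring.
  (* [W] has the same samples as [h], satisfies the norm bound through the decaying kernel $K^2$,
     and its frequencies are at most 3/4 of $2^{m+1}$. *)
  - set (W := Iop 2 (S m) h).
    assert (TW : TP (2 ^ S m * (1 - / 2 ^ 2)) W) by (apply Iop_TP; lia).
    assert (BW : I1 q W <= C * (S0 / 2 ^ S m)).
    { eapply Rle_trans; [apply (HR (S m) (fun u => h (gpt (2 ^ S m) (gs (S m)) u)) (gs (S m)))|].
      right. unfold S0. field. lra. }
    assert (EW : forall x, Iop 1 (S m) h x = Iop 1 (S m) W x).
    { intros x. apply Iop_ext. intros u Hu. symmetry. apply Iop_interp; [lia|exact Hu]. }
    set (P := Z.of_nat (2 ^ m)). pose proof (pow2_nat_pos m) as HP.
    assert (HPS : (Z.of_nat (2 ^ S m) = 2 * P)%Z) by (unfold P; simpl (2 ^ S m)%nat; lia).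
    assert (HkW : forall k, Rabs (IZR k) <= 2 ^ S m * (1 - / 2 ^ 2) -> (2 * Z.abs k < 4 * P)%Z).
    { intros k Hk. apply lt_IZR. rewrite !mult_IZR, abs_IZR. unfold P. rewrite IZR_pow2_nat.
      simpl in Hk. pose proof (pow2_gt0 m). lra. }
    (* With [P = 2^m] the frequencies of [W] reach at most [3 P / 2]. Those from [P] on are shifted
       by [- 2 P] and those below [- P] by [2 P]; this changes no sample and brings them into the
       reproduced block. *)
    destruct (HS _ W (P - 1)%Z TW) as [F [G [HF [HG [E [BF BG]]]]]].
    destruct (HS _ G (- P - 1)%Z HG) as [Mi [Lo [HMi [HLo [E2 [BMi BLo]]]]]].
    set (F' := fun t => (F t * ek (-1 * Z.of_nat (2 ^ S m)) t)%C).
    set (Lo' := fun t => (Lo t * ek (1 * Z.of_nat (2 ^ S m)) t)%C).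
    assert (TF' : TS (fun k => (- P <= k < P)%Z) F').
    { eapply (TS_mul _ (fun k => k = (-1 * Z.of_nat (2 ^ S m))%Z)); [|exact HF|apply TS_ek; reflexivity].
      cbv beta. intros k l [Hk Hk2] ->. pose proof (HkW k Hk). lia. }
    assert (TLo' : TS (fun k => (- P <= k < P)%Z) Lo').
    { eapply (TS_mul _ (fun k => k = (1 * Z.of_nat (2 ^ S m))%Z)); [|exact HLo|apply TS_ek; reflexivity].
      cbv beta. intros k l [[Hk Hk2] Hk3] ->. pose proof (HkW k Hk). lia. }
    assert (TMi : TS (fun k => (- P <= k < P)%Z) Mi).
    { revert HMi. apply TS_mono. intros k [[Hk Hk2] Hk3]. lia. }
    assert (EI : forall x, Iop 1 (S m) h x = (F' x + (Mi x + Lo' x))%C).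
    { intros x. rewrite EW, (Iop_ext 1 (S m) W (fun t => (F' t + (Mi t + Lo' t))%C)).
      - rewrite !Iop_plus, !Iop1_rep by assumption. reflexivity.
      - intros u Hu. rewrite E, E2. unfold F', Lo'. rewrite !ek_node by lia. cring. }
    rewrite (I1_ext q _ (fun x => (F' x + (Mi x + Lo' x))%C)) by (intros; rewrite EI; reflexivity).
    assert (CF : cont_norm F') by (eapply TS_cont, TF').
    assert (CM : cont_norm Mi) by (eapply TS_cont, TMi).
    assert (CL : cont_norm Lo') by (eapply TS_cont, TLo').
    assert (TML : TS (fun k => (- P <= k < P)%Z) (fun t => (Mi t + Lo' t)%C)) by (apply TS_plus; assumption).
    assert (CML : cont_norm (fun t => (Mi t + Lo' t)%C)) by (eapply TS_cont, TML).
    assert (EF : I1 q F' = I1 q F) by (apply I1_ext; intros; unfold F'; rewrite Cmod_mult, Cmod_ek; ring).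
    assert (EL : I1 q Lo' = I1 q Lo) by (apply I1_ext; intros; unfold Lo'; rewrite Cmod_mult, Cmod_ek; ring).
    assert (B1 : I1 q (fun x => (F' x + (Mi x + Lo' x))%C) <= rpow 2 q * (I1 q F' + I1 q (fun t => (Mi t + Lo' t)%C))).
    { apply (I1_plus q F' (fun t => (Mi t + Lo' t)%C)); try assumption.
      eapply TS_cont. apply (TS_plus _ F' _ TF' TML). }
    pose proof (I1_plus q Mi Lo' Hq CM CL CML) as B2.
    assert (NW : 0 <= I1 q W) by (apply I1_nonneg; [exact Hq|eapply TS_cont, TW]).
    assert (B0 : Cr * I1 q G <= Cr * (Cr * I1 q W)) by (apply Rmult_le_compat_l; lra).
    assert (B3 : I1 q Mi <= Cr * Cr * I1 q W) by lra.
    assert (B4 : I1 q Lo' <= Cr * Cr * I1 q W) by (rewrite EL; lra).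
    assert (B5 : I1 q (fun x => (F' x + (Mi x + Lo' x))%C) <=
      rpow 2 q * (Cr + rpow 2 q * (Cr * Cr + Cr * Cr)) * I1 q W).
    { eapply Rle_trans; [exact B1|]. rewrite Rmult_assoc. apply Rmult_le_compat_l; [lra|].
      rewrite EF. assert (rpow 2 q * (I1 q Mi + I1 q Lo') <= rpow 2 q * (Cr * Cr * I1 q W + Cr * Cr * I1 q W))
        by (apply Rmult_le_compat_l; lra). lra. }
    eapply Rle_trans; [exact B5|].
    apply Rle_trans with (Q * (S0 / 2 ^ S m)); [|nra].
    unfold Q. rewrite !(Rmult_assoc (rpow 2 q * _) C). apply Rmult_le_compat_l; [|exact BW].
    apply Rmult_le_pos; [lra|]. nra.
Qed.

Definition op1 := (R -> C) -> R -> C.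

(* For [p = Fin q] the quantities compared are q-th powers of norms. *)
Definition opbd (p : ext) (a D : R) (T : op1) : Prop :=
  match p with
  | Fin q => forall h, TP D h -> I1 q (T h) <= a * I1 q h
  | Inf => forall h M, TP D h -> (forall t, Cmod (h t) <= M) -> forall t, Cmod (T h t) <= a * M
  end.

(** Cost of discretisation on $q$-th powers: the constant [2 ^ j + 2 ^ l] of [sampling] divided by
    the number [2 ^ j] of nodes. The supremum norm pays nothing. *)
Definition gfac (p : ext) (j l : nat) : R :=
  match p with Fin _ => 1 + 2 ^ l / 2 ^ j | Inf => 1 end.

Lemma pow2_div_pos j l : 0 < 2 ^ l / 2 ^ j.
Proof. apply Rdiv_lt_0_compat; apply pow2_gt0. Qed.

Lemma gfac_pos p j l : 0 < gfac p j l.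
Proof. destruct p; simpl; [pose proof (pow2_div_pos j l)|]; lra. Qed.

Lemma iop_opbd p L : ext_pos p -> (1 <= L)%nat -> gt_invp (INR L) p -> (L = 1%nat -> p <> Inf) ->
  exists C, 0 < C /\ forall j l, opbd p (C * gfac p j l) (2 ^ l) (Iop L j).
Proof.
  intros Hp HL HpL HL1. destruct p as [q|]; simpl in *.
  - destruct (iop_bound q L Hp HL HpL) as [C1 [HC1 H1]].
    destruct (sampling q Hp) as [C2 [HC2 H2]].
    exists (C1 * C2). split; [nra|]. intros j l h Hh.
    eapply Rle_trans; [apply H1|]. pose proof (pow2_gt0 j) as Hj.
    replace (C1 * C2 * (1 + 2 ^ l / 2 ^ j) * I1 q h) with (C1 / 2 ^ j * (C2 * (2 ^ j + 2 ^ l) * I1 q h))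
      by (field; lra).
    apply Rmult_le_compat_l; [apply Rlt_le, Rdiv_lt_0_compat; lra|]. apply H2, Hh.
  - destruct (recon_sup L) as [C [HC H]].
    { destruct (Nat.eq_dec L 1) as [E|E]; [contradiction (HL1 E); reflexivity|lia]. }
    exists C. split; [exact HC|]. intros j l h M _ HM t. rewrite Rmult_1_r.
    apply (H j (fun u => h (gpt (2 ^ j) (gs j) u)) (gs j)). intros; apply HM.
Qed.

Lemma eta_TP L j h : (1 <= L)%nat -> TP (2 ^ j * (1 - / 2 ^ L)) (etaop L j h).
Proof.
  intros HL. destruct j as [|j]; [apply Iop_TP, HL|]. simpl etaop.
  apply (TS_minus _ (Iop L (S j) h) (Iop L j h)); [apply Iop_TP, HL|].
  apply (TP_mono (2 ^ j * (1 - / 2 ^ L))); [|apply Iop_TP, HL].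
  apply Rmult_le_compat_r; [|apply Rle_pow; [lra|lia]].
  pose proof (pow2_ge1 L). assert (/ 2 ^ L <= / 1) by (apply Rinv_le_contravar; lra).
  rewrite Rinv_1 in *. lra.
Qed.

Lemma eta_opbd p L : ext_pos p -> (1 <= L)%nat -> gt_invp (INR L) p -> (L = 1%nat -> p <> Inf) ->
  exists C, 0 < C /\ forall j l, opbd p (C * gfac p j l) (2 ^ l) (etaop L j).
Proof.
  intros Hp HL HpL HL1. destruct (iop_opbd p L Hp HL HpL HL1) as [C [HC H]].
  destruct p as [q|]; simpl in *.
  - set (r2 := rpow 2 q). assert (Hr : 0 < r2) by (apply rpow_gt0; lra).
    exists (C + r2 * (3 * C)). split; [nra|]. intros j l h Hh.
    assert (N0 : 0 <= I1 q h) by (apply I1_nonneg; [exact Hp|eapply TS_cont, Hh]).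
    destruct j as [|j].
    + eapply Rle_trans; [apply (H O l h Hh)|]. pose proof (pow2_div_pos 0 l) as P.
      apply Rmult_le_compat_r; [exact N0|]. apply Rmult_le_compat_r; nra.
    + pose proof (Iop_TP L (S j) h HL) as T1.
      pose proof (TS_scal _ (- (1))%C _ (Iop_TP L j h HL)) as T2. cbv beta in T2.
      pose proof (TS_all _ _ T1) as T1'. pose proof (TS_all _ _ T2) as T2'.
      rewrite (I1_ext q _ (fun t => (Iop L (S j) h t + (- (1)) * Iop L j h t)%C))
        by (intros; f_equal; simpl; cring).
      eapply Rle_trans; [apply I1_plus; [exact Hp|eapply TS_cont, T1'|eapply TS_cont, T2'|]|].
      * eapply TS_cont. apply (TS_plus _ _ _ T1' T2').
      * rewrite (I1_ext q (fun t => ((- (1)) * Iop L j h t)%C) (Iop L j h))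
          by (intros; rewrite Cmod_mult, Cmod_opp, Cmod_1; ring).
        pose proof (H (S j) l h Hh) as B1. pose proof (H j l h Hh) as B2.
        pose proof (pow2_div_pos j l) as P. pose proof (pow2_gt0 j) as Pj.
        assert (E : 2 ^ l / 2 ^ j = 2 * (2 ^ l / 2 ^ S j)) by (simpl; field; lra).
        rewrite E in B2. pose proof (pow2_div_pos (S j) l) as P2. fold r2.
        set (z := 2 ^ l / 2 ^ S j) in *. set (N := I1 q h) in *.
        apply Rle_trans with (r2 * (C * (1 + z) * N + C * (1 + 2 * z) * N));
          [apply Rmult_le_compat_l; lra|].
        assert (0 <= C * (1 + z) * N) by (apply Rmult_le_pos; nra).
        assert (0 <= r2 * (C * N)) by (apply Rmult_le_pos; [lra|apply Rmult_le_pos; lra]).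
        replace ((C + r2 * (3 * C)) * (1 + z) * N) with
          (C * (1 + z) * N + r2 * (C * (1 + z) * N + C * (1 + 2 * z) * N) + r2 * (C * N)) by ring.
        lra.
  - exists (2 * C). split; [lra|]. intros j l h M Hh HM t.
    assert (0 <= M) by (eapply Rle_trans; [apply Cmod_ge_0|apply (HM 0)]).
    destruct j as [|j]; simpl etaop.
    + pose proof (H O l h M Hh HM t). nra.
    + pose proof (H (S j) l h M Hh HM t). pose proof (H j l h M Hh HM t).
      pose proof (Cmod_minus_le (Iop L (S j) h t) (Iop L j h t)). lra.
Qed.

Lemma eta_zero L j l h x : (1 <= L)%nat -> (l + L + 2 <= j)%nat -> TP (2 ^ l) h ->
  etaop L j h x = RtoC 0.
Proof.
  intros HL Hj Hh. destruct j as [|j]; [lia|]. simpl etaop.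
  assert (T : forall m, (j <= m)%nat -> TS (fun k => Rabs (IZR k) < 2 ^ m / 2 ^ L) h).
  { intros m Hm. revert Hh. apply TS_mono. intros k Hk. eapply Rle_lt_trans; [exact Hk|].
    apply (Rlt_div_r _ _ (2 ^ L)); [apply pow2_gt0|]. rewrite <- pow_add.
    apply Rlt_pow; [lra|lia]. }
  rewrite !Iop_rep by (try exact HL; apply T; lia). cring.
Qed.

(** * Discretised Fourier multipliers *)

(** [c0] is the mean of [g]. It is chosen before the grid, so all sufficiently fine grids,
    translated or reflected, give one and the same average. *)
Lemma grid_average A g : TP A g -> exists c0, forall n, A < 2 ^ n ->
  (forall s, (RtoC (/ 2 ^ n) * Csum (2 ^ n) (fun u => g (gpt (2 ^ n) s u)))%C = c0) /\
  (forall s x, (RtoC (/ 2 ^ n) * Csum (2 ^ n) (fun u => g (x - gpt (2 ^ n) s u)%R))%C = c0).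
Proof.
  assert (EK : forall n k x, Rabs (IZR k) < 2 ^ n ->
    (RtoC (/ 2 ^ n) * Csum (2 ^ n) (fun u => ek k (gpt (2 ^ n) x u)))%C =
    if Z.eq_dec k 0 then RtoC 1 else RtoC 0).
  { intros n k x Hk. pose proof (pow2_gt0 n). destruct (Z.eq_dec k 0) as [->|Hne].
    - rewrite (Csum_ext _ _ (fun _ => RtoC 1)) by (intros; apply ek_0).
      rewrite Csum_const, INR_pow2, Cmult_1_r, <- RtoC_mult. f_equal. field. lra.
    - rewrite <- abs_IZR, <- IZR_pow2_nat in Hk. apply lt_IZR in Hk.
      destruct (Z_lt_le_dec 0 k).
      + replace k with (Z.of_nat (2 ^ n) * 0 + k)%Z by lia. rewrite gridsum_ek_ndiv by lia. cring.
      + replace k with (Z.of_nat (2 ^ n) * (-1) + (k + Z.of_nat (2 ^ n)))%Z by lia.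
        rewrite gridsum_ek_ndiv by lia. cring. }
  induction 1 as [|k a h Hk Hh [c0 IH]].
  - exists (RtoC 0). intros n _. split; intros; rewrite Csum_zero by reflexivity; cring.
  - exists (a * (if Z.eq_dec k 0 then RtoC 1 else RtoC 0) + c0)%C. intros n Hn.
    destruct (IH n Hn) as [I1 I2]. split.
    + intros s. rewrite Csum_plus, Csum_scal.
      transitivity (a * (RtoC (/ 2 ^ n) * Csum (2 ^ n) (fun u => ek k (gpt (2 ^ n) s u))) +
        RtoC (/ 2 ^ n) * Csum (2 ^ n) (fun u => h (gpt (2 ^ n) s u)))%C; [cring|].
      rewrite EK, I1 by lra. reflexivity.
    + intros s x. rewrite Csum_plus, Csum_scal.
      transitivity (a * (ek k x * (RtoC (/ 2 ^ n) * Csum (2 ^ n) (fun u => ek (- k) (gpt (2 ^ n) s u)))) +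
        RtoC (/ 2 ^ n) * Csum (2 ^ n) (fun u => h (x - gpt (2 ^ n) s u)%R))%C.
      { rewrite (Csum_ext _ (fun u => ek k (x - gpt (2 ^ n) s u)%R)
          (fun u => ek k x * ek (- k) (gpt (2 ^ n) s u))%C).
        - rewrite Csum_scal. cring.
        - intros u _. unfold Rminus. rewrite ek_plus, ek_opp. reflexivity. }
      rewrite EK, I2 by (rewrite opp_IZR, Rabs_Ropp; lra).
      destruct (Z.eq_dec (- k) 0) as [E|E], (Z.eq_dec k 0) as [E'|E']; try lia.
      * subst k. rewrite ek_0. cring.
      * cring.
Qed.

(** Convolution with [Phi], with the mean over the circle replaced by quadrature. The nodes are
    those of [Iop n], so the result depends on [h] only through its interpolant of level [n]. *)
Definition Dop (n : nat) (Phi : R -> C) : op1 := fun h x =>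
  (RtoC (/ 2 ^ n) * Csum (2 ^ n) (fun u =>
     h (gpt (2 ^ n) (gs n) u) * Phi (x - gpt (2 ^ n) (gs n) u)%R))%C.

(** Quadrature is exact at both levels, and a mean is invariant under reflection and translation.
    The number of nodes becomes a free choice, so estimates need not depend on [n]. *)
Lemma Dop_regrid A B n m Phi h x : TP A h -> TP B Phi -> A + B < 2 ^ n -> A + B < 2 ^ m ->
  Dop n Phi h x = (RtoC (/ 2 ^ m) * Csum (2 ^ m) (fun u =>
     Phi (gpt (2 ^ m) 0 u) * h (x - gpt (2 ^ m) 0 u)%R))%C.
Proof.
  intros Hh HP Hn Hm. set (g := fun y => (h y * Phi (x - y)%R)%C).
  assert (Hg : TP (A + B) g) by (apply (TP_mul _ _ h (fun y => Phi (x - y))); [exact Hh|apply TP_reflect, HP]).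
  destruct (grid_average _ g Hg) as [c0 Hc].
  transitivity c0; [apply (proj1 (Hc n Hn))|]. symmetry.
  rewrite <- (proj2 (Hc m Hm) 0 x). f_equal. apply Csum_ext. intros u _. unfold g.
  replace (x - (x - gpt (2 ^ m) 0 u)) with (gpt (2 ^ m) 0 u) by ring. cring.
Qed.

(** Disjoint spectra leave no zero frequency in the product with the reflected kernel, and the grid
    is too fine to alias any other frequency to zero. *)
Lemma Dop_zero A B b n Phi h x : TP A h -> TS (fun k => b <= Rabs (IZR k) <= B) Phi ->
  A < b -> A + B < 2 ^ n -> Dop n Phi h x = RtoC 0.
Proof.
  intros Hh HP Hb Hn. set (g := fun y => (h y * Phi (x - y)%R)%C).
  assert (Hg : TS (fun k => Rabs (IZR k) <= A + B /\ k <> 0%Z) g).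
  { apply (TS_mul (fun k => Rabs (IZR k) <= A) (fun k => b <= Rabs (IZR k) <= B) _ h (fun y => Phi (x - y))).
    - intros k l Hk Hl. split.
      + rewrite plus_IZR. eapply Rle_trans; [apply Rabs_triang|]. lra.
      + intros E. assert (k = (- l)%Z) by lia. subst. rewrite opp_IZR, Rabs_Ropp in Hk. lra.
    - exact Hh.
    - revert HP. apply TS_reflect. intros k Hk. rewrite opp_IZR, Rabs_Ropp. exact Hk. }
  enough (E : Csum (2 ^ n) (fun u => g (gpt (2 ^ n) (gs n) u)) = RtoC 0).
  { change ((RtoC (/ 2 ^ n) * Csum (2 ^ n) (fun u => g (gpt (2 ^ n) (gs n) u)))%C = RtoC 0).
    rewrite E. cring. }
  clearbody g. induction Hg as [|k a g [Hk Hk0] Hg IH]; [apply Csum_zero; reflexivity|].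
  rewrite Csum_plus, Csum_scal, IH.
  assert (Hk2 : Rabs (IZR k) < 2 ^ n) by lra.
  rewrite <- abs_IZR, <- IZR_pow2_nat in Hk2. apply lt_IZR in Hk2.
  destruct (Z_lt_le_dec 0 k).
  - replace k with (Z.of_nat (2 ^ n) * 0 + k)%Z by lia. rewrite gridsum_ek_ndiv by lia. cring.
  - replace k with (Z.of_nat (2 ^ n) * (-1) + (k + Z.of_nat (2 ^ n)))%Z by lia.
    rewrite gridsum_ek_ndiv by lia. cring.
Qed.

Lemma Dop_TP n Phi B h : TP B Phi -> TP B (Dop n Phi h).
Proof.
  intros HP. apply TS_scal.
  apply (TS_csum _ _ (fun u x => (h (gpt (2 ^ n) (gs n) u) * Phi (x - gpt (2 ^ n) (gs n) u)%R)%C)).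
  intros u _. apply (TS_scal _ _ (fun x => Phi (x - gpt (2 ^ n) (gs n) u))).
  apply (TS_shift _ Phi), HP.
Qed.

Definition ker_decay (K : R) (P l : nat) (Phi : R -> C) : Prop :=
  forall x, Cmod (Phi x) <= K * 2 ^ l * wt (2 ^ l) (INR P) x.

Lemma Dop_sup : exists C, 0 < C /\ forall K P l n Phi h M, 0 < K -> (2 <= P)%nat -> (l <= n)%nat ->
  ker_decay K P l Phi -> (forall t, Cmod (h t) <= M) -> forall x, Cmod (Dop n Phi h x) <= C * K * M.
Proof.
  destruct (wt_grid_sum 2 ltac:(lra)) as [C0 [HC0 Hgrid]].
  exists (2 * C0). split; [lra|]. intros K P l n Phi h M HK HP Hln HD HM x.
  pose proof (pow2_gt0 n) as Hn. pose proof (pow2_gt0 l) as Hl.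
  assert (HM0 : 0 <= M) by (eapply Rle_trans; [apply Cmod_ge_0|apply (HM 0)]).
  assert (Hin : 0 < / 2 ^ n) by (apply Rinv_0_lt_compat, Hn).
  unfold Dop. rewrite Cmod_mult, Cmod_R, Rabs_pos_eq by lra.
  apply Rle_trans with (/ 2 ^ n * (M * (K * 2 ^ l) * (C0 * (1 + 2 ^ n / 2 ^ l)))).
  - apply Rmult_le_compat_l; [lra|]. eapply Rle_trans; [apply Cmod_Csum|].
    apply Rle_trans with (Rsum (2 ^ n) (fun u => M * (K * 2 ^ l) * wt (2 ^ l) 2 (x - gpt (2 ^ n) (gs n) u))).
    + apply Rsum_le. intros u _. rewrite Cmod_mult, Rmult_assoc.
      apply Rmult_le_compat; try apply Cmod_ge_0; [apply HM|].
      eapply Rle_trans; [apply HD|]. apply Rmult_le_compat_l; [nra|].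
      apply wt_anti; [lra|]. apply (le_INR 2), HP.
    + rewrite Rsum_scal. apply Rmult_le_compat_l; [repeat apply Rmult_le_pos; lra|].
      pose proof (Hgrid (2 ^ n)%nat (2 ^ l) x (gs n) (pow2_nat_pos n) Hl) as G. rewrite INR_pow2 in G. exact G.
  - assert (E : / 2 ^ n * (M * (K * 2 ^ l) * (C0 * (1 + 2 ^ n / 2 ^ l))) = C0 * K * M * (2 ^ l / 2 ^ n + 1))
      by (field; lra). rewrite E.
    assert (2 ^ l / 2 ^ n <= 1).
    { apply Rle_div_l; [exact Hn|]. rewrite Rmult_1_l. apply Rle_pow; [lra|exact Hln]. }
    assert (0 <= C0 * K * M) by (repeat apply Rmult_le_pos; lra). nra.
Qed.

(** The bound obtained from a weighted sum grows with the number of nodes per length $2^{-l}$. The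
    grid is therefore first coarsened to the order of the larger of the two degrees. *)
Lemma Dop_opbd p d : ext_pos p -> exists (P : nat) C, (2 <= P)%nat /\ 0 < C /\
  forall K l j n Phi, 0 < K -> ker_decay K P l Phi -> TP (2 ^ (l + d)) Phi ->
  forall A, A <= 2 ^ j -> A + 2 ^ (l + d) < 2 ^ n -> (l <= n)%nat ->
  opbd p (C * (match p with Fin q => rpow K q | Inf => K end) * gfac p l j) A (Dop n Phi).
Proof.
  intros Hp. destruct p as [q|]; simpl in *.
  - destruct (exists_power q Hp) as [P [HP HP2]]. destruct (wt_grid_sum 2 ltac:(lra)) as [C0 [HC0 Hgrid]].
    set (c := (d + 2)%nat). pose proof (pow2_gt0 c) as Hc.
    exists P, (rpow (2 * C0) q * (2 * C0) * 2 ^ c). split; [exact HP2|].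
    split; [repeat apply Rmult_lt_0_compat; try lra; apply rpow_gt0; lra|].
    intros K l j n Phi HK HD HPhi A HA Hn Hln h Hh.
    (* A grid just fine enough, up to a constant factor, for the product of [h] and [Phi]; [k] below
       is its oversampling relative to the scale of [Phi]. *)
    set (m := (Nat.max l j + c)%nat).
    pose proof (pow2_gt0 l) as Hl. pose proof (pow2_gt0 m) as Hm. pose proof (pow2_gt0 j) as Hj.
    assert (Hlm : 2 ^ l <= 2 ^ m) by (apply Rle_pow; [lra|unfold m; lia]).
    assert (Hmb : 2 ^ m <= (2 ^ l + 2 ^ j) * 2 ^ c).
    { unfold m. rewrite pow_add. apply Rmult_le_compat_r; [lra|].
      destruct (Nat.max_spec l j) as [[_ ->]|[_ ->]]; lra. }
    assert (Hab : A + 2 ^ (l + d) < 2 ^ m).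
    { unfold m, c. rewrite !pow_add. pose proof (pow2_ge1 d).
      assert (2 ^ l <= 2 ^ Nat.max l j) by (apply Rle_pow; [lra|lia]).
      assert (2 ^ j <= 2 ^ Nat.max l j) by (apply Rle_pow; [lra|lia]).
      set (z := 2 ^ Nat.max l j) in *. set (w := 2 ^ d) in *. simpl (2 ^ 2). nra. }
    set (k := 2 ^ m / 2 ^ l). assert (Hk : 1 <= k).
    { unfold k. apply (Rle_div_r _ _ (2 ^ l)); lra. }
    set (y := gpt (2 ^ m) 0).
    set (al := fun u => / 2 ^ m * Cmod (Phi (y u))).
    assert (E : forall x, Cmod (Dop n Phi h x) <= Rsum (2 ^ m) (fun u => al u * Cmod (h (x - y u)))).
    { intros x. rewrite (Dop_regrid A (2 ^ (l + d)) n m Phi h x Hh HPhi Hn Hab).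
      rewrite Cmod_mult, Cmod_R, Rabs_pos_eq by (apply Rlt_le, Rinv_0_lt_compat, Hm).
      eapply Rle_trans; [apply Rmult_le_compat_l; [apply Rlt_le, Rinv_0_lt_compat, Hm|apply Cmod_Csum]|].
      rewrite <- Rsum_scal. apply Rsum_le. intros u _. rewrite Cmod_mult. unfold al. fold y. lra. }
    set (Wc := C0 * (1 + k)). assert (HWc : 0 < Wc) by (unfold Wc; nra).
    set (be := fun u => / wt (2 ^ l) 2 (y u) * al u).
    assert (Hbe : forall u, 0 <= be u /\ rpow (be u) q <= rpow (K / k) q * wt (2 ^ l) 2 (y u)).
    { intros u. unfold be, al. pose proof (wt_pos (2 ^ l) 2 (y u)) as W2.
      pose proof (wt_pos (2 ^ l) (INR P) (y u)) as WP. pose proof (Cmod_ge_0 (Phi (y u))) as CP.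
      assert (Him : 0 < / 2 ^ m) by (apply Rinv_0_lt_compat, Hm).
      assert (Hiw : 0 < / wt (2 ^ l) 2 (y u)) by (apply Rinv_0_lt_compat, W2).
      assert (B : / wt (2 ^ l) 2 (y u) * (/ 2 ^ m * Cmod (Phi (y u))) <=
        K / k * wt (2 ^ l) (- (2) + INR P) (y u)).
      { rewrite <- wt_mult, <- wt_inv.
        replace (K / k * (/ wt (2 ^ l) 2 (y u) * wt (2 ^ l) (INR P) (y u))) with
          (/ wt (2 ^ l) 2 (y u) * (/ 2 ^ m * (K * 2 ^ l * wt (2 ^ l) (INR P) (y u))))
          by (unfold k; field; repeat split; lra).
        apply Rmult_le_compat_l; [lra|]. apply Rmult_le_compat_l; [lra|]. apply HD. }
      split; [apply Rmult_le_pos; [lra|apply Rmult_le_pos; lra]|].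
      assert (HKk : 0 < K / k) by (apply Rdiv_lt_0_compat; lra).
      eapply Rle_trans; [apply rpow_le; [lra|split; [apply Rmult_le_pos; [lra|apply Rmult_le_pos; lra]|exact B]]|].
      rewrite rpow_mult by (try apply Rlt_le, wt_pos; lra).
      apply Rmult_le_compat_l; [apply rpow_ge0|]. rewrite wt_rpow. apply wt_anti; [lra|]. lra. }
    assert (Hal : forall u, 0 <= al u).
    { intros u. unfold al. apply Rmult_le_pos; [apply Rlt_le, Rinv_0_lt_compat, Hm|apply Cmod_ge_0]. }
    assert (PW : forall x, rpow (Cmod (Dop n Phi h x)) q <=
      rpow Wc q * Rsum (2 ^ m) (fun u => rpow (be u) q * rpow (Cmod (h (x - y u))) q)).
    { intros x. eapply Rle_trans; [apply rpow_le; [lra|split; [apply Cmod_ge_0|apply E]]|].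
      eapply Rle_trans; [apply (rpow_Rsum_weight _ _ (fun u => / wt (2 ^ l) 2 (y u)) Wc q Hp)|].
      - intros u _. apply Rmult_le_pos; [apply Hal|apply Cmod_ge_0].
      - intros u _. apply Rinv_0_lt_compat, wt_pos.
      - eapply Rle_trans; [right; apply Rsum_ext; intros u _; apply Rinv_inv|].
        pose proof (Hgrid (2 ^ m)%nat (2 ^ l) 0 0 (pow2_nat_pos m) Hl) as G. rewrite INR_pow2 in G.
        eapply Rle_trans; [|exact G]. right. apply Rsum_ext. intros u _. rewrite wt_sym. f_equal. unfold y; ring.
      - apply Rmult_le_compat_l; [apply rpow_ge0|]. apply Rsum_le. intros u _.
        destruct (Hbe u) as [Hb0 _]. rewrite <- Rmult_assoc. fold (be u).
        rewrite rpow_mult by (try apply Cmod_ge_0; assumption). lra. }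
    assert (Th : forall u, TP A (fun x => h (x - y u))) by (intros u; apply (TS_shift _ h (- y u)), Hh).
    assert (Hcu : forall u x, continuous (fun x => rpow (be u) q * rpow (Cmod (h (x - y u))) q) x).
    { intros u x. apply cont_scal. apply rpow_cont; [exact Hp|]. eapply TS_cont, (Th u). }
    pose proof PI_RGT_0 as HPI.
    assert (N0 : 0 <= I1 q h) by (apply I1_nonneg; [exact Hp|eapply TS_cont, Hh]).
    apply Rle_trans with (RInt (fun x => rpow Wc q * Rsum (2 ^ m) (fun u => rpow (be u) q * rpow (Cmod (h (x - y u))) q)) (- PI) PI).
    { apply RInt_mono; [lra| | |exact PW].
      - apply rpow_cont; [exact Hp|]. eapply TS_cont. apply (Dop_TP n Phi _ h HPhi).
      - intros x. apply cont_scal, (Rsum_continuous _ (fun u x => rpow (be u) q * rpow (Cmod (h (x - y u))) q)).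
        intros; apply Hcu. }
    rewrite RInt_scal_R by (intros; apply (Rsum_continuous _
      (fun u x => rpow (be u) q * rpow (Cmod (h (x - y u))) q)); intros; apply Hcu).
    rewrite (RInt_Rsum _ (fun u x => rpow (be u) q * rpow (Cmod (h (x - y u))) q)) by exact Hcu.
    assert (S1 : Rsum (2 ^ m) (fun v => RInt (fun x => rpow (be v) q * rpow (Cmod (h (x - y v))) q) (- PI) PI)
      <= rpow (K / k) q * Wc * I1 q h).
    { apply Rle_trans with (Rsum (2 ^ m) (fun v => rpow (K / k) q * I1 q h * wt (2 ^ l) 2 (y v))).
      - apply Rsum_le. intros v _.
        rewrite (RInt_scal_R (fun x => rpow (Cmod (h (x - y v))) q))
          by (apply rpow_cont; [exact Hp|eapply TS_cont, (Th v)]).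
        pose proof (I1_translate q _ h (- y v) Hp Hh) as Et. unfold I1 at 1 in Et.
        unfold Rminus. rewrite Et. destruct (Hbe v) as [_ Hb].
        replace (rpow (K / k) q * I1 q h * wt (2 ^ l) 2 (y v)) with
          (rpow (K / k) q * wt (2 ^ l) 2 (y v) * I1 q h) by ring.
        apply Rmult_le_compat_r; [exact N0|exact Hb].
      - rewrite Rsum_scal. pose proof (Hgrid (2 ^ m)%nat (2 ^ l) 0 0 (pow2_nat_pos m) Hl) as G. rewrite INR_pow2 in G.
        replace (rpow (K / k) q * Wc * I1 q h) with (rpow (K / k) q * I1 q h * Wc) by ring.
        apply Rmult_le_compat_l; [apply Rmult_le_pos; [apply rpow_ge0|exact N0]|].
        eapply Rle_trans; [|exact G]. right. apply Rsum_ext. intros u _. rewrite wt_sym. f_equal. unfold y; ring. }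
    eapply Rle_trans; [apply Rmult_le_compat_l; [apply rpow_ge0|exact S1]|].
    (* The power [k^q] from the weights cancels against [(K / k)^q]. One factor [Wc] of order [k]
       remains, and it is of the order of [gfac]. *)
    assert (F1 : rpow Wc q <= rpow (2 * C0) q * rpow k q).
    { rewrite <- rpow_mult by lra. apply rpow_le; [lra|]. unfold Wc. split; nra. }
    assert (F2 : rpow k q * rpow (K / k) q = rpow K q).
    { rewrite <- rpow_mult by (try apply Rlt_le, Rdiv_lt_0_compat; lra). f_equal. field. lra. }
    assert (F3 : Wc <= 2 * C0 * (2 ^ c * (1 + 2 ^ j / 2 ^ l))).
    { apply Rle_trans with (2 * C0 * k); [unfold Wc; nra|]. apply Rmult_le_compat_l; [lra|].
      unfold k. apply Rle_div_l; [exact Hl|].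
      replace (2 ^ c * (1 + 2 ^ j / 2 ^ l) * 2 ^ l) with ((2 ^ l + 2 ^ j) * 2 ^ c) by (field; lra). exact Hmb. }
    pose proof (rpow_ge0 (K / k) q) as P1. pose proof (rpow_ge0 K q) as P2. pose proof (rpow_ge0 (2 * C0) q) as P3.
    apply Rle_trans with (rpow (2 * C0) q * rpow k q * (rpow (K / k) q * (2 * C0 * (2 ^ c * (1 + 2 ^ j / 2 ^ l))) * I1 q h)).
    + apply Rmult_le_compat; [apply rpow_ge0|apply Rmult_le_pos; [nra|exact N0]|exact F1|].
      apply Rmult_le_compat_r; [exact N0|]. apply Rmult_le_compat_l; assumption.
    + right. rewrite <- F2. ring.
  - destruct Dop_sup as [C [HC H]]. exists 2%nat, C. split; [lia|]. split; [exact HC|].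
    intros K l j n Phi HK HD HPhi A HA Hn Hln h M Hh HM t. rewrite Rmult_1_r.
    apply (H K 2%nat l n Phi h M); auto.
Qed.

(** * Kernels of smooth frequency cut-offs *)

Definition wker (T : nat) (psi : R -> R) (x : R) : C :=
  symsum (fun k => (RtoC (psi (IZR k)) * ek k x)%C) T.

Fixpoint fdiff (n : nat) (f : R -> R) : R -> R :=
  match n with O => f | S m => fdiff m (fun x => f (x + 1) - f x) end.

(** [E] is the tower of derivatives. Differencing the whole tower yields another tower, so each
    induction step is one mean value theorem. *)
Lemma fdiff_bound n (E : nat -> R -> R) b :
  (forall j x, derivable_pt_lim (E j) x (E (S j) x)) ->
  (forall x, Rabs (E n x) <= b) -> forall x, Rabs (fdiff n (E O) x) <= b.
Proof.
  revert E. induction n; intros E HE Hb; simpl; [exact Hb|].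
  apply (IHn (fun j x => E j (x + 1) - E j x)).
  - intros j x. apply derivable_pt_lim_minus; [|apply HE].
    apply is_derive_Reals. eapply is_derive_ext_val.
    + apply (is_derive_comp (E j) (fun x => x + 1)); [apply is_derive_Reals, HE|].
      eapply is_derive_ext_val; [apply der_plus; [apply is_derive_id|apply is_derive_const]|].
      unfold zero, one; simpl. reflexivity.
    + unfold scal; simpl; unfold mult; simpl. ring.
  - intros x. destruct (MVT_gen (E n) x (x + 1) (E (S n))) as [c [_ Ec]].
    + intros y _. apply is_derive_Reals, HE.
    + intros y _. apply derivable_continuous_pt. exists (E (S n) y). apply HE.
    + rewrite Ec. replace (x + 1 - x) with 1 by ring. rewrite Rmult_1_r. apply Hb.
Qed.

Lemma symsum_widen F T R : (T <= R)%nat -> (forall k, (Z.of_nat T < Z.abs k)%Z -> F k = RtoC 0) ->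
  symsum F R = symsum F T.
Proof.
  intros HR HF. induction HR as [|R HR IH]; [reflexivity|].
  rewrite symsum_S, IH, !HF by lia. cring.
Qed.

Lemma symsum_bound F T b : (forall k, Cmod (F k) <= b) -> Cmod (symsum F T) <= (2 * INR T + 1) * b.
Proof.
  intros HF. unfold symsum. eapply Rle_trans; [apply Cmod_Csum|].
  eapply Rle_trans; [apply Rsum_le_const; intros; apply HF|].
  rewrite plus_INR, mult_INR. simpl. lra.
Qed.

(** Summation by parts. The window is one wider than the support, so both boundary terms vanish. *)
Lemma wker_fdiff1 T psi x : (forall y, INR T < Rabs y -> psi y = 0) ->
  (wker (S T) psi x * (ek (-1) x - 1) = wker (S T) (fun y => psi (y + 1) - psi y)%R x)%C.
Proof.
  intros Hpsi. unfold wker, symsum. rewrite <- Csum_scal_r. set (Q := S T).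
  set (G := fun v : nat => (RtoC (psi (IZR (Z.of_nat v - Z.of_nat Q))) *
    ek (Z.of_nat v - Z.of_nat Q - 1) x)%C).
  enough (D : (Csum (2 * Q + 1) (fun v => (RtoC (psi (IZR (Z.of_nat v - Z.of_nat Q) + 1)%R -
      psi (IZR (Z.of_nat v - Z.of_nat Q))) * ek (Z.of_nat v - Z.of_nat Q) x)%C) -
    Csum (2 * Q + 1) (fun v => (RtoC (psi (IZR (Z.of_nat v - Z.of_nat Q))) * ek (Z.of_nat v - Z.of_nat Q) x *
      (ek (-1) x - 1))%C) = 0)%C).
  { match type of D with (?a - ?b = _)%C => replace b with (a - (a - b))%C by cring end.
    rewrite D. cring. }
  rewrite <- Csum_minus.
  transitivity (Csum (2 * Q + 1) (fun v => (G (S v) - G v)%C)).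
  - apply Csum_ext. intros v _. unfold G.
    replace (Z.of_nat (S v) - Z.of_nat Q)%Z with ((Z.of_nat v - Z.of_nat Q) + 1)%Z by lia.
    replace ((Z.of_nat v - Z.of_nat Q) + 1 - 1)%Z with (Z.of_nat v - Z.of_nat Q)%Z by lia.
    rewrite plus_IZR, RtoC_minus. unfold Z.sub at 9. rewrite (ek_add _ (-1) x). cring.
  - rewrite Csum_telescope. unfold G.
    rewrite (Hpsi (IZR (Z.of_nat (2 * Q + 1) - Z.of_nat Q))), (Hpsi (IZR (Z.of_nat 0 - Z.of_nat Q))).
    + cring.
    + rewrite <- abs_IZR, INR_IZR_INZ. apply IZR_lt. unfold Q; lia.
    + rewrite <- abs_IZR, INR_IZR_INZ. apply IZR_lt. unfold Q; lia.
Qed.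

Lemma wker_fdiff n T psi x : (forall y, INR T < Rabs y -> psi y = 0) ->
  (wker (n + T) psi x * Cprod n (fun _ => (ek (-1) x - 1)) = wker (n + T) (fdiff n psi) x)%C.
Proof.
  revert T psi. induction n; intros T psi Hpsi; simpl; [cring|].
  transitivity ((wker (S (n + T)) psi x * (ek (-1) x - 1)) * Cprod n (fun _ => (ek (-1) x - 1)))%C; [cring|].
  rewrite wker_fdiff1.
  - replace (S (n + T)) with (n + S T)%nat by lia. rewrite IHn; [reflexivity|].
    intros y Hy. rewrite S_INR in Hy.
    rewrite (Hpsi y), (Hpsi (y + 1)); [ring| |lra].
    pose proof (Rabs_triang_inv y (-1)) as H. replace (y - -1) with (y + 1) in H by ring.
    rewrite (Rabs_left (-1)) in H by lra. lra.
  - intros y Hy. apply Hpsi. rewrite plus_INR in Hy. pose proof (pos_INR n). lra.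
Qed.

Lemma Cmod_Cprod_const n z : Cmod (Cprod n (fun _ => z)) = Cmod z ^ n.
Proof. induction n; simpl; [apply Cmod_1|]. rewrite Cmod_mult, IHn. ring. Qed.

Lemma pow_1p_le y P : 0 <= y -> (1 + y) ^ P <= 2 ^ P * (1 + y ^ P).
Proof.
  intros Hy. assert (0 <= y ^ P) by (apply pow_le, Hy). pose proof (pow2_gt0 P).
  destruct (Rle_dec y 1) as [H1|H1].
  - apply Rle_trans with (2 ^ P); [apply pow_incr; lra|]. nra.
  - apply Rle_trans with ((2 * y) ^ P); [apply pow_incr; lra|]. rewrite Rpow_mult_distr. nra.
Qed.

(** The number of frequencies gives the height $2^l$. Each of the [P] summations by parts trades a
    factor $|e^{-ix}-1|$ for a derivative, hence for $2^{-l}$. *)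
Lemma wker_decay P T0 b : 0 < b -> exists K, 0 < K /\ forall l T (E : nat -> R -> R),
  (forall j x, derivable_pt_lim (E j) x (E (S j) x)) ->
  INR T <= T0 * 2 ^ l -> (forall y, INR T < Rabs y -> E O y = 0) ->
  (forall x, Rabs (E O x) <= b) -> (forall x, 2 ^ (l * P) * Rabs (E P x) <= b) ->
  ker_decay K P l (wker T (E O)).
Proof.
  intros Hb. set (t := Rabs T0). assert (Ht : 0 <= t) by apply Rabs_pos.
  exists (2 ^ P * ((4 * t + 2 * INR P + 2) * b)).
  pose proof (pow2_gt0 P) as HP. pose proof (pos_INR P) as HP0.
  split; [apply Rmult_lt_0_compat; [lra|]; apply Rmult_lt_0_compat; lra|].
  intros l T E HE HT Hsupp H0 HPb x. pose proof (pow2_gt0 l) as Hl. pose proof (pow2_ge1 l) as Hl1.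
  assert (HT' : INR T <= t * 2 ^ l).
  { eapply Rle_trans; [exact HT|]. apply Rmult_le_compat_r; [lra|apply Rle_abs]. }
  set (Phi := wker T (E O) x). set (a := 2 ^ l * asin2 x).
  assert (Ha : 0 <= a) by (unfold a; pose proof (asin2_ge0 x); nra).
  assert (B1 : Cmod Phi <= (2 * (t * 2 ^ l) + 1) * b).
  { eapply Rle_trans; [apply (symsum_bound _ _ b)|].
    - intros k. rewrite Cmod_mult, Cmod_ek, Cmod_R, Rmult_1_r. apply H0.
    - apply Rmult_le_compat_r; lra. }
  assert (B2 : Cmod Phi * (2 * asin2 x) ^ P <= (2 * (t * 2 ^ l + INR P) + 1) * (b / 2 ^ (l * P))).
  { assert (EW : Phi = wker (P + T) (E O) x).
    { unfold Phi, wker. symmetry. apply symsum_widen; [lia|]. intros k Hk. rewrite Hsupp; [cring|].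
      rewrite <- abs_IZR, INR_IZR_INZ. apply IZR_lt, Hk. }
    pose proof (f_equal Cmod (wker_fdiff P T (E O) x Hsupp)) as EM.
    rewrite <- EW, Cmod_mult, Cmod_Cprod_const in EM.
    assert (E2 : Cmod (ek (-1) x - 1) = 2 * asin2 x).
    { unfold ek. rewrite Cmod_Cei_sub1. fold (asin2 (-1 * x)). replace (-1 * x) with (- x) by ring.
      rewrite asin2_opp. reflexivity. }
    rewrite E2 in EM. rewrite EM.
    eapply Rle_trans; [apply (symsum_bound _ _ (b / 2 ^ (l * P)))|].
    - intros k. rewrite Cmod_mult, Cmod_ek, Cmod_R, Rmult_1_r.
      apply (fdiff_bound P E _ HE). intros y. apply Rle_div_r; [apply pow2_gt0|].
      rewrite Rmult_comm. apply HPb.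
    - rewrite plus_INR. apply Rmult_le_compat_r; [|lra].
      apply Rlt_le, Rdiv_lt_0_compat; [lra|apply pow2_gt0]. }
  pose proof (Cmod_ge_0 Phi) as HPhi.
  assert (B3 : Cmod Phi * a ^ P <= (2 * (t * 2 ^ l + INR P) + 1) * b).
  { assert (Ea : a ^ P = 2 ^ (l * P) * asin2 x ^ P) by (unfold a; rewrite Rpow_mult_distr, pow_mult; reflexivity).
    rewrite Ea. rewrite Rpow_mult_distr in B2. pose proof (pow2_gt0 (l * P)) as HlP.
    assert (0 <= asin2 x ^ P) by (apply pow_le, asin2_ge0).
    apply Rmult_le_compat_l with (r := 2 ^ (l * P)) in B2; [|lra].
    replace (2 ^ (l * P) * ((2 * (t * 2 ^ l + INR P) + 1) * (b / 2 ^ (l * P)))) with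
      ((2 * (t * 2 ^ l + INR P) + 1) * b) in B2 by (field; lra).
    eapply Rle_trans; [|exact B2].
    replace (2 ^ (l * P) * (Cmod Phi * (2 ^ P * asin2 x ^ P))) with
      (2 ^ P * (Cmod Phi * (2 ^ (l * P) * asin2 x ^ P))) by ring.
    assert (0 <= Cmod Phi * (2 ^ (l * P) * asin2 x ^ P)) by (apply Rmult_le_pos; [lra|nra]).
    pose proof (pow2_ge1 P). nra. }
  pose proof (wt_pow (2 ^ l) P x ltac:(lra)) as W. fold a in W.
  pose proof (wt_pos (2 ^ l) (INR P) x) as Wp.
  assert (B4 : Cmod Phi * (1 + a) ^ P <= 2 ^ P * ((4 * t + 2 * INR P + 2) * b) * 2 ^ l).
  { eapply Rle_trans; [apply Rmult_le_compat_l; [exact HPhi|apply pow_1p_le, Ha]|].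
    replace (Cmod Phi * (2 ^ P * (1 + a ^ P))) with (2 ^ P * (Cmod Phi + Cmod Phi * a ^ P)) by ring.
    rewrite (Rmult_assoc (2 ^ P)). apply Rmult_le_compat_l; [lra|].
    eapply Rle_trans; [apply Rplus_le_compat; [exact B1|exact B3]|].
    replace ((2 * (t * 2 ^ l) + 1) * b + (2 * (t * 2 ^ l + INR P) + 1) * b) with
      ((4 * (t * 2 ^ l) + 2 * INR P + 2) * b) by ring.
    replace ((4 * t + 2 * INR P + 2) * b * 2 ^ l) with ((4 * t * 2 ^ l + (2 * INR P + 2) * 2 ^ l) * b) by ring.
    apply Rmult_le_compat_r; nra. }
  fold Phi. apply Rmult_le_compat_r with (r := wt (2 ^ l) (INR P) x) in B4; [|lra].
  replace (Cmod Phi * (1 + a) ^ P * wt (2 ^ l) (INR P) x) with (Cmod Phi * (wt (2 ^ l) (INR P) x * (1 + a) ^ P)) in B4 by ring.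
  rewrite W, Rmult_1_r in B4. exact B4.
Qed.

Definition phiT (A C : R) : nat := Z.to_nat (up (Rmax A C)).

Lemma phiT_gt A C : 0 < A -> Rmax A C < INR (phiT A C).
Proof.
  intros HA. destruct (archimed (Rmax A C)) as [H1 _]. pose proof (Rmax_l A C).
  unfold phiT. rewrite INR_IZR_INZ, Z2Nat.id; [lra|]. apply le_IZR. lra.
Qed.

Lemma INR_Tb A C l : INR (Tb A C l) = INR (phiT A C) * 2 ^ l.
Proof. unfold Tb. rewrite mult_INR, INR_pow2. reflexivity. Qed.

Lemma phi_support phi A B C l y : admissible phi A B C -> phi l y <> 0 -> Rabs y <= Rmax A C * 2 ^ l.
Proof.
  intros [HA [HB [HC [H0 [H1 _]]]]] Hy. pose proof (Rmax_l A C). pose proof (Rmax_r A C).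
  destruct l as [|l].
  - specialize (H0 y Hy). simpl. lra.
  - destruct (H1 (S l) y ltac:(lia) Hy) as [_ HH]. pose proof (pow2_gt0 (S l)). nra.
Qed.

Lemma phi_zero phi A B C l y : admissible phi A B C -> INR (Tb A C l) < Rabs y -> phi l y = 0.
Proof.
  intros Ha Hy. destruct (Req_dec (phi l y) 0) as [E|E]; [exact E|exfalso].
  pose proof (phi_support phi A B C l y Ha E) as S. rewrite INR_Tb in Hy.
  pose proof (phiT_gt A C (proj1 Ha)). pose proof (pow2_gt0 l). nra.
Qed.

Definition Phik (phi : nat -> R -> R) (A C : R) (l : nat) : R -> Complex.C := wker (Tb A C l) (phi l).

Lemma Phik_decay phi A B C P : admissible phi A B C -> exists K, 0 < K /\
  forall l, ker_decay K P l (Phik phi A C l).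
Proof.
  intros Ha. pose proof Ha as [HA [HB [HC [H0 [H1 [[D [D0 [D1 D2]]] Hs]]]]]].
  destruct (D2 O) as [M0 HM0]. destruct (D2 P) as [MP HMP].
  set (b := Rabs M0 + Rabs MP + 1).
  assert (Hb : 0 < b) by (unfold b; pose proof (Rabs_pos M0); pose proof (Rabs_pos MP); lra).
  destruct (wker_decay P (INR (phiT A C)) b Hb) as [K [HK H]]. exists K. split; [exact HK|].
  intros l. unfold Phik. rewrite <- (D0 l). apply H.
  - apply D1.
  - rewrite INR_Tb. lra.
  - intros y Hy. rewrite D0. apply (phi_zero phi A B C l y Ha Hy).
  - intros x. specialize (HM0 l x). rewrite Nat.mul_0_r, pow_O, Rmult_1_l in HM0.
    pose proof (Rle_abs M0). pose proof (Rabs_pos MP). unfold b. lra.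
  - intros x. specialize (HMP l x). pose proof (Rle_abs MP). pose proof (Rabs_pos M0). unfold b. lra.
Qed.

Lemma symsum_TS (S : Z -> Prop) F T : (forall k, (Z.abs k <= Z.of_nat T)%Z -> F k <> RtoC 0 -> S k) ->
  TS S (fun x => symsum (fun k => (F k * ek k x)%C) T).
Proof.
  intros HF. unfold symsum.
  apply (TS_csum _ _ (fun v x => (F (Z.of_nat v - Z.of_nat T)%Z * ek (Z.of_nat v - Z.of_nat T) x)%C)).
  intros v Hv. destruct (excluded_middle_informative (F (Z.of_nat v - Z.of_nat T)%Z = RtoC 0)) as [E|E].
  - eapply TS_eq; [constructor|]. intros; simpl. rewrite E. cring.
  - apply TS_scal, TS_ek, HF; [lia|exact E].
Qed.

Lemma Phik_TS phi A B C l : admissible phi A B C ->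
  TS (fun k => phi l (IZR k) <> 0) (Phik phi A C l).
Proof.
  intros Ha. apply symsum_TS. intros k _ H E. apply H. rewrite E. reflexivity.
Qed.

Lemma Phik_TP phi A B C l : admissible phi A B C -> TP (INR (Tb A C l)) (Phik phi A C l).
Proof.
  intros Ha. generalize (Phik_TS phi A B C l Ha). apply TS_mono. intros k Hk.
  destruct (Rle_dec (Rabs (IZR k)) (INR (Tb A C l))) as [H|H]; [exact H|].
  contradiction Hk. apply (phi_zero phi A B C l _ Ha). lra.
Qed.

(** * De la Vallee-Poussin kernels as partial sums of the admissible system *)

Definition Vsum (E : nat -> R -> R) (N : nat) (x : R) : R := Rsum (S N) (fun i => E i x).

Lemma Vsum_one phi A B C N y : admissible phi A B C -> Rabs y < B * 2 ^ S N -> Vsum phi N y = 1.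
Proof.
  intros [HA [HB [HC [H0 [H1 [_ Hs]]]]]] Hy.
  assert (Z : forall i, (N < i)%nat -> phi i y = 0).
  { intros i Hi. destruct (Req_dec (phi i y) 0) as [E|E]; [exact E|exfalso].
    destruct (H1 i y ltac:(lia) E) as [H2 _].
    assert (2 ^ S N <= 2 ^ i) by (apply Rle_pow; [lra|lia]). nra. }
  apply (UL_sequence (fun _ => Vsum phi N y)); [intros eps He; exists O; intros; rewrite R_dist_eq; exact He|].
  intros eps He. destruct (Hs y eps He) as [M HM]. exists O. intros n _.
  specialize (HM (M + N)%nat ltac:(lia)).
  replace (Vsum phi N y) with (sum_f_R0 (fun j => phi j y) (M + N)); [exact HM|].
  clear HM. unfold Vsum. induction M as [|M IH]; simpl.
  - clear -N. induction N as [|N IH]; [simpl; ring|]. simpl. rewrite IH. simpl. ring.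
  - rewrite IH, Z by lia. simpl. ring.
Qed.

Lemma locally_R (x e : R) (P : R -> Prop) : 0 < e -> (forall y, Rabs (y - x) < e -> P y) -> locally x P.
Proof. intros He H. exists (mkposreal e He). exact H. Qed.

Lemma derive_zero_open (f f' : R -> R) (r c : R) : (forall x, derivable_pt_lim f x (f' x)) ->
  (forall y, Rabs y < r -> f y = c) -> forall x, Rabs x < r -> f' x = 0.
Proof.
  intros Hd Hf x Hx. apply (uniqueness_limite f x); [apply Hd|].
  apply is_derive_Reals. apply (is_derive_ext_loc (fun _ => c)); [|apply is_derive_Reals, derivable_pt_lim_const].
  apply (locally_R x (r - Rabs x)); [lra|]. intros y Hy. symmetry. apply Hf.
  replace y with (x + (y - x)) by ring. eapply Rle_lt_trans; [apply Rabs_triang|]. lra.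
Qed.

Lemma derive_zero_outside (f f' : R -> R) (r : R) : (forall x, derivable_pt_lim f x (f' x)) ->
  (forall y, r < Rabs y -> f y = 0) -> forall x, r < Rabs x -> f' x = 0.
Proof.
  intros Hd Hf x Hx. apply (uniqueness_limite f x); [apply Hd|].
  apply is_derive_Reals. apply (is_derive_ext_loc (fun _ => 0)); [|apply is_derive_Reals, derivable_pt_lim_const].
  apply (locally_R x (Rabs x - r)); [lra|]. intros y Hy. symmetry. apply Hf.
  pose proof (Rabs_triang_inv x (- (y - x))) as T. replace (x - - (y - x)) with y in T by ring.
  rewrite Rabs_Ropp in T. lra.
Qed.

Lemma Rsum_few n c b (F : nat -> R) : 0 <= b ->
  (forall i, (i <= n)%nat -> F i <= if le_dec (n - i) c then b else 0) -> Rsum (S n) F <= INR (S c) * b.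
Proof.
  intros Hb HF. rewrite Rsum_rev.
  apply Rle_trans with (Rsum (S n) (fun i => if le_dec i c then b else 0)).
  - apply Rsum_le. intros v Hv. eapply Rle_trans; [apply HF; lia|].
    replace (n - (S n - 1 - v))%nat with v by lia. lra.
  - clear HF. generalize (S n). intros m.
    assert (H : Rsum m (fun i => if le_dec i c then b else 0) <= INR (Nat.min m (S c)) * b).
    { induction m; simpl Rsum; [simpl; lra|]. destruct (le_dec m c).
      - replace (Nat.min (S m) (S c)) with (S (Nat.min m (S c))) by lia. rewrite S_INR. lra.
      - replace (Nat.min (S m) (S c)) with (Nat.min m (S c)) by lia. lra. }
    eapply Rle_trans; [exact H|]. apply Rmult_le_compat_r; [exact Hb|]. apply le_INR. lia.
Qed.

Definition Vker (phi : nat -> R -> R) (A C : R) (N : nat) : R -> Complex.C := wker (Tb A C N) (Vsum phi N).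

(** Adding the bounds of the single $\varphi_i$ would lose the gain $2^{-Nn}$ of the $n$-th
    derivative. It vanishes instead where the partial sum is constantly 1, and outside that range
    only the last few summands, of scale comparable with $2^N$, are non-zero. *)
Lemma Vker_decay phi A B C P : admissible phi A B C -> exists K, 0 < K /\
  forall N, ker_decay K P N (Vker phi A C N).
Proof.
  intros Ha. pose proof Ha as [HA [HB [HC [H0 [H1 [[D [D0 [D1 D2]]] Hs]]]]]].
  set (C' := Rmax A C). assert (HC' : 0 < C') by (unfold C'; pose proof (Rmax_l A C); lra).
  (* Number of overlapping scales: a point with [|y| >= B * 2 ^ S N] lies beyond the support of
     every [phi i] with [i + c < N]. *)
  destruct (pow2_unbounded (C' / (2 * B))) as [c Hc]. specialize (Hc c ltac:(lia)).
  assert (DV : forall N j x, derivable_pt_lim (Vsum (fun i => D i j) N) x (Vsum (fun i => D i (S j)) N x)).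
  { intros N j x. apply is_derive_Reals. apply (is_derive_Rsum (S N) (fun i => D i j) (fun i => D i (S j) x)).
    intros i. apply is_derive_Reals, D1. }
  assert (Dz : forall i n y, C' * 2 ^ i < Rabs y -> D i n y = 0).
  { intros i n. induction n; intros y Hy.
    - rewrite D0. destruct (Req_dec (phi i y) 0) as [E|E]; [exact E|exfalso].
      pose proof (phi_support phi A B C i y Ha E). fold C' in H. lra.
    - apply (derive_zero_outside (D i n) (D i (S n)) (C' * 2 ^ i)); auto. }
  assert (Vz : forall N n y, (1 <= n)%nat -> Rabs y < B * 2 ^ S N -> Vsum (fun i => D i n) N y = 0).
  { intros N n y Hn. revert y. induction Hn as [|n Hn IH]; intros y Hy.
    - apply (derive_zero_open (Vsum (fun i => D i O) N) _ (B * 2 ^ S N) 1); [apply DV| |exact Hy].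
      intros z Hz. rewrite <- (Vsum_one phi A B C N z Ha Hz). apply Rsum_ext. intros; rewrite D0; reflexivity.
    - apply (derive_zero_open (Vsum (fun i => D i n) N) _ (B * 2 ^ S N) 0); [apply DV|exact IH|exact Hy]. }
  assert (Vb : forall n, exists b, 0 < b /\ forall N y, B * 2 ^ S N <= Rabs y ->
    2 ^ (N * n) * Rabs (Vsum (fun i => D i n) N y) <= b).
  { intros n. destruct (D2 n) as [M HM]. assert (HM0 : 0 <= M).
    { eapply Rle_trans; [|apply (HM O 0)]. apply Rmult_le_pos; [apply Rlt_le, pow2_gt0|apply Rabs_pos]. }
    pose proof (pow2_gt0 (c * n)) as Hcn.
    exists (INR (S c) * (M * 2 ^ (c * n)) + 1). pose proof (pos_INR (S c)).
    split; [assert (0 <= INR (S c) * (M * 2 ^ (c * n))) by (apply Rmult_le_pos; nra); lra|].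
    intros N y Hy. pose proof (pow2_gt0 (N * n)) as HNn.
    apply Rle_trans with (INR (S c) * (M * 2 ^ (c * n))); [|lra].
    apply Rle_trans with (2 ^ (N * n) * Rsum (S N) (fun i => Rabs (D i n y))).
    { apply Rmult_le_compat_l; [lra|]. apply Rsum_Rabs. }
    rewrite <- Rsum_scal. apply Rsum_few; [nra|]. intros i Hi.
    destruct (le_dec (N - i) c) as [Hic|Hic].
    - replace (N * n)%nat with (i * n + (N - i) * n)%nat by nia. rewrite pow_add.
      specialize (HM i y).
      assert (2 ^ ((N - i) * n) <= 2 ^ (c * n)) by (apply Rle_pow; [lra|nia]).
      pose proof (pow2_gt0 ((N - i) * n)). pose proof (pow2_gt0 (i * n)). pose proof (Rabs_pos (D i n y)).
      replace (2 ^ (i * n) * 2 ^ ((N - i) * n) * Rabs (D i n y)) with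
        ((2 ^ (i * n) * Rabs (D i n y)) * 2 ^ ((N - i) * n)) by ring.
      apply Rmult_le_compat; try lra. apply Rmult_le_pos; lra.
    - rewrite Dz; [rewrite Rabs_R0; lra|]. eapply Rlt_le_trans; [|exact Hy].
      assert (2 ^ i * 2 ^ c <= 2 ^ N) by (rewrite <- pow_add; apply Rle_pow; [lra|lia]).
      apply Rlt_div_l in Hc; [|lra]. pose proof (pow2_gt0 i). simpl (2 ^ S N).
      apply Rlt_le_trans with (2 ^ c * (2 * B) * 2 ^ i); [apply Rmult_lt_compat_r; lra|]. nra. }
  destruct (Vb O) as [b0 [Hb0 V0]]. destruct (Vb P) as [bP [HbP VP]].
  set (b := b0 + bP + 1). assert (Hb : 0 < b) by (unfold b; lra).
  destruct (wker_decay P (INR (phiT A C)) b Hb) as [K [HK H]]. exists K. split; [exact HK|].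
  intros N. unfold Vker.
  replace (Vsum phi N) with (Vsum (fun i => D i O) N)
    by (apply functional_extensionality; intros y; apply Rsum_ext; intros; rewrite D0; reflexivity).
  assert (Va : forall y, Rabs (Vsum (fun i => D i O) N y) <= b).
  { intros y. destruct (Rlt_dec (Rabs y) (B * 2 ^ S N)) as [Hy|Hy].
    - replace (Vsum (fun i => D i O) N y) with 1; [rewrite Rabs_R1; unfold b; lra|].
      rewrite <- (Vsum_one phi A B C N y Ha Hy). apply Rsum_ext. intros; rewrite D0; reflexivity.
    - specialize (V0 N y ltac:(lra)). rewrite Nat.mul_0_r, pow_O, Rmult_1_l in V0. unfold b. lra. }
  apply (H N (Tb A C N) (fun n => Vsum (fun i => D i n) N)).
  - intros; apply DV.
  - rewrite INR_Tb. lra.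
  - intros y Hy. unfold Vsum. rewrite (Rsum_ext _ _ (fun _ => 0)); [rewrite Rsum_const; ring|].
    intros i Hi. rewrite D0. apply (phi_zero phi A B C i y Ha). eapply Rle_lt_trans; [|exact Hy].
    rewrite !INR_Tb. apply Rmult_le_compat_l; [apply pos_INR|]. apply Rle_pow; [lra|lia].
  - exact Va.
  - intros y. destruct P as [|P]; [rewrite Nat.mul_0_r, pow_O, Rmult_1_l; apply Va|].
    destruct (Rlt_dec (Rabs y) (B * 2 ^ S N)) as [Hy|Hy].
    + rewrite Vz by (try lia; exact Hy). rewrite Rabs_R0. lra.
    + specialize (VP N y ltac:(lra)). unfold b. lra.
Qed.

Lemma Vker_sum phi A B C N x : admissible phi A B C ->
  Vker phi A C N x = Csum (S N) (fun l => Phik phi A C l x).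
Proof.
  intros Ha. unfold Vker, Phik, wker.
  transitivity (Csum (S N) (fun l => symsum (fun k => (RtoC (phi l (IZR k)) * ek k x)%C) (Tb A C N))).
  - unfold symsum. rewrite Csum_swap. apply Csum_ext. intros v _.
    unfold Vsum. rewrite RtoC_Rsum, <- Csum_scal_r. reflexivity.
  - apply Csum_ext. intros l Hl. apply symsum_widen.
    + unfold Tb. apply Nat.mul_le_mono_l, Nat.pow_le_mono_r; lia.
    + intros k Hk. rewrite (phi_zero phi A B C l (IZR k) Ha); [cring|].
      rewrite <- abs_IZR, INR_IZR_INZ. apply IZR_lt, Hk.
Qed.

(** * Functions of several variables *)

Definition near (d : nat) (e : R) (x y : nat -> R) : Prop := forall i, (i < d)%nat -> Rabs (x i - y i) < e.

(** Uniform continuity in the first [d] coordinates also forces independence of the others. The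
    class contains the continuous periodic functions, is preserved by all operators below, and
    suffices for iterated Riemann integrals. *)
Definition BUC (d : nat) (g : (nat -> R) -> C) : Prop :=
  (exists M, forall x, Cmod (g x) <= M) /\
  forall eps, 0 < eps -> exists e, 0 < e /\ forall x y, near d e x y -> Cmod (g x - g y) <= eps.

Lemma near_mono d e e' x y : e <= e' -> near d e x y -> near d e' x y.
Proof. intros He H i Hi. specialize (H i Hi). lra. Qed.

Lemma upd_eq x i t : upd x i t i = t.
Proof. unfold upd. rewrite Nat.eqb_refl. reflexivity. Qed.

Lemma upd_neq x i t k : k <> i -> upd x i t k = x k.
Proof. intros H. unfold upd. destruct (Nat.eqb_spec k i); [contradiction|reflexivity]. Qed.

Lemma upd_upd x i s t : upd (upd x i s) i t = upd x i t.
Proof. apply functional_extensionality. intros k. unfold upd. destruct (Nat.eqb k i); reflexivity. Qed.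

Lemma upd_comm x i j s t : i <> j -> upd (upd x i s) j t = upd (upd x j t) i s.
Proof.
  intros H. apply functional_extensionality. intros k. unfold upd.
  destruct (Nat.eqb_spec k i), (Nat.eqb_spec k j); try reflexivity. lia.
Qed.

Lemma upd_id x i : upd x i (x i) = x.
Proof.
  apply functional_extensionality. intros k. unfold upd. destruct (Nat.eqb_spec k i); [subst|]; reflexivity.
Qed.

Lemma near_upd d e x y i s t : 0 < e -> near d e x y -> Rabs (s - t) < e -> near d e (upd x i s) (upd y i t).
Proof.
  intros He H Hst k Hk. destruct (Nat.eq_dec k i) as [->|Hne]; [rewrite !upd_eq; exact Hst|].
  rewrite !upd_neq by assumption. apply H, Hk.
Qed.

Lemma BUC_const d c : BUC d (fun _ => c).
Proof.
  split; [exists (Cmod c); intros; lra|]. intros eps He. exists 1. split; [lra|]. intros.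
  replace (c - c)%C with (RtoC 0) by cring. rewrite Cmod_0. lra.
Qed.

Lemma BUC_plus d f g : BUC d f -> BUC d g -> BUC d (fun x => (f x + g x)%C).
Proof.
  intros [[M HM] Hf] [[M' HM'] Hg]. split.
  - exists (M + M'). intros x. eapply Rle_trans; [apply Cmod_triangle|]. specialize (HM x); specialize (HM' x); lra.
  - intros eps He. destruct (Hf (eps / 2) ltac:(lra)) as [e [He1 H1]].
    destruct (Hg (eps / 2) ltac:(lra)) as [e' [He2 H2]].
    exists (Rmin e e'). split; [apply Rmin_glb_lt; assumption|]. intros x y Hxy.
    replace (f x + g x - (f y + g y))%C with ((f x - f y) + (g x - g y))%C by cring.
    eapply Rle_trans; [apply Cmod_triangle|].
    pose proof (H1 x y (near_mono _ _ _ _ _ (Rmin_l _ _) Hxy)).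
    pose proof (H2 x y (near_mono _ _ _ _ _ (Rmin_r _ _) Hxy)). lra.
Qed.

Lemma BUC_mult d f g : BUC d f -> BUC d g -> BUC d (fun x => (f x * g x)%C).
Proof.
  intros [[M HM] Hf] [[M' HM'] Hg].
  assert (HM0 : 0 <= M) by (eapply Rle_trans; [apply Cmod_ge_0|apply (HM (fun _ => 0))]).
  assert (HM0' : 0 <= M') by (eapply Rle_trans; [apply Cmod_ge_0|apply (HM' (fun _ => 0))]).
  split.
  - exists (M * M'). intros x. rewrite Cmod_mult. apply Rmult_le_compat; try apply Cmod_ge_0; auto.
  - intros eps He.
    destruct (Hf (eps / 2 / (M' + 1)) ltac:(repeat apply Rdiv_lt_0_compat; lra)) as [e [He1 H1]].
    destruct (Hg (eps / 2 / (M + 1)) ltac:(repeat apply Rdiv_lt_0_compat; lra)) as [e' [He2 H2]].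
    exists (Rmin e e'). split; [apply Rmin_glb_lt; assumption|]. intros x y Hxy.
    replace (f x * g x - f y * g y)%C with ((f x - f y) * g x + f y * (g x - g y))%C by cring.
    eapply Rle_trans; [apply Cmod_triangle|]. rewrite !Cmod_mult.
    pose proof (H1 x y (near_mono _ _ _ _ _ (Rmin_l _ _) Hxy)) as B1.
    pose proof (H2 x y (near_mono _ _ _ _ _ (Rmin_r _ _) Hxy)) as B2.
    pose proof (HM' x). pose proof (HM y). pose proof (Cmod_ge_0 (g x)). pose proof (Cmod_ge_0 (f y)).
    assert (Cmod (f x - f y) * Cmod (g x) <= eps / 2 / (M' + 1) * (M' + 1))
      by (apply Rmult_le_compat; try apply Cmod_ge_0; lra).
    assert (Cmod (f y) * Cmod (g x - g y) <= (M + 1) * (eps / 2 / (M + 1)))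
      by (apply Rmult_le_compat; try apply Cmod_ge_0; lra).
    replace (eps / 2 / (M' + 1) * (M' + 1)) with (eps / 2) in * by (field; lra).
    replace ((M + 1) * (eps / 2 / (M + 1))) with (eps / 2) in * by (field; lra). lra.
Qed.

Lemma BUC_upd d g i s : BUC d g -> BUC d (fun x => g (upd x i s)).
Proof.
  intros [[M HM] Hg]. split; [exists M; auto|]. intros eps He. destruct (Hg eps He) as [e [He1 H]].
  exists e. split; [exact He1|]. intros x y Hxy. apply H, near_upd; [exact He1|exact Hxy|].
  rewrite Rminus_diag, Rabs_R0. exact He1.
Qed.

Lemma TS_bounded S h : TS S h -> exists M, 0 <= M /\ forall t, Cmod (h t) <= M.
Proof.
  induction 1 as [|k a h Hk Hh [M [HM H]]].
  - exists 0. split; [lra|]. intros; rewrite Cmod_0; lra.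
  - exists (Cmod a + M). pose proof (Cmod_ge_0 a). split; [lra|]. intros t.
    eapply Rle_trans; [apply Cmod_triangle|]. rewrite Cmod_mult, Cmod_ek. specialize (H t). lra.
Qed.

Lemma BUC_coord d S h i : (i < d)%nat -> TS S h -> BUC d (fun x => h (x i)).
Proof.
  intros Hi Hh. destruct (TS_bounded S h Hh) as [M [_ HM]]. destruct (TS_lip S h Hh) as [K [HK HL]].
  split; [exists M; auto|]. intros eps He. exists (eps / (K + 1)). split; [apply Rdiv_lt_0_compat; lra|].
  intros x y Hxy. specialize (Hxy i Hi). eapply Rle_trans; [apply HL|].
  apply Rlt_div_r in Hxy; [|lra]. pose proof (Rabs_pos (x i - y i)). nra.
Qed.

(** Finite sums of point evaluations with trigonometric coefficients. Interpolation and discretised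
    convolution are both of this form, so linearity, commutation in different variables and
    preservation of continuity are each one induction. *)
Inductive fsop : op1 -> Prop :=
| fs_nil : fsop (fun _ _ => RtoC 0)
| fs_cons s S kap T : TS S kap -> fsop T -> fsop (fun h x => (h s * kap x + T h x)%C).

Lemma fsop_ext T T' : fsop T -> (forall h x, T h x = T' h x) -> fsop T'.
Proof.
  intros H E. replace T' with T; [exact H|].
  apply functional_extensionality; intros h. apply functional_extensionality; intros x. apply E.
Qed.

Lemma fsop_plus T T' : fsop T -> fsop T' -> fsop (fun h x => (T h x + T' h x)%C).
Proof.
  intros H H'. induction H.
  - eapply fsop_ext; [exact H'|]. intros; cring.
  - eapply fsop_ext; [apply (fs_cons s S kap _ H IHfsop)|]. intros; simpl; cring.
Qed.

Lemma fsop_scal a T : fsop T -> fsop (fun h x => (a * T h x)%C).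
Proof.
  induction 1.
  - eapply fsop_ext; [constructor|]. intros; simpl; cring.
  - eapply fsop_ext; [apply (fs_cons s S (fun x => (a * kap x)%C) _ (TS_scal _ _ _ H) IHfsop)|].
    intros; simpl; cring.
Qed.

Lemma fsop_csum n (T : nat -> op1) : (forall u, fsop (T u)) -> fsop (fun h x => Csum n (fun u => T u h x)).
Proof.
  intros H. induction n; simpl; [constructor|].
  apply (fsop_plus (fun h x => Csum n (fun u => T u h x)) (T n)); auto.
Qed.

Lemma fsop_point s S kap : TS S kap -> fsop (fun h x => (h s * kap x)%C).
Proof.
  intros H. eapply fsop_ext; [apply (fs_cons s S kap _ H fs_nil)|]. intros; simpl; cring.
Qed.

Lemma Iop_fsop L m : (1 <= L)%nat -> fsop (Iop L m).
Proof.
  intros HL. apply (fsop_csum _ (fun u h x => (h (gpt (2 ^ m) (gs m) u) * Kper L m (x - gpt (2 ^ m) (gs m) u))%C)).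
  intros u. apply (fsop_point _ (fun k => Rabs (IZR k) <= 2 ^ m * (1 - / 2 ^ L)) (fun x => Kper L m (x - gpt (2 ^ m) (gs m) u))).
  apply (TS_shift _ (Kper L m)), Kper_TP, HL.
Qed.

Lemma eta_fsop L j : (1 <= L)%nat -> fsop (etaop L j).
Proof.
  intros HL. destruct j; [apply Iop_fsop, HL|].
  eapply fsop_ext; [apply (fsop_plus _ _ (Iop_fsop L (S j) HL) (fsop_scal (- (1))%C _ (Iop_fsop L j HL)))|].
  intros; simpl; cring.
Qed.

Lemma Dop_fsop n S Phi : TS S Phi -> fsop (Dop n Phi).
Proof.
  intros HP. apply (fsop_scal (RtoC (/ 2 ^ n)) (fun h x => Csum (2 ^ n) (fun u =>
    (h (gpt (2 ^ n) (gs n) u) * Phi (x - gpt (2 ^ n) (gs n) u)%R)%C))).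
  apply (fsop_csum _ (fun u h x => (h (gpt (2 ^ n) (gs n) u) * Phi (x - gpt (2 ^ n) (gs n) u)%R)%C)).
  intros u. apply (fsop_point _ S (fun x => Phi (x - gpt (2 ^ n) (gs n) u))).
  apply (TS_shift _ Phi), HP.
Qed.

Lemma fsop_lin T a h g x : fsop T -> T (fun t => (a * h t + g t)%C) x = (a * T h x + T g x)%C.
Proof. induction 1; [cring|]. rewrite IHfsop. cring. Qed.

Lemma fsop_zero T x : fsop T -> T (fun _ => RtoC 0) x = RtoC 0.
Proof. induction 1; [reflexivity|]. rewrite IHfsop. cring. Qed.

Lemma fsop_scal_in T a h x : fsop T -> T (fun t => (a * h t)%C) x = (a * T h x)%C.
Proof.
  intros H. replace (fun t => (a * h t)%C) with (fun t => (a * h t + 0)%C)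
    by (apply functional_extensionality; intros; cring).
  rewrite fsop_lin, fsop_zero by exact H. cring.
Qed.

Lemma fsop_plus_in T h g x : fsop T -> T (fun t => (h t + g t)%C) x = (T h x + T g x)%C.
Proof.
  intros H. replace (fun t => (h t + g t)%C) with (fun t => (RtoC 1 * h t + g t)%C)
    by (apply functional_extensionality; intros; cring).
  rewrite fsop_lin by exact H. cring.
Qed.

Lemma fsop_minus_in T h g x : fsop T -> T (fun t => (h t - g t)%C) x = (T h x - T g x)%C.
Proof.
  intros H. replace (fun t => (h t - g t)%C) with (fun t => ((- (1)) * g t + h t)%C)
    by (apply functional_extensionality; intros; cring).
  rewrite fsop_lin by exact H. cring.
Qed.

Lemma fsop_csum_in T n (F : nat -> R -> C) x : fsop T ->
  T (fun t => Csum n (fun u => F u t)) x = Csum n (fun u => T (F u) x).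
Proof.
  intros H. induction n; simpl; [apply fsop_zero, H|].
  rewrite <- IHn. apply (fsop_plus_in T (fun t => Csum n (fun u => F u t)) (F n) x H).
Qed.

Lemma fsop_bounded T : fsop T -> exists K, 0 <= K /\
  forall h M, (forall t, Cmod (h t) <= M) -> forall x, Cmod (T h x) <= K * M.
Proof.
  induction 1 as [|s S kap T Hk HT [K [HK IH]]].
  - exists 0. split; [lra|]. intros. rewrite Cmod_0. lra.
  - destruct (TS_bounded S kap Hk) as [B [HB Hb]]. exists (B + K). split; [lra|]. intros h M HM x.
    eapply Rle_trans; [apply Cmod_triangle|]. rewrite Cmod_mult.
    specialize (IH h M HM x). specialize (Hb x). pose proof (HM s).
    assert (Cmod (h s) * Cmod (kap x) <= M * B) by (apply Rmult_le_compat; try apply Cmod_ge_0; assumption).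
    lra.
Qed.

(** * Tensor products of one-variable operators *)

Definition lift (T : op1) (i : nat) (g : (nat -> R) -> C) (x : nat -> R) : C :=
  T (fun t => g (upd x i t)) (x i).

Fixpoint nest (d : nat) (T : nat -> op1) (f : (nat -> R) -> C) : (nat -> R) -> C :=
  match d with O => f | S n => lift (T n) n (nest n T f) end.

Lemma BUC_lift d T i g : (i < d)%nat -> fsop T -> BUC d g -> BUC d (lift T i g).
Proof.
  intros Hi HT Hg. unfold lift. induction HT; [apply BUC_const|].
  apply (BUC_plus d (fun x => (g (upd x i s) * kap (x i))%C)); [|exact IHHT].
  apply (BUC_mult d (fun x => g (upd x i s))); [apply BUC_upd, Hg|]. eapply BUC_coord; eassumption.
Qed.

(** [T] is a finite sum, through which the linear operator [T'] passes; a coefficient depending on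
    [x i] is a constant for [T']. *)
Lemma lift_comm T T' i j g x : i <> j -> fsop T -> fsop T' ->
  lift T i (lift T' j g) x = lift T' j (lift T i g) x.
Proof.
  intros Hij HT HT'. unfold lift. induction HT.
  - symmetry. apply fsop_zero, HT'.
  - rewrite IHHT. rewrite (upd_neq x i s j) by auto.
    rewrite (fsop_plus_in T' (fun t => (g (upd (upd x j t) i s) * kap (upd x j t i))%C)
      (fun t => T (fun t0 => g (upd (upd x j t) i t0)) (upd x j t i)) (x j) HT').
    f_equal. rewrite Cmult_comm.
    transitivity (T' (fun t => (kap (x i) * g (upd (upd x i s) j t))%C) (x j)).
    + symmetry. apply fsop_scal_in, HT'.
    + f_equal. apply functional_extensionality. intros t. rewrite (upd_neq x j t i) by auto.
      rewrite (upd_comm x i j) by exact Hij. cring.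
Qed.

Lemma lift_lift T T' i g x : lift T i (lift T' i g) x = lift (fun h => T (T' h)) i g x.
Proof.
  unfold lift. f_equal. apply functional_extensionality. intros t. rewrite upd_eq.
  f_equal. apply functional_extensionality. intros s. rewrite upd_upd. reflexivity.
Qed.

Lemma lift_nest_comm n T T' i g : (n <= i)%nat -> (forall k, fsop (T k)) -> fsop T' ->
  nest n T (lift T' i g) = lift T' i (nest n T g).
Proof.
  intros Hn HT HT'. induction n; [reflexivity|]. simpl. rewrite IHn by lia.
  apply functional_extensionality. intros x. apply lift_comm; auto. lia.
Qed.

Lemma nest_nest n T T' f : (forall k, fsop (T k)) -> (forall k, fsop (T' k)) ->
  nest n T (nest n T' f) = nest n (fun i h => T i (T' i h)) f.
Proof.
  intros HT HT'. induction n; [reflexivity|]. simpl.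
  rewrite lift_nest_comm by auto. rewrite IHn.
  apply functional_extensionality. intros x. apply lift_lift.
Qed.

Lemma BUC_nest d n T f : (n <= d)%nat -> (forall i, fsop (T i)) -> BUC d f -> BUC d (nest n T f).
Proof.
  intros Hn HT Hf. induction n; [exact Hf|]. simpl. apply BUC_lift; [lia|apply HT|apply IHn; lia].
Qed.

Fixpoint CNbox (d N : nat) (F : (nat -> nat) -> C) (j : nat -> nat) : C :=
  match d with
  | O => F j
  | S n => Csum (S N) (fun i => CNbox n N F (updN j n i))
  end.

(** The multi-indices visited by [Nbox] and [CNbox] from the base index [j0]; coordinates from [d]
    on are inherited from it. *)
Definition inN (d N : nat) (j0 j : nat -> nat) : Prop :=
  (forall i, (i < d)%nat -> (j i <= N)%nat) /\ forall i, (d <= i)%nat -> j i = j0 i.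

Lemma inN_step n N m j0 j : (m <= N)%nat -> inN n N (updN j0 n m) j -> inN (S n) N j0 j.
Proof.
  intros Hm [H1 H2]. split.
  - intros i Hi. destruct (Nat.eq_dec i n) as [->|Hne]; [|apply H1; lia].
    rewrite H2 by lia. unfold updN. rewrite Nat.eqb_refl. exact Hm.
  - intros i Hi. rewrite H2 by lia. unfold updN. destruct (Nat.eqb_spec i n); [lia|reflexivity].
Qed.

Lemma CNbox_ext d N F G j0 : (forall j, inN d N j0 j -> F j = G j) -> CNbox d N F j0 = CNbox d N G j0.
Proof.
  revert j0. induction d; intros j0 H; simpl.
  - apply H. split; [lia|reflexivity].
  - apply Csum_ext with (n := S N). intros m Hm. apply IHd. intros j Hj. apply H.
    apply (inN_step d N m); [lia|exact Hj].
Qed.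

Lemma updN_at j n m : updN j n m n = m.
Proof. unfold updN. rewrite Nat.eqb_refl. reflexivity. Qed.

Lemma lift_CNbox T i n N (F : (nat -> nat) -> (nat -> R) -> C) j0 x : fsop T ->
  lift T i (fun y => CNbox n N (fun j => F j y) j0) x = CNbox n N (fun j => lift T i (F j) x) j0.
Proof.
  intros HT. revert j0. induction n; intros j0; [reflexivity|].
  cbn [CNbox]. unfold lift.
  rewrite (fsop_csum_in T (S N) (fun m t => CNbox n N (fun j => F j (upd x i t)) (updN j0 n m)) (x i) HT).
  apply Csum_ext. intros m _. apply IHn.
Qed.

Lemma nest_sum d N (E : nat -> nat -> op1) f x j0 : (forall m i, fsop (E m i)) ->
  CNbox d N (fun j => nest d (fun i => E (j i) i) f x) j0 =
  nest d (fun i h y => Csum (S N) (fun m => E m i h y)) f x.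
Proof.
  intros HE. revert x j0. induction d; intros x j0; [reflexivity|].
  cbn [CNbox nest].
  set (g := nest d (fun i h y => Csum (S N) (fun m => E m i h y)) f) in *.
  transitivity (Csum (S N) (fun m => lift (E m d) d g x)); [|reflexivity].
  apply Csum_ext. intros m Hm.
  transitivity (CNbox d N (fun j => lift (E m d) d (nest d (fun i => E (j i) i) f) x) (updN j0 d m)).
  - apply CNbox_ext. intros j [_ Hj]. rewrite (Hj d) by lia. rewrite updN_at. reflexivity.
  - rewrite <- (lift_CNbox (E m d) d d N (fun j => nest d (fun i => E (j i) i) f)) by apply HE.
    unfold lift. f_equal. apply functional_extensionality. intros t. apply IHd.
Qed.

Definition TPv (i : nat) (D : R) (g : (nat -> R) -> C) : Prop := forall x, TP D (fun t => g (upd x i t)).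

Lemma TPv_lift_other T i j D g : i <> j -> fsop T -> TPv i D g -> TPv i D (lift T j g).
Proof.
  intros Hij HT Hg x. unfold lift.
  apply (TS_eq _ (fun t => T (fun s => g (upd (upd x j s) i t)) (x j))).
  - induction HT; [constructor|].
    apply (TS_plus _ (fun t => (g (upd (upd x j s) i t) * kap (x j))%C)); [|exact IHHT].
    apply (TS_scal_r _ _ (fun t => g (upd (upd x j s) i t))), Hg.
  - intros t. rewrite upd_neq by auto. f_equal. apply functional_extensionality. intros s.
    rewrite (upd_comm x j i) by auto. reflexivity.
Qed.

Lemma TPv_lift_same T i D g : (forall h, TP D (T h)) -> TPv i D (lift T i g).
Proof.
  intros HT x. eapply TS_eq; [apply (HT (fun s => g (upd x i s)))|]. intros t. unfold lift.
  rewrite upd_eq. f_equal. apply functional_extensionality. intros s. rewrite upd_upd. reflexivity.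
Qed.

Lemma TPv_nest_ge n T i D g : (n <= i)%nat -> (forall k, fsop (T k)) -> TPv i D g -> TPv i D (nest n T g).
Proof.
  intros Hn HT Hg. induction n; [exact Hg|]. simpl. apply TPv_lift_other; [lia|apply HT|apply IHn; lia].
Qed.

Lemma TPv_nest_lt n T i D g : (i < n)%nat -> (forall k, fsop (T k)) -> (forall h, TP D (T i h)) ->
  TPv i D (nest n T g).
Proof.
  intros Hi HT HD. induction n; [lia|]. simpl. destruct (Nat.eq_dec i n) as [->|Hne].
  - apply TPv_lift_same, HD.
  - apply TPv_lift_other; [exact Hne|apply HT|apply IHn; lia].
Qed.

(** * Uniform continuity of continuous periodic functions *)

Lemma cont_periodic_Cmod d f : cont_periodic d f ->
  forall x eps, 0 < eps -> exists del, 0 < del /\ forall y, near d del y x -> Cmod (f y - f x) < eps.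
Proof.
  intros [_ [_ H]] x eps He. destruct (H x eps He) as [del [Hd Hy]]. exists del. split; [exact Hd|].
  intros y Hn. rewrite <- Cabs_sub. apply Hy. exact Hn.
Qed.

(* Compactness in one coordinate at a time. *)
Lemma uniform_on_box d f n : cont_periodic d f -> (n <= d)%nat -> forall x eps, 0 < eps ->
  exists del, 0 < del /\ forall z, (forall i, (i < n)%nat -> - PI <= z i <= PI) ->
    (forall i, (n <= i < d)%nat -> Rabs (z i - x i) < del) ->
    forall y, near d del y z -> Cmod (f y - f z) < eps.
Proof.
  intros Hf. induction n; intros Hn x eps He.
  - destruct (cont_periodic_Cmod d f Hf x (eps / 2) ltac:(lra)) as [del [Hd H]].
    exists (del / 2). split; [lra|]. intros z _ Hz y Hy.
    pose proof (H z ltac:(intros i Hi; specialize (Hz i ltac:(lia)); lra)) as B1.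
    assert (B2 : Cmod (f y - f x) < eps / 2).
    { apply H. intros i Hi. specialize (Hz i ltac:(lia)). specialize (Hy i Hi).
      replace (y i - x i) with ((y i - z i) + (z i - x i)) by ring.
      eapply Rle_lt_trans; [apply Rabs_triang|]. lra. }
    pose proof (Cmod_sub3 (f y) (f x) (f z)) as T. rewrite (Cmod_minus_sym (f x)) in T. lra.
  - assert (HP : forall t, exists del, 0 < del /\ forall z, (forall i, (i < n)%nat -> - PI <= z i <= PI) ->
      (forall i, (n <= i < d)%nat -> Rabs (z i - upd x n t i) < del) ->
      forall y, near d del y z -> Cmod (f y - f z) < eps) by (intros t; apply IHn; [lia|exact He]).
    (* The covering argument needs the radius as a function of the centre, so it is selected by a
       choice principle. *)
    set (del := fun t => proj1_sig (constructive_indefinite_description _ (HP t))).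
    assert (Hdel : forall t, 0 < del t /\ forall z, (forall i, (i < n)%nat -> - PI <= z i <= PI) ->
      (forall i, (n <= i < d)%nat -> Rabs (z i - upd x n t i) < del t) ->
      forall y, near d (del t) y z -> Cmod (f y - f z) < eps)
      by (intros t; exact (proj2_sig (constructive_indefinite_description _ (HP t)))).
    destruct (compactness_value_1d (- PI) PI (fun t => mkposreal (del t) (proj1 (Hdel t)))) as [e He2].
    exists e. split; [apply cond_pos|]. intros z Hz Hz2 y Hy.
    (* The covering is available in doubly negated form only; as the goal is decidable, it is used
       by contradiction. *)
    destruct (Rlt_dec (Cmod (f y - f z)) eps) as [Hl|Hl]; [exact Hl|exfalso].
    apply (He2 (z n) (Hz n ltac:(lia))). intros [t [Ht [H1 H2]]]. simpl in H1, H2. apply Hl.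
    apply (proj2 (Hdel t)).
    + intros i Hi. apply Hz. lia.
    + intros i Hi. destruct (Nat.eq_dec i n) as [->|Hne]; [rewrite upd_eq; exact H1|].
      rewrite upd_neq by exact Hne. specialize (Hz2 i ltac:(lia)). lra.
    + intros i Hi. specialize (Hy i Hi). lra.
Qed.

Lemma cont_periodic_upd d f x i k : cont_periodic d f -> (i < d)%nat ->
  f (upd x i (x i + 2 * PI * IZR k)) = f x.
Proof.
  intros [_ [Hp _]] Hi.
  assert (N : forall n x, f (upd x i (x i + 2 * PI * INR n)) = f x).
  { induction n; intros y.
    - simpl. rewrite Rmult_0_r, Rplus_0_r, upd_id. reflexivity.
    - rewrite <- (IHn y). rewrite <- (Hp (upd y i (y i + 2 * PI * INR n)) i Hi).
      rewrite upd_eq, upd_upd. f_equal. f_equal. rewrite S_INR. ring. }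
  destruct (Z_le_gt_dec 0 k) as [H|H].
  - rewrite <- (Z2Nat.id k H), <- INR_IZR_INZ. apply N.
  - rewrite <- (N (Z.to_nat (- k)) (upd x i (x i + 2 * PI * IZR k))). rewrite upd_eq, upd_upd.
    rewrite INR_IZR_INZ, Z2Nat.id, opp_IZR by lia.
    replace (x i + 2 * PI * IZR k + 2 * PI * - IZR k) with (x i) by ring. rewrite upd_id. reflexivity.
Qed.

Lemma cont_periodic_shift d f x (k : nat -> Z) : cont_periodic d f ->
  f (fun i => x i + 2 * PI * IZR (k i)) = f x.
Proof.
  intros Hf.
  set (sh := fun n i => if lt_dec i n then x i + 2 * PI * IZR (k i) else x i).
  assert (H : forall n, (n <= d)%nat -> f (sh n) = f x).
  { induction n; intros Hn.
    - f_equal.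
    - rewrite <- IHn by lia. rewrite <- (cont_periodic_upd d f (sh n) n (k n) Hf ltac:(lia)).
      f_equal. apply functional_extensionality. intros i. unfold sh, upd.
      destruct (Nat.eqb_spec i n) as [->|Hne].
      + destruct (lt_dec n (S n)), (lt_dec n n); try lia. reflexivity.
      + destruct (lt_dec i (S n)), (lt_dec i n); try lia; reflexivity. }
  rewrite <- (H d) by lia. apply (proj1 Hf). intros i Hi. unfold sh. destruct (lt_dec i d); [reflexivity|lia].
Qed.

Lemma cont_periodic_uc d f : cont_periodic d f -> forall eps, 0 < eps ->
  exists del, 0 < del /\ forall x y, near d del x y -> Cmod (f x - f y) <= eps.
Proof.
  intros Hf eps He. destruct (uniform_on_box d f d Hf (Nat.le_refl d) (fun _ => 0) eps He) as [del [Hd H]].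
  exists del. split; [exact Hd|]. intros x y Hxy.
  assert (HK : forall i, exists k, - PI <= y i + 2 * PI * IZR k <= PI) by (intros; apply mod2PI).
  set (k := fun i => proj1_sig (constructive_indefinite_description _ (HK i))).
  assert (Hk : forall i, - PI <= y i + 2 * PI * IZR (k i) <= PI)
    by (intros i; exact (proj2_sig (constructive_indefinite_description _ (HK i)))).
  rewrite <- (cont_periodic_shift d f x k Hf), <- (cont_periodic_shift d f y k Hf).
  apply Rlt_le. apply H; [intros; apply Hk|lia|]. intros i Hi.
  replace (x i + 2 * PI * IZR (k i) - (y i + 2 * PI * IZR (k i))) with (x i - y i) by ring. apply Hxy, Hi.
Qed.

Lemma cont_periodic_BUC d f : cont_periodic d f -> BUC d f.
Proof.
  intros Hf. split; [|apply cont_periodic_uc, Hf].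
  destruct (cont_periodic_uc d f Hf 1 ltac:(lra)) as [del [Hd H]].
  destruct (INR_unbounded (PI / del)) as [K0 HK0]. set (K := S K0).
  assert (HK : PI / INR K < del).
  { assert (INR K0 < INR K) by (apply lt_INR; unfold K; lia). pose proof PI_RGT_0.
    assert (0 < PI / del) by (apply Rdiv_lt_0_compat; lra).
    pose proof (pos_INR K0). apply Rlt_div_l; [lra|]. apply Rlt_div_l in HK0; [|lra].
    apply Rlt_trans with (INR K0 * del); [exact HK0|]. rewrite Rmult_comm. apply Rmult_lt_compat_l; lra. }
  assert (HKp : 0 < INR K) by (apply lt_0_INR; unfold K; lia).
  exists (Cmod (f (fun _ => 0)) + INR K). intros x.
  assert (HKx : forall i, exists k, - PI <= x i + 2 * PI * IZR k <= PI) by (intros; apply mod2PI).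
  set (k := fun i => proj1_sig (constructive_indefinite_description _ (HKx i))).
  assert (Hk : forall i, - PI <= x i + 2 * PI * IZR (k i) <= PI)
    by (intros i; exact (proj2_sig (constructive_indefinite_description _ (HKx i)))).
  rewrite <- (cont_periodic_shift d f x k Hf). set (z := fun i => x i + 2 * PI * IZR (k i)).
  (* A walk from the origin to [z] in [K] steps, each moving every coordinate by less than [del] and
     so changing [f] by at most 1. *)
  assert (St : forall m, Cmod (f (fun i => INR m / INR K * z i)) <= Cmod (f (fun _ => 0)) + INR m).
  { induction m.
    - change (INR 0) with 0. rewrite Rplus_0_r.
      replace (fun i => 0 / INR K * z i) with (fun _ : nat => 0); [apply Rle_refl|].
      apply functional_extensionality. intros i. unfold Rdiv. ring.
    - eapply Rle_trans; [apply (Cmod_triangle_sub _ (f (fun i => INR m / INR K * z i)))|].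
      rewrite S_INR. assert (Cmod (f (fun i => (INR m + 1) / INR K * z i) - f (fun i => INR m / INR K * z i)) <= 1);
        [|lra].
      apply H. intros i Hi.
      replace ((INR m + 1) / INR K * z i - INR m / INR K * z i) with (z i / INR K) by (field; lra).
      unfold Rdiv. rewrite Rabs_mult, (Rabs_pos_eq (/ INR K)) by (apply Rlt_le, Rinv_0_lt_compat, HKp).
      eapply Rle_lt_trans; [|exact HK]. apply Rmult_le_compat_r; [apply Rlt_le, Rinv_0_lt_compat, HKp|].
      apply Rabs_le. apply Hk. }
  specialize (St K). replace (fun i => INR K / INR K * z i) with z in St; [exact St|].
  apply functional_extensionality. intros i. field. lra.
Qed.

(** * Sums over boxes of multi-indices *)

Lemma Nbox_le d N F G j0 : (forall j, inN d N j0 j -> F j <= G j) -> Nbox d N F j0 <= Nbox d N G j0.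
Proof.
  revert j0. induction d; intros j0 H; simpl.
  - apply H. split; [lia|reflexivity].
  - apply (Rsum_le (S N)). intros m Hm. apply IHd. intros j Hj. apply H.
    apply (inN_step d N m); [lia|exact Hj].
Qed.

Lemma Nbox_ext d N F G j0 : (forall j, inN d N j0 j -> F j = G j) -> Nbox d N F j0 = Nbox d N G j0.
Proof. intros H. apply Rle_antisym; apply Nbox_le; intros j Hj; rewrite (H j Hj); lra. Qed.

Lemma Nbox_scal d N a F j0 : Nbox d N (fun j => a * F j) j0 = a * Nbox d N F j0.
Proof.
  revert j0. induction d; intros j0; [reflexivity|]. cbn [Nbox]. rewrite <- Rsum_scal.
  apply Rsum_ext. intros; apply IHd.
Qed.

Lemma Nbox_plus d N F G j0 : Nbox d N (fun j => F j + G j) j0 = Nbox d N F j0 + Nbox d N G j0.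
Proof.
  revert j0. induction d; intros j0; [reflexivity|]. cbn [Nbox]. rewrite <- Rsum_plus.
  apply Rsum_ext. intros; apply IHd.
Qed.

Lemma Nbox_const d N a j0 : Nbox d N (fun _ => a) j0 = INR (S N) ^ d * a.
Proof.
  revert j0. induction d; intros j0; [simpl; ring|]. cbn [Nbox].
  rewrite (Rsum_ext _ _ (fun _ => INR (S N) ^ d * a)) by (intros; apply IHd).
  rewrite Rsum_const. change (INR (S N) ^ S d) with (INR (S N) * INR (S N) ^ d). ring.
Qed.

Lemma Nbox_nonneg d N F j0 : (forall j, 0 <= F j) -> 0 <= Nbox d N F j0.
Proof.
  intros H. replace 0 with (Nbox d N (fun _ => 0) j0) by (rewrite Nbox_const; ring).
  apply Nbox_le. intros; apply H.
Qed.

Lemma Nbox_ge_term d N F j0 j : (forall j, 0 <= F j) -> inN d N j0 j -> F j <= Nbox d N F j0.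
Proof.
  intros HF. revert j0. induction d; intros j0 [H1 H2].
  - simpl. replace j0 with j; [lra|]. apply functional_extensionality. intros; apply H2; lia.
  - cbn [Nbox]. apply Rle_trans with (Nbox d N F (updN j0 d (j d))).
    + apply IHd. split; [intros; apply H1; lia|]. intros i Hi. unfold updN.
      destruct (Nat.eqb_spec i d); [subst; reflexivity|]. apply H2; lia.
    + apply (Rsum_ge_term (S N) (fun m => Nbox d N F (updN j0 d m))).
      * intros; apply Nbox_nonneg, HF.
      * specialize (H1 d ltac:(lia)). lia.
Qed.

Lemma Nbox_swap d N d' N' F j0 l0 :
  Nbox d N (fun j => Nbox d' N' (fun l => F j l) l0) j0 =
  Nbox d' N' (fun l => Nbox d N (fun j => F j l) j0) l0.
Proof.
  revert j0. induction d; intros j0; [reflexivity|]. cbn [Nbox].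
  rewrite (Rsum_ext _ _ (fun m => Nbox d' N' (fun l => Nbox d N (fun j => F j l) (updN j0 d m)) l0))
    by (intros; apply IHd).
  generalize (S N). intros n. induction n; simpl.
  - rewrite Nbox_const. ring.
  - rewrite IHn, Nbox_plus. reflexivity.
Qed.

Lemma Nbox_prod d N (w : nat -> nat -> R) j0 :
  Nbox d N (fun j => Rprod d (fun i => w i (j i))) j0 = Rprod d (fun i => Rsum (S N) (w i)).
Proof.
  revert j0. induction d; intros j0; [reflexivity|]. cbn [Nbox Rprod].
  transitivity (Rsum (S N) (fun m => Nbox d N (fun j => w d m * Rprod d (fun i => w i (j i))) (updN j0 d m))).
  - apply Rsum_ext. intros m _. apply Nbox_ext. intros j [_ Hj]. rewrite (Hj d) by lia.
    rewrite updN_at. ring.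
  - rewrite (Rsum_ext _ _ (fun m => w d m * Rprod d (fun i => Rsum (S N) (w i))))
      by (intros; rewrite Nbox_scal, IHd; reflexivity).
    rewrite Rsum_scal_r. ring.
Qed.

Lemma rpow_Nbox_weight d N F w W q j0 : 0 < q -> (forall j, 0 <= F j) -> (forall j, 0 < w j) ->
  Nbox d N (fun j => / w j) j0 <= W ->
  rpow (Nbox d N F j0) q <= rpow W q * Nbox d N (fun j => rpow (w j * F j) q) j0.
Proof.
  intros Hq HF Hw HW.
  set (S := Nbox d N (fun j => rpow (w j * F j) q) j0).
  assert (HS : 0 <= S) by (apply Nbox_nonneg; intros; apply rpow_ge0).
  assert (HWp : 0 <= W).
  { eapply Rle_trans; [|exact HW]. apply Nbox_nonneg; intros. apply Rlt_le, Rinv_0_lt_compat, Hw. }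
  rewrite <- (rpow_inv_l S q) by assumption.
  rewrite <- rpow_mult by (try apply rpow_ge0; assumption).
  apply rpow_le; [lra|]. split; [apply Nbox_nonneg, HF|].
  apply Rle_trans with (rpow S (1 / q) * Nbox d N (fun j => / w j) j0);
    [|rewrite Rmult_comm; apply Rmult_le_compat_r; [apply rpow_ge0|exact HW]].
  rewrite <- Nbox_scal. apply Nbox_le. intros j Hj. specialize (Hw j). specialize (HF j).
  apply (Rmult_le_reg_r (w j)); [exact Hw|]. rewrite Rmult_assoc, Rinv_l, Rmult_1_r by lra.
  rewrite Rmult_comm, <- (rpow_inv_r (w j * F j) q) by nra.
  apply rpow_le; [apply Rlt_le, Rdiv_lt_0_compat; lra|]. split; [apply rpow_ge0|].
  apply (Nbox_ge_term d N (fun j => rpow (w j * F j) q)); [intros; apply rpow_ge0|exact Hj].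
Qed.

Lemma Cmod_CNbox d N (F : (nat -> nat) -> C) j0 : Cmod (CNbox d N F j0) <= Nbox d N (fun j => Cmod (F j)) j0.
Proof.
  revert j0. induction d; intros j0; [apply Rle_refl|]. cbn [CNbox Nbox].
  eapply Rle_trans; [apply Cmod_Csum|]. apply Rsum_le. intros; apply IHd.
Qed.

(** * Iterated integrals *)

Definition RBU (d : nat) (F : (nat -> R) -> R) : Prop :=
  (exists M, forall x, Rabs (F x) <= M) /\
  forall eps, 0 < eps -> exists e, 0 < e /\ forall x y, near d e x y -> Rabs (F x - F y) <= eps.

Lemma RBU_rpow d g q : 0 < q -> BUC d g -> RBU d (fun x => rpow (Cmod (g x)) q).
Proof.
  intros Hq [[M HM] Hg]. split.
  - exists (rpow M q). intros x. rewrite Rabs_pos_eq by apply rpow_ge0. apply rpow_le; [lra|].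
    split; [apply Cmod_ge_0|apply HM].
  - intros eps He.
    destruct (Heine_cor2 (f := fun z => rpow z q) (a := 0) (b := M)
      ltac:(intros; apply continuity_pt_filterlim, rpow_continuous, Hq) (mkposreal eps He)) as [de Hde].
    destruct (Hg (de / 2) ltac:(pose proof (cond_pos de); lra)) as [e [He1 H]].
    exists e. split; [exact He1|]. intros x y Hxy. apply Rlt_le. apply Hde.
    + split; [apply Cmod_ge_0|apply HM].
    + split; [apply Cmod_ge_0|apply HM].
    + eapply Rle_lt_trans; [apply Cmod_rev_triangle|]. specialize (H x y Hxy).
      pose proof (cond_pos de). lra.
Qed.

Lemma RBU_ext d F G : (forall x, F x = G x) -> RBU d F -> RBU d G.
Proof.
  intros E H. replace G with F; [exact H|]. apply functional_extensionality, E.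
Qed.

Lemma RBU_plus d F G : RBU d F -> RBU d G -> RBU d (fun x => F x + G x).
Proof.
  intros [[M HM] HF] [[M' HM'] HG]. split.
  - exists (M + M'). intros x. eapply Rle_trans; [apply Rabs_triang|]. specialize (HM x); specialize (HM' x); lra.
  - intros eps He. destruct (HF (eps / 2) ltac:(lra)) as [e [He1 H1]].
    destruct (HG (eps / 2) ltac:(lra)) as [e' [He2 H2]].
    exists (Rmin e e'). split; [apply Rmin_glb_lt; assumption|]. intros x y Hxy.
    replace (F x + G x - (F y + G y)) with ((F x - F y) + (G x - G y)) by ring.
    eapply Rle_trans; [apply Rabs_triang|].
    pose proof (H1 x y (near_mono _ _ _ _ _ (Rmin_l _ _) Hxy)).
    pose proof (H2 x y (near_mono _ _ _ _ _ (Rmin_r _ _) Hxy)). lra.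
Qed.

Lemma RBU_const d c : RBU d (fun _ => c).
Proof.
  split; [exists (Rabs c); intros; lra|]. intros eps He. exists 1. split; [lra|]. intros.
  rewrite Rminus_diag, Rabs_R0. lra.
Qed.

Lemma RBU_scal d a F : RBU d F -> RBU d (fun x => a * F x).
Proof.
  intros [[M HM] HF]. pose proof (Rabs_pos a) as Ha. split.
  - exists (Rabs a * M). intros x. rewrite Rabs_mult. apply Rmult_le_compat_l; [exact Ha|apply HM].
  - intros eps He. destruct (HF (eps / (Rabs a + 1)) ltac:(apply Rdiv_lt_0_compat; lra)) as [e [He1 H]].
    exists e. split; [exact He1|]. intros x y Hxy. rewrite <- Rmult_minus_distr_l, Rabs_mult.
    specialize (H x y Hxy). apply Rle_trans with ((Rabs a + 1) * (eps / (Rabs a + 1))).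
    + apply Rmult_le_compat; try apply Rabs_pos; lra.
    + right. field. lra.
Qed.

Lemma RBU_Rsum d n (F : nat -> (nat -> R) -> R) : (forall u, RBU d (F u)) -> RBU d (fun x => Rsum n (fun u => F u x)).
Proof.
  intros H. induction n; simpl; [apply RBU_const|].
  apply (RBU_plus d (fun x => Rsum n (fun u => F u x)) (F n)); auto.
Qed.

Lemma RBU_Nbox d n N (F : (nat -> nat) -> (nat -> R) -> R) j0 : (forall j, RBU d (F j)) ->
  RBU d (fun x => Nbox n N (fun j => F j x) j0).
Proof.
  intros H. revert j0. induction n; intros j0; [apply H|]. cbn [Nbox].
  apply (RBU_Rsum d (S N) (fun m x => Nbox n N (fun j => F j x) (updN j0 n m))). intros; apply IHn.
Qed.

Lemma RBU_line d F x i t : RBU d F -> (i < d)%nat -> continuous (fun t => F (upd x i t)) t.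
Proof.
  intros [_ HF] Hi. apply continuity_pt_filterlim. intros eps He.
  destruct (HF (eps / 2) ltac:(lra)) as [e [He1 H]]. exists e. split; [exact He1|].
  intros s [_ Hs]. simpl in *. unfold R_dist in *. apply Rle_lt_trans with (eps / 2); [|lra].
  apply H, near_upd; [exact He1| |exact Hs]. intros k _. rewrite Rminus_diag, Rabs_R0. exact He1.
Qed.

Lemma DRInt_eq f a b : ex_RInt f a b -> Defs.RInt f a b = RInt f a b.
Proof.
  intros H. unfold Defs.RInt.
  destruct (excluded_middle_informative _) as [Hi|Hi].
  - symmetry. apply RInt_Reals.
  - exfalso. apply Hi. constructor. apply ex_RInt_Reals_0, H.
Qed.

Lemma RInt_abs_bound (f : R -> R) b : (forall t, continuous f t) -> (forall t, Rabs (f t) <= b) ->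
  Rabs (RInt f (- PI) PI) <= 2 * PI * b.
Proof.
  intros Hc Hb. pose proof PI_RGT_0. replace (2 * PI) with (PI - - PI) by ring.
  apply abs_RInt_le_const; [lra|apply ex_RInt_cont, Hc|auto].
Qed.

Lemma RInt_diff_bound (f g : R -> R) b : (forall t, continuous f t) -> (forall t, continuous g t) ->
  (forall t, Rabs (f t - g t) <= b) -> Rabs (RInt f (- PI) PI - RInt g (- PI) PI) <= 2 * PI * b.
Proof.
  intros Hf Hg Hb.
  replace (RInt f (- PI) PI - RInt g (- PI) PI) with (RInt (fun t => f t - g t) (- PI) PI).
  - apply RInt_abs_bound; [|exact Hb]. intros t. apply (continuous_minus f g); auto.
  - apply (RInt_minus (V := R_CompleteNormedModule)); apply ex_RInt_cont; assumption.
Qed.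

Lemma intbox_S n F x : intbox (S n) F x = Defs.RInt (fun t => intbox n F (upd x n t)) (- PI) PI.
Proof. reflexivity. Qed.

Lemma RBU_RInt d F i : (i < d)%nat -> RBU d F -> RBU d (fun x => RInt (fun t => F (upd x i t)) (- PI) PI).
Proof.
  intros Hi HF. pose proof HF as [[M HM] HU]. pose proof PI_RGT_0. split.
  - exists (2 * PI * M). intros x. apply RInt_abs_bound; [intros; apply (RBU_line d); assumption|auto].
  - intros eps He. destruct (HU (eps / (2 * PI)) ltac:(apply Rdiv_lt_0_compat; lra)) as [e [He1 H1]].
    exists e. split; [exact He1|]. intros x y Hxy.
    replace eps with (2 * PI * (eps / (2 * PI))) by (field; lra).
    apply RInt_diff_bound; try (intros; apply (RBU_line d); assumption).
    intros t. apply H1, near_upd; [exact He1|exact Hxy|]. rewrite Rminus_diag, Rabs_R0. exact He1.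
Qed.

Lemma intbox_RBU d n F : (n <= d)%nat -> RBU d F -> RBU d (intbox n F).
Proof.
  intros Hn HF. induction n; [exact HF|]. specialize (IHn ltac:(lia)).
  apply (RBU_ext d (fun x => RInt (fun t => intbox n F (upd x n t)) (- PI) PI)); [|apply RBU_RInt; [lia|exact IHn]].
  intros x. rewrite intbox_S, DRInt_eq; [reflexivity|]. apply ex_RInt_cont. intros; apply (RBU_line d); [exact IHn|lia].
Qed.

Lemma intbox_S' d n F x : (n < d)%nat -> RBU d F ->
  intbox (S n) F x = RInt (fun t => intbox n F (upd x n t)) (- PI) PI.
Proof.
  intros Hn HF. rewrite intbox_S, DRInt_eq; [reflexivity|]. apply ex_RInt_cont. intros.
  apply (RBU_line d); [apply intbox_RBU; [lia|exact HF]|exact Hn].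
Qed.

Lemma intbox_mono d n F G x : (n <= d)%nat -> RBU d F -> RBU d G -> (forall x, F x <= G x) ->
  intbox n F x <= intbox n G x.
Proof.
  intros Hn HF HG H. revert x. induction n; intros x; [apply H|]. pose proof PI_RGT_0.
  rewrite !(intbox_S' d) by (assumption || lia). apply RInt_mono; [lra| | |].
  - intros t. apply (RBU_line d); [apply intbox_RBU; [lia|exact HF]|lia].
  - intros t. apply (RBU_line d); [apply intbox_RBU; [lia|exact HG]|lia].
  - intros t. apply IHn. lia.
Qed.

Lemma intbox_plus d n F G x : (n <= d)%nat -> RBU d F -> RBU d G ->
  intbox n (fun x => F x + G x) x = intbox n F x + intbox n G x.
Proof.
  intros Hn HF HG. revert x. induction n; intros x; [reflexivity|].
  rewrite !(intbox_S' d) by (try apply RBU_plus; assumption || lia).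
  rewrite (RInt_ext _ (fun t => intbox n F (upd x n t) + intbox n G (upd x n t)))
    by (intros; apply IHn; lia).
  apply (RInt_plus (V := R_CompleteNormedModule)); apply ex_RInt_cont; intros t;
    (apply (RBU_line d); [apply intbox_RBU; [lia|assumption]|lia]).
Qed.

Lemma intbox_scal d n a F x : (n <= d)%nat -> RBU d F ->
  intbox n (fun x => a * F x) x = a * intbox n F x.
Proof.
  intros Hn HF. revert x. induction n; intros x; [reflexivity|].
  rewrite !(intbox_S' d) by (try apply RBU_scal; assumption || lia).
  rewrite (RInt_ext _ (fun t => a * intbox n F (upd x n t))) by (intros; apply IHn; lia).
  apply RInt_scal_R. intros t. apply (RBU_line d); [apply intbox_RBU; [lia|assumption]|lia].
Qed.

Lemma intbox_const d n c x : (n <= d)%nat -> intbox n (fun _ => c) x = (2 * PI) ^ n * c.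
Proof.
  intros Hn. revert x. induction n; intros x; [simpl; ring|].
  rewrite (intbox_S' d) by (try apply RBU_const; lia).
  rewrite (RInt_ext _ (fun _ => (2 * PI) ^ n * c)) by (intros; apply IHn; lia).
  rewrite RInt_const_R. simpl. ring.
Qed.

Lemma intbox_Rsum d n m (F : nat -> (nat -> R) -> R) x : (n <= d)%nat -> (forall u, RBU d (F u)) ->
  intbox n (fun x => Rsum m (fun u => F u x)) x = Rsum m (fun u => intbox n (F u) x).
Proof.
  intros Hn HF. induction m; simpl.
  - rewrite (intbox_const d) by exact Hn. ring.
  - rewrite <- IHm. apply (intbox_plus d n (fun x => Rsum m (fun u => F u x)) (F m)); auto.
    apply RBU_Rsum, HF.
Qed.

Lemma intbox_Nbox d n m N (F : (nat -> nat) -> (nat -> R) -> R) j0 x : (n <= d)%nat ->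
  (forall j, RBU d (F j)) ->
  intbox n (fun x => Nbox m N (fun j => F j x) j0) x = Nbox m N (fun j => intbox n (F j) x) j0.
Proof.
  intros Hn HF. revert j0. induction m; intros j0; [reflexivity|]. cbn [Nbox].
  rewrite (intbox_Rsum d n (S N) (fun k x => Nbox m N (fun j => F j x) (updN j0 m k))) by
    (try exact Hn; intros; apply RBU_Nbox, HF).
  apply Rsum_ext. intros k _. apply IHm.
Qed.

(** * Dyadic averages and Fubini's theorem *)

Fixpoint avgb (d N : nat) (F : (nat -> R) -> R) (x : nat -> R) : R :=
  match d with
  | O => F x
  | S n => / 2 ^ N * Rsum (2 ^ N) (fun u => avgb n N F (upd x n (gpt (2 ^ N) (gs N) u)))
  end.

Lemma riemann_cells (f : R -> R) a h n eps : 0 <= h -> (forall t, continuous f t) ->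
  (forall s t, Rabs (s - t) <= h -> Rabs (f s - f t) <= eps) ->
  Rabs (RInt f a (a + INR n * h) - h * Rsum n (fun u => f (a + INR u * h))) <= INR n * h * eps.
Proof.
  intros Hh Hc Ho. induction n.
  - simpl. rewrite Rmult_0_l, Rplus_0_r, RInt_point. unfold zero; simpl.
    replace (0 - h * 0) with 0 by ring. rewrite Rabs_R0. lra.
  - rewrite S_INR. simpl Rsum.
    pose proof (RInt_Chasles f a (a + INR n * h) (a + (INR n + 1) * h)
      (ex_RInt_cont _ _ _ Hc) (ex_RInt_cont _ _ _ Hc)) as E. unfold plus in E; simpl in E. rewrite <- E.
    set (b := a + INR n * h) in *.
    assert (B : Rabs (RInt f b (a + (INR n + 1) * h) - h * f b) <= h * eps).
    { replace (a + (INR n + 1) * h) with (b + h) by (unfold b; ring).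
      assert (E2 : h * f b = RInt (fun _ => f b) b (b + h)) by (rewrite RInt_const_R; set (y := f b); clearbody y; clearbody b; match goal with |- ?u = ?v => change (u = v :> R) end; ring). rewrite E2.
      replace (RInt f b (b + h) - RInt (fun _ => f b) b (b + h)) with (RInt (fun t => f t - f b) b (b + h))
        by (apply (RInt_minus (V := R_CompleteNormedModule)); apply ex_RInt_cont; [exact Hc|intros; apply continuous_const]).
      replace (h * eps) with ((b + h - b) * eps) by ring.
      apply abs_RInt_le_const; [lra| |].
      - apply ex_RInt_cont. intros t. apply (continuous_minus f); [apply Hc|apply continuous_const].
      - intros t Ht. apply Ho. apply Rabs_le. lra. }
    match goal with |- Rabs (?p + ?q - h * (?s + ?r)) <= _ =>
      replace (p + q - h * (s + r)) with ((p - h * s) + (q - h * r)) by ring end.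
    eapply Rle_trans; [apply Rabs_triang|]. lra.
Qed.

Lemma riemann_grid (f : R -> R) N eps : (1 <= N)%nat -> (forall t, continuous f t) ->
  (forall s t, Rabs (s - t) <= 2 * PI / 2 ^ N -> Rabs (f s - f t) <= eps) ->
  Rabs (RInt f (- PI) PI - 2 * PI * (/ 2 ^ N * Rsum (2 ^ N) (fun u => f (gpt (2 ^ N) (gs N) u)))) <= 2 * PI * eps.
Proof.
  intros HN Hc Ho. pose proof (pow2_gt0 N) as Hp. pose proof PI_RGT_0.
  pose proof (riemann_cells f (- PI) (2 * PI / 2 ^ N) (2 ^ N) eps
    ltac:(apply Rlt_le, Rdiv_lt_0_compat; lra) Hc Ho) as B.
  rewrite INR_pow2 in B. replace (2 ^ N * (2 * PI / 2 ^ N)) with (2 * PI) in B by (field; lra).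
  replace (- PI + 2 * PI) with PI in B by ring.
  replace (2 * PI * (/ 2 ^ N * Rsum (2 ^ N) (fun u => f (gpt (2 ^ N) (gs N) u)))) with
    (2 * PI / 2 ^ N * Rsum (2 ^ N) (fun u => f (- PI + INR u * (2 * PI / 2 ^ N)))); [exact B|].
  unfold Rdiv at 1. rewrite Rmult_assoc. do 2 f_equal. apply Rsum_ext. intros u _. f_equal.
  unfold gpt, gs. destruct N; [lia|]. rewrite INR_pow2. field. lra.
Qed.

Lemma grid_mean_bound N (F G : nat -> R) b : (forall u, Rabs (F u - G u) <= b) ->
  Rabs (/ 2 ^ N * Rsum (2 ^ N) F - / 2 ^ N * Rsum (2 ^ N) G) <= b.
Proof.
  intros H. pose proof (pow2_gt0 N) as Hp. pose proof (Rinv_0_lt_compat _ Hp).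
  replace (/ 2 ^ N * Rsum (2 ^ N) F - / 2 ^ N * Rsum (2 ^ N) G) with
    (/ 2 ^ N * Rsum (2 ^ N) (fun u => F u + -1 * G u)) by (rewrite Rsum_plus, Rsum_scal; ring).
  rewrite Rabs_mult, Rabs_pos_eq by lra.
  assert (B : Rabs (Rsum (2 ^ N) (fun u => F u + -1 * G u)) <= 2 ^ N * b).
  { eapply Rle_trans; [apply Rsum_Rabs|]. rewrite <- (INR_pow2 N). apply Rsum_le_const. intros u _.
    replace (F u + -1 * G u) with (F u - G u) by ring. apply H. }
  apply Rmult_le_compat_l with (r := / 2 ^ N) in B; [|lra].
  rewrite <- Rmult_assoc, Rinv_l, Rmult_1_l in B by lra. exact B.
Qed.

Lemma mesh_small e : 0 < e -> exists N0, forall N, (N0 <= N)%nat -> (1 <= N)%nat /\ 2 * PI / 2 ^ N < e.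
Proof.
  intros He. destruct (pow2_unbounded (2 * PI / e)) as [N0 H]. exists (S N0). intros N HN.
  split; [lia|]. specialize (H N ltac:(lia)). pose proof (pow2_gt0 N).
  apply Rlt_div_l; [assumption|]. apply Rlt_div_l in H; lra.
Qed.

Lemma line_mesh d F i e eps x N : (forall x y, near d e x y -> Rabs (F x - F y) <= eps) -> 0 < e ->
  2 * PI / 2 ^ N < e -> forall s t, Rabs (s - t) <= 2 * PI / 2 ^ N -> Rabs (F (upd x i s) - F (upd x i t)) <= eps.
Proof.
  intros H He HN s t Hst. apply H, near_upd; [exact He| |lra].
  intros k _. rewrite Rminus_diag, Rabs_R0. exact He.
Qed.

Lemma intbox_avgb d n F : (n <= d)%nat -> RBU d F -> forall eps, 0 < eps ->
  exists N0, forall N, (N0 <= N)%nat -> forall x, Rabs (intbox n F x - (2 * PI) ^ n * avgb n N F x) <= eps.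
Proof.
  intros Hn HF. pose proof PI_RGT_0 as HPI. induction n; intros eps He.
  - exists O. intros N _ x. simpl. rewrite Rmult_1_l, Rminus_diag, Rabs_R0. lra.
  - set (e1 := eps / (4 * PI)). assert (He1 : 0 < e1) by (apply Rdiv_lt_0_compat; lra).
    destruct (IHn ltac:(lia) e1 He1) as [N1 H1].
    pose proof (intbox_RBU d n F ltac:(lia) HF) as HI.
    destruct (proj2 HI e1 He1) as [e [He2 H2]]. destruct (mesh_small e He2) as [N2 H3].
    exists (N1 + N2)%nat. intros N HN x. destruct (H3 N ltac:(lia)) as [HN1 Hm].
    rewrite (intbox_S' d) by (assumption || lia).
    pose proof (riemann_grid (fun t => intbox n F (upd x n t)) N e1 HN1
      ltac:(intros; apply (RBU_line d); [exact HI|lia])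
      (line_mesh d (intbox n F) n e e1 x N H2 He2 Hm)) as B1.
    pose proof (grid_mean_bound N (fun u => intbox n F (upd x n (gpt (2 ^ N) (gs N) u)))
      (fun u => (2 * PI) ^ n * avgb n N F (upd x n (gpt (2 ^ N) (gs N) u))) e1
      ltac:(intros; apply H1; lia)) as B2.
    rewrite Rsum_scal in B2. cbv beta in B1. cbn [avgb].
    set (I := RInt _ _ _) in *. set (S1 := / 2 ^ N * Rsum (2 ^ N) (fun u => intbox n F _)) in *.
    set (S2 := Rsum (2 ^ N) (fun u => avgb n N F _)) in *.
    replace (I - (2 * PI) ^ S n * (/ 2 ^ N * S2)) with
      ((I - 2 * PI * S1) + 2 * PI * (S1 - / 2 ^ N * ((2 * PI) ^ n * S2))) by (simpl; ring).
    eapply Rle_trans; [apply Rabs_triang|]. rewrite (Rabs_mult (2 * PI)), (Rabs_pos_eq (2 * PI)) by lra.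
    assert (2 * PI * Rabs (S1 - / 2 ^ N * ((2 * PI) ^ n * S2)) <= 2 * PI * e1) by (apply Rmult_le_compat_l; lra).
    replace eps with (2 * PI * e1 + 2 * PI * e1) by (unfold e1; field; lra). lra.
Qed.

Lemma avgb_upd n N F i s x : (n <= i)%nat -> avgb n N (fun y => F (upd y i s)) x = avgb n N F (upd x i s).
Proof.
  intros Hn. revert x. induction n; intros x; [reflexivity|]. cbn [avgb]. f_equal.
  apply Rsum_ext. intros u _. rewrite IHn by lia. f_equal. apply upd_comm. lia.
Qed.

Lemma avgb_scal n N a F x : avgb n N (fun y => a * F y) x = a * avgb n N F x.
Proof.
  revert x. induction n; intros x; [reflexivity|]. cbn [avgb].
  rewrite (Rsum_ext _ _ (fun u => a * avgb n N F (upd x n (gpt (2 ^ N) (gs N) u)))) by (intros; apply IHn).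
  rewrite Rsum_scal. ring.
Qed.

Lemma avgb_Rsum n N m (F : nat -> (nat -> R) -> R) x :
  avgb n N (fun y => Rsum m (fun u => F u y)) x = Rsum m (fun u => avgb n N (F u) x).
Proof.
  revert x. induction n; intros x; [reflexivity|]. cbn [avgb].
  rewrite (Rsum_ext (2 ^ N) _ (fun v => Rsum m (fun u => avgb n N (F u) (upd x n (gpt (2 ^ N) (gs N) v)))))
    by (intros; apply IHn).
  rewrite Rsum_swap, <- Rsum_scal. reflexivity.
Qed.

Lemma avgb_diff n N F G b x : (forall y, Rabs (F y - G y) <= b) -> Rabs (avgb n N F x - avgb n N G x) <= b.
Proof.
  intros H. revert x. induction n; intros x; [apply H|]. cbn [avgb]. apply grid_mean_bound. intros; apply IHn.
Qed.

(** The discrete form of Fubini's theorem: averages over one grid commute, and averaging a second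
    time over the same coordinate changes nothing. *)
Lemma avgb_inner n N F i x : (i < n)%nat ->
  avgb n N (fun y => / 2 ^ N * Rsum (2 ^ N) (fun u => F (upd y i (gpt (2 ^ N) (gs N) u)))) x = avgb n N F x.
Proof.
  revert x. induction n; intros x Hi; [lia|]. cbn [avgb]. pose proof (pow2_gt0 N).
  destruct (Nat.eq_dec i n) as [->|Hne].
  - rewrite (Rsum_ext _ _ (fun _ => / 2 ^ N * Rsum (2 ^ N) (fun u => avgb n N F (upd x n (gpt (2 ^ N) (gs N) u))))).
    + rewrite Rsum_const, INR_pow2. field. lra.
    + intros v _. rewrite avgb_scal, (avgb_Rsum n N (2 ^ N) (fun u y => F (upd y n (gpt (2 ^ N) (gs N) u)))). f_equal.
      apply Rsum_ext. intros u _. rewrite avgb_upd by lia. rewrite upd_upd. reflexivity.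
  - f_equal. apply Rsum_ext. intros v _. apply IHn. lia.
Qed.

Lemma eq_eps a b : (forall e, 0 < e -> Rabs (a - b) <= e) -> a = b.
Proof.
  intros H. destruct (Req_dec a b) as [E|E]; [exact E|exfalso].
  assert (0 < Rabs (a - b)) by (apply Rabs_pos_lt; lra). specialize (H (Rabs (a - b) / 2) ltac:(lra)). lra.
Qed.

(** Integrating out coordinate [i] and then over the whole box counts that coordinate twice, whence
    the factor. In this form any coordinate becomes the innermost one without reordering the
    iterated integral; dyadic averages satisfy the identity exactly. *)
Lemma fubini d F i x : (i < d)%nat -> RBU d F ->
  intbox d (fun y => RInt (fun t => F (upd y i t)) (- PI) PI) x = 2 * PI * intbox d F x.
Proof.
  intros Hi HF. pose proof PI_RGT_0 as HPI. set (J := fun y => RInt (fun t => F (upd y i t)) (- PI) PI).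
  assert (HJ : RBU d J) by (apply RBU_RInt; assumption).
  apply eq_eps. intros eps He. set (V := (2 * PI) ^ d). assert (HV : 0 < V) by (apply pow_lt; lra).
  destruct (intbox_avgb d d J (Nat.le_refl d) HJ (eps / 3) ltac:(lra)) as [N1 H1].
  destruct (intbox_avgb d d F (Nat.le_refl d) HF (eps / (6 * PI)) ltac:(apply Rdiv_lt_0_compat; lra)) as [N2 H2].
  set (e1 := eps / (6 * PI * V)). assert (He1 : 0 < e1) by (apply Rdiv_lt_0_compat; nra).
  destruct (proj2 HF e1 He1) as [e [He2 H3]]. destruct (mesh_small e He2) as [N3 H4].
  set (N := (N1 + N2 + N3)%nat). destruct (H4 N ltac:(unfold N; lia)) as [HN Hm].
  specialize (H1 N ltac:(unfold N; lia) x). specialize (H2 N ltac:(unfold N; lia) x).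
  assert (B : Rabs (avgb d N J x - 2 * PI * avgb d N F x) <= 2 * PI * e1).
  { rewrite <- (avgb_inner d N F i x Hi), <- avgb_scal. apply avgb_diff. intros y.
    apply (riemann_grid (fun t => F (upd y i t)) N e1 HN).
    - intros; apply (RBU_line d); assumption.
    - apply (line_mesh d F i e e1 y N H3 He2 Hm). }
  fold V in H1, H2.
  replace (intbox d J x - 2 * PI * intbox d F x) with
    ((intbox d J x - V * avgb d N J x) + (V * (avgb d N J x - 2 * PI * avgb d N F x)
      + - (2 * PI * (intbox d F x - V * avgb d N F x)))) by ring.
  eapply Rle_trans; [apply Rabs_triang|].
  eapply Rle_trans; [apply Rplus_le_compat_l, Rabs_triang|].
  rewrite Rabs_Ropp, !Rabs_mult, (Rabs_pos_eq V), (Rabs_pos_eq 2), (Rabs_pos_eq PI) by lra.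
  assert (V * Rabs (avgb d N J x - 2 * PI * avgb d N F x) <= eps / 3).
  { replace (eps / 3) with (V * (2 * PI * e1)) by (unfold e1; field; lra). apply Rmult_le_compat_l; lra. }
  assert (2 * PI * Rabs (intbox d F x - V * avgb d N F x) <= eps / 3).
  { replace (eps / 3) with (2 * PI * (eps / (6 * PI))) by (field; lra). apply Rmult_le_compat_l; lra. }
  lra.
Qed.

(** * The norms *)

Definition ee (p : ext) : R := match p with Fin q => q | Inf => 1 end.

(* The e-th power of the [L_p] (quasi-)norm, [e = p] for finite [p] and [e = 1] for [p = oo]. *)
Definition nn (p : ext) (d : nat) (g : (nat -> R) -> C) : R :=
  match p with Fin q => integral d (fun x => rpow (Cabs (g x)) q) | Inf => supbox d g end.

Lemma inbox_0 d : inbox d (fun _ => 0).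
Proof. intros i _. pose proof PI_RGT_0. lra. Qed.

Lemma supbox_lub d g : BUC d g -> is_lub (fun y => exists x, inbox d x /\ y = Cabs (g x)) (supbox d g).
Proof.
  intros [[M HM] _]. unfold supbox. apply epsilon_spec.
  destruct (completeness (fun y => exists x, inbox d x /\ y = Cabs (g x))) as [m Hm].
  - exists M. intros y [x [_ ->]]. rewrite Cabs_Cmod. apply HM.
  - exists (Cabs (g (fun _ => 0))), (fun _ => 0). split; [apply inbox_0|reflexivity].
  - exists m. exact Hm.
Qed.

Lemma supbox_ub d g x : BUC d g -> inbox d x -> Cmod (g x) <= supbox d g.
Proof.
  intros Hg Hx. apply (proj1 (supbox_lub d g Hg)). exists x. split; [exact Hx|]. symmetry; apply Cabs_Cmod.
Qed.

Lemma supbox_le d g M : BUC d g -> (forall x, inbox d x -> Cmod (g x) <= M) -> supbox d g <= M.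
Proof.
  intros Hg H. apply (proj2 (supbox_lub d g Hg)). intros y [x [Hx ->]]. rewrite Cabs_Cmod. apply H, Hx.
Qed.

Lemma nn_Fin q d g : nn (Fin q) d g = intbox d (fun x => rpow (Cmod (g x)) q) (fun _ => 0).
Proof.
  unfold nn, integral. f_equal. apply functional_extensionality. intros x. rewrite Cabs_Cmod. reflexivity.
Qed.

Lemma nn_nonneg p d g : ext_pos p -> BUC d g -> 0 <= nn p d g.
Proof.
  intros Hp Hg. destruct p as [q|]; simpl in Hp.
  - rewrite nn_Fin. pose proof (intbox_const d d 0 (fun _ => 0) (Nat.le_refl d)) as E.
    rewrite Rmult_0_r in E. rewrite <- E at 1.
    apply (intbox_mono d d (fun _ => 0)); [lia|apply RBU_const|apply RBU_rpow; assumption|intros; apply rpow_ge0].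
  - eapply Rle_trans; [apply Cmod_ge_0|apply (supbox_ub d g (fun _ => 0) Hg (inbox_0 d))].
Qed.

Lemma Lpnorm_nn p d g : ext_pos p -> BUC d g -> Lpnorm d p g = rpow (nn p d g) (1 / ee p).
Proof.
  intros Hp Hg. destruct p as [q|]; [reflexivity|]. simpl. rewrite Rdiv_1_r, rpow_1r; [reflexivity|].
  apply (nn_nonneg Inf d g I Hg).
Qed.

(** By [fubini] the integral in coordinate [i] is moved inside, where the one-variable bound applies
    with the other coordinates frozen. *)
Lemma nn_lift p d g T i a D : ext_pos p -> (i < d)%nat -> BUC d g -> fsop T -> opbd p a D T -> 0 <= a ->
  TPv i D g -> nn p d (lift T i g) <= a * nn p d g.
Proof.
  intros Hp Hi Hg HT Hop Ha HD. pose proof (BUC_lift d T i g Hi HT Hg) as HG. pose proof PI_RGT_0 as HPI.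
  destruct p as [q|]; simpl in Hp, Hop.
  - rewrite !nn_Fin. set (x0 := fun _ : nat => 0).
    set (F := fun x => rpow (Cmod (g x)) q). set (F' := fun x => rpow (Cmod (lift T i g x)) q).
    assert (HF : RBU d F) by (apply RBU_rpow; assumption).
    assert (HF' : RBU d F') by (apply RBU_rpow; assumption).
    apply (Rmult_le_reg_l (2 * PI)); [lra|]. rewrite <- (fubini d F' i x0 Hi HF').
    replace (2 * PI * (a * intbox d F x0)) with (a * (2 * PI * intbox d F x0)) by ring.
    rewrite <- (fubini d F i x0 Hi HF).
    rewrite <- (intbox_scal d d a (fun y => RInt (fun t => F (upd y i t)) (- PI) PI)) by
      (try lia; apply RBU_RInt; assumption).
    apply (intbox_mono d d); [lia|apply RBU_RInt; assumption|apply RBU_scal, RBU_RInt; assumption|].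
    intros y. pose proof (Hop (fun t => g (upd y i t)) (HD y)) as B. unfold I1 in B.
    rewrite (RInt_ext _ (fun t => rpow (Cmod (T (fun s => g (upd y i s)) t)) q)); [exact B|].
    intros t _. unfold F', lift. rewrite upd_eq. do 3 f_equal.
    apply functional_extensionality. intros s. rewrite upd_upd. reflexivity.
  - simpl. apply supbox_le; [exact HG|]. intros x Hx. unfold lift.
    apply (Hop (fun t => g (upd x i t)) (supbox d g) (HD x)). intros t.
    (* The supremum runs over the cube only; periodicity in coordinate [i] moves the argument into
       it. *)
    destruct (mod2PI t) as [k Hk]. rewrite <- (TS_period _ _ t k (HD x)). apply supbox_ub; [exact Hg|].
    intros j Hj. destruct (Nat.eq_dec j i) as [->|Hne]; [rewrite upd_eq; exact Hk|].
    rewrite upd_neq by exact Hne. apply Hx, Hj.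
Qed.

Lemma nn_chain p d n g (T : nat -> op1) (a D : nat -> R) : ext_pos p -> (n <= d)%nat -> BUC d g ->
  (forall i, fsop (T i)) -> (forall i, (i < n)%nat -> opbd p (a i) (D i) (T i)) -> (forall i, 0 <= a i) ->
  (forall i, (i < n)%nat -> TPv i (D i) g) -> nn p d (nest n T g) <= Rprod n a * nn p d g.
Proof.
  intros Hp Hn Hg HT Hop Ha HD. induction n; [simpl; lra|]. simpl.
  eapply Rle_trans; [apply (nn_lift p d (nest n T g) (T n) n (a n) (D n)); auto|].
  - apply BUC_nest; [lia|exact HT|exact Hg].
  - apply TPv_nest_ge; auto.
  - rewrite (Rmult_comm (Rprod n a)), Rmult_assoc. apply Rmult_le_compat_l; [apply Ha|].
    apply IHn; [lia| |]; intros; [apply Hop|apply HD]; lia.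
Qed.

Lemma ee_pos p : ext_pos p -> 0 < ee p.
Proof. destruct p; simpl; intros; lra. Qed.

(** The weights stand in for the triangle inequality, which fails for [p < 1]: after [e]-th powers
    are taken pointwise, every [p] leads to the same weighted sum. *)
Lemma nn_dominated p d N (g : (nat -> R) -> C) (G : (nat -> nat) -> (nat -> R) -> C) w W eta j0 :
  ext_pos p -> BUC d g -> (forall j, BUC d (G j)) -> 0 <= eta -> (forall j, 0 < w j) ->
  Nbox d N (fun j => / w j) j0 <= W ->
  (forall x, Cmod (g x) <= Nbox d N (fun j => Cmod (G j x)) j0 + eta) ->
  nn p d g <= rpow 2 (ee p) * (rpow W (ee p) * Nbox d N (fun j => rpow (w j) (ee p) * nn p d (G j)) j0
    + (2 * PI) ^ d * rpow eta (ee p)).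
Proof.
  intros Hp Hg HG He Hw HW H. pose proof (ee_pos p Hp) as Hep.
  assert (Pt : forall (b : (nat -> nat) -> R) c, (forall j, 0 <= b j) -> 0 <= c -> c <= Nbox d N b j0 + eta ->
    rpow c (ee p) <= rpow 2 (ee p) * (rpow W (ee p) * Nbox d N (fun j => rpow (w j) (ee p) * rpow (b j) (ee p)) j0
      + rpow eta (ee p))).
  { intros b c Hb Hc0 Hc. eapply Rle_trans; [apply rpow_le; [lra|split; [exact Hc0|exact Hc]]|].
    eapply Rle_trans; [apply rpow_plus_le; [exact Hep|apply Nbox_nonneg, Hb|exact He]|].
    apply Rmult_le_compat_l; [apply rpow_ge0|]. apply Rplus_le_compat_r.
    eapply Rle_trans; [apply (rpow_Nbox_weight d N b w W); assumption|].
    right. f_equal. apply Nbox_ext. intros j _. apply rpow_mult; [apply Rlt_le, Hw|apply Hb]. }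
  destruct p as [q|]; simpl ee in *; simpl in Hp.
  - rewrite nn_Fin. set (x0 := fun _ : nat => 0).
    assert (HF : forall j, RBU d (fun x => rpow (w j) q * rpow (Cmod (G j x)) q))
      by (intros; apply RBU_scal, RBU_rpow; [exact Hp|apply HG]).
    eapply Rle_trans.
    + apply (intbox_mono d d _ (fun x => rpow 2 q * (rpow W q * Nbox d N (fun j => rpow (w j) q * rpow (Cmod (G j x)) q) j0 + rpow eta q)));
        [lia|apply RBU_rpow; assumption| |].
      * apply RBU_scal, RBU_plus; [|apply RBU_const]. apply RBU_scal.
        apply (RBU_Nbox d d N (fun j x => rpow (w j) q * rpow (Cmod (G j x)) q)), HF.
      * intros x. apply Pt; [intros; apply Cmod_ge_0|apply Cmod_ge_0|apply H].
    + right.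
      assert (HN : RBU d (fun x => Nbox d N (fun j => rpow (w j) q * rpow (Cmod (G j x)) q) j0))
        by (apply (RBU_Nbox d d N (fun j x => rpow (w j) q * rpow (Cmod (G j x)) q)), HF).
      rewrite (intbox_scal d) by (solve [lia | apply RBU_plus; [apply RBU_scal, HN|apply RBU_const]]).
      rewrite (intbox_plus d) by (solve [lia | apply RBU_const | apply RBU_scal, HN]).
      rewrite (intbox_scal d) by (try lia; exact HN). rewrite (intbox_const d) by lia.
      rewrite (intbox_Nbox d d d N (fun j x => rpow (w j) q * rpow (Cmod (G j x)) q)) by (try lia; exact HF).
      do 4 f_equal. apply functional_extensionality. intros j.
      rewrite nn_Fin. apply (intbox_scal d); [lia|]. apply RBU_rpow; [exact Hp|apply HG].
  - rewrite <- (rpow_1r (nn Inf d g)) by (apply (nn_nonneg Inf); [exact I|exact Hg]).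
    eapply Rle_trans; [apply (Pt (fun j => nn Inf d (G j)))|].
    + intros j. apply (nn_nonneg Inf); [exact I|apply HG].
    + apply (nn_nonneg Inf); [exact I|exact Hg].
    + simpl. apply supbox_le; [exact Hg|]. intros x Hx. eapply Rle_trans; [apply H|].
      apply Rplus_le_compat_r. apply Nbox_le. intros j _. apply supbox_ub; [apply HG|exact Hx].
    + apply Rmult_le_compat_l; [apply rpow_ge0|]. apply Rplus_le_compat.
      * right. f_equal. apply Nbox_ext. intros j _. f_equal. apply rpow_1r.
        apply (nn_nonneg Inf); [exact I|apply HG].
      (* The volume factor stems from finite [p]; here it is at least 1 and may be inserted. *)
      * assert (1 <= (2 * PI) ^ d) by (apply pow_R1_Rle; pose proof PI2_3_2; unfold PI2 in *; lra).
        pose proof (rpow_ge0 eta 1). nra.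
Qed.

(** * The operators [q_j] and [delta_l] *)

Lemma Ivar_lift L m i g x : Ivar L m i g x = lift (Iop L m) i g x.
Proof.
  unfold lift, Iop. destruct m as [|m].
  - cbn [Ivar Nat.pow Csum]. replace (gpt 1 (gs 0) 0) with 0 by (unfold gpt, gs; simpl; field).
    change (Cadd C0 (Cmul (g (upd x i 0)) (Kper L 0 (x i - 0)))) with
      (RtoC 0 + g (upd x i 0%R) * Kper L 0 (x i - 0)%R)%C. rewrite Cplus_0_l. reflexivity.
  - unfold Ivar. apply Csum_ext. intros u _. cbv zeta.
    assert (E : 2 * PI * IZR (Z.of_nat u - Z.of_nat (2 ^ m)) / 2 ^ S m = gpt (2 ^ S m) (gs (S m)) u).
    { unfold gpt, gs. rewrite INR_pow2, minus_IZR, IZR_pow2_nat, <- INR_IZR_INZ.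
      pose proof (pow2_gt0 m). simpl (2 ^ S m). field. lra. }
    rewrite E. reflexivity.
Qed.

Lemma etavar_lift L j i g : etavar L j i g = lift (etaop L j) i g.
Proof.
  apply functional_extensionality. intros x. destruct j as [|j]; unfold etavar.
  - apply Ivar_lift.
  - rewrite !Ivar_lift. reflexivity.
Qed.

Lemma qop_nest d L j f : qop d L j f = nest d (fun i => etaop L (j i)) f.
Proof. induction d; [reflexivity|]. simpl. rewrite etavar_lift, IHd. reflexivity. Qed.

Definition inZ (d : nat) (T : nat -> nat) (k0 k : nat -> Z) : Prop :=
  (forall i, (i < d)%nat -> (Z.abs (k i) <= Z.of_nat (T i))%Z) /\ forall i, (d <= i)%nat -> k i = k0 i.

Lemma updZ_at k n z : updZ k n z n = z.
Proof. unfold updZ. rewrite Nat.eqb_refl. reflexivity. Qed.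

Lemma inZ_step n T z k0 k : (Z.abs z <= Z.of_nat (T n))%Z -> inZ n T (updZ k0 n z) k -> inZ (S n) T k0 k.
Proof.
  intros Hz [H1 H2]. split.
  - intros i Hi. destruct (Nat.eq_dec i n) as [->|Hne]; [|apply H1; lia]. rewrite H2 by lia. rewrite updZ_at. exact Hz.
  - intros i Hi. rewrite H2 by lia. unfold updZ. destruct (Nat.eqb_spec i n); [lia|reflexivity].
Qed.

Lemma Zbox_closed (X : Type) (Q : (X -> C) -> Prop) d T (F : (nat -> Z) -> X -> C) k0 :
  (forall n (G : nat -> X -> C), (forall v, (v < n)%nat -> Q (G v)) -> Q (fun x => Csum n (fun v => G v x))) ->
  (forall k, inZ d T k0 k -> Q (F k)) -> Q (fun x => Zbox d T (fun k => F k x) k0).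
Proof.
  intros HQ. revert k0. induction d; intros k0 H; cbn [Zbox].
  - apply H. split; [lia|reflexivity].
  - apply (HQ _ (fun v x => Zbox d T (fun k => F k x) (updZ k0 d (Z.of_nat v - Z.of_nat (T d))%Z))).
    intros v Hv. apply IHd. intros k Hk. apply H.
    apply (inZ_step d T (Z.of_nat v - Z.of_nat (T d))%Z); [lia|exact Hk].
Qed.

Lemma Zbox_ext d T (F G : (nat -> Z) -> C) k0 : (forall k, inZ d T k0 k -> F k = G k) -> Zbox d T F k0 = Zbox d T G k0.
Proof.
  revert k0. induction d; intros k0 H; cbn [Zbox].
  - apply H. split; [lia|reflexivity].
  - apply Csum_ext. intros v Hv. apply IHd. intros k Hk. apply H.
    apply (inZ_step d T (Z.of_nat v - Z.of_nat (T d))%Z); [lia|exact Hk].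
Qed.

Lemma lift_Zbox T i n Tn (F : (nat -> Z) -> (nat -> R) -> C) k0 x : fsop T ->
  lift T i (fun y => Zbox n Tn (fun k => F k y) k0) x = Zbox n Tn (fun k => lift T i (F k) x) k0.
Proof.
  intros HT. revert k0. induction n; intros k0; [reflexivity|]. cbn [Zbox]. unfold lift.
  rewrite (fsop_csum_in T _ (fun v t => Zbox n Tn (fun k => F k (upd x i t)) (updZ k0 n (Z.of_nat v - Z.of_nat (Tn n))))) by exact HT.
  apply Csum_ext. intros v _. apply IHn.
Qed.

Lemma nest_Zsum d Tn (E : Z -> nat -> op1) f x k0 : (forall m i, fsop (E m i)) ->
  Zbox d Tn (fun k => nest d (fun i => E (k i) i) f x) k0 =
  nest d (fun i h y => Csum (2 * Tn i + 1) (fun v => E (Z.of_nat v - Z.of_nat (Tn i))%Z i h y)) f x.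
Proof.
  intros HE. revert x k0. induction d; intros x k0; [reflexivity|]. cbn [Zbox nest].
  set (g := nest d (fun i h y => Csum (2 * Tn i + 1) (fun v => E (Z.of_nat v - Z.of_nat (Tn i))%Z i h y)) f) in *.
  transitivity (Csum (2 * Tn d + 1) (fun v => lift (E (Z.of_nat v - Z.of_nat (Tn d))%Z d) d g x)); [|reflexivity].
  apply Csum_ext. intros v _. set (z := (Z.of_nat v - Z.of_nat (Tn d))%Z).
  transitivity (Zbox d Tn (fun k => lift (E z d) d (nest d (fun i => E (k i) i) f) x) (updZ k0 d z)).
  - apply Zbox_ext. intros k [_ Hk]. rewrite (Hk d) by lia. rewrite updZ_at. reflexivity.
  - rewrite <- (lift_Zbox (E z d) d d Tn (fun k => nest d (fun i => E (k i) i) f)) by apply HE.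
    unfold lift. f_equal. apply functional_extensionality. intros t. apply IHd.
Qed.

Fixpoint Crprod (n : nat) (F : nat -> C) : C := match n with O => RtoC 1 | S m => (Crprod m F * F m)%C end.

Lemma nest_scal d (c : nat -> C) (T : nat -> op1) f x : (forall i, fsop (T i)) ->
  nest d (fun i h y => (c i * T i h y)%C) f x = (Crprod d c * nest d T f x)%C.
Proof.
  intros HT. revert x. induction d; intros x; [simpl; cring|]. cbn [nest Crprod].
  unfold lift at 1. transitivity (c d * T d (fun t => (Crprod d c * nest d T f (upd x d t))%C) (x d))%C.
  - do 2 f_equal. apply functional_extensionality. intros t. apply IHd.
  - rewrite fsop_scal_in by apply HT. unfold lift. cring.
Qed.

Lemma Crprod_RtoC d (F : nat -> R) : Crprod d (fun i => RtoC (F i)) = RtoC (Rprod d F).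
Proof. induction d; [reflexivity|]. simpl. rewrite IHd, RtoC_mult. reflexivity. Qed.

Lemma Dop_wker n T psi h x : Dop n (wker T psi) h x =
  Csum (2 * T + 1) (fun v => (RtoC (psi (IZR (Z.of_nat v - Z.of_nat T))) *
    Dop n (ek (Z.of_nat v - Z.of_nat T)%Z) h x)%C).
Proof.
  unfold Dop, wker, symsum.
  rewrite (Csum_ext (2 ^ n) _ (fun u => Csum (2 * T + 1) (fun v =>
    (h (gpt (2 ^ n) (gs n) u) * (RtoC (psi (IZR (Z.of_nat v - Z.of_nat T))) *
      ek (Z.of_nat v - Z.of_nat T) (x - gpt (2 ^ n) (gs n) u)%R))%C)))
    by (intros; symmetry; apply Csum_scal).
  rewrite Csum_swap, <- Csum_scal. apply Csum_ext. intros v _.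
  set (a := RtoC (psi _)). rewrite (Cmult_assoc a), (Cmult_comm a), <- Cmult_assoc, <- (Csum_scal _ a). f_equal.
  apply Csum_ext. intros u _. cring.
Qed.

(** * Discrete Fourier coefficients *)

Fixpoint cavg (d N : nat) (G : (nat -> R) -> C) (x : nat -> R) : C :=
  match d with
  | O => G x
  | S n => (RtoC (/ 2 ^ N) * Csum (2 ^ N) (fun u => cavg n N G (upd x n (gpt (2 ^ N) (gs N) u))))%C
  end.

Lemma fst_Csum n (F : nat -> C) : fst (Csum n F) = Rsum n (fun u => fst (F u)).
Proof. induction n; [reflexivity|]. simpl. rewrite IHn. reflexivity. Qed.

Lemma snd_Csum n (F : nat -> C) : snd (Csum n F) = Rsum n (fun u => snd (F u)).
Proof. induction n; [reflexivity|]. simpl. rewrite IHn. reflexivity. Qed.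

Lemma fst_cavg d N G x : fst (cavg d N G x) = avgb d N (fun y => fst (G y)) x.
Proof.
  revert x. induction d; intros x; [reflexivity|]. cbn [cavg avgb]. rewrite <- Cscal_mult. unfold Cscal. simpl fst.
  rewrite fst_Csum. f_equal. apply Rsum_ext. intros; apply IHd.
Qed.

Lemma snd_cavg d N G x : snd (cavg d N G x) = avgb d N (fun y => snd (G y)) x.
Proof.
  revert x. induction d; intros x; [reflexivity|]. cbn [cavg avgb]. rewrite <- Cscal_mult. unfold Cscal. simpl snd.
  rewrite snd_Csum. f_equal. apply Rsum_ext. intros; apply IHd.
Qed.

Lemma cavg_scal_r m n N G (c : R -> C) x : (m <= n)%nat ->
  cavg m N (fun y => (G y * c (y n))%C) x = (cavg m N G x * c (x n))%C.
Proof.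
  intros Hm. revert x. induction m; intros x; [reflexivity|]. cbn [cavg].
  rewrite <- Cmult_assoc, <- Csum_scal_r. f_equal. apply Csum_ext. intros u _.
  rewrite IHm by lia. rewrite upd_neq by lia. reflexivity.
Qed.

Lemma dotZ_ext d k x y : (forall i, (i < d)%nat -> x i = y i) -> dotZ d k x = dotZ d k y.
Proof. intros H. apply Rsum_ext. intros i Hi. rewrite H by exact Hi. reflexivity. Qed.

(** Each character splits into its value at [x] and its value at the node, so the variables
    separate. This is the link between discretised convolutions and Fourier coefficients. *)
Lemma nest_ek d n f (k : nat -> Z) x :
  nest d (fun i => Dop n (ek (k i))) f x =
  (cavg d n (fun y => (f y * Cei (- dotZ d k y))%C) x * Cei (dotZ d k x))%C.
Proof.
  revert x. induction d; intros x.
  - simpl. unfold dotZ. simpl. rewrite Ropp_0, Cei_0. cring.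
  - cbn [nest cavg]. unfold lift, Dop. rewrite <- Cmult_assoc, <- Csum_scal_r. f_equal. apply Csum_ext. intros u _.
    rewrite IHd. set (s := gpt (2 ^ n) (gs n) u). set (y := upd x d s).
    replace (fun y : nat -> R => (f y * Cei (- dotZ (S d) k y))%C) with
      (fun y : nat -> R => (f y * Cei (- dotZ d k y) * ek (k d) (- y d))%C).
    + rewrite (cavg_scal_r d d n (fun y => (f y * Cei (- dotZ d k y))%C) (fun t => ek (k d) (- t))) by lia.
      unfold y at 4. rewrite upd_eq.
      replace (dotZ d k y) with (dotZ d k x) by (apply dotZ_ext; intros; unfold y; rewrite upd_neq by lia; reflexivity).
      replace (dotZ (S d) k x) with (dotZ d k x + IZR (k d) * x d) by reflexivity.
      rewrite Cei_plus. change (Cei (IZR (k d) * x d)) with (ek (k d) (x d)).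
      replace (x d - s) with (x d + - s) by ring. rewrite ek_plus. cring.
    + apply functional_extensionality. intros z.
      replace (dotZ (S d) k z) with (dotZ d k z + IZR (k d) * z d) by reflexivity.
      rewrite Ropp_plus_distr, Cei_plus. unfold ek. rewrite Ropp_mult_distr_r. cring.
Qed.

Lemma avgb_dep d n N F x x' : (n <= d)%nat ->
  (forall y y', (forall i, (i < d)%nat -> y i = y' i) -> F y = F y') ->
  (forall i, (n <= i < d)%nat -> x i = x' i) -> avgb n N F x = avgb n N F x'.
Proof.
  intros Hn HF. revert x x'. induction n; intros x x' H; cbn [avgb].
  - apply HF. intros; apply H; lia.
  - f_equal. apply Rsum_ext. intros u _. apply IHn; [lia|]. intros i Hi. unfold upd.
    destruct (Nat.eqb_spec i n); [reflexivity|]. apply H. lia.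
Qed.

(** * Uniform approximation *)

Definition uapp {X : Type} (F : X -> C) (G : nat -> X -> C) : Prop :=
  forall eps, 0 < eps -> exists n0, forall n, (n0 <= n)%nat -> forall x, Cmod (F x - G n x) <= eps.

Lemma uapp_csum (X : Type) m (F : nat -> X -> C) (G : nat -> nat -> X -> C) :
  (forall v, (v < m)%nat -> uapp (F v) (fun n => G n v)) ->
  uapp (fun x => Csum m (fun v => F v x)) (fun n x => Csum m (fun v => G n v x)).
Proof.
  induction m; intros H eps He.
  - exists O. intros n _ x. simpl. change C0 with (RtoC 0). replace (0 - 0)%C with (RtoC 0) by cring. rewrite Cmod_0. lra.
  - destruct (IHm ltac:(intros; apply H; lia) (eps / 2) ltac:(lra)) as [n1 H1].
    destruct (H m ltac:(lia) (eps / 2) ltac:(lra)) as [n2 H2].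
    exists (n1 + n2)%nat. intros n Hn x. rewrite !Csum_S.
    specialize (H1 n ltac:(lia) x). specialize (H2 n ltac:(lia) x).
    match goal with |- Cmod (?a + ?b - (?c + ?e)) <= _ =>
      replace (a + b - (c + e))%C with ((a - c) + (b - e))%C by cring end.
    eapply Rle_trans; [apply Cmod_triangle|]. lra.
Qed.

Lemma uapp_Zbox (X : Type) d T (F : (nat -> Z) -> X -> C) (G : nat -> (nat -> Z) -> X -> C) k0 :
  (forall k, uapp (F k) (fun n => G n k)) ->
  uapp (fun x => Zbox d T (fun k => F k x) k0) (fun n x => Zbox d T (fun k => G n k x) k0).
Proof.
  intros H. revert k0. induction d; intros k0; cbn [Zbox]; [apply H|].
  apply (uapp_csum X _ (fun v x => Zbox d T (fun k => F k x) (updZ k0 d (Z.of_nat v - Z.of_nat (T d))))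
    (fun n v x => Zbox d T (fun k => G n k x) (updZ k0 d (Z.of_nat v - Z.of_nat (T d))))).
  intros; apply IHd.
Qed.

Lemma uapp_CNbox (X : Type) d N (F : (nat -> nat) -> X -> C) (G : nat -> (nat -> nat) -> X -> C) k0 :
  (forall k, uapp (F k) (fun n => G n k)) ->
  uapp (fun x => CNbox d N (fun k => F k x) k0) (fun n x => CNbox d N (fun k => G n k x) k0).
Proof.
  intros H. revert k0. induction d; intros k0; cbn [CNbox]; [apply H|].
  apply (uapp_csum X _ (fun v x => CNbox d N (fun k => F k x) (updN k0 d v))
    (fun n v x => CNbox d N (fun k => G n k x) (updN k0 d v))).
  intros; apply IHd.
Qed.

Lemma uapp_scal (X : Type) (F : X -> C) (G : nat -> X -> C) (b : X -> C) M :
  (forall x, Cmod (b x) <= M) -> uapp F G -> uapp (fun x => (b x * F x)%C) (fun n x => (b x * G n x)%C).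
Proof.
  intros Hb H eps He. destruct (H (eps / (Rabs M + 1)) ltac:(apply Rdiv_lt_0_compat; pose proof (Rabs_pos M); lra)) as [n0 Hn].
  exists n0. intros n Hn0 x. specialize (Hn n Hn0 x). specialize (Hb x). pose proof (Rle_abs M). pose proof (Rabs_pos M).
  replace (b x * F x - b x * G n x)%C with (b x * (F x - G n x))%C by cring. rewrite Cmod_mult.
  apply Rle_trans with ((Rabs M + 1) * (eps / (Rabs M + 1))); [|right; field; lra].
  apply Rmult_le_compat; try apply Cmod_ge_0; lra.
Qed.

Lemma fst_le_Cmod (z : C) : Rabs (fst z) <= Cmod z.
Proof. eapply Rle_trans; [apply Rmax_l|apply Rmax_Cmod]. Qed.

Lemma snd_le_Cmod (z : C) : Rabs (snd z) <= Cmod z.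
Proof. eapply Rle_trans; [apply Rmax_r|apply Rmax_Cmod]. Qed.

Lemma Cmod_le_sum (z : C) : Cmod z <= Rabs (fst z) + Rabs (snd z).
Proof.
  replace z with (RtoC (fst z) + RtoC (snd z) * Ci)%C at 1 by
    (apply injective_projections; simpl; ring).
  eapply Rle_trans; [apply Cmod_triangle|]. rewrite Cmod_mult, !Cmod_R, Cmod_Ci. lra.
Qed.

Lemma BUC_fst d g : BUC d g -> RBU d (fun x => fst (g x)).
Proof.
  intros [[M HM] Hg]. split.
  - exists M. intros x. eapply Rle_trans; [apply fst_le_Cmod|apply HM].
  - intros eps He. destruct (Hg eps He) as [e [He1 H]]. exists e. split; [exact He1|]. intros x y Hxy.
    eapply Rle_trans; [|apply (H x y Hxy)]. apply (fst_le_Cmod (g x - g y)%C).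
Qed.

Lemma BUC_snd d g : BUC d g -> RBU d (fun x => snd (g x)).
Proof.
  intros [[M HM] Hg]. split.
  - exists M. intros x. eapply Rle_trans; [apply snd_le_Cmod|apply HM].
  - intros eps He. destruct (Hg eps He) as [e [He1 H]]. exists e. split; [exact He1|]. intros x y Hxy.
    eapply Rle_trans; [|apply (H x y Hxy)]. apply (snd_le_Cmod (g x - g y)%C).
Qed.

Lemma BUC_expi d n k : (n <= d)%nat -> BUC d (fun x => Cei (dotZ n k x)).
Proof.
  intros Hn. induction n.
  - replace (fun x : nat -> R => Cei (dotZ 0 k x)) with (fun _ : nat -> R => Cei 0) by reflexivity. apply BUC_const.
  - replace (fun x : nat -> R => Cei (dotZ (S n) k x)) with (fun x => (Cei (dotZ n k x) * ek (k n) (x n))%C)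
      by (apply functional_extensionality; intros; symmetry; apply Cei_plus).
    apply (BUC_mult d (fun x => Cei (dotZ n k x))); [apply IHn; lia|].
    apply (BUC_coord d (fun z => z = k n) (ek (k n))); [lia|]. apply TS_ek. reflexivity.
Qed.

Lemma dotZ_opp d k x : dotZ d (fun i => (- k i)%Z) x = - dotZ d k x.
Proof.
  unfold dotZ. induction d; [simpl; ring|]. simpl. rewrite IHd, opp_IZR. ring.
Qed.

Lemma fcoef_approx d f k : cont_periodic d f ->
  uapp (fun _ : nat -> R => fcoef d f k) (fun n x => cavg d n (fun y => (f y * Cei (- dotZ d k y))%C) x).
Proof.
  intros Hf eps He. pose proof PI_RGT_0 as HPI. set (G := fun y => (f y * Cei (- dotZ d k y))%C).
  assert (HG : BUC d G).
  { apply BUC_mult; [apply cont_periodic_BUC, Hf|].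
    replace (fun x => Cei (- dotZ d k x)) with (fun x => Cei (dotZ d (fun i => (- k i)%Z) x))
      by (apply functional_extensionality; intros; rewrite dotZ_opp; reflexivity).
    apply BUC_expi. lia. }
  assert (Gd : forall y y', (forall i, (i < d)%nat -> y i = y' i) -> G y = G y').
  { intros y y' H. unfold G. rewrite (dotZ_ext d k y y' H), (proj1 Hf y y' H). reflexivity. }
  set (V := (2 * PI) ^ d). assert (HV : 0 < V) by (apply pow_lt; lra).
  destruct (intbox_avgb d d _ (Nat.le_refl d) (BUC_fst d G HG) (V * (eps / 2)) ltac:(nra)) as [n1 H1].
  destruct (intbox_avgb d d _ (Nat.le_refl d) (BUC_snd d G HG) (V * (eps / 2)) ltac:(nra)) as [n2 H2].
  exists (n1 + n2)%nat. intros n Hn x. specialize (H1 n ltac:(lia) (fun _ => 0)). specialize (H2 n ltac:(lia) (fun _ => 0)).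
  rewrite <- fst_cavg in H1. rewrite <- snd_cavg in H2. fold V in H1, H2.
  (* The average covers all coordinates below [d], so its base point is immaterial; hence the
     uniformity in [x]. *)
  replace (cavg d n G x) with (cavg d n G (fun _ => 0)).
  2:{ apply injective_projections.
      - rewrite !fst_cavg. apply (avgb_dep d); [lia| |lia]. intros y y' H. rewrite (Gd y y' H). reflexivity.
      - rewrite !snd_cavg. apply (avgb_dep d); [lia| |lia]. intros y y' H. rewrite (Gd y y' H). reflexivity. }
  set (z := cavg d n G (fun _ => 0)) in *. unfold fcoef, integral.
  change (fun x => fst (Cmul (f x) (Cei (- dotZ d k x)))) with (fun x => fst (G x)).
  change (fun x => snd (Cmul (f x) (Cei (- dotZ d k x)))) with (fun x => snd (G x)).
  set (a := intbox d (fun x => fst (G x)) (fun _ => 0)) in *.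
  set (b := intbox d (fun x => snd (G x)) (fun _ => 0)) in *. fold V.
  eapply Rle_trans; [apply Cmod_le_sum|]. simpl.
  assert (HA : Rabs (/ V * a + - fst z) <= eps / 2).
  { replace (/ V * a + - fst z) with (/ V * (a - V * fst z)) by (field; lra).
    rewrite Rabs_mult, (Rabs_pos_eq (/ V)) by (apply Rlt_le, Rinv_0_lt_compat, HV).
    apply (Rmult_le_reg_l V); [exact HV|]. rewrite <- Rmult_assoc, Rinv_r, Rmult_1_l by lra. exact H1. }
  assert (HB : Rabs (/ V * b + - snd z) <= eps / 2).
  { replace (/ V * b + - snd z) with (/ V * (b - V * snd z)) by (field; lra).
    rewrite Rabs_mult, (Rabs_pos_eq (/ V)) by (apply Rlt_le, Rinv_0_lt_compat, HV).
    apply (Rmult_le_reg_l V); [exact HV|]. rewrite <- Rmult_assoc, Rinv_r, Rmult_1_l by lra. exact H2. }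
  lra.
Qed.

(** Both sides expand over the same finite set of frequencies. Only the Fourier coefficients are
    replaced by their quadratures, so the convergence is uniform. *)
Lemma delta_approx d phi A C f l : cont_periodic d f ->
  uapp (delta d phi A C f l) (fun n => nest d (fun i => Dop n (Phik phi A C (l i))) f).
Proof.
  intros Hf. set (T := fun i => Tb A C (l i)).
  set (b := fun (k : nat -> Z) x => (RtoC (Rprod d (fun i => phi (l i) (IZR (k i)))) * Cei (dotZ d k x))%C).
  assert (E1 : forall x, delta d phi A C f l x = Zbox d T (fun k => (b k x * fcoef d f k)%C) (fun _ => 0%Z)).
  { intros x. unfold delta. apply Zbox_ext. intros k _. rewrite Cscal_mult. unfold b.
    change (Cmul (fcoef d f k) (Cei (dotZ d k x))) with (fcoef d f k * Cei (dotZ d k x))%C. cring. }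
  assert (E2 : forall n x, nest d (fun i => Dop n (Phik phi A C (l i))) f x =
    Zbox d T (fun k => (b k x * cavg d n (fun y => (f y * Cei (- dotZ d k y))%C) x)%C) (fun _ => 0%Z)).
  { intros n x. transitivity (Zbox d T (fun k => nest d (fun i h y =>
      (RtoC (phi (l i) (IZR (k i))) * Dop n (ek (k i)) h y)%C) f x) (fun _ => 0%Z)).
    - rewrite (nest_Zsum d T (fun z i h y => (RtoC (phi (l i) (IZR z)) * Dop n (ek z) h y)%C)).
      + f_equal. apply functional_extensionality. intros i. apply functional_extensionality. intros h.
        apply functional_extensionality. intros y. unfold Phik. apply Dop_wker.
      + intros m i. apply fsop_scal. apply (Dop_fsop n (fun z => z = m)), TS_ek. reflexivity.
    - apply Zbox_ext. intros k _. rewrite (nest_scal d (fun i => RtoC (phi (l i) (IZR (k i)))) (fun i => Dop n (ek (k i)))).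
      + rewrite Crprod_RtoC, nest_ek. unfold b. cring.
      + intros i. apply (Dop_fsop n (fun z => z = k i)), TS_ek. reflexivity. }
  pose proof (uapp_Zbox (nat -> R) d T (fun k x => (b k x * fcoef d f k)%C)
    (fun n k x => (b k x * cavg d n (fun y => (f y * Cei (- dotZ d k y))%C) x)%C) (fun _ => 0%Z)) as U.
  intros eps He. destruct (U ltac:(intros k; apply (uapp_scal _ (fun _ => fcoef d f k) _ (b k)
      (Rabs (Rprod d (fun i => phi (l i) (IZR (k i))))));
      [intros x; unfold b; rewrite Cmod_mult, Cmod_Cei, Cmod_R; lra|apply fcoef_approx, Hf]) eps He) as [n0 H].
  exists n0. intros n Hn x. rewrite E1, E2. apply H, Hn.
Qed.

Lemma delta_BUC d phi A C f l : BUC d (delta d phi A C f l).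
Proof.
  unfold delta. apply (Zbox_closed _ (BUC d) d _ (fun k x => Cscal _ (Cmul (fcoef d f k) (Cei (dotZ d k x))))).
  - intros n G HG. induction n; [apply (BUC_const d (RtoC 0))|].
    apply (BUC_plus d (fun x => Csum n (fun v => G v x)) (G n)); [apply IHn; intros; apply HG; lia|apply HG; lia].
  - intros k _. set (c := Rprod _ _).
    replace (fun x => Cscal c (Cmul (fcoef d f k) (Cei (dotZ d k x)))) with
      (fun x => (RtoC c * fcoef d f k * Cei (dotZ d k x))%C).
    + apply (BUC_mult d (fun _ => (RtoC c * fcoef d f k)%C)); [apply BUC_const|apply BUC_expi; lia].
    + apply functional_extensionality. intros x. rewrite Cscal_mult.
      change (Cmul (fcoef d f k) (Cei (dotZ d k x))) with (fcoef d f k * Cei (dotZ d k x))%C. cring.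
Qed.

Lemma dotZ_upd d k x i t : (i < d)%nat -> dotZ d k (upd x i t) = dotZ d k (upd x i 0) + IZR (k i) * t.
Proof.
  induction d; intros Hi; [lia|]. unfold dotZ in *. simpl. destruct (Nat.eq_dec i d) as [->|Hne].
  - rewrite !upd_eq. rewrite (Rsum_ext d _ (fun j => IZR (k j) * upd x d 0 j)) by (intros; rewrite !upd_neq by lia; reflexivity). ring.
  - rewrite IHd by lia. rewrite !(upd_neq x i _ d) by lia. ring.
Qed.

Lemma delta_TPv d phi A C f l i : (i < d)%nat -> TPv i (INR (Tb A C (l i))) (delta d phi A C f l).
Proof.
  intros Hi x. unfold delta.
  apply (Zbox_closed _ (TP (INR (Tb A C (l i)))) d _ (fun k t => Cscal _ (Cmul (fcoef d f k) (Cei (dotZ d k (upd x i t)))))).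
  - intros n G HG. apply TS_csum, HG.
  - intros k [Hk _]. set (c := Rprod _ _).
    apply (TS_eq _ (fun t => ((RtoC c * fcoef d f k * Cei (dotZ d k (upd x i 0))) * ek (k i) t)%C)).
    + apply TS_scal, TS_ek. rewrite <- abs_IZR, INR_IZR_INZ. apply IZR_le, Hk, Hi.
    + intros t. rewrite Cscal_mult, (dotZ_upd d k x i t Hi), Cei_plus.
      change (Cei (IZR (k i) * t)) with (ek (k i) t).
      change (Cmul (fcoef d f k) (Cei (dotZ d k (upd x i 0)) * ek (k i) t)%C) with
        (fcoef d f k * (Cei (dotZ d k (upd x i 0%R)) * ek (k i) t))%C. cring.
Qed.

(** * Reproduction of [f] by its Littlewood-Paley pieces *)

Lemma Dop_one n T Phi (a : C) y : TP T (fun y => (Phi y - a)%C) ->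
  TS (fun k => 1 <= Rabs (IZR k) <= T) (fun y => (Phi y - a)%C) -> T < 2 ^ n ->
  Dop n Phi (fun _ => RtoC 1) y = a.
Proof.
  intros HT HS Hn. pose proof (pow2_gt0 n) as Hp.
  pose proof (Dop_zero 0 T 1 n _ (fun _ => RtoC 1) y (TP_const 0 (RtoC 1) (Rle_refl 0)) HS ltac:(lra) ltac:(lra)) as Z.
  transitivity (Dop n (fun y => (Phi y - a)%C) (fun _ => RtoC 1) y + a)%C; [|rewrite Z; cring].
  unfold Dop. rewrite (Csum_ext _ (fun u => (RtoC 1 * (Phi (y - gpt (2 ^ n) (gs n) u)%R - a))%C)
    (fun u => (RtoC 1 * Phi (y - gpt (2 ^ n) (gs n) u)%R + - a)%C)) by (intros; cring).
  rewrite Csum_plus, Csum_const, INR_pow2.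
  replace a with (RtoC (/ 2 ^ n) * (RtoC (2 ^ n) * a))%C at 2
    by (rewrite Cmult_assoc, <- RtoC_mult, Rinv_l by lra; cring).
  cring.
Qed.

Lemma Vker_TS phi A B C N : admissible phi A B C ->
  TS (fun k => 1 <= Rabs (IZR k) <= INR (Tb A C N)) (fun y => (Vker phi A C N y - RtoC 1)%C).
Proof.
  intros Ha. set (psi := Vsum phi N). set (T := Tb A C N).
  assert (P0 : psi 0 = 1).
  { apply (Vsum_one phi A B C); [exact Ha|]. rewrite Rabs_R0. apply Rmult_lt_0_compat; [apply Ha|apply pow2_gt0]. }
  set (F := fun k : Z => if Z.eq_dec k 0 then RtoC 0 else RtoC (psi (IZR k))).
  apply (TS_eq _ (fun y => symsum (fun k => (F k * ek k y)%C) T)).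
  - apply symsum_TS. intros k Hk HF. unfold F in HF. destruct (Z.eq_dec k 0) as [->|Hne]; [congruence|].
    split; [apply IZR_ge1, Hne|]. rewrite <- abs_IZR, INR_IZR_INZ. apply IZR_le, Hk.
  - intros y. set (G := fun k : Z => if Z.eq_dec k 0 then RtoC 1 else RtoC 0).
    transitivity (symsum (fun k => (RtoC (psi (IZR k)) * ek k y)%C) T - symsum G T)%C.
    + unfold symsum. rewrite <- Csum_minus. apply Csum_ext. intros v _. unfold F, G.
      destruct (Z.eq_dec _ 0) as [E|E]; [|cring]. rewrite E, P0, ek_0. cring.
    + rewrite (symsum_widen G 0 T) by (first [lia | intros k Hk; unfold G; destruct (Z.eq_dec k 0); [lia|reflexivity]]).
      unfold Vker, wker. f_equal. unfold symsum, G. simpl. cring.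
Qed.

Lemma Dop_Vker_one phi A B C N n y : admissible phi A B C -> INR (Tb A C N) < 2 ^ n ->
  Dop n (Vker phi A C N) (fun _ => RtoC 1) y = RtoC 1.
Proof.
  intros Ha Hn. pose proof (Vker_TS phi A B C N Ha) as H.
  apply (Dop_one n (INR (Tb A C N))); [|exact H|exact Hn]. eapply TS_mono; [|exact H]. intros k Hk. apply Hk.
Qed.

(** Nearby points give [eps]; at distance at least [e] the crude bound [2 * M] is at most
    [2 * M * (18 / e)] times [asin2], with 18 from [asin2_ge]. *)
Lemma near_or_far d f i : cont_periodic d f -> (i < d)%nat -> forall eps, 0 < eps -> exists Q, 0 <= Q /\
  forall x s, Cmod (f (upd x i s) - f x) <= eps + Q * asin2 (x i - s).
Proof.
  intros Hf Hi eps He. destruct (cont_periodic_BUC d f Hf) as [[M HM] _].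
  destruct (cont_periodic_uc d f Hf eps He) as [e [He1 H]].
  assert (HM0 : 0 <= M) by (eapply Rle_trans; [apply Cmod_ge_0|apply (HM (fun _ => 0))]).
  exists (2 * M * (18 / e)). assert (HQ : 0 <= 2 * M * (18 / e)) by (apply Rmult_le_pos; [lra|apply Rlt_le, Rdiv_lt_0_compat; lra]).
  split; [exact HQ|]. intros x s. destruct (mod2PI (s - x i)) as [k Hk]. set (t := s - x i + 2 * PI * IZR k) in *.
  assert (E : f (upd x i s) = f (upd x i (x i + t))).
  { rewrite <- (cont_periodic_upd d f (upd x i s) i k Hf Hi), upd_eq, upd_upd. do 2 f_equal. unfold t. ring. }
  assert (Ea : asin2 (x i - s) = asin2 t) by (unfold t; rewrite asin2_period; apply asin2_sym).
  rewrite E, Ea. pose proof (asin2_ge0 t). destruct (Rlt_dec (Rabs t) e) as [Hlt|Hge].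
  - apply Rle_trans with eps; [|nra]. apply H. intros j Hj. destruct (Nat.eq_dec j i) as [->|Hne].
    + rewrite upd_eq. replace (x i + t - x i) with t by ring. exact Hlt.
    + rewrite upd_neq by exact Hne. rewrite Rminus_diag, Rabs_R0. exact He1.
  - eapply Rle_trans; [apply Cmod_minus_le|]. pose proof (HM (upd x i (x i + t))). pose proof (HM x).
    pose proof (asin2_ge t ltac:(apply Rabs_le; pose proof PI_RGT_0; lra)) as Ht. apply Rnot_lt_le in Hge.
    assert (1 <= 18 / e * asin2 t).
    { replace (18 / e * asin2 t) with (18 * asin2 t / e) by (field; lra). apply (Rle_div_r _ _ e); lra. }
    assert (2 * M * 1 <= 2 * M * (18 / e * asin2 t)) by (apply Rmult_le_compat_l; lra). lra.
Qed.

Lemma asin2_wt lam y : 0 < lam -> asin2 y * wt lam (INR 3) y <= / lam * wt lam 2 y.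
Proof.
  intros Hl. pose proof (wt_pow lam 1 y ltac:(lra)) as W1. rewrite pow_1 in W1.
  assert (E : wt lam (INR 3) y = wt lam 2 y * wt lam (INR 1) y).
  { rewrite wt_mult. replace (2 + INR 1) with (INR 3) by (simpl; ring). reflexivity. }
  rewrite E. pose proof (wt_pos lam 2 y). pose proof (wt_pos lam (INR 1) y). pose proof (asin2_ge0 y).
  assert (lam * asin2 y * wt lam (INR 1) y <= 1) by nra.
  apply (Rmult_le_reg_l lam); [exact Hl|]. rewrite <- (Rmult_assoc lam (/ lam)), Rinv_r by lra. nra.
Qed.

(** Approximate-identity argument with quadrature for the integral: the discrete mass of the kernel
    is 1, and of its decay of order 3 two orders pay for the grid sum and one for the distance. The
    condition [N + c <= n] makes the grid resolve the kernel. *)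
Lemma Vker_approx phi A B C c d f i : admissible phi A B C -> INR (phiT A C) < 2 ^ c ->
  cont_periodic d f -> (i < d)%nat -> forall eps, 0 < eps -> exists N0, forall N n, (N0 <= N)%nat -> (N + c <= n)%nat ->
  forall x, Cmod (lift (Dop n (Vker phi A C N)) i f x - f x) <= eps.
Proof.
  intros Ha Hc Hf Hi eps He. destruct (Vker_decay phi A B C 3 Ha) as [K [HK HD]].
  destruct (wt_grid_sum 2 ltac:(lra)) as [C0 [HC0 Hgrid]].
  (* The grid sum is at most [K * (2 * e1) * C0 * 2]. *)
  set (e1 := eps / (4 * C0 * K)). assert (HCK : 0 < C0 * K) by nra. assert (He1 : 0 < e1) by (apply Rdiv_lt_0_compat; lra).
  destruct (near_or_far d f i Hf Hi e1 He1) as [Q [HQ HQ2]].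
  destruct (pow2_unbounded (Q / e1)) as [N0 HN0]. exists N0. intros N n HN Hn x. specialize (HN0 N HN).
  pose proof (pow2_gt0 n) as Hpn. pose proof (pow2_gt0 N) as HpN.
  assert (HQN : Q * / 2 ^ N <= e1).
  { apply (Rmult_le_reg_r (2 ^ N)); [exact HpN|]. rewrite Rmult_assoc, Rinv_l, Rmult_1_r by lra.
    apply Rlt_div_l in HN0; lra. }
  assert (HT : INR (Tb A C N) < 2 ^ n).
  { rewrite INR_Tb. apply Rlt_le_trans with (2 ^ c * 2 ^ N); [nra|]. rewrite <- pow_add. apply Rle_pow; [lra|lia]. }
  set (V := Vker phi A C N) in *. set (y := x i). set (h := fun t => f (upd x i t)).
  assert (E : (lift (Dop n V) i f x - f x)%C =
    (RtoC (/ 2 ^ n) * Csum (2 ^ n) (fun u => (h (gpt (2 ^ n) (gs n) u) - f x) * V (y - gpt (2 ^ n) (gs n) u)%R))%C).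
  { pose proof (Dop_Vker_one phi A B C N n y Ha HT) as E1. fold V in E1.
    replace (f x) with (f x * Dop n V (fun _ => RtoC 1) y)%C at 1 by (rewrite E1; cring).
    unfold lift. fold y. change (fun t => f (upd x i t)) with h. unfold Dop.
    rewrite (Csum_ext _ (fun u => ((h (gpt (2 ^ n) (gs n) u) - f x) * V (y - gpt (2 ^ n) (gs n) u)%R)%C)
      (fun u => (h (gpt (2 ^ n) (gs n) u) * V (y - gpt (2 ^ n) (gs n) u)%R -
        f x * (RtoC 1 * V (y - gpt (2 ^ n) (gs n) u)%R))%C)) by (intros; cring).
    rewrite Csum_minus, (Csum_scal _ (f x)). cring. }
  rewrite E, Cmod_mult, Cmod_R, Rabs_pos_eq by (apply Rlt_le, Rinv_0_lt_compat, Hpn).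
  apply (Rmult_le_reg_l (2 ^ n)); [exact Hpn|]. rewrite <- Rmult_assoc, Rinv_r, Rmult_1_l by lra.
  eapply Rle_trans; [apply Cmod_Csum|].
  apply Rle_trans with (Rsum (2 ^ n) (fun u => K * 2 ^ N * (2 * e1) * wt (2 ^ N) 2 (y - gpt (2 ^ n) (gs n) u))).
  - apply Rsum_le. intros u _. rewrite Cmod_mult. set (s := gpt (2 ^ n) (gs n) u).
    pose proof (HQ2 x s) as B1. fold y in B1. change (f (upd x i s)) with (h s) in B1.
    pose proof (HD N (y - s)) as B2. fold V in B2.
    pose proof (asin2_wt (2 ^ N) (y - s) HpN) as B3.
    pose proof (wt_anti (2 ^ N) 2 (INR 3) (y - s) ltac:(lra) ltac:(simpl; lra)) as B4.
    set (w3 := wt (2 ^ N) (INR 3) (y - s)) in *. set (w2 := wt (2 ^ N) 2 (y - s)) in *.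
    set (a := asin2 (y - s)) in *. assert (Hw2 : 0 < w2) by apply wt_pos.
    apply Rle_trans with ((e1 + Q * a) * (K * 2 ^ N * w3)).
    + apply Rmult_le_compat; try apply Cmod_ge_0; assumption.
    + assert (B5 : Q * (a * w3) <= e1 * w2).
      { apply Rle_trans with (Q * (/ 2 ^ N * w2)); [apply Rmult_le_compat_l; lra|].
        rewrite <- Rmult_assoc. apply Rmult_le_compat_r; lra. }
      assert (B6 : e1 * w3 <= e1 * w2) by (apply Rmult_le_compat_l; lra).
      replace ((e1 + Q * a) * (K * 2 ^ N * w3)) with (K * 2 ^ N * (e1 * w3 + Q * (a * w3))) by ring.
      replace (K * 2 ^ N * (2 * e1) * w2) with (K * 2 ^ N * (e1 * w2 + e1 * w2)) by ring.
      apply Rmult_le_compat_l; [nra|lra].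
  - rewrite Rsum_scal. pose proof (Hgrid (2 ^ n)%nat (2 ^ N) y (gs n) (pow2_nat_pos n) HpN) as G. rewrite INR_pow2 in G.
    set (S := Rsum _ _) in *.
    assert (B0 : 2 ^ N * (1 + 2 ^ n / 2 ^ N) <= 2 * 2 ^ n).
    { replace (2 ^ N * (1 + 2 ^ n / 2 ^ N)) with (2 ^ N + 2 ^ n) by (field; lra).
      assert (2 ^ N <= 2 ^ n) by (apply Rle_pow; [lra|lia]). lra. }
    apply Rle_trans with (K * (2 * e1) * C0 * (2 ^ N * (1 + 2 ^ n / 2 ^ N))).
    + replace (K * (2 * e1) * C0 * (2 ^ N * (1 + 2 ^ n / 2 ^ N))) with (K * 2 ^ N * (2 * e1) * (C0 * (1 + 2 ^ n / 2 ^ N))) by ring.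
      apply Rmult_le_compat_l; [|exact G]. apply Rmult_le_pos; [nra|lra].
    + apply Rle_trans with (K * (2 * e1) * C0 * (2 * 2 ^ n)).
      * apply Rmult_le_compat_l; [|exact B0]. apply Rmult_le_pos; [nra|lra].
      * right. unfold e1. field. lra.
Qed.

Lemma fsop_minus_lift T i f g x : fsop T ->
  (lift T i f x - lift T i g x)%C = lift T i (fun y => (f y - g y)%C) x.
Proof. intros HT. unfold lift. symmetry. apply (fsop_minus_in T (fun t => f (upd x i t)) (fun t => g (upd x i t))), HT. Qed.

(** One variable at a time: the uniform bound of the operators in the supremum norm carries along
    the error made in the earlier variables. *)
Lemma Vker_nest phi A B C c d f m : admissible phi A B C -> INR (phiT A C) < 2 ^ c ->
  cont_periodic d f -> (m <= d)%nat -> forall eps, 0 < eps -> exists N0, forall N n, (N0 <= N)%nat -> (N + c <= n)%nat ->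
  forall x, Cmod (nest m (fun _ => Dop n (Vker phi A C N)) f x - f x) <= eps.
Proof.
  intros Ha Hc Hf. induction m; intros Hm eps He.
  - exists O. intros N n _ _ x. simpl. replace (f x - f x)%C with (RtoC 0) by cring. rewrite Cmod_0. lra.
  - destruct Dop_sup as [C1 [HC1 HS]]. destruct (Vker_decay phi A B C 2 Ha) as [K [HK HD]].
    assert (HCK : 0 < C1 * K) by nra.
    destruct (IHm ltac:(lia) (eps / (2 * (C1 * K))) ltac:(apply Rdiv_lt_0_compat; lra)) as [N1 H1].
    destruct (Vker_approx phi A B C c d f m Ha Hc Hf ltac:(lia) (eps / 2) ltac:(lra)) as [N2 H2].
    exists (N1 + N2)%nat. intros N n HN Hn x. specialize (H1 N n ltac:(lia) Hn). specialize (H2 N n ltac:(lia) Hn x).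
    assert (HV : fsop (Dop n (Vker phi A C N))).
    { eapply Dop_fsop. apply (TS_eq _ (fun y => ((Vker phi A C N y - RtoC 1) + RtoC 1)%C)); [|intros; cring].
      apply TS_plus; [eapply (TS_mono _ (fun _ => True)); [auto|apply (Vker_TS phi A B C N Ha)]|].
      eapply (TS_mono _ (fun _ => True)); [auto|apply (TP_const 0 (RtoC 1) (Rle_refl 0))]. }
    cbn [nest]. eapply Rle_trans; [apply (Cmod_sub3 _ (lift (Dop n (Vker phi A C N)) m f x))|].
    rewrite fsop_minus_lift by exact HV.
    assert (B0 : Cmod (lift (Dop n (Vker phi A C N)) m
      (fun y => (nest m (fun _ => Dop n (Vker phi A C N)) f y - f y)%C) x) <= C1 * K * (eps / (2 * (C1 * K)))).
    { apply (HS K 2%nat N n _ _ (eps / (2 * (C1 * K)))); try assumption; try lia; [apply HD|]. intros t. apply H1. }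
    replace (C1 * K * (eps / (2 * (C1 * K)))) with (eps / 2) in B0 by (field; lra). lra.
Qed.

(** At a fixed grid level the tensor products built from the [Phik] add up to the one built from
    [Vker]. The level is chosen after [N], because only finitely many [delta] can be approximated
    simultaneously. *)
Lemma delta_reproduce phi A B C d f j0 : admissible phi A B C -> cont_periodic d f ->
  forall eps, 0 < eps -> exists N0, forall N, (N0 <= N)%nat -> forall x,
  Cmod (f x - CNbox d N (fun l => delta d phi A C f l x) j0) <= eps.
Proof.
  intros Ha Hf eps He. destruct (pow2_unbounded (INR (phiT A C))) as [c Hc]. specialize (Hc c (Nat.le_refl c)).
  destruct (Vker_nest phi A B C c d f d Ha Hc Hf (Nat.le_refl d) (eps / 2) ltac:(lra)) as [N0 H0].
  exists N0. intros N HN x.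
  destruct (uapp_CNbox (nat -> R) d N (fun l => delta d phi A C f l)
    (fun n l => nest d (fun i => Dop n (Phik phi A C (l i))) f) j0
    ltac:(intros l; apply delta_approx, Hf) (eps / 2) ltac:(lra)) as [n0 H1].
  specialize (H1 (n0 + N + c)%nat ltac:(lia) x). specialize (H0 N (n0 + N + c)%nat HN ltac:(lia) x).
  set (n := (n0 + N + c)%nat) in *.
  rewrite (nest_sum d N (fun l i => Dop n (Phik phi A C l)) f x j0) in H1 by
    (intros; eapply Dop_fsop, (Phik_TS phi A B C), Ha).
  replace (fun (i : nat) (h : R -> Complex.C) (y : R) => Csum (S N) (fun m => Dop n (Phik phi A C m) h y)) with
    (fun (i : nat) => Dop n (Vker phi A C N)) in H1.
  2:{ apply functional_extensionality; intros i. apply functional_extensionality; intros h.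
      apply functional_extensionality; intros y. unfold Dop. rewrite Csum_scal, Csum_swap. f_equal.
      apply Csum_ext. intros u _. rewrite (Vker_sum phi A B C N _ Ha), <- Csum_scal. reflexivity. }
  eapply Rle_trans; [apply (Cmod_sub3 _ (nest d (fun _ => Dop n (Vker phi A C N)) f x))|].
  rewrite Cmod_minus_sym in H0. rewrite Cmod_minus_sym in H1. lra.
Qed.

(** * The two discrete decompositions *)

Lemma nest_CNbox n m N T (F : (nat -> nat) -> (nat -> R) -> C) j0 x : (forall i, fsop (T i)) ->
  nest n T (fun y => CNbox m N (fun l => F l y) j0) x = CNbox m N (fun l => nest n T (F l) x) j0.
Proof.
  intros HT. revert x. induction n; intros x; [reflexivity|]. cbn [nest].
  rewrite <- (lift_CNbox (T n) n m N (fun l => nest n T (F l))) by apply HT.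
  unfold lift. f_equal. apply functional_extensionality. intros t. apply IHn.
Qed.

(** The constant may depend on the operators, as it serves only to choose the tolerance in an
    approximation of [f]. *)
Lemma nest_bounded n T : (forall i, fsop (T i)) -> exists K, 0 <= K /\ forall f g M,
  (forall x, Cmod (f x - g x) <= M) -> forall x, Cmod (nest n T f x - nest n T g x) <= K * M.
Proof.
  intros HT. induction n.
  - exists 1. split; [lra|]. intros f g M H x. simpl. rewrite Rmult_1_l. apply H.
  - destruct IHn as [K [HK H]]. destruct (fsop_bounded (T n) (HT n)) as [K' [HK' H']].
    exists (K' * K). split; [nra|]. intros f g M HM x. cbn [nest]. rewrite fsop_minus_lift by apply HT.
    rewrite Rmult_assoc. apply H'. intros t. apply (H f g M HM).
Qed.

(* [H j] is, up to [eps], dominated by pieces whose norms are controlled by those of the [G l]. *)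
Definition dominated (p : ext) (d : nat) (a : nat -> nat -> R) (H G : (nat -> nat) -> (nat -> R) -> C) : Prop :=
  forall j eps, 0 < eps -> exists N0, forall N, (N0 <= N)%nat -> exists E : (nat -> nat) -> (nat -> R) -> C,
    (forall l, BUC d (E l)) /\
    (forall x, Cmod (H j x) <= Nbox d N (fun l => Cmod (E l x)) (fun _ => O) + eps) /\
    (forall l, inN d N (fun _ => O) l -> nn p d (E l) <= Rprod d (fun i => a (j i) (l i)) * nn p d (G l)).

(** The entry vanishes for [j > l + c], because interpolation reproduces low frequencies or because
    spectra are disjoint; otherwise it is the cost of discretisation. Both inequalities of the
    theorem produce this same kernel. *)
Definition ker (p : ext) (K : R) (c : nat) (j l : nat) : R := if le_dec j (l + c) then K * gfac p j l else 0.

Lemma ker_nonneg p K c j l : 0 <= K -> 0 <= ker p K c j l.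
Proof. intros. unfold ker. destruct (le_dec _ _); [|lra]. pose proof (gfac_pos p j l). nra. Qed.

Lemma opbd_mono p a a' D T : ext_pos p -> a <= a' -> opbd p a D T -> opbd p a' D T.
Proof.
  intros Hp Ha H. destruct p as [q|]; simpl in *.
  - intros h Hh. eapply Rle_trans; [apply H, Hh|]. apply Rmult_le_compat_r; [|exact Ha].
    apply I1_nonneg; [exact Hp|eapply TS_cont, Hh].
  - intros h M Hh HM t. eapply Rle_trans; [apply (H h M Hh HM)|]. apply Rmult_le_compat_r; [|exact Ha].
    eapply Rle_trans; [apply Cmod_ge_0|apply (HM 0)].
Qed.

Lemma opbd_zero p D T : ext_pos p -> (forall h x, TP D h -> T h x = RtoC 0) -> opbd p 0 D T.
Proof.
  intros Hp H. destruct p as [q|]; simpl in *.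
  - intros h Hh. rewrite Rmult_0_l. unfold I1. rewrite (RInt_ext _ (fun _ => 0)).
    + rewrite RInt_const_R. lra.
    + intros x _. rewrite (H h x Hh), Cmod_0, rpow_0. reflexivity.
  - intros h M Hh _ t. rewrite (H h t Hh), Cmod_0. lra.
Qed.

Lemma nat_bound d (j : nat -> nat) : exists m, forall i, (i < d)%nat -> (j i <= m)%nat.
Proof.
  induction d as [|d [m Hm]]; [exists O; intros; lia|]. exists (m + j d)%nat. intros i Hi.
  destruct (Nat.eq_dec i d) as [->|Hne]; [lia|]. specialize (Hm i ltac:(lia)). lia.
Qed.

Lemma gfac_shift p j l c : gfac p j (l + c) <= 2 ^ c * gfac p j l.
Proof.
  pose proof (pow2_ge1 c). destruct p as [q|]; simpl; [|lra]. rewrite pow_add. pose proof (pow2_div_pos j l).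
  replace (2 ^ l * 2 ^ c / 2 ^ j) with (2 ^ c * (2 ^ l / 2 ^ j)) by (unfold Rdiv; ring). nra.
Qed.

(** The pieces are [q_j] applied to [delta_l f]. Their source only approximates [f], and [q_j] may
    magnify the error, so the tolerance for [f] is fixed after [j]. *)
Lemma q_dominated phi A B C p d L : admissible phi A B C -> ext_pos p -> (1 <= L)%nat ->
  gt_invp (INR L) p -> (L = 1%nat -> p <> Inf) -> exists K c, 0 < K /\ forall f, cont_periodic d f -> dominated p d (ker p K c) (fun j => qop d L j f) (delta d phi A C f).
Proof.
  intros Ha Hp HL HpL HL1. destruct (eta_opbd p L Hp HL HpL HL1) as [C1 [HC1 Hop]].
  destruct (pow2_unbounded (INR (phiT A C))) as [c0 Hc0]. specialize (Hc0 c0 (Nat.le_refl c0)).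
  (* [delta_l f] has degree at most [2 ^ (l + c0)], so [eta_zero] applies from [l + c0 + L + 2] on;
     the shift by [c0] costs [2 ^ c0] in [gfac]. *)
  exists (C1 * 2 ^ c0), (c0 + L + 1)%nat. pose proof (pow2_gt0 c0) as Hp0. split; [nra|].
  intros f Hf j eps He. set (T := fun i => etaop L (j i)).
  assert (HT : forall i, fsop (T i)) by (intros; apply eta_fsop, HL).
  destruct (nest_bounded d T HT) as [K [HK Hb]].
  destruct (delta_reproduce phi A B C d f (fun _ => O) Ha Hf (eps / (K + 1)) ltac:(apply Rdiv_lt_0_compat; lra)) as [N0 H0].
  exists N0. intros N HN. specialize (H0 N HN). exists (fun l => nest d T (delta d phi A C f l)).
  split; [intros l; apply BUC_nest; [lia|exact HT|apply delta_BUC]|]. split.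
  - intros x. rewrite qop_nest. fold T. specialize (Hb _ _ _ H0 x).
    rewrite (nest_CNbox d d N T (fun l => delta d phi A C f l)) in Hb by exact HT.
    eapply Rle_trans; [apply (Cmod_triangle_sub _ (CNbox d N (fun l => nest d T (delta d phi A C f l) x) (fun _ => O)))|].
    apply Rplus_le_compat; [apply Cmod_CNbox|]. eapply Rle_trans; [exact Hb|].
    apply Rle_trans with ((K + 1) * (eps / (K + 1))); [|right; field; lra].
    apply Rmult_le_compat_r; [apply Rlt_le, Rdiv_lt_0_compat; lra|lra].
  - intros l _. apply (nn_chain p d d _ T (fun i => ker p (C1 * 2 ^ c0) (c0 + L + 1) (j i) (l i)) (fun i => 2 ^ (l i + c0))).
    + exact Hp.
    + lia.
    + apply delta_BUC.
    + exact HT.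
    + intros i _. unfold ker, T. destruct (le_dec (j i) (l i + (c0 + L + 1))) as [H|H].
      * apply (opbd_mono p (C1 * gfac p (j i) (l i + c0))); [exact Hp| |apply Hop].
        pose proof (gfac_shift p (j i) (l i) c0). rewrite Rmult_assoc. apply Rmult_le_compat_l; lra.
      * apply opbd_zero; [exact Hp|]. intros h x Hh. apply (eta_zero L (j i) (l i + c0)); [exact HL|lia|exact Hh].
    + intros i. apply ker_nonneg. nra.
    + intros i Hi x. eapply TP_mono; [|apply (delta_TPv d phi A C f l i Hi)].
      rewrite INR_Tb, pow_add. pose proof (pow2_gt0 (l i)). nra.
Qed.

Lemma Dop_Iop L n Phi h : (1 <= L)%nat -> Dop n Phi (Iop L n h) = Dop n Phi h.
Proof.
  intros HL. apply functional_extensionality. intros x. unfold Dop. f_equal. apply Csum_ext. intros u Hu.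
  rewrite Iop_interp by assumption. reflexivity.
Qed.

(** Exact although [f] is not the finite sum of its [q_j f]: that sum is the interpolant of level
    [N], which has the same values as [f] at the nodes of [Dop N]. *)
Lemma nest_Dop_decomp d L N (Phi : nat -> R -> C) f x : (1 <= L)%nat ->
  (forall i, fsop (Dop N (Phi i))) ->
  nest d (fun i => Dop N (Phi i)) f x = CNbox d N (fun j => nest d (fun i => Dop N (Phi i)) (qop d L j f) x) (fun _ => O).
Proof.
  intros HL HT. set (T := fun i => Dop N (Phi i)) in *.
  rewrite <- (nest_CNbox d d N T (fun j => qop d L j f)) by exact HT.
  transitivity (nest d T (nest d (fun _ => Iop L N) f) x).
  - rewrite nest_nest by (try exact HT; intros; apply Iop_fsop, HL). f_equal.
    apply functional_extensionality. intros i. apply functional_extensionality. intros h.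
    symmetry. apply Dop_Iop, HL.
  - f_equal. apply functional_extensionality. intros y.
    rewrite (CNbox_ext d N _ (fun j => nest d (fun i => etaop L (j i)) f y)) by (intros; rewrite qop_nest; reflexivity).
    rewrite (nest_sum d N (fun m _ => etaop L m)) by (intros; apply eta_fsop, HL). f_equal.
    apply functional_extensionality. intros i. apply functional_extensionality. intros h.
    apply functional_extensionality. intros z. symmetry. apply Iop_telescope.
Qed.

(** The pieces are discretised convolutions of the [q_j f], whose finite sum is exact on the grid;
    only the passage from discretised convolution to [delta] costs [eps]. *)
Lemma delta_dominated phi A B C p d L : admissible phi A B C -> ext_pos p -> (1 <= L)%nat -> exists K c, 0 < K /\ forall f, cont_periodic d f -> dominated p d (ker p K c) (delta d phi A C f) (fun j => qop d L j f).
Proof.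
  intros Ha Hp HL. destruct (pow2_unbounded (INR (phiT A C))) as [c0 Hc0]. specialize (Hc0 c0 (Nat.le_refl c0)).
  destruct (Dop_opbd p c0 Hp) as [P [C1 [HP [HC1 Hop]]]].
  destruct (Phik_decay phi A B C P Ha) as [Kd [HKd HD]].
  assert (HB : 0 < B) by apply Ha. destruct (pow2_unbounded (/ B)) as [c Hc]. specialize (Hc c (Nat.le_refl c)).
  set (K := C1 * match p with Fin q => rpow Kd q | Inf => Kd end).
  assert (HK : 0 < K) by (unfold K; apply Rmult_lt_0_compat; [exact HC1|]; destruct p; [apply rpow_gt0, HKd|exact HKd]).
  exists K, c. split; [exact HK|]. intros f Hf l eps He.
  destruct (delta_approx d phi A C f l Hf eps He) as [n0 Hn0]. destruct (nat_bound d l) as [m Hm].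
  exists (n0 + m + c0 + L + 1)%nat. intros N HN. specialize (Hn0 N ltac:(lia)).
  set (T := fun i => Dop N (Phik phi A C (l i))) in *.
  assert (HT : forall i, fsop (T i)) by (intros; eapply Dop_fsop, (Phik_TS phi A B C), Ha).
  assert (HBq : forall j, BUC d (qop d L j f)).
  { intros j. rewrite qop_nest. apply BUC_nest; [lia|intros; apply eta_fsop, HL|apply cont_periodic_BUC, Hf]. }
  exists (fun j => nest d T (qop d L j f)). split; [intros j; apply BUC_nest; [lia|exact HT|apply HBq]|]. split.
  - intros x. specialize (Hn0 x). pose proof (nest_Dop_decomp d L N (fun i => Phik phi A C (l i)) f x HL HT) as E0. cbv beta in E0. fold T in E0.
    rewrite E0 in Hn0.
    eapply Rle_trans; [apply (Cmod_triangle_sub _ (CNbox d N (fun j => nest d T (qop d L j f) x) (fun _ => O)))|].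
    apply Rplus_le_compat; [apply Cmod_CNbox|exact Hn0].
  - intros j [Hj _].
    (* For [j i = N] the degree of [q_j f] nearly fills the grid; the factor $1-2^{-L}$ leaves a gap
       $2^{N-L}$ into which the spectrum of the kernel fits, so nothing is aliased. *)
    assert (HA : forall i, (i < d)%nat -> 2 ^ j i * (1 - / 2 ^ L) + 2 ^ (l i + c0) < 2 ^ N).
    { intros i Hi. specialize (Hj i Hi). specialize (Hm i Hi). pose proof (pow2_gt0 L) as HpL.
      pose proof (pow2_ge1 L). assert (/ 2 ^ L <= / 1) by (apply Rinv_le_contravar; lra). rewrite Rinv_1 in *.
      assert (2 ^ j i <= 2 ^ N) by (apply Rle_pow; [lra|lia]).
      assert (2 ^ (l i + c0) < 2 ^ N * / 2 ^ L).
      { apply (Rmult_lt_reg_r (2 ^ L)); [exact HpL|]. rewrite Rmult_assoc, Rinv_l, Rmult_1_r, <- pow_add by lra.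
        apply Rlt_pow; [lra|lia]. }
      assert (2 ^ j i * (1 - / 2 ^ L) <= 2 ^ N * (1 - / 2 ^ L)) by (apply Rmult_le_compat_r; lra). lra. }
    assert (HTb : forall i, INR (Tb A C (l i)) <= 2 ^ (l i + c0)).
    { intros i. rewrite INR_Tb, pow_add. pose proof (pow2_gt0 (l i)). nra. }
    assert (HL1 : 0 < / 2 ^ L) by (apply Rinv_0_lt_compat, pow2_gt0).
    apply (nn_chain p d d _ T (fun i => ker p K c (l i) (j i)) (fun i => 2 ^ j i * (1 - / 2 ^ L))).
    + exact Hp.
    + lia.
    + apply HBq.
    + exact HT.
    + intros i Hi. specialize (HA i Hi). specialize (HTb i). specialize (Hm i Hi). pose proof (pow2_gt0 (j i)) as Hpj.
      unfold ker, T. destruct (le_dec (l i) (j i + c)) as [H|H].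
      * apply (Hop Kd (l i) (j i) N (Phik phi A C (l i)) HKd (HD (l i))); [|nra|exact HA|lia].
        eapply TP_mono; [exact HTb|apply (Phik_TP phi A B C), Ha].
      * apply opbd_zero; [exact Hp|]. intros h x Hh.
        apply (Dop_zero (2 ^ j i * (1 - / 2 ^ L)) (INR (Tb A C (l i))) (B * 2 ^ l i) N); [exact Hh| | |lra].
        -- eapply TS_mono; [|apply (Phik_TS phi A B C), Ha]. intros k Hk.
           split; [apply Ha in Hk; [apply Hk|lia]|].
           destruct (Rle_dec (Rabs (IZR k)) (INR (Tb A C (l i)))) as [E|E]; [exact E|].
           apply Rnot_le_lt in E. exfalso. apply Hk. apply (phi_zero phi A B C (l i) (IZR k) Ha E).
        -- apply Rle_lt_trans with (2 ^ j i); [nra|].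
           apply Rlt_le_trans with (B * 2 ^ (j i + c)).
           ++ rewrite pow_add. assert (1 < B * 2 ^ c).
              { apply (Rmult_lt_compat_l B) in Hc; [|exact HB]. rewrite Rinv_r in Hc; lra. } nra.
           ++ apply Rmult_le_compat_l; [lra|]. apply Rle_pow; [lra|lia].
    + intros i. apply ker_nonneg. lra.
    + intros i Hi. rewrite qop_nest. apply TPv_nest_lt; [exact Hi|intros; apply eta_fsop, HL|].
      intros h. apply eta_TP, HL.
Qed.

(** * Almost diagonal kernels on sequence spaces *)

Definition nd (j l : nat) : nat := ((j - l) + (l - j))%nat.
Definition dist (d : nat) (j l : nat -> nat) : R := Rsum d (fun i => INR (nd (j i) (l i))).

Lemma dist_sym d j l : dist d j l = dist d l j.
Proof. apply Rsum_ext. intros i _. f_equal. unfold nd. lia. Qed.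

Lemma Rpower2_pos x : 0 < Rpower 2 x.
Proof. apply exp_pos. Qed.

Lemma Rpower2_le x y : x <= y -> Rpower 2 x <= Rpower 2 y.
Proof. intros. apply Rle_Rpower; lra. Qed.

Lemma Rprod_mult n F G : Rprod n (fun i => F i * G i) = Rprod n F * Rprod n G.
Proof. induction n; simpl; [ring|]. rewrite IHn. ring. Qed.

Lemma Rprod_nonneg n F : (forall i, (i < n)%nat -> 0 <= F i) -> 0 <= Rprod n F.
Proof. induction n; simpl; intros H; [lra|]. apply Rmult_le_pos; [apply IHn; intros; apply H; lia|apply H; lia]. Qed.

Lemma Rprod_le n F G : (forall i, (i < n)%nat -> 0 <= F i <= G i) -> Rprod n F <= Rprod n G.
Proof.
  induction n; simpl; intros H; [lra|]. apply Rmult_le_compat.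
  - apply Rprod_nonneg. intros; apply H; lia.
  - apply H; lia.
  - apply IHn. intros; apply H; lia.
  - apply H; lia.
Qed.

Lemma Rprod_Rpower n F : Rprod n (fun i => Rpower 2 (F i)) = Rpower 2 (Rsum n F).
Proof. induction n; simpl; [rewrite Rpower_O; lra|]. rewrite IHn, Rpower_plus. reflexivity. Qed.

Lemma Rprod_const n a : Rprod n (fun _ => a) = a ^ n.
Proof. induction n; simpl; [reflexivity|]. rewrite IHn. ring. Qed.

(** The right side is the value of the full series over [l]; passing from [j] to [j + 1] adds one
    term at the far end. *)
Lemma geom_dist x j N : 0 < x < 1 -> Rsum N (fun l => x ^ nd j l) <= (1 + x - x ^ S j) / (1 - x).
Proof.
  intros Hx. revert N. induction j; intros N.
  - replace ((1 + x - x ^ 1) / (1 - x)) with (/ (1 - x)) by (field; lra).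
    assert (E : Rsum N (fun l => x ^ nd 0 l) * (1 - x) = 1 - x ^ N).
    { induction N; simpl; [ring|]. rewrite Rmult_plus_distr_r, IHN. unfold nd. simpl. rewrite Nat.sub_0_r. ring. }
    apply (Rmult_le_reg_r (1 - x)); [lra|]. rewrite E, Rinv_l by lra. pose proof (pow_le x N). lra.
  - assert (P : 0 <= x ^ S (S j) <= x).
    { split; [apply pow_le; lra|]. simpl. assert (0 <= x ^ S j <= 1); [|simpl in *; nra].
      split; [apply pow_le; lra|]. rewrite <- (pow1 (S j)). apply pow_incr. lra. }
    destruct N as [|N]; [simpl Rsum; apply Rdiv_le_0_compat; lra|].
    rewrite Rsum_shift. replace (nd (S j) 0) with (S j) by (unfold nd; lia).
    rewrite (Rsum_ext _ _ (fun l => x ^ nd j l)) by (intros; unfold nd; f_equal; lia).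
    specialize (IHj N). apply Rle_trans with (x ^ S j + (1 + x - x ^ S j) / (1 - x)); [lra|].
    right. simpl. field. lra.
Qed.

Definition geo (s : R) : R := 2 / (1 - Rpower 2 (- s)).

Lemma Rpower2_lt1 s : 0 < s -> 0 < Rpower 2 (- s) < 1.
Proof.
  intros Hs. split; [apply Rpower2_pos|]. rewrite <- (Rpower_O 2) by lra. apply Rpower_lt; lra.
Qed.

Lemma geo_pos s : 0 < s -> 0 < geo s.
Proof. intros Hs. pose proof (Rpower2_lt1 s Hs). apply Rdiv_lt_0_compat; lra. Qed.

Lemma Nbox_dist d N s j : 0 < s ->
  Nbox d N (fun l => Rpower 2 (- s * dist d j l)) (fun _ => O) <= geo s ^ d.
Proof.
  intros Hs. pose proof (Rpower2_lt1 s Hs) as Hx. set (x := Rpower 2 (- s)) in *.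
  rewrite (Nbox_ext d N _ (fun l => Rprod d (fun i => x ^ nd (j i) (l i)))).
  - rewrite (Nbox_prod d N (fun i l => x ^ nd (j i) l)), <- Rprod_const. apply Rprod_le. intros i _. split.
    + apply Rsum_nonneg. intros. apply pow_le. lra.
    + eapply Rle_trans; [apply geom_dist, Hx|]. unfold geo. fold x. apply Rmult_le_compat_r.
      * apply Rlt_le, Rinv_0_lt_compat. lra.
      * pose proof (pow_le x (S (j i))). lra.
  - intros l _. unfold dist. rewrite <- Rsum_scal, <- Rprod_Rpower. apply Rle_antisym; apply Rprod_le; intros i _;
      unfold x; rewrite <- Rpower_pow by apply Rpower2_pos; rewrite Rpower_mult;
      (split; [apply Rlt_le, Rpower2_pos|right; reflexivity]).
Qed.

Lemma finite_lower d (x : nat -> R) : (forall i, (i < d)%nat -> 0 < x i) -> exists m, 0 < m /\ forall i, (i < d)%nat -> m <= x i.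
Proof.
  induction d; intros H; [exists 1; split; [lra|]; intros; lia|].
  destruct (IHd ltac:(intros; apply H; lia)) as [m [Hm Hi]]. specialize (H d ltac:(lia)).
  exists (Rmin m (x d)). split; [apply Rmin_glb_lt; assumption|]. intros i Hid.
  destruct (Nat.eq_dec i d) as [->|Hne]; [apply Rmin_r|]. eapply Rle_trans; [apply Rmin_l|apply Hi; lia].
Qed.

Lemma finite_upper d (x : nat -> R) : exists m, 0 <= m /\ forall i, (i < d)%nat -> x i <= m.
Proof.
  induction d as [|d [m [Hm Hi]]]; [exists 0; split; [lra|]; intros; lia|].
  exists (Rmax m (x d)). split; [eapply Rle_trans; [exact Hm|apply Rmax_l]|]. intros i Hid.
  destruct (Nat.eq_dec i d) as [->|Hne]; [apply Rmax_r|]. eapply Rle_trans; [apply Hi; lia|apply Rmax_l].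
Qed.

(** Growth exponent of [gfac] in [l - j]. On [e]-th powers it is 1 for every finite [p], which turns
    $r>1/p$ into [sgm p < ee p * r]. *)
Definition sgm (p : ext) : R := match p with Fin _ => 1 | Inf => 0 end.

Lemma gt_invp_ee p y : ext_pos p -> gt_invp y p -> sgm p < ee p * y.
Proof.
  destruct p as [q|]; simpl; intros Hp H; [|lra]. apply (Rmult_lt_compat_l q) in H; [|exact Hp].
  rewrite Rinv_r in H; lra.
Qed.

Lemma gfac_le p j l : gfac p j l <= 2 * Rpower 2 (sgm p * INR (l - j)).
Proof.
  destruct p as [q|]; simpl.
  - rewrite Rmult_1_l, Rpower_pow by lra. pose proof (pow2_gt0 j) as Hj. destruct (le_dec j l) as [H|H].
    + replace (2 ^ l / 2 ^ j) with (2 ^ (l - j)).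
      * pose proof (pow2_ge1 (l - j)). lra.
      * replace l with (j + (l - j))%nat at 2 by lia. rewrite pow_add. field. lra.
    + replace (l - j)%nat with O by lia. simpl. assert (2 ^ l / 2 ^ j <= 1); [|lra].
      apply Rle_div_l; [exact Hj|]. rewrite Rmult_1_l. apply Rle_pow; [lra|lia].
  - rewrite Rmult_0_l, Rpower_O by lra. lra.
Qed.

(** For [j <= l] the smoothness weight exceeds the discretisation cost by [2 * tau]; half of this
    compensates the inserted weight and half remains as decay. For [l < j <= l + c] all factors are
    bounded in terms of [c]. *)
Lemma ker_weighted p K c a tau j l b : 0 < K -> 0 < tau -> sgm p + 2 * tau <= a -> a <= b ->
  Rpower 2 (a * (INR j - INR l)) * Rpower 2 (tau * INR (nd j l)) * ker p K c j l <=
  2 * K * Rpower 2 ((b + 2 * tau) * INR c) * Rpower 2 (- tau * INR (nd j l)).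
Proof.
  intros HK Ht Ha Hb. assert (Hs : 0 <= sgm p) by (destruct p; simpl; lra). pose proof (pos_INR c) as Hc.
  assert (P : 0 <= 2 * K * Rpower 2 ((b + 2 * tau) * INR c) * Rpower 2 (- tau * INR (nd j l))).
  { repeat apply Rmult_le_pos; try lra; apply Rlt_le, Rpower2_pos. }
  unfold ker. destruct (le_dec j (l + c)) as [H|H]; [|rewrite Rmult_0_r; exact P].
  apply Rle_trans with (Rpower 2 (a * (INR j - INR l)) * Rpower 2 (tau * INR (nd j l)) * (K * (2 * Rpower 2 (sgm p * INR (l - j))))).
  - apply Rmult_le_compat_l; [apply Rmult_le_pos; apply Rlt_le, Rpower2_pos|].
    apply Rmult_le_compat_l; [lra|apply gfac_le].
  - replace (Rpower 2 (a * (INR j - INR l)) * Rpower 2 (tau * INR (nd j l)) * (K * (2 * Rpower 2 (sgm p * INR (l - j)))))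
      with (2 * K * Rpower 2 (a * (INR j - INR l) + tau * INR (nd j l) + sgm p * INR (l - j)))
      by (rewrite !Rpower_plus; ring).
    replace (2 * K * Rpower 2 ((b + 2 * tau) * INR c) * Rpower 2 (- tau * INR (nd j l)))
      with (2 * K * Rpower 2 ((b + 2 * tau) * INR c + - tau * INR (nd j l))) by (rewrite Rpower_plus; ring).
    apply Rmult_le_compat_l; [lra|]. apply Rpower2_le.
    destruct (le_dec j l) as [Hjl|Hjl].
    + replace (nd j l) with (l - j)%nat by (unfold nd; lia). rewrite minus_INR by exact Hjl.
      pose proof (le_INR _ _ Hjl). assert (0 <= (b + 2 * tau) * INR c) by nra.
      assert (0 <= (a - sgm p - 2 * tau) * (INR l - INR j)) by nra. lra.
    + replace (nd j l) with (j - l)%nat by (unfold nd; lia). replace (l - j)%nat with O by lia.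
      rewrite minus_INR by lia. assert (INR j - INR l <= INR c) by (apply le_INR in H; rewrite plus_INR in H; lra).
      assert (0 <= INR j - INR l) by (pose proof (le_INR l j ltac:(lia)); lra). simpl (INR 0).
      assert ((b + 2 * tau) * (INR j - INR l) <= (b + 2 * tau) * INR c) by (apply Rmult_le_compat_l; lra).
      assert ((a - b) * (INR j - INR l) <= 0) by nra. lra.
Qed.

Definition weighted (d : nat) (p : ext) (r : nat -> R) (G : (nat -> nat) -> (nat -> R) -> C) (j : nat -> nat) : R :=
  Rpower 2 (dotr d r j) * Lpnorm d p (G j).

Lemma weighted_ge0 d p r G j : ext_pos p -> BUC d (G j) -> 0 <= weighted d p r G j.
Proof.
  intros Hp HG. apply Rmult_le_pos; [apply Rlt_le, Rpower2_pos|]. rewrite (Lpnorm_nn p d _ Hp HG). apply rpow_ge0.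
Qed.

Lemma weighted_ee d p r G j : ext_pos p -> BUC d (G j) ->
  rpow (weighted d p r G j) (ee p) = Rpower 2 (ee p * dotr d r j) * nn p d (G j).
Proof.
  intros Hp HG. unfold weighted. rewrite (Lpnorm_nn p d _ Hp HG).
  rewrite rpow_mult by (try apply rpow_ge0; apply Rlt_le, Rpower2_pos).
  rewrite rpow_inv_l by (try apply ee_pos; try apply nn_nonneg; assumption).
  rewrite rpow_pos by apply Rpower2_pos. rewrite Rpower_mult, (Rmult_comm (ee p)). reflexivity.
Qed.

Lemma dotr_split d r e tau j l :
  Rpower 2 (e * dotr d r j) * Rpower 2 (tau * dist d j l) =
  Rprod d (fun i => Rpower 2 (e * r i * (INR (j i) - INR (l i))) * Rpower 2 (tau * INR (nd (j i) (l i)))) * Rpower 2 (e * dotr d r l).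
Proof.
  rewrite Rprod_mult, !Rprod_Rpower, Rsum_scal. fold (dist d j l).
  replace (e * dotr d r j) with (Rsum d (fun i => e * r i * (INR (j i) - INR (l i))) + e * dotr d r l).
  - rewrite Rpower_plus. ring.
  - unfold dotr. rewrite <- !Rsum_scal, <- Rsum_plus. apply Rsum_ext. intros. ring.
Qed.

Lemma dominated_weighted p d r K c : ext_pos p -> (forall i, (i < d)%nat -> gt_invp (r i) p) -> 0 < K ->
  exists Q tau, 0 < Q /\ 0 < tau /\ forall H G, (forall j, BUC d (H j)) -> (forall j, BUC d (G j)) ->
  dominated p d (ker p K c) H G -> forall j eps, 0 < eps -> exists N0, forall N, (N0 <= N)%nat ->
  rpow (weighted d p r H j) (ee p) <=
    Q * Nbox d N (fun l => Rpower 2 (- tau * dist d j l) * rpow (weighted d p r G l) (ee p)) (fun _ => O) + eps.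
Proof.
  intros Hp Hr HK. pose proof (ee_pos p Hp) as He. set (e := ee p) in *.
  (* A common margin in $r_i>1/p$, halved because [tau] is spent twice. *)
  destruct (finite_lower d (fun i => (e * r i - sgm p) / 2)) as [tau [Ht Htau]].
  { intros i Hi. pose proof (gt_invp_ee p (r i) Hp (Hr i Hi)). fold e in H. lra. }
  destruct (finite_upper d (fun i => e * r i)) as [b [Hb0 Hb]].
  set (K1 := 2 * K * Rpower 2 ((b + 2 * tau) * INR c)).
  assert (HK1 : 0 < K1) by (unfold K1; pose proof (Rpower2_pos ((b + 2 * tau) * INR c)); nra).
  (* The weights enter [nn_dominated] before [e]-th powers are taken, so their rate is [tau / e]. *)
  set (sg := tau / e). assert (Hsg : 0 < sg) by (apply Rdiv_lt_0_compat; assumption).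
  set (W := geo sg ^ d). assert (HW : 0 < W) by (apply pow_lt, geo_pos, Hsg).
  set (Q0 := rpow 2 e * rpow W e). assert (HQ0 : 0 < Q0) by (apply Rmult_lt_0_compat; apply rpow_gt0; lra).
  exists (Q0 * K1 ^ d), tau. split; [apply Rmult_lt_0_compat; [exact HQ0|apply pow_lt, HK1]|]. split; [exact Ht|].
  intros H G HH HG Dom j eps Heps. pose proof PI_RGT_0 as HPI.
  set (rho := Rpower 2 (e * dotr d r j)). assert (Hrho : 0 < rho) by apply Rpower2_pos.
  set (V := rho * (rpow 2 e * (2 * PI) ^ d)).
  assert (HV : 0 < V) by (apply Rmult_lt_0_compat; [exact Hrho|]; apply Rmult_lt_0_compat; [apply rpow_gt0; lra|apply pow_lt; lra]).
  (* The pointwise error enters through its [e]-th power, multiplied by the smoothness weight at [j]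
     and the volume; with this [eta] the product is exactly [eps]. *)
  set (eta := rpow (eps / V) (1 / e)).
  assert (Hq : 0 < eps / V) by (apply Rdiv_lt_0_compat; assumption).
  assert (Heta : 0 < eta) by (apply rpow_gt0, Hq).
  assert (Eeta : rpow eta e = eps / V) by (apply rpow_inv_l; lra).
  destruct (Dom j eta Heta) as [N0 HN0]. exists N0. intros N HN. destruct (HN0 N HN) as [E [HE1 [HE2 HE3]]].
  pose proof (nn_dominated p d N (H j) E (fun l => Rpower 2 (sg * dist d j l)) W eta (fun _ => O) Hp (HH j) HE1
    ltac:(lra) ltac:(intros; apply Rpower2_pos)) as B. fold e in B.
  assert (HB1 : Nbox d N (fun l => / Rpower 2 (sg * dist d j l)) (fun _ => O) <= W).
  { eapply Rle_trans; [|apply (Nbox_dist d N sg j Hsg)]. right. apply Nbox_ext. intros l _.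
    rewrite <- Rpower_Ropp. f_equal. ring. }
  specialize (B HB1 HE2). pose proof (weighted_ee d p r H j Hp (HH j)) as E1. fold e in E1. fold rho in E1. rewrite E1.
  apply Rle_trans with (rho * (rpow 2 e * (rpow W e * Nbox d N (fun l => rpow (Rpower 2 (sg * dist d j l)) e * nn p d (E l))
    (fun _ => O) + (2 * PI) ^ d * rpow eta e))).
  { apply Rmult_le_compat_l; [lra|exact B]. }
  rewrite Eeta.
  replace (rho * (rpow 2 e * (rpow W e * Nbox d N (fun l => rpow (Rpower 2 (sg * dist d j l)) e * nn p d (E l))
    (fun _ => O) + (2 * PI) ^ d * (eps / V)))) with
    (Q0 * (rho * Nbox d N (fun l => rpow (Rpower 2 (sg * dist d j l)) e * nn p d (E l)) (fun _ => O)) + V * (eps / V))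
    by (unfold Q0, V; ring).
  replace (V * (eps / V)) with eps by (field; lra). apply Rplus_le_compat_r. rewrite Rmult_assoc.
  apply Rmult_le_compat_l; [lra|]. rewrite <- !Nbox_scal. apply Nbox_le. intros l Hl.
  pose proof (weighted_ee d p r G l Hp (HG l)) as E2. fold e in E2. rewrite E2.
  rewrite rpow_pos by apply Rpower2_pos. rewrite Rpower_mult.
  replace (sg * dist d j l * e) with (tau * dist d j l) by (unfold sg; field; lra).
  pose proof (nn_nonneg p d (G l) Hp (HG l)) as HnG.
  apply Rle_trans with (rho * (Rpower 2 (tau * dist d j l) * (Rprod d (fun i => ker p K c (j i) (l i)) * nn p d (G l)))).
  { apply Rmult_le_compat_l; [lra|]. apply Rmult_le_compat_l; [apply Rlt_le, Rpower2_pos|]. apply HE3, Hl. }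
  rewrite <- Rmult_assoc. unfold rho. rewrite (dotr_split d r e tau j l).
  match goal with |- ?P * ?y * (?k * ?g) <= _ => replace (P * y * (k * g)) with (P * k * (y * g)) by ring end.
  rewrite <- (Rmult_assoc (K1 ^ d)). apply Rmult_le_compat_r; [apply Rmult_le_pos; [apply Rlt_le, Rpower2_pos|exact HnG]|].
  rewrite <- Rprod_mult. unfold dist. rewrite <- Rsum_scal, <- Rprod_Rpower, <- (Rprod_const d K1), <- Rprod_mult.
  apply Rprod_le. intros i Hi. split.
  - repeat apply Rmult_le_pos; try (apply Rlt_le, Rpower2_pos). apply ker_nonneg. lra.
  - apply (ker_weighted p K c (e * r i) tau (j i) (l i) b HK Ht); [|apply (Hb i Hi)].
    specialize (Htau i Hi). cbv beta in Htau. lra.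
Qed.

Lemma box_eventually d (P : (nat -> nat) -> nat -> Prop) :
  (forall j, exists N0, forall N, (N0 <= N)%nat -> P j N) ->
  forall M j0, exists N0, forall N, (N0 <= N)%nat -> forall j, inN d M j0 j -> P j N.
Proof.
  intros HP M. induction d; intros j0.
  - destruct (HP j0) as [N0 H]. exists N0. intros N HN j [_ Hj].
    replace j with j0; [apply H, HN|]. apply functional_extensionality. intros i. symmetry. apply Hj. lia.
  - assert (HS : forall m, exists N0, forall N, (N0 <= N)%nat -> forall v, (v < m)%nat ->
      forall j, inN d M (updN j0 d v) j -> P j N).
    { induction m as [|m [N1 H1]]; [exists O; intros; lia|].
      destruct (IHd (updN j0 d m)) as [N2 H2]. exists (N1 + N2)%nat. intros N HN v Hv j Hj.
      destruct (Nat.eq_dec v m) as [->|Hne]; [apply H2; [lia|exact Hj]|apply (H1 N ltac:(lia) v); [lia|exact Hj]]. }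
    destruct (HS (S M)) as [N0 H]. exists N0. intros N HN j [Hj1 Hj2].
    apply (H N HN (j d)); [specialize (Hj1 d ltac:(lia)); lia|]. split.
    + intros i Hi. apply Hj1. lia.
    + intros i Hi. unfold updN. destruct (Nat.eqb_spec i d) as [->|Hne]; [reflexivity|]. apply Hj2. lia.
Qed.

Lemma Rle_eps a b : (forall e, 0 < e -> a <= b + e) -> a <= b.
Proof. intros H. apply Rnot_lt_le. intros Hlt. specialize (H ((a - b) / 2) ltac:(lra)). lra. Qed.

Lemma transfer_Inf d (a b : (nat -> nat) -> R) e Q tau : 0 < e -> 0 < Q -> 0 < tau ->
  (forall j, 0 <= a j) -> (forall j, 0 <= b j) ->
  (forall j eps, 0 < eps -> exists N0, forall N, (N0 <= N)%nat -> rpow (a j) e <=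
    Q * Nbox d N (fun l => Rpower 2 (- tau * dist d j l) * rpow (b l) e) (fun _ => O) + eps) ->
  forall M, seqnorm_le d Inf b M -> seqnorm_le d Inf a (rpow (Q * geo tau ^ d) (1 / e) * M).
Proof.
  intros He HQ Ht Ha Hb H M HM j. simpl in HM. assert (HM0 : 0 <= M) by (eapply Rle_trans; [apply (Hb j)|apply HM]).
  assert (HG : 0 < geo tau ^ d) by (apply pow_lt, geo_pos, Ht).
  apply (rpow_le_inv _ _ e He (Ha j)); [apply Rmult_le_pos; [apply rpow_ge0|exact HM0]|].
  rewrite rpow_mult by (try apply rpow_ge0; exact HM0). rewrite rpow_inv_l by (try exact He; nra).
  apply Rle_eps. intros eps Heps. destruct (H j eps Heps) as [N0 HN]. specialize (HN N0 (Nat.le_refl N0)).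
  eapply Rle_trans; [exact HN|]. apply Rplus_le_compat_r. rewrite Rmult_assoc. apply Rmult_le_compat_l; [lra|].
  apply Rle_trans with (Nbox d N0 (fun l => rpow M e * Rpower 2 (- tau * dist d j l)) (fun _ => O)).
  - apply Nbox_le. intros l _. rewrite Rmult_comm. apply Rmult_le_compat_r; [apply Rlt_le, Rpower2_pos|].
    apply rpow_le; [lra|]. split; [apply Hb|apply HM].
  - rewrite Nbox_scal, (Rmult_comm (geo tau ^ d)). apply Rmult_le_compat_l; [apply rpow_ge0|apply Nbox_dist, Ht].
Qed.

(** A Schur test without duality: half of the exponential decay pays for raising the inner sum to
    the power [t / e]; the other half survives that power and is summed over [j] after exchanging
    the sums. *)
Lemma transfer_Fin d (a b : (nat -> nat) -> R) t e Q tau : 0 < t -> 0 < e -> 0 < Q -> 0 < tau ->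
  (forall j, 0 <= a j) -> (forall j, 0 <= b j) ->
  (forall j eps, 0 < eps -> exists N0, forall N, (N0 <= N)%nat -> rpow (a j) e <=
    Q * Nbox d N (fun l => Rpower 2 (- tau * dist d j l) * rpow (b l) e) (fun _ => O) + eps) ->
  forall M, seqnorm_le d (Fin t) b M -> seqnorm_le d (Fin t) a
    (rpow (rpow 2 (t / e) * (rpow Q (t / e) * (rpow (geo (tau / 2) ^ d) (t / e) * geo (tau / 2 * (t / e)) ^ d))) (1 / t) * M).
Proof.
  intros Ht0 He HQ Ht Ha Hb H M HM N. simpl in HM. set (q := t / e). assert (Hq : 0 < q) by (apply Rdiv_lt_0_compat; assumption).
  set (W := geo (tau / 2) ^ d). assert (HW : 0 < W) by (apply pow_lt, geo_pos; lra).
  set (g := geo (tau / 2 * q) ^ d). assert (Hg : 0 < g) by (apply pow_lt, geo_pos; apply Rmult_lt_0_compat; lra).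
  set (j0 := fun _ : nat => O). set (A := rpow 2 q * (rpow Q q * (rpow W q * g))).
  assert (HA : 0 < A) by (repeat apply Rmult_lt_0_compat; try exact Hg; apply rpow_gt0; lra).
  assert (HM0 : 0 <= M) by (eapply Rle_trans; [apply rpow_ge0|apply (HM O)]).
  assert (HS : forall N, Nbox d N (fun l => rpow (b l) t) j0 <= rpow M t).
  { intros N'. specialize (HM N'). fold j0 in HM. set (S := Nbox d N' _ j0) in *.
    assert (0 <= S) by (apply Nbox_nonneg; intros; apply rpow_ge0).
    rewrite <- (rpow_inv_l S t) by assumption. apply rpow_le; [lra|]. split; [apply rpow_ge0|exact HM]. }
  apply (rpow_le_inv _ _ t Ht0); [apply rpow_ge0|apply Rmult_le_pos; [apply rpow_ge0|exact HM0]|].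
  rewrite rpow_mult by (try apply rpow_ge0; exact HM0). rewrite !rpow_inv_l by
    (try exact Ht0; try lra; apply Nbox_nonneg; intros; apply rpow_ge0).
  apply Rle_eps. intros eps Heps.
  set (V := INR (S N) ^ d * rpow 2 q). assert (HV : 0 < V).
  { apply Rmult_lt_0_compat; [apply pow_lt, lt_0_INR; lia|apply rpow_gt0; lra]. }
  (* The outer box has [S N ^ d] indices, each contributing this error; dividing by [V] makes their
     total [eps]. *)
  set (e1 := rpow (eps / V) (1 / q)). assert (Hev : 0 < eps / V) by (apply Rdiv_lt_0_compat; assumption).
  assert (He1 : 0 < e1) by (apply rpow_gt0, Hev). assert (Ee1 : rpow e1 q = eps / V) by (apply rpow_inv_l; lra).
  destruct (box_eventually d _ (fun j => H j e1 He1) N j0) as [N' HN']. specialize (HN' N' (Nat.le_refl N')).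
  set (F := fun j l => Rpower 2 (- (tau / 2 * q) * dist d j l) * rpow (b l) t).
  apply Rle_trans with (Nbox d N (fun j => rpow 2 q * (rpow Q q * (rpow W q * Nbox d N' (F j) j0)) + rpow 2 q * rpow e1 q) j0).
  - apply Nbox_le. intros j Hj. specialize (HN' j Hj). fold j0 in HN'.
    set (S := Nbox d N' _ j0) in HN'.
    assert (HS0 : 0 <= S) by (apply Nbox_nonneg; intros; apply Rmult_le_pos; [apply Rlt_le, Rpower2_pos|apply rpow_ge0]).
    replace (rpow (a j) t) with (rpow (rpow (a j) e) q) by (rewrite rpow_rpow; f_equal; unfold q; field; lra).
    eapply Rle_trans; [apply rpow_le; [lra|split; [apply rpow_ge0|exact HN']]|].
    eapply Rle_trans; [apply rpow_plus_le; [exact Hq|nra|lra]|].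
    rewrite Rmult_plus_distr_l. apply Rplus_le_compat_r. apply Rmult_le_compat_l; [apply rpow_ge0|].
    rewrite rpow_mult by lra. apply Rmult_le_compat_l; [apply rpow_ge0|].
    unfold S. eapply Rle_trans; [apply (rpow_Nbox_weight d N' _ (fun l => Rpower 2 (tau / 2 * dist d j l)) W q j0 Hq)|].
    + intros l. apply Rmult_le_pos; [apply Rlt_le, Rpower2_pos|apply rpow_ge0].
    + intros l. apply Rpower2_pos.
    + eapply Rle_trans; [|apply (Nbox_dist d N' (tau / 2) j); lra]. right. apply Nbox_ext. intros l _.
      rewrite <- Rpower_Ropp. f_equal. lra.
    + right. f_equal. apply Nbox_ext. intros l _. unfold F.
      rewrite <- Rmult_assoc, <- Rpower_plus, rpow_mult by (try apply rpow_ge0; apply Rlt_le, Rpower2_pos).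
      rewrite rpow_rpow, rpow_pos, Rpower_mult by apply Rpower2_pos. f_equal; f_equal; unfold q; field; lra.
  - rewrite Nbox_plus, Nbox_const, Ee1.
    replace (INR (S N) ^ d * (rpow 2 q * (eps / V))) with eps by (unfold V; field; unfold V in HV; split; intros E0; rewrite E0 in HV; lra).
    apply Rplus_le_compat_r. rewrite !Nbox_scal. unfold A. rewrite !Rmult_assoc.
    apply Rmult_le_compat_l; [apply rpow_ge0|]. apply Rmult_le_compat_l; [apply rpow_ge0|].
    apply Rmult_le_compat_l; [apply rpow_ge0|]. rewrite (Nbox_swap d N d N').
    apply Rle_trans with (Nbox d N' (fun l => g * rpow (b l) t) j0).
    + apply Nbox_le. intros l _. unfold F.
      rewrite (Nbox_ext d N _ (fun j => rpow (b l) t * Rpower 2 (- (tau / 2 * q) * dist d l j)))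
        by (intros; rewrite (dist_sym d l); ring).
      rewrite Nbox_scal, Rmult_comm. apply Rmult_le_compat_r; [apply rpow_ge0|]. apply Nbox_dist.
      apply Rmult_lt_0_compat; lra.
    + rewrite Nbox_scal. apply Rmult_le_compat_l; [lra|apply HS].
Qed.

Lemma seq_transfer p theta d r K c : ext_pos p -> ext_pos theta ->
  (forall i, (i < d)%nat -> gt_invp (r i) p) -> 0 < K ->
  exists c', 0 < c' /\ forall H G, (forall j, BUC d (H j)) -> (forall j, BUC d (G j)) ->
  dominated p d (ker p K c) H G -> forall M,
  seqnorm_le d theta (weighted d p r G) M -> seqnorm_le d theta (weighted d p r H) (c' * M).
Proof.
  intros Hp Hth Hr HK. destruct (dominated_weighted p d r K c Hp Hr HK) as [Q [tau [HQ [Ht Key]]]].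
  pose proof (ee_pos p Hp) as He. destruct theta as [t|]; simpl in Hth.
  - eexists. split; [|intros H G HH HG Dom M; apply (transfer_Fin d _ _ t (ee p) Q tau); try assumption].
    + apply rpow_gt0. repeat apply Rmult_lt_0_compat; try (apply rpow_gt0; try lra); apply pow_lt, geo_pos; try lra.
      apply Rmult_lt_0_compat; [lra|apply Rdiv_lt_0_compat; lra].
    + intros; apply weighted_ge0; auto.
    + intros; apply weighted_ge0; auto.
    + apply Key; assumption.
  - eexists. split; [|intros H G HH HG Dom M; apply (transfer_Inf d _ _ (ee p) Q tau); try assumption].
    + apply rpow_gt0. apply Rmult_lt_0_compat; [exact HQ|apply pow_lt, geo_pos, Ht].
    + intros; apply weighted_ge0; auto.
    + intros; apply weighted_ge0; auto.
    + apply Key; assumption.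
Qed.

Lemma seqnorm_le_mono d theta a M M' : M <= M' -> seqnorm_le d theta a M -> seqnorm_le d theta a M'.
Proof. intros HM H. destruct theta; simpl in *; intros N; eapply Rle_trans; [apply H|exact HM|apply H|exact HM]. Qed.

Lemma seqnorm_ge0 d theta a M : (forall j, 0 <= a j) -> seqnorm_le d theta a M -> 0 <= M.
Proof.
  intros Ha H. destruct theta; simpl in H.
  - eapply Rle_trans; [apply rpow_ge0|apply (H O)].
  - eapply Rle_trans; [apply Ha|apply (H (fun _ => O))].
Qed.

Theorem theorem5p2 :
  forall (d : nat) (phi : nat -> R -> R) (A B C : R)
         (p theta : ext) (L : nat) (r : nat -> R),
    (1 <= d)%nat ->
    admissible phi A B C ->
    ext_pos p -> ext_pos theta ->
    gt_invp (INR L) p ->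
    (L = 1%nat -> p <> Inf) ->
    (forall i, (i < d)%nat -> gt_invp (r i) p) ->
    exists c, 0 < c /\
      forall f : (nat -> R) -> Cx,
        cont_periodic d f ->
        (exists M, seqnorm_le d theta (besov_terms d phi A C p r f) M) ->
        forall M,
          (seqnorm_le d theta (besov_terms d phi A C p r f) M ->
             seqnorm_le d theta (q_terms d L p r f) (c * M)) /\
          (seqnorm_le d theta (q_terms d L p r f) M ->
             seqnorm_le d theta (besov_terms d phi A C p r f) (c * M)).
Proof.
  intros d phi A B C p theta L r _ Ha Hp Hth HL HL1 Hr.
  (* The case [L = 0] contradicts [gt_invp (INR L) p], for finite as well as infinite [p]. *)
  assert (HLn : (1 <= L)%nat).
  { destruct L; [|lia]. destruct p as [q|]; simpl in *; [pose proof (Rinv_0_lt_compat q Hp)|]; lra. }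
  destruct (q_dominated phi A B C p d L Ha Hp HLn HL HL1) as [K1 [c1 [HK1 D1]]].
  destruct (delta_dominated phi A B C p d L Ha Hp HLn) as [K2 [c2 [HK2 D2]]].
  destruct (seq_transfer p theta d r K1 c1 Hp Hth Hr HK1) as [e1 [He1 T1]].
  destruct (seq_transfer p theta d r K2 c2 Hp Hth Hr HK2) as [e2 [He2 T2]].
  (* One constant for both directions; enlarging either bound to it relies on [0 <= M], which holds
     because the terms are nonnegative. *)
  exists (e1 + e2). split; [lra|]. intros f Hf _ M.
  assert (Bd : forall j, BUC d (delta d phi A C f j)) by (intros; apply delta_BUC).
  assert (Bq : forall j, BUC d (qop d L j f)).
  { intros j. rewrite qop_nest. apply BUC_nest; [lia|intros; apply eta_fsop, HLn|apply cont_periodic_BUC, Hf]. }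
  split; intros H.
  - assert (0 <= M) by (eapply seqnorm_ge0; [|exact H]; intros; apply (weighted_ge0 d p r (delta d phi A C f)); auto).
    apply (seqnorm_le_mono d theta _ (e1 * M)); [nra|]. apply (T1 _ _ Bq Bd (D1 f Hf) M H).
  - assert (0 <= M) by (eapply seqnorm_ge0; [|exact H]; intros; apply (weighted_ge0 d p r (fun j => qop d L j f)); auto).
    apply (seqnorm_le_mono d theta _ (e2 * M)); [nra|]. apply (T2 _ _ Bd Bq (D2 f Hf) M H).
Qed.
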